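(* Let $\mathcal{C}$ be a concept class over $\mathcal{X}$ and let $\mathcal{A}$ be an agnostic TDS learner for $\mathcal{C}$ that achieves error $O(\lambda)+\varepsilon$, runs in time $T_{\mathcal{A}}(\varepsilon)$ and has total sample complexity $m_{\mathcal{A}}(\varepsilon)$. Then there is a PQ learner for $\mathcal{C}$ in the agnostic setting which receives parameters $(\varepsilon,\eta,\delta)$ as inputs and achieves error $O(\frac{\lambda}{\eta}+\varepsilon)$, rejection rate $O(\eta+\varepsilon)$ and probability of failure $\delta$. This learner runs in time $T_{\mathcal{A}}\cdot\widetilde{O}_{\varepsilon,\delta}(m_{\mathcal{A}}^6)+\mathrm{poly}(m_{\mathcal{A}},\frac1\varepsilon,\frac1\eta,\log\frac1\delta)$ and uses $\mathrm{poly}(m_{\mathcal{A}},\frac1\varepsilon,\frac1\eta,\log\frac1\delta)$ samples from the training and test distributions.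
   Context: A concept class $\mathcal{C}$ over $\mathcal{X}$ is a set of functions $\mathcal{X}\to\{\pm1\}$. Agnostic setting: the learner has labeled sample access to a training distribution $\bar{\mathcal{D}}^{\mathsf{train}}$ over $\mathcal{X}\times\{\pm1\}$ and unlabeled sample access to the $\mathcal{X}$-marginal $\mathcal{D}^{\mathsf{test}}$ of a test distribution $\bar{\mathcal{D}}^{\mathsf{test}}$ over $\mathcal{X}\times\{\pm1\}$ (labels need not be realizable by $\mathcal{C}$), and the benchmark is $\lambda=\min_{f\in\mathcal{C}}\left(\Pr_{(\mathbf{x},y)\sim\bar{\mathcal{D}}^{\mathsf{train}}}[f(\mathbf{x})\ne y]+\Pr_{(\mathbf{x},y)\sim\bar{\mathcal{D}}^{\mathsf{test}}}[f(\mathbf{x})\ne y]\right)$. Agnostic TDS learner up to error $O(\lambda)+\varepsilon$ and failure probability $\delta$: outputs REJECT, or ACCEPT with a hypothesis $h:\mathcal{X}\to\{\pm1\}$, such that with probability at least $1-\delta$: (soundness) upon acceptance $\Pr_{(\mathbf{x},\mathbf{y})\sim\bar{\mathcal{D}}^{\mathsf{test}}}[\mathbf{y}\ne h(\mathbf{x})]\le A\lambda+\varepsilon$ for some constant $A\ge1$; (completeness) if $\mathcal{D}^{\mathsf{train}}=\mathcal{D}^{\mathsf{test}}$ it accepts. Here the TDS learner is taken to have failure probability $0.01$. Agnostic PQ learner up to error $O(\lambda)+\varepsilon'$ (resp. any stated error bound $E$), rejection rate $\eta'$ and failure probability $\delta$: with probability at least $1-\delta$ it outputs $h:\mathcal{X}\to\{\pm1\}$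 and $g:\mathcal{X}\to\{0,1\}$ with $\Pr_{(\mathbf{x},\mathbf{y})\sim\bar{\mathcal{D}}^{\mathsf{test}}}[\mathbf{y}\ne h(\mathbf{x})\text{ and }g(\mathbf{x})=1]\le E$ and $\Pr_{\mathbf{x}\sim\mathcal{D}^{\mathsf{train}}}[g(\mathbf{x})=0]\le\eta'$. Hidden constants in $O(\cdot)$ are absolute (depending only on the constant $A$). *)

(* Defs.v *)
From HB Require Import structures.
From mathcomp Require Import all_boot all_order all_algebra.
From mathcomp Require Import all_classical all_reals all_analysis.

Set Implicit Arguments.
Unset Strict Implicit.
Unset Printing Implicit Defensive.
Import Order.TTheory GRing.Theory Num.Theory.
Local Open Scope classical_set_scope.
Local Open Scope ring_scope.

(** * Model of computation

  Algorithms are programs of a call-by-value functional language whose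
  numbers are exact reals (as on a real RAM), with unit cost per evaluation
  step.  Points of the domain [X] are opaque except through a family of
  unit-cost real-valued features [feat : nat -> X -> R], e.g. the coordinates
  when [X] is R^d.  The syntax mentions neither [R] nor [X], so a program can
  only contain natural-number constants.  Programs are deterministic:
  randomness reaches them through the lists of samples and of fair coin flips
  that they receive as inputs. *)

Inductive term : Type :=
| TVar (i : nat)          (* de Bruijn index *)
| TFun (t : term)         (* recursive function: in [t], [TVar 0] is the argument
                            and [TVar 1] the function itself *)
| TApp (t u : term)
| TUnit
| TPair (t u : term) | TFst (t : term) | TSnd (t : term)
| TInl (t : term) | TInr (t : term)
| TCase (t u v : term)    (* [u] and [v] bind the payload as [TVar 0] *)
| TNat (n : nat)
| TAdd (t u : term) | TSub (t u : term) | TMul (t u : term) | TDiv (t u : term)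
| TLe (t u : term)
| TFeat (t u : term).

Inductive value (R X : Type) : Type :=
| VUnit
| VNum (r : R)
| VPt (x : X)
| VPair (v w : value R X)
| VInl (v : value R X)
| VInr (v : value R X)
| VClo (e : seq (value R X)) (t : term).

Arguments VUnit {R X}.
Arguments VNum {R X} r.
Arguments VPt {R X} x.

(* The label +1 is [true] and the label -1 is [false]; likewise a selector
   with values in {0,1} is a boolean function. *)
Definition vbool {R X : Type} (b : bool) : value R X :=
  if b then VInr VUnit else VInl VUnit.

Definition vlist {R X : Type} (s : seq (value R X)) : value R X :=
  foldr (fun v l => VInr (VPair v l)) (VInl VUnit) s.

(* [eval feat e t v k]: in environment [e], [t] evaluates to [v] in [k] steps *)
Inductive eval (R : realType) (X : Type) (feat : nat -> X -> R) :
  seq (value R X) -> term -> value R X -> nat -> Prop :=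
| EVar e i v : onth e i = Some v -> eval feat e (TVar i) v 1
| EFun e t : eval feat e (TFun t) (VClo e t) 1
| EApp e t u e' b v w k1 k2 k3 :
    eval feat e t (VClo e' b) k1 -> eval feat e u v k2 ->
    eval feat (v :: VClo e' b :: e') b w k3 ->
    eval feat e (TApp t u) w (k1 + k2 + k3).+1
| EUnit e : eval feat e TUnit VUnit 1
| EPair e t u v w k1 k2 : eval feat e t v k1 -> eval feat e u w k2 ->
    eval feat e (TPair t u) (VPair v w) (k1 + k2).+1
| EFst e t v w k : eval feat e t (VPair v w) k -> eval feat e (TFst t) v k.+1
| ESnd e t v w k : eval feat e t (VPair v w) k -> eval feat e (TSnd t) w k.+1
| EInl e t v k : eval feat e t v k -> eval feat e (TInl t) (VInl v) k.+1
| EInr e t v k : eval feat e t v k -> eval feat e (TInr t) (VInr v) k.+1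
| ECaseL e t a b v w k1 k2 :
    eval feat e t (VInl v) k1 -> eval feat (v :: e) a w k2 ->
    eval feat e (TCase t a b) w (k1 + k2).+1
| ECaseR e t a b v w k1 k2 :
    eval feat e t (VInr v) k1 -> eval feat (v :: e) b w k2 ->
    eval feat e (TCase t a b) w (k1 + k2).+1
| ENat e n : eval feat e (TNat n) (VNum n%:R) 1
| EAdd e t u r s k1 k2 : eval feat e t (VNum r) k1 -> eval feat e u (VNum s) k2 ->
    eval feat e (TAdd t u) (VNum (r + s)) (k1 + k2).+1
| ESub e t u r s k1 k2 : eval feat e t (VNum r) k1 -> eval feat e u (VNum s) k2 ->
    eval feat e (TSub t u) (VNum (r - s)) (k1 + k2).+1
| EMul e t u r s k1 k2 : eval feat e t (VNum r) k1 -> eval feat e u (VNum s) k2 ->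
    eval feat e (TMul t u) (VNum (r * s)) (k1 + k2).+1
| EDiv e t u r s k1 k2 : eval feat e t (VNum r) k1 -> eval feat e u (VNum s) k2 ->
    eval feat e (TDiv t u) (VNum (r / s)) (k1 + k2).+1
| ELe e t u r s k1 k2 : eval feat e t (VNum r) k1 -> eval feat e u (VNum s) k2 ->
    eval feat e (TLe t u) (vbool (r <= s)) (k1 + k2).+1
| EFeat e t u i x k1 k2 :
    eval feat e t (VNum i%:R) k1 -> eval feat e u (VPt x) k2 ->
    eval feat e (TFeat t u) (VNum (feat i x)) (k1 + k2).+1.

(* The function value [v] denotes the classifier [f], each evaluation of which
   takes at most [V] steps. *)
Definition denotes {R : realType} {X : Type} (feat : nat -> X -> R) (V : R)
    (v : value R X) (f : X -> bool) : Prop :=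
  forall x, exists2 k : nat, k%:R <= V &
    eval feat [:: v; VPt x] (TApp (TVar 0) (TVar 1)) (vbool (f x)) k.

(** * Learners

  A learner works in two phases.  Given its parameters, [plan] computes how
  many training samples, test samples and coin flips to draw; then [fit]
  receives the parameters and the drawn lists and computes the output. *)

Record learner : Type := Learner { plan : term; fit : term }.

Section Learners.
Context {R : realType} {d : measure_display} {X : measurableType d}.
Variable feat : nat -> X -> R.

Definition plans (L : learner) (p : value R X) (n1 n2 r k : nat) : Prop :=
  eval feat [:: p] (plan L)
    (VPair (VNum n1%:R) (VPair (VNum n2%:R) (VNum r%:R))) k.

Definition fits (L : learner) (p : value R X) (S : seq (X * bool)) (U : seq X)
    (w : seq bool) (v : value R X) (k : nat) : Prop :=
  eval feat
    [:: p; vlist [seq VPair (VPt z.1) (vbool z.2) | z <- S];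
        vlist [seq VPt x | x <- U]; vlist [seq vbool b | b <- w]]
    (fit L) v k.

(* On every input, training takes at most [T] steps, each drawn sample and coin
   flip counting for one step, draws at most [M] samples in total, and ends
   with a value representing some output in the sense of [dec]. *)
Definition resources {O : Type} (dec : value R X -> O -> Prop) (L : learner)
    (p : value R X) (T M : R) : Prop :=
  exists n1 n2 r k1 : nat,
    [/\ plans L p n1 n2 r k1, (n1 + n2)%:R <= M &
     forall S U w, size S = n1 -> size U = n2 -> size w = r ->
       exists v k2 o, [/\ fits L p S U w v k2, dec v o &
                         (k1 + (n1 + n2 + r) + k2)%:R <= T]].

(* Expectation of [F s] for a list [s] of [n] i.i.d. draws from [P], written as
   an iterated integral. *)
Fixpoint iid_E {d'} {Y : measurableType d'} (P : set Y -> \bar R) (n : nat)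
    (F : seq Y -> \bar R) : \bar R :=
  if n is n'.+1 then (\int[P]_y iid_E P n' (fun s => F (y :: s)))%E
  else F [::].

Definition marginal (P : probability (X * bool)%type R) : set X -> \bar R :=
  pushforward P fst.

Definition fair_coin : set bool -> \bar R := bernoulli_prob (2^-1).

(* With probability at least [q] over labeled training samples from [Ptrain],
   unlabeled samples from the marginal of [Ptest] and fair coins, the learner
   ends with an output satisfying [good]. *)
Definition succeeds {O : Type} (dec : value R X -> O -> Prop) (L : learner)
    (p : value R X) (Ptrain Ptest : probability (X * bool)%type R) (q : R)
    (good : O -> Prop) : Prop :=
  exists n1 n2 r k1 : nat, plans L p n1 n2 r k1 /\
    (q%:E <=
      iid_E Ptrain n1 (fun S => iid_E (marginal Ptest) n2 (fun U =>
        iid_E fair_coin r (fun w =>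
          (`[< exists v k2 o, [/\ fits L p S U w v k2, dec v o & good o] >]
             : nat)%:R%:E))))%E.

Definition risk (P : probability (X * bool)%type R) (f : X -> bool) : \bar R :=
  P [set z | f z.1 != z.2].

(* The minimum in the definition of lambda is rendered as an infimum, which
   always exists. *)
Definition lambda (C : set (X -> bool))
    (Ptrain Ptest : probability (X * bool)%type R) : \bar R :=
  ereal_inf [set (risk Ptrain f + risk Ptest f)%E | f in C].

(* [None] is REJECT, [Some h] is ACCEPT with hypothesis [h]. *)
Definition tds_output (V : R) (v : value R X) (o : option (X -> bool)) : Prop :=
  if o is Some h then exists2 u, v = VInr u & denotes feat V u h
  else v = VInl VUnit.

(* A learner with error A lambda + eps and failure probability 1/100.  [T], [V]
   and [m] bound the training time, the time needed to evaluate the output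
   hypothesis at one point, and the total number of samples. *)
Definition agnostic_tds_learner (C : set (X -> bool)) (A : R) (L : learner)
    (T V m : R -> nat) : Prop :=
  forall eps : R, 0 < eps < 1 ->
    let dec := tds_output (V eps)%:R in
    resources dec L (VNum eps) (T eps)%:R (m eps)%:R /\
    forall Ptrain Ptest : probability (X * bool)%type R,
      succeeds dec L (VNum eps) Ptrain Ptest (1 - 100^-1) (fun o =>
        (forall h, o = Some h ->
           (risk Ptest h <= A%:E * lambda C Ptrain Ptest + eps%:E)%E) /\
        ((forall B, measurable B -> marginal Ptrain B = marginal Ptest B) ->
           o <> None)).

Definition pq_output (V : R) (v : value R X)
    (hg : (X -> bool) * (X -> bool)) : Prop :=
  exists u1 u2, [/\ v = VPair u1 u2, denotes feat V u1 hg.1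
                  & denotes feat V u2 hg.2].

(* For the parameters (eps, eta, delta), given to the learner as inputs: error
   bound [E], a function of lambda; rejection rate [rho]; failure probability
   delta; training time [T], evaluation time [V] and total number of samples
   [M]. *)
Definition agnostic_pq_learner (C : set (X -> bool)) (L : learner)
    (eps eta delta : R) (E : \bar R -> \bar R) (rho T V M : R) : Prop :=
  let p := VPair (VNum eps) (VPair (VNum eta) (VNum delta)) in
  let dec := pq_output V in
  resources dec L p T M /\
  forall Ptrain Ptest : probability (X * bool)%type R,
    succeeds dec L p Ptrain Ptest (1 - delta) (fun hg =>
      (Ptest [set z | (z.2 != hg.1 z.1) && hg.2 z.1]
         <= E (lambda C Ptrain Ptest))%E /\
      (marginal Ptrain [set x | hg.2 x = false] <= rho%:E)%E).

End Learners.

(* Main.v *)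
(** Keep an integer score [G] on the points.  A point is weighted by [v] as a
  training point and by [1 - v] as a test point, where [v] grows linearly from 0
  at [G = - h] to 1 at [G = h].  With [p = E_P v] and [a = (1 - p)^k], drawing
  blocks of points and keeping the only accepted one yields samples of
  [P' = a (k+1) v P + rest P] and [Q' = a (1 - v) Q + rest P].  In each round the
  TDS learner runs many times on fresh samples of [(P', Q')].

  - If [p] looks too large for the target rejection rate, lower [G] everywhere.
  - If the learner often rejects, it tells [P'] from [Q'], because it accepts
    [(P', P')]: a hybrid argument gives a function [D] of one test point for which
    [E_Q (1 - v) D - (k+1) E_P v D] has a positive mean; add [D] to [G].
  - Otherwise stop with the majority vote of the accepted hypotheses and the
    selector [G <= 0].  By soundness the error of the vote is small for [(1 - v) Q], and
    [1 - v >= 1/2] on the selected points; a training point is rejected only if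
    [v >= 1/2], which has probability at most [2 p].

  The first two moves decrease a convex potential [Phi] by a fixed amount in the
  mean, so that [exp (s Phi)] shrinks geometrically and the third case occurs in
  time.  The procedure is analysed as a random decision tree [prog], and a term
  computes the leaf of that tree reached on the given lists. *)
Require Import Defs.
From HB Require Import structures.
From mathcomp Require Import all_boot all_order all_algebra.
From mathcomp Require Import all_classical all_reals all_analysis.
From mathcomp Require Import measurable_realfun.
From mathcomp Require Import zify ring lra.

Set Implicit Arguments.
Unset Strict Implicit.
Unset Printing Implicit Defensive.
Import Order.TTheory GRing.Theory Num.Theory numFieldNormedType.Exports.
Local Open Scope classical_set_scope.
Local Open Scope ring_scope.

(** * Evaluation of terms *)

(** Three obstacles shape the development. The success event of the TDS learner may be
    nonmeasurable, and its iterated integral is then a supremum over simple functions; so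
    expectations are bounded from above, draw by draw, and whatever must be integrated exactly is
    measurable because the evaluation of terms is, once the features are. The weights must be
    sampled exactly with fair coins: hence an integer score, a piecewise linear weight and a width
    that is a power of two. Training blocks have one point more than test blocks, which puts the
    same factor [a] in both laws; [Q' - P'] is then [a] times the first-order decrease of [Phi], up
    to a term that recentering at a fresh training point cancels. Selectors and votes are closures,
    so a score reruns the TDS learner on samples kept from earlier rounds. Up to logarithms and
    factors in [eps] and [delta], there are [m ^ 2] rounds, a score costs [m ^ 2] runs, a trial
    evaluates [m] scores: [m ^ 5] in all, and the sixth power covers the logarithmic number of
    trials. The term [lambda / eta] arises because [P'] may charge an error [k.+2] times as much as
    [P]. *)

Section Semantics.
Context {R : realType} {X : Type} (feat : nat -> X -> R).
Notation value := (value R X).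
Notation eval := (Defs.eval feat).

Ltac inv_eval := match goal with
  | H : Defs.eval _ _ (_ _) _ _ |- _ => inversion H; clear H; subst
  | H : Defs.eval _ _ TUnit _ _ |- _ => inversion H; clear H; subst
  end.

Ltac det_step := match goal with
  | IH : forall v2 k2, Defs.eval _ ?e ?t v2 k2 -> _,
    H : Defs.eval _ ?e ?t _ _ |- _ =>
    let E := fresh in let F := fresh in
    destruct (IH _ _ H) as [E F]; clear H IH;
    first [discriminate E | injection E; intros | idtac]; subst
  end.

(** Runs are given by existential statements throughout; determinism is what identifies the results
    of two of them. *)
Lemma eval_det e t v1 k1 : eval e t v1 k1 ->
  forall v2 k2, eval e t v2 k2 -> v1 = v2 /\ k1 = k2.
Proof.
elim=> {e t v1 k1}; intros; inv_eval; try (repeat det_step; by split).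
  by split => //; congruence.
do 2 det_step.
have /eqP : i%:R = i0%:R :> R by congruence.
by rewrite eqr_nat => /eqP ->.
Qed.

(* [v'] is [v] with environments of closures extended at their far end. *)
Inductive vext : value -> value -> Prop :=
| XUnit : vext VUnit VUnit
| XNum r : vext (VNum r) (VNum r)
| XPt x : vext (VPt x) (VPt x)
| XPair v v' w w' : vext v v' -> vext w w' -> vext (VPair v w) (VPair v' w')
| XInl v v' : vext v v' -> vext (VInl v) (VInl v')
| XInr v v' : vext v v' -> vext (VInr v) (VInr v')
| XClo e e' t : eext e e' -> vext (VClo e t) (VClo e' t)
with eext : seq value -> seq value -> Prop :=
| XNil e : eext [::] e
| XCons v v' e e' : vext v v' -> eext e e' -> eext (v :: e) (v' :: e').

Fixpoint vext_refl (v : value) : vext v v :=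
  match v with
  | VUnit => XUnit
  | VNum r => XNum r
  | VPt x => XPt x
  | VPair v w => XPair (vext_refl v) (vext_refl w)
  | VInl v => XInl (vext_refl v)
  | VInr v => XInr (vext_refl v)
  | VClo e t => XClo t ((fix er e : eext e e :=
      if e is v :: e' then XCons (vext_refl v) (er e') else XNil [::]) e)
  end.

Lemma eext_onth e e' i v : eext e e' -> onth e i = Some v ->
  exists2 v', onth e' i = Some v' & vext v v'.
Proof.
move=> h; elim: h i => [e0|v0 v' {}e {}e' vv' ee' IH] [|i] //=.
  by move=> [<-]; exists v'.
exact: IH.
Qed.

Lemma vext_bool b v : vext (vbool b) v -> v = vbool b.
Proof.
by case: b => h; inversion h; subst;
  match goal with H : vext VUnit _ |- _ => inversion H end.
Qed.

Ltac ext_step := match goal with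
  | IH : forall e', eext ?e e' -> exists2 v', vext ?v v' & _,
    E : eext ?e ?e' |- _ =>
    let v' := fresh "v'" in let h := fresh in let k := fresh in
    destruct (IH e' E) as [v' h k]; clear IH;
    try match type of h with
    | vext (VNum _) _ => inversion h; subst
    | vext (VPt _) _ => inversion h; subst
    | vext (VClo _ _) _ => inversion h; subst
    | vext (VInl _) _ => inversion h; subst
    | vext (VInr _) _ => inversion h; subst
    | vext (VPair _ _) _ => inversion h; subst
    end
  end.

Ltac ext_close := eexists;
  last (by econstructor; eassumption); by [|constructor|exact: vext_refl].

(** The code of the given learner expects a short fixed environment. Inside a larger program the
    environment is longer, and so are those of the closures it returns; results agree up to [vext],
    with the same cost, and [vext] is equality on booleans and numbers. *)
Lemma eval_ext e t v k : eval e t v k -> forall e', eext e e' ->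
  exists2 v', vext v v' & eval e' t v' k.
Proof.
elim=> {e t v k}; intros; try by (repeat ext_step; ext_close).
- match goal with E : eext _ _, H : onth _ _ = _ |- _ =>
    have [v' ? ?] := eext_onth E H end.
  by exists v' => //; constructor.
- do 2 ext_step; match goal with IH : forall e', eext (?v :: ?c :: ?f) e' -> _,
    V : vext ?v _, C : vext ?c _, E : eext ?f _ |- _ =>
    have [w' hw ew] := IH _ (XCons V (XCons C E)) end.
  by exists w' => //; econstructor; eassumption.
- match goal with E : eext e _ |- _ => have E0 := E end.
  ext_step; match goal with IH : forall e', eext (?v :: _) e' -> _,
    V : vext ?v _ |- _ =>
    have [w' hw ew] := IH _ (XCons V E0) end.
  by exists w' => //; eapply ECaseL; eassumption.
- match goal with E : eext e _ |- _ => have E0 := E end.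
  ext_step; match goal with IH : forall e', eext (?v :: _) e' -> _,
    V : vext ?v _ |- _ =>
    have [w' hw ew] := IH _ (XCons V E0) end.
  by exists w' => //; eapply ECaseR; eassumption.
Qed.

Definition ev e t v (K : nat) := exists2 k, eval e t v k & (k <= K)%N.

Definition vapp (f a b : value) (K : nat) :=
  exists e t, f = VClo e t /\ ev (a :: f :: e) t b K.

Lemma ev_le e t v K K' : ev e t v K -> (K <= K')%N -> ev e t v K'.
Proof. by move=> [k ? kK] KK'; exists k => //; exact: leq_trans KK'. Qed.

Lemma vapp_le f a b K K' : vapp f a b K -> (K <= K')%N -> vapp f a b K'.
Proof. by move=> [e [t [-> h]]] hK; exists e, t; split=> //; exact: ev_le hK. Qed.

Lemma ev_var e i v : onth e i = Some v -> ev e (TVar i) v 1.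
Proof. by exists 1%N => //; constructor. Qed.

Lemma ev_fun e t : ev e (TFun t) (VClo e t) 1.
Proof. by exists 1%N => //; constructor. Qed.

Lemma ev_app e t u f v w k1 k2 k3 :
  ev e t f k1 -> ev e u v k2 -> vapp f v w k3 ->
  ev e (TApp t u) w (k1 + k2 + k3).+1.
Proof.
move=> [j1 h1 l1] [j2 h2 l2] [e' [b [? [j3 h3 l3]]]]; subst.
exists (j1 + j2 + j3).+1; last by lia.
by econstructor; eassumption.
Qed.

Lemma ev_unit e : ev e TUnit VUnit 1.
Proof. by exists 1%N => //; constructor. Qed.

Lemma ev_pair e t u v w k1 k2 : ev e t v k1 -> ev e u w k2 ->
  ev e (TPair t u) (VPair v w) (k1 + k2).+1.
Proof.
move=> [j1 h1 l1] [j2 h2 l2]; exists (j1 + j2).+1; last by lia.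
by constructor.
Qed.

Lemma ev_fst e t v w k : ev e t (VPair v w) k -> ev e (TFst t) v k.+1.
Proof. by move=> [j h l]; exists j.+1 => //; econstructor; eassumption. Qed.

Lemma ev_snd e t v w k : ev e t (VPair v w) k -> ev e (TSnd t) w k.+1.
Proof. by move=> [j h l]; exists j.+1 => //; econstructor; eassumption. Qed.

Lemma ev_inl e t v k : ev e t v k -> ev e (TInl t) (VInl v) k.+1.
Proof. by move=> [j h l]; exists j.+1 => //; constructor. Qed.

Lemma ev_inr e t v k : ev e t v k -> ev e (TInr t) (VInr v) k.+1.
Proof. by move=> [j h l]; exists j.+1 => //; constructor. Qed.

Lemma ev_caseL e t a b v w k1 k2 : ev e t (VInl v) k1 -> ev (v :: e) a w k2 ->
  ev e (TCase t a b) w (k1 + k2).+1.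
Proof.
move=> [j1 h1 l1] [j2 h2 l2]; exists (j1 + j2).+1; last by lia.
by eapply ECaseL; eassumption.
Qed.

Lemma ev_caseR e t a b v w k1 k2 : ev e t (VInr v) k1 -> ev (v :: e) b w k2 ->
  ev e (TCase t a b) w (k1 + k2).+1.
Proof.
move=> [j1 h1 l1] [j2 h2 l2]; exists (j1 + j2).+1; last by lia.
by eapply ECaseR; eassumption.
Qed.

Lemma ev_case_bool e t a b (c : bool) w k1 k2 : ev e t (vbool c) k1 ->
  ev (VUnit :: e) (if c then b else a) w k2 ->
  ev e (TCase t a b) w (k1 + k2).+1.
Proof. by case: c => h1 h2; [exact: ev_caseR h1 h2|exact: ev_caseL h1 h2]. Qed.

Lemma ev_nat e n : ev e (TNat n) (VNum n%:R) 1.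
Proof. by exists 1%N => //; constructor. Qed.

Lemma ev_add e t u r s k1 k2 : ev e t (VNum r) k1 -> ev e u (VNum s) k2 ->
  ev e (TAdd t u) (VNum (r + s)) (k1 + k2).+1.
Proof.
move=> [j1 h1 l1] [j2 h2 l2]; exists (j1 + j2).+1; last by lia.
by constructor.
Qed.

Lemma ev_sub e t u r s k1 k2 : ev e t (VNum r) k1 -> ev e u (VNum s) k2 ->
  ev e (TSub t u) (VNum (r - s)) (k1 + k2).+1.
Proof.
move=> [j1 h1 l1] [j2 h2 l2]; exists (j1 + j2).+1; last by lia.
by constructor.
Qed.

Lemma ev_mul e t u r s k1 k2 : ev e t (VNum r) k1 -> ev e u (VNum s) k2 ->
  ev e (TMul t u) (VNum (r * s)) (k1 + k2).+1.
Proof.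
move=> [j1 h1 l1] [j2 h2 l2]; exists (j1 + j2).+1; last by lia.
by constructor.
Qed.

Lemma ev_div e t u r s k1 k2 : ev e t (VNum r) k1 -> ev e u (VNum s) k2 ->
  ev e (TDiv t u) (VNum (r / s)) (k1 + k2).+1.
Proof.
move=> [j1 h1 l1] [j2 h2 l2]; exists (j1 + j2).+1; last by lia.
by constructor.
Qed.

Lemma ev_tle e t u r s k1 k2 : ev e t (VNum r) k1 -> ev e u (VNum s) k2 ->
  ev e (TLe t u) (vbool (r <= s)) (k1 + k2).+1.
Proof.
move=> [j1 h1 l1] [j2 h2 l2]; exists (j1 + j2).+1; last by lia.
by constructor.
Qed.

Lemma vapp_clo e t a b K : ev (a :: VClo e t :: e) t b K -> vapp (VClo e t) a b K.
Proof. by move=> h; exists e, t. Qed.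

Lemma denotes_vapp (V : nat) v f : denotes feat V%:R v f ->
  forall x, vapp v (VPt x) (vbool (f x)) V.
Proof.
move=> h x; have [k kV ek] := h x.
inv_eval; do 2 match goal with
  H : Defs.eval _ _ (TVar _) _ _ |- _ => inversion H; clear H; subst end.
simpl in *; do 2 match goal with H : Some _ = Some _ |- _ => case: H => ? end.
subst; exists e', b; split => //; exists k3 => //.
by rewrite ler_nat in kV; lia.
Qed.

Lemma vapp_denotes (K : nat) (V : R) v f : K.+3%:R <= V ->
  (forall x, vapp v (VPt x) (vbool (f x)) K) -> denotes feat V v f.
Proof.
move=> hV h x; have := h x => -[e [t [-> [k ek kK]]]].
exists k.+3; first by apply: le_trans hV; rewrite ler_nat.
by rewrite -[k.+3]/((1 + 1 + k).+1); apply: EApp ek; constructor.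
Qed.

Lemma denotes_ext V v v' f : denotes feat V v f -> vext v v' ->
  denotes feat V v' f.
Proof.
move=> h vv' x; have [k kV ek] := h x; exists k => //.
have [w /vext_bool -> //] := eval_ext ek
  (XCons vv' (XCons (XPt x) (XNil [::]))).
Qed.

End Semantics.

(** * Measurable dependence of evaluation on a parameter *)

Section MeasurableEval.
Context {R : realType} {d d' : measure_display} {X : measurableType d}
  {O : measurableType d'} (feat : nat -> X -> R).
Hypothesis mfeat : forall i, measurable_fun setT (feat i).

(* values depending measurably on a parameter, with a fixed shape *)
Notation pvalue := (value (O -> R) (O -> X)).

Fixpoint inst (w : O) (v : pvalue) : value R X :=
  match v with
  | VUnit => VUnit
  | VNum r => VNum (r w)
  | VPt x => VPt (x w)
  | VPair u v => VPair (inst w u) (inst w v)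
  | VInl v => VInl (inst w v)
  | VInr v => VInr (inst w v)
  | VClo e t => VClo (map (inst w) e) t
  end.

Fixpoint mval (v : pvalue) : Prop :=
  match v with
  | VUnit => True
  | VNum r => measurable_fun setT r
  | VPt x => measurable_fun setT x
  | VPair u v => mval u /\ mval v
  | VInl v => mval v
  | VInr v => mval v
  | VClo e t => foldr and True (map mval e)
  end.

Notation menv e := (foldr and True (map mval e)).

Lemma menv_onth e i v : menv e -> onth e i = Some v -> mval v.
Proof.
elim: e i => [|u e IH] [|i] //= [hu he]; last exact: IH.
by move=> [<-].
Qed.

Lemma inst_bool w b : inst w (vbool b) = vbool b.
Proof. by case: b. Qed.

Lemma measurable_invr : measurable_fun setT (fun r : R => r^-1).
Proof.
rewrite -(setUv [set 0 : R]); apply/measurable_funU => //.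
  exact: measurableC.
split; first exact: measurable_fun_set1.
apply: open_continuous_measurable_fun.
  by apply: closed_openC; exact: closed_eq.
by move=> x; rewrite inE /= => /eqP x0; exact: inv_continuous.
Qed.

Lemma measurable_exists (P : nat -> O -> Prop) :
  (forall n, measurable [set w | P n w]) -> measurable [set w | exists n, P n w].
Proof.
move=> h; rewrite (_ : [set w | _] = \bigcup_n [set w | P n w]).
  exact: bigcupT_measurable.
by apply/seteqP; split => w /= => [[n ?]|[n _ ?]]; exists n.
Qed.

Lemma measurable_andl (B : Prop) (P : O -> Prop) :
  (B -> measurable [set w | P w]) -> measurable [set w | B /\ P w].
Proof.
move=> h; have [b|nb] := pselect B.
  rewrite (_ : [set w | _] = [set w | P w]); first exact: h.
  by apply/seteqP; split => w //= [].
rewrite (_ : [set w | _] = set0); first exact: measurable0.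
by apply/seteqP; split => w //= [].
Qed.

Lemma measurable_conj (P Q : O -> Prop) :
  measurable [set w | P w] -> measurable [set w | Q w] ->
  measurable [set w | P w /\ Q w].
Proof. exact: measurableI. Qed.

Lemma measurable_disj (P Q : O -> Prop) :
  measurable [set w | P w] -> measurable [set w | Q w] ->
  measurable [set w | P w \/ Q w].
Proof. exact: measurableU. Qed.

Lemma measurable_le_fun (r s : O -> R) (b : bool) :
  measurable_fun setT r -> measurable_fun setT s ->
  measurable [set w | (r w <= s w) = b].
Proof.
move=> mr ms; have := measurable_fun_ler mr ms.
by move=> /(_ measurableT [set b]); rewrite setTI; apply.
Qed.

Ltac inv_app := match goal with
  | H1 : Defs.eval _ ?e ?t (VNum ?r) _, K1 : Defs.eval _ ?e ?t (VNum ?r') _,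
    H2 : Defs.eval _ ?e ?u (VNum ?s) _, K2 : Defs.eval _ ?e ?u (VNum ?s') _ |- _ =>
    let E := fresh in let F := fresh in
    have [[E] _] := eval_det K1 H1; have [[F] _] := eval_det K2 H2; subst
  end.

Ltac set_ext := apply/seteqP; split => w /=.

(** No sigma-algebra is put on values. [Q] stands for the rest of the computation and is only tested
    on results of a fixed shape whose numbers and points vary measurably. Where the course of a run
    depends on the parameter, at comparisons and feature indices, the set is cut into countably many
    measurable pieces; sharing the [k] steps between subterms adds a countable union. *)
Lemma measurable_eval k e t (Q : O -> value R X -> Prop) :
  menv e -> (forall v, mval v -> measurable [set w | Q w (inst w v)]) ->
  measurable [set w | exists2 v, Defs.eval feat (map (inst w) e) t v k & Q w v].
Proof.
elim/ltn_ind: k e t Q => k IH e t Q me mQ.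
(* The evaluation of the second subterm is made part of the predicate on the first result, so that
   the induction hypothesis applies twice. *)
have two (t1 t2 : term) (Q1 : O -> value R X -> value R X -> Prop) :
  (forall v1 v2, mval v1 -> mval v2 ->
    measurable [set w | Q1 w (inst w v1) (inst w v2)]) ->
  measurable [set w | exists k1 k2, k = (k1 + k2).+1 /\
    exists2 v1, Defs.eval feat (map (inst w) e) t1 v1 k1 &
    exists2 v2, Defs.eval feat (map (inst w) e) t2 v2 k2 & Q1 w v1 v2].
  move=> mQ1; apply: measurable_exists => k1; apply: measurable_exists => k2.
  apply: measurable_andl => ke; apply: (IH) => //; first by lia.
  move=> v1 mv1; apply: (IH) => //; first by lia.
  by move=> v2 mv2; exact: mQ1.
have arith t1 t2 (c : term) (Q2 : O -> R -> R -> Prop) :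
  (forall e v, Defs.eval feat e c v k -> exists k1 k2, k = (k1 + k2).+1 /\
     exists r s, Defs.eval feat e t1 (VNum r) k1 /\ Defs.eval feat e t2 (VNum s) k2) ->
  (forall e r s k1 k2, k = (k1 + k2).+1 -> Defs.eval feat e t1 (VNum r) k1 ->
     Defs.eval feat e t2 (VNum s) k2 -> forall w,
     Q2 w r s <-> exists2 v, Defs.eval feat e c v k & Q w v) ->
  (forall r s, measurable_fun setT r -> measurable_fun setT s ->
     measurable [set w | Q2 w (r w) (s w)]) ->
  measurable [set w | exists2 v, Defs.eval feat (map (inst w) e) c v k & Q w v].
  move=> h1 h2 h3.
  rewrite (_ : [set w | _] = [set w | exists k1 k2, k = (k1 + k2).+1 /\
    exists2 v1, Defs.eval feat (map (inst w) e) t1 v1 k1 &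
    exists2 v2, Defs.eval feat (map (inst w) e) t2 v2 k2 &
      if v1 is VNum r then if v2 is VNum s then Q2 w r s else False else False]).
    apply: two => -[|r|x|v1 v2|v1|v1|e1 u1] [|s|y|w1 w2|w1|w1|e2 u2] //= *;
      try exact: measurable0; exact: h3.
  set_ext.
    move=> [v ec qv]; have [k1 [k2 [ke [r [s [er es]]]]]] := h1 _ _ ec.
    exists k1, k2; split => //; exists (VNum r) => //; exists (VNum s) => //.
    by apply/(h2 _ _ _ _ _ ke er es); exists v.
  move=> [k1 [k2 [ke [v1 er [v2 es qrs]]]]].
  case: v1 er qrs => // r er; case: v2 es => // s es qrs.
  exact/(h2 _ _ _ _ _ ke er es).
have num r : measurable_fun setT r -> measurable [set w | Q w (VNum (r w))].
  by move=> mr; exact: (mQ (VNum r)).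
have const (c : term) (v : pvalue) (B : Prop) : mval v ->
  (forall w v', Defs.eval feat (map (inst w) e) c v' k <->
     B /\ v' = inst w v) ->
  measurable [set w | exists2 v, Defs.eval feat (map (inst w) e) c v k & Q w v].
  move=> mv h.
  rewrite (_ : [set w | _] = [set w | B /\ Q w (inst w v)]).
    by apply: measurable_andl => _; exact: mQ.
  set_ext; first by move=> [v' /h[b ->]].
  by move=> [b q]; exists (inst w v) => //; apply/h.
have one (c t1 : term) (Q1 : O -> value R X -> Prop) :
  (forall w, (exists2 v, Defs.eval feat (map (inst w) e) c v k & Q w v) <->
     exists k1, k = k1.+1 /\
     exists2 v, Defs.eval feat (map (inst w) e) t1 v k1 & Q1 w v) ->
  (forall v, mval v -> measurable [set w | Q1 w (inst w v)]) ->
  measurable [set w | exists2 v, Defs.eval feat (map (inst w) e) c v k & Q w v].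
  move=> h mQ1.
  rewrite (_ : [set w | _] = [set w | exists k1, k = k1.+1 /\
     exists2 v, Defs.eval feat (map (inst w) e) t1 v k1 & Q1 w v]).
    apply: measurable_exists => k1; apply: measurable_andl => ke.
    by apply: (IH) => //; lia.
  by set_ext; move/h.
case: t.
- move=> i; case hv : (onth e i) => [v|].
    apply: (const _ v (k = 1%N)); first exact: menv_onth hv.
    move=> w v'; split.
      by move=> h; inversion h; subst; move: H1; rewrite onth_map hv => -[].
    by move=> [-> ->]; constructor; rewrite onth_map hv.
  apply: (const _ VUnit False) => // w v'; split; last by case.
  by move=> h; inversion h; subst; move: H1; rewrite onth_map hv.
- move=> t; apply: (const _ (VClo e t) (k = 1%N)) => // w v'; split.
    by move=> h; inversion h; subst.
  by move=> [-> ->]; constructor.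
- move=> t u.
  rewrite (_ : [set w | _] = [set w | exists k3 k1 k2, k = (k1 + k2 + k3).+1 /\
    exists2 f, Defs.eval feat (map (inst w) e) t f k1 &
    exists2 v, Defs.eval feat (map (inst w) e) u v k2 &
    if f is VClo e' b then exists2 z,
      Defs.eval feat (v :: VClo e' b :: e') b z k3 & Q w z else False]).
    apply: measurable_exists => k3; apply: measurable_exists => k1.
    apply: measurable_exists => k2; apply: measurable_andl => ke.
    apply: (IH) => //; first by lia.
    move=> f mf; apply: (IH) => //; first by lia.
    case: f mf => [|r|x|v1 v2|v1|v1|e' b] mf v mv /=; try exact: measurable0.
    by apply: (IH k3 _ [:: v, VClo e' b & e']) => //; lia.
  set_ext.
    move=> [z h qz]; inversion h; subst; exists k3, k1, k2; split => //.
    by exists (VClo e' b) => //; exists v => //; exists z.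
  move=> [k3 [k1 [k2 [-> [f ef [v ev' q]]]]]].
  case: f ef q => // e' b ef [z ez qz].
  by exists z => //; econstructor; eassumption.
- apply: (const _ VUnit (k = 1%N)) => // w v'; split.
    by move=> h; inversion h; subst.
  by move=> [-> ->]; constructor.
- move=> t u.
  rewrite (_ : [set w | _] = [set w | exists k1 k2, k = (k1 + k2).+1 /\
    exists2 v1, Defs.eval feat (map (inst w) e) t v1 k1 &
    exists2 v2, Defs.eval feat (map (inst w) e) u v2 k2 & Q w (VPair v1 v2)]).
    by apply: two => v1 v2 m1 m2; apply: (mQ (VPair v1 v2)).
  set_ext.
    move=> [z h qz]; inversion h; subst; exists k1, k2; split => //.
    by exists v => //; exists w0.
  move=> [k1 [k2 [-> [v1 e1 [v2 e2 q]]]]].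
  by exists (VPair v1 v2) => //; constructor.
- move=> t.
  apply: (one _ t (fun w v => if v is VPair a b then Q w a else False)).
    move=> w; split.
      move=> [z h qz]; inversion h; subst; exists k0; split=> //.
      by exists (VPair z w0).
    move=> [k1 [-> [[] //= a b h q]]].
    by exists a => //; econstructor; eassumption.
  by move=> [|r|x|v1 v2|v1|v1|e' b] //= m; try exact: measurable0; exact: mQ m.1.
- move=> t.
  apply: (one _ t (fun w v => if v is VPair a b then Q w b else False)).
    move=> w; split.
      move=> [z h qz]; inversion h; subst; exists k0; split=> //.
      by exists (VPair v z).
    move=> [k1 [-> [[] //= a b h q]]].
    by exists b => //; econstructor; eassumption.
  by move=> [|r|x|v1 v2|v1|v1|e' b] //= m; try exact: measurable0; exact: mQ m.2.
- move=> t; apply: (one _ t (fun w v => Q w (VInl v))).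
    move=> w; split.
      by move=> [z h qz]; inversion h; subst; exists k0; split=> //; exists v.
    by move=> [k1 [-> [v h q]]]; exists (VInl v) => //; constructor.
  by move=> v mv; exact: (mQ (VInl v)).
- move=> t; apply: (one _ t (fun w v => Q w (VInr v))).
    move=> w; split.
      by move=> [z h qz]; inversion h; subst; exists k0; split=> //; exists v.
    by move=> [k1 [-> [v h q]]]; exists (VInr v) => //; constructor.
  by move=> v mv; exact: (mQ (VInr v)).
- move=> t a b.
  rewrite (_ : [set w | _] = [set w | exists k1 k2, k = (k1 + k2).+1 /\
    exists2 v1, Defs.eval feat (map (inst w) e) t v1 k1 &
    match v1 with
    | VInl v => exists2 z, Defs.eval feat (v :: map (inst w) e) a z k2 & Q w z
    | VInr v => exists2 z, Defs.eval feat (v :: map (inst w) e) b z k2 & Q w z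
    | _ => False end]).
    apply: measurable_exists => k1; apply: measurable_exists => k2.
    apply: measurable_andl => ke; apply: (IH) => //; first by lia.
    move=> [|r|x|v1 v2|v|v|e' c] //= m; try exact: measurable0.
      by apply: (IH k2 _ (v :: e)) => //; lia.
    by apply: (IH k2 _ (v :: e)) => //; lia.
  set_ext.
    move=> [z h qz]; inversion h; subst; exists k1, k2; split => //.
      by exists (VInl v) => //; exists z.
    by exists (VInr v) => //; exists z.
  move=> [k1 [k2 [-> [f e1]]]]; case: f e1 => // v e1 [z e2 q]; exists z => //.
    by eapply ECaseL; eassumption.
  by eapply ECaseR; eassumption.
- move=> n; apply: (const _ (VNum (fun=> n%:R)) (k = 1%N)).
    exact: measurable_cst.
  move=> w v'; split; first by move=> h; inversion h; subst.
  by move=> [-> ->]; constructor.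
1-5: move=> t u.
- apply: (arith t u _ (fun w r s => Q w (VNum (r + s)))).
  + move=> e0 v h; inversion h; subst; exists k1, k2; split=> //.
    by exists r, s.
  + move=> e0 r s k1 k2 -> e1 e2 w; split.
      by move=> q; eexists; last exact: q; constructor.
    move=> [v h]; inversion h; subst.
    by inv_app.
  + by move=> r s mr ms; apply: (mQ (VNum _)); exact: measurable_funD.
- apply: (arith t u _ (fun w r s => Q w (VNum (r - s)))).
  + move=> e0 v h; inversion h; subst; exists k1, k2; split=> //.
    by exists r, s.
  + move=> e0 r s k1 k2 -> e1 e2 w; split.
      by move=> q; eexists; last exact: q; constructor.
    move=> [v h]; inversion h; subst.
    by inv_app.
  + by move=> r s mr ms; apply: (mQ (VNum _)); exact: measurable_funB.
- apply: (arith t u _ (fun w r s => Q w (VNum (r * s)))).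
  + move=> e0 v h; inversion h; subst; exists k1, k2; split=> //.
    by exists r, s.
  + move=> e0 r s k1 k2 -> e1 e2 w; split.
      by move=> q; eexists; last exact: q; constructor.
    move=> [v h]; inversion h; subst.
    by inv_app.
  + by move=> r s mr ms; apply: (mQ (VNum _)); exact: measurable_funM.
- apply: (arith t u _ (fun w r s => Q w (VNum (r / s)))).
  + move=> e0 v h; inversion h; subst; exists k1, k2; split=> //.
    by exists r, s.
  + move=> e0 r s k1 k2 -> e1 e2 w; split.
      by move=> q; eexists; last exact: q; constructor.
    move=> [v h]; inversion h; subst.
    by inv_app.
  + move=> r s mr ms; apply: (mQ (VNum _)).
    apply: measurable_funM => //.
    exact: measurableT_comp measurable_invr ms.
- apply: (arith t u _ (fun w r s => Q w (vbool (r <= s)))).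
  + move=> e0 v h; inversion h; subst; exists k1, k2; split=> //.
    by exists r, s.
  + move=> e0 r s k1 k2 -> e1 e2 w; split.
      by move=> q; eexists; last exact: q; constructor.
    move=> [v h]; inversion h; subst.
    by inv_app.
  + move=> r s mr ms.
    rewrite (_ : [set w | _] = [set w |
      ((r w <= s w) = true /\ Q w (vbool true)) \/
      ((r w <= s w) = false /\ Q w (vbool false))]).
      apply: measurable_disj; apply: measurable_conj; try exact: measurable_le_fun.
        exact: (mQ (vbool true)).
      exact: (mQ (vbool false)).
    by set_ext; case: (_ <= _) => //; [left|right|move=> [|] []..].
- move=> t u.
  rewrite (_ : [set w | _] = [set w | exists k1 k2, k = (k1 + k2).+1 /\
    exists2 v1, Defs.eval feat (map (inst w) e) t v1 k1 &
    exists2 v2, Defs.eval feat (map (inst w) e) u v2 k2 &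
    if v1 is VNum r then if v2 is VPt x then
      exists i, r = i%:R /\ Q w (VNum (feat i x)) else False else False]).
    apply: two => -[|r|x|v1 v2|v1|v1|e1 u1] [|s|y|w1 w2|w1|w1|e2 u2] //= m1 m2;
      try exact: measurable0.
    apply: measurable_exists => i; apply: measurable_conj.
      rewrite (_ : [set w | _] = [set w | (r w <= i%:R) = true /\
         (i%:R <= r w) = true]).
        by apply: measurable_conj; apply: measurable_le_fun => //;
           exact: measurable_cst.
      set_ext; first by move=> ->; rewrite lexx.
      by move=> [h1 h2]; apply/eqP; rewrite eq_le h1 h2.
    by apply: (mQ (VNum _)); exact: measurableT_comp.
  set_ext.
    move=> [z h qz]; inversion h; subst; exists k1, k2; split => //.
    by exists (VNum i%:R) => //; exists (VPt x) => //; exists i.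
  move=> [k1 [k2 [-> [v1 er [v2 es q]]]]].
  case: v1 er q => // r er; case: v2 es => // y es [i [? q]]; subst.
  by exists (VNum (feat i y)) => //; constructor.
Qed.

End MeasurableEval.

(** * Bounded measurable functions and iterated expectations *)

Section BoundedMeasurable.
Context {R : realType} {d : measure_display} {Y : measurableType d}.

Definition bm (f : Y -> R) :=
  measurable_fun setT f /\ exists C : R, forall y, `|f y| <= C.

Lemma bm_cst (c : R) : bm (fun=> c).
Proof. by split; [exact: measurable_cst|exists `|c|]. Qed.

Lemma bmD f g : bm f -> bm g -> bm (fun y => f y + g y).
Proof.
move=> [mf [C hC]] [mg [D hD]]; split; first exact: measurable_funD.
exists (C + D) => y; apply: le_trans (ler_normD _ _) _; exact: lerD.
Qed.

Lemma bmM f g : bm f -> bm g -> bm (fun y => f y * g y).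
Proof.
move=> [mf [C hC]] [mg [D hD]]; split; first exact: measurable_funM.
by exists (C * D) => y; rewrite normrM; apply: ler_pM.
Qed.

Lemma bmZ (c : R) f : bm f -> bm (fun y => c * f y).
Proof. by move=> h; apply: bmM => //; exact: bm_cst. Qed.

Lemma bmN f : bm f -> bm (fun y => - f y).
Proof.
move=> [mf [C hC]]; split; first exact: measurableT_comp.
by exists C => y; rewrite normrN.
Qed.

Lemma bmB f g : bm f -> bm g -> bm (fun y => f y - g y).
Proof. by move=> hf hg; apply: bmD => //; exact: bmN. Qed.

Lemma bm_indic (b : Y -> bool) : measurable [set y | b y] ->
  bm (fun y => (b y)%:R).
Proof.
move=> mb; split; last by exists 1 => y; case: (b y); rewrite ?normr1 ?normr0.
rewrite (_ : (fun y => _) = \1_[set y | b y]); first exact: measurable_indic.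
apply/funext => y; rewrite indicE; congr (nat_of_bool _)%:R.
by apply/idP/idP; rewrite inE.
Qed.

Definition Ex (P : probability Y R) (f : Y -> R) : R := (\int[P]_y f y)%R.

Variable P : probability Y R.

Lemma bm_integrable f : bm f -> P.-integrable setT (EFin \o f).
Proof.
move=> [mf [C hC]]; apply: measurable_bounded_integrable => //.
  by apply: le_lt_trans (ltry 1); exact: (probability_le1 P measurableT).
by exists C; split => [|M CM y _]; [exact: num_real|exact: le_trans (hC y) (ltW CM)].
Qed.

Lemma Ex_EFin f : bm f -> (\int[P]_y (f y)%:E)%E = (Ex P f)%:E.
Proof.
move=> /bm_integrable h; rewrite /Ex /Rintegral fineK //.
exact: integrable_fin_num.
Qed.

Lemma ExD f g : bm f -> bm g -> Ex P (fun y => f y + g y) = Ex P f + Ex P g.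
Proof. by move=> /bm_integrable ? /bm_integrable ?; exact: RintegralD. Qed.

Lemma ExB f g : bm f -> bm g -> Ex P (fun y => f y - g y) = Ex P f - Ex P g.
Proof. by move=> /bm_integrable ? /bm_integrable ?; exact: RintegralB. Qed.

Lemma ExZ c f : bm f -> Ex P (fun y => c * f y) = c * Ex P f.
Proof. by move=> /bm_integrable ?; exact: RintegralZl. Qed.

Lemma Ex_cst c : Ex P (fun=> c) = c.
Proof.
rewrite /Ex Rintegral_cst// -[RHS]mulr1; congr (_ * _).
by rewrite -[RHS]/(fine 1%E); congr fine; exact: probability_setT.
Qed.

Lemma Ex_le f g : bm f -> bm g -> (forall y, f y <= g y) -> Ex P f <= Ex P g.
Proof.
by move=> /bm_integrable ? /bm_integrable ? fg; apply: le_Rintegral.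
Qed.

Lemma Ex_bounded f C : bm f -> (forall y, `|f y| <= C) ->
  `|Ex P f| <= C.
Proof.
move=> bf hC; rewrite ler_norml.
rewrite -{1}(Ex_cst (- C)) -[X in _ && (_ <= X)](Ex_cst C).
by apply/andP; split; apply: Ex_le => //; try exact: bm_cst;
  move=> y; have := hC y; rewrite ler_norml => /andP[].
Qed.

Lemma Ex_ge0 f : (forall y, 0 <= f y) -> 0 <= Ex P f.
Proof. by move=> h; apply: Rintegral_ge0. Qed.

Lemma eq_Ex f g : f =1 g -> Ex P f = Ex P g.
Proof. by move=> /funext ->. Qed.

Lemma Ex_indic (b : Y -> bool) : measurable [set y | b y] ->
  (P [set y | b y] = (Ex P (fun y => (b y)%:R))%:E)%E.
Proof.
move=> mb; rewrite -Ex_EFin; last exact: bm_indic.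
rewrite -[in LHS](setIT [set y | b y]) -integral_indic //.
apply: eq_integral => y _; rewrite indicE; congr ((nat_of_bool _)%:R%:E).
by apply/idP/idP; rewrite inE.
Qed.

End BoundedMeasurable.

Lemma bm_comp {R : realType} {d1 d2} {Y1 : measurableType d1}
    {Y2 : measurableType d2} (f : Y2 -> R) (g : Y1 -> Y2) :
  measurable_fun setT g -> bm f -> bm (f \o g).
Proof.
move=> mg [mf [C hC]]; split; first exact: measurableT_comp.
by exists C => y; exact: hC.
Qed.

Section Fubini.
Context {R : realType} {d1 d2 : measure_display} {O : measurableType d1}
  {Y : measurableType d2}.
Variable Q : probability Y R.

(** Tonelli's theorem wants a nonnegative integrand, hence the shift by the bound [C], which a
    probability integrates to [C]. *)
Lemma bm_Ex (f : O * Y -> R) : bm f -> bm (fun w => Ex Q (fun y => f (w, y))).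
Proof.
move=> [mf [C hC]].
have bmf w : bm (fun y => f (w, y)).
  by apply: (@bm_comp _ _ _ _ _ f (pair w)); [exact: measurable_pair1|split; last exists C].
split; last first.
  by exists C => w; apply: Ex_bounded => // y; exact: hC.
have mF : measurable_fun setT (fun w => \int[Q]_y (f (w, y) + C)%:E)%E.
  apply: (@measurable_fun_fubini_tonelli_F _ _ _ _ _ Q (fun z => (f z + C)%:E)).
    by apply: measurableT_comp => //; exact: measurable_funD.
  by move=> z; rewrite lee_fin; have := hC z; rewrite ler_norml => /andP[]; lra.
rewrite (_ : (fun w => _) = (fun w =>
    fine (\int[Q]_y (f (w, y) + C)%:E)%E - C)).
  apply: measurable_funB => //.
  exact: measurableT_comp mF.
apply/funext => w.
rewrite (@Ex_EFin _ _ _ Q (fun y => f (w, y) + C)) /=.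
  by rewrite ExD //; [rewrite Ex_cst addrK|exact: bm_cst].
by apply: bmD => //; exact: bm_cst.
Qed.

End Fubini.

Lemma Ex_swap {R : realType} {d1 d2} {O : measurableType d1}
    {Y : measurableType d2} (P : probability O R) (Q : probability Y R)
    (f : O * Y -> R) : bm f ->
  Ex P (fun w => Ex Q (fun y => f (w, y))) =
  Ex Q (fun y => Ex P (fun w => f (w, y))).
Proof.
move=> bf; have [mf [C hC]] := bf.
have bf1 w : bm (fun y => f (w, y)).
  by apply: (@bm_comp _ _ _ _ _ f (pair w)); first exact: measurable_pair1.
have bf2 y : bm (fun w => f (w, y)).
  by apply: (@bm_comp _ _ _ _ _ f (pair^~ y)); first exact: measurable_pair2.
have bsw : bm (fun y => Ex P (fun w => f (w, y))).
  apply: (@bm_Ex _ _ _ _ _ P (fun z => f (z.2, z.1))).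
  by apply: (@bm_comp _ _ _ _ _ f (fun z => (z.2, z.1))) => //; exact: measurable_swap.
have bsf := bm_Ex Q bf.
have fC0 z : (0 <= (f z + C)%:E)%E.
  by rewrite lee_fin; have := hC z; rewrite ler_norml => /andP[]; lra.
have := @fubini_tonelli _ _ _ _ _ P Q (fun z => (f z + C)%:E) _ fC0.
have -> : (fun x => \int[Q]_y (f (x, y) + C)%:E)%E =
    (fun x => (Ex Q (fun y => f (x, y)) + C)%:E).
  apply/funext => x; rewrite (@Ex_EFin _ _ _ _ (fun y => f (x, y) + C)).
    by rewrite ExD //; [rewrite Ex_cst|exact: bm_cst].
  by apply: bmD => //; exact: bm_cst.
have -> : (fun y => \int[P]_x (f (x, y) + C)%:E)%E =
    (fun y => (Ex P (fun x => f (x, y)) + C)%:E).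
  apply/funext => x; rewrite (@Ex_EFin _ _ _ _ (fun w => f (w, x) + C)).
    by rewrite ExD //; [rewrite Ex_cst|exact: bm_cst].
  by apply: bmD => //; exact: bm_cst.
rewrite !Ex_EFin; try by apply: bmD => //; exact: bm_cst.
rewrite !ExD ?Ex_cst //; try exact: bm_cst.
move=> h; apply: (addIr C); apply: EFin_inj; apply: h.
apply/measurable_EFinP; apply: measurable_funD => //.
Qed.

Section JointMeasurability.
Context {R : realType} {d : measure_display} {Y : measurableType d}.

(* Joint measurability and boundedness of [f] on lists of length [n], phrased
   through arbitrary measurable parametrizations of the list entries so that
   no measurable structure on lists is needed. *)
Definition jm (n : nat) (f : seq Y -> R) :=
  (forall d' (O : measurableType d') (a : seq (O -> Y)), size a = n ->
    (forall g, List.In g a -> measurable_fun setT g) ->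
    measurable_fun setT (fun w => f [seq g w | g <- a])) /\
  exists C : R, forall s, size s = n -> `|f s| <= C.

Lemma jm_bm n f d' (O : measurableType d') (a : seq (O -> Y)) : jm n f ->
  size a = n -> (forall g, List.In g a -> measurable_fun setT g) ->
  bm (fun w => f [seq g w | g <- a]).
Proof.
move=> [mf [C hC]] sa ma; split; [exact: mf|].
by exists C => w; apply: hC; rewrite size_map.
Qed.

(* [rho] rearranges, drops, duplicates or adds fixed entries *)
Lemma jm_comp n m (f : seq Y -> R) (rho : seq Y -> seq Y) : jm m f ->
  (forall d' (O : measurableType d') (a : seq (O -> Y)), size a = n ->
    (forall g, List.In g a -> measurable_fun setT g) ->
    exists b : seq (O -> Y), [/\ size b = m,
      (forall g, List.In g b -> measurable_fun setT g) &
      forall w, rho [seq g w | g <- a] = [seq g w | g <- b]]) ->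
  jm n (f \o rho).
Proof.
move=> [mf [C hC]] h; split; last first.
  exists C => s sz; apply: hC.
  have [||b [<- _ hb]] := h _ Y [seq (fun=> y) | y <- s].
  - by rewrite size_map.
  - by elim: s {sz} => //= y s IH g [<-|/IH //]; exact: measurable_cst.
  have := hb point; rewrite (_ : map _ [seq _ | _ <- _] = s).
    by move=> ->; rewrite size_map.
  by elim: s {sz hb} => //= y s ->.
move=> d' O a sa ma; have [b [sb mb ab]] := h _ _ a sa ma.
rewrite (_ : (fun w => _) = (fun w => f [seq g w | g <- b])); first exact: mf.
by apply/funext => w /=; rewrite ab.
Qed.

Lemma In_cat T (x : T) s t : List.In x (s ++ t) -> List.In x s \/ List.In x t.
Proof. by elim: s => [|y s IH] /= h; [right|case: h => [->|/IH]; tauto]. Qed.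

Lemma In_take_drop T n (x : T) s :
  List.In x (take n s) \/ List.In x (drop n s) -> List.In x s.
Proof.
elim: s n => [|y s IH] [|n] //= [h|h] //; try tauto.
  by case: h => [->|h]; [left|right; apply: (IH n); left].
by right; apply: (IH n); right.
Qed.

Lemma jm_cat n m f s0 t0 : jm m f -> (size s0 + n + size t0)%N = m ->
  jm n (fun s => f (s0 ++ s ++ t0)).
Proof.
move=> jf sz; apply: (jm_comp jf) => d' O a sa ma.
exists ([seq (fun=> y) | y <- s0] ++ a ++ [seq (fun=> y) | y <- t0]); split.
- by rewrite !size_cat !size_map; lia.
- have hc (s : seq Y) (g : O -> Y) : List.In g [seq (fun=> y) | y <- s] ->
    measurable_fun setT g.
    by elim: s => //= y s IH [<-|/IH //]; exact: measurable_cst.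
  move=> g h; case: (In_cat h) => [|{}h]; first exact: hc.
  by case: (In_cat h) => [|]; [exact: ma|exact: hc].
- have hm w (s : seq Y) :
    [seq g w | g <- [seq ((fun=> y) : O -> Y) | y <- s]] = s.
    by elim: s => //= y s ->.
  by move=> w; rewrite !map_cat !hm.
Qed.

Lemma jm_insert n i f y : jm n.+1 f -> (i <= n)%N ->
  jm n (fun s => f (take i s ++ y :: drop i s)).
Proof.
move=> jf hi; apply: (jm_comp jf) => d' O a sa ma.
exists (take i a ++ (fun=> y) :: drop i a); split.
- by rewrite size_cat /= size_take size_drop sa; case: ltnP => //; lia.
- move=> g h; case: (In_cat h) => [{}h|/= [<-|{}h]]; try exact: measurable_cst.
    by apply: ma; apply: (@In_take_drop _ i); left.
  by apply: ma; apply: (@In_take_drop _ i); right.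
- by move=> w; rewrite map_cat /= map_take map_drop.
Qed.

Lemma jm_head n f s : jm n.+1 f -> size s = n -> bm (fun y => f (y :: s)).
Proof.
move=> jf sz.
have h : (fun y => f (y :: s)) =
    (fun y => f [seq g y | g <- id :: [seq (fun=> z) | z <- s]]).
  by apply/funext => y /=; rewrite -map_comp map_id.
rewrite h; apply: jm_bm jf _ _; first by rewrite /= size_map sz.
move=> g /= [<-|]; first exact: measurable_id.
by elim: s {sz h} => //= y s IH [<-|/IH //]; exact: measurable_cst.
Qed.

Lemma jm_cons n f y : jm n.+1 f -> jm n (fun s => f (y :: s)).
Proof.
move=> jf; have := @jm_cat n n.+1 f [:: y] [::] jf _.
by rewrite /= addn0; under eq_fun do rewrite cats0; apply.
Qed.

Lemma jm_ext n f g : (forall s, size s = n -> f s = g s) ->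
  jm n f -> jm n g.
Proof.
move=> fg [mf [C hC]]; split; last by exists C => s sz; rewrite -fg // hC.
move=> d' O a sa ma.
rewrite (_ : (fun w => _) = (fun w => f [seq h w | h <- a])); first exact: mf.
by apply/funext => w; rewrite fg // size_map.
Qed.

Lemma jm_cst n c : jm n (fun=> c).
Proof. by split; [move=> *; exact: measurable_cst|exists `|c|]. Qed.

Lemma jmD n f g : jm n f -> jm n g -> jm n (fun s => f s + g s).
Proof.
move=> [mf [C hC]] [mg [D hD]]; split.
  by move=> d' O a sa ma; apply: measurable_funD; [exact: mf|exact: mg].
exists (C + D) => y sy; apply: le_trans (ler_normD _ _) _.
by apply: lerD; [exact: hC|exact: hD].
Qed.

Lemma jmM n f g : jm n f -> jm n g -> jm n (fun s => f s * g s).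
Proof.
move=> [mf [C hC]] [mg [D hD]]; split.
  by move=> d' O a sa ma; apply: measurable_funM; [exact: mf|exact: mg].
by exists (C * D) => y sy; rewrite normrM; apply: ler_pM; rewrite ?hC ?hD.
Qed.

End JointMeasurability.

(** * Iterated expectations over samples and over coins *)

Section IteratedExpectation.
Context {R : realType} {d : measure_display} {Y : measurableType d}.
Implicit Type P : probability Y R.

Fixpoint EI P (n : nat) (f : seq Y -> R) : R :=
  if n is m.+1 then Ex P (fun y => EI P m (fun s => f (y :: s))) else f [::].

Lemma eq_EI P n f g : (forall s, size s = n -> f s = g s) -> EI P n f = EI P n g.
Proof.
elim: n f g => [|n IH] f g fg /=; first exact: fg.
by apply: eq_Ex => y; apply: IH => s sz; apply: fg; rewrite /= sz.
Qed.

(** The drawn point becomes a coordinate: a parametrization over [O] turns into one over [O * Y]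
    whose last entry is the projection, and [bm_Ex] integrates that coordinate out. *)
Lemma jm_Ex P n f : jm n.+1 f -> jm n (fun s => Ex P (fun y => f (rcons s y))).
Proof.
move=> jf; have [mf [C hC]] := jf.
pose a0 d' (O : measurableType d') (a : seq (O -> Y)) : seq (O * Y -> Y) :=
  rcons [seq (g \o fst) | g <- a] snd.
have ha d' (O : measurableType d') (a : seq (O -> Y)) w y :
  [seq g (w, y) | g <- a0 _ _ a] = rcons [seq g w | g <- a] y.
  by rewrite /a0 map_rcons -map_comp.
have key d' (O : measurableType d') (a : seq (O -> Y)) : size a = n ->
  (forall g, List.In g a -> measurable_fun setT g) ->
  bm (fun z : O * Y => f [seq g z | g <- a0 _ _ a]).
  move=> sa ma; apply: jm_bm jf _ _; first by rewrite size_rcons size_map sa.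
  move=> g; rewrite /a0 -cats1 => h; case: (In_cat h) => [|/= [<-|//]].
    elim: (a) ma => //= k s IH mk [<-|].
      apply: measurableT_comp; [apply: mk; left => //|exact: measurable_fst].
    by move=> /IH; apply => l hl; apply: mk; right.
  exact: measurable_snd.
split.
  move=> d' O a sa ma; have := bm_Ex P (key _ _ a sa ma) => -[+ _].
  by apply: eq_measurable_fun => w _; apply: eq_Ex => y; rewrite ha.
exists C => s sz; apply: Ex_bounded.
  apply: (@bm_comp _ _ _ _ _ (fun z : Y * Y => f (rcons s z.2)) (fun y => (y, y))).
    exact: measurable_fun_pair.
  have hs (w : Y * Y) : rcons s w.2 =
      [seq g w | g <- rcons [seq (fun=> y) | y <- s] snd].
    by rewrite map_rcons -map_comp; congr rcons; rewrite -[LHS]map_id; apply: eq_map.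
  rewrite (_ : (fun z => _) = (fun w : Y * Y => f
      [seq g w | g <- rcons [seq (fun=> y) | y <- s] snd])); last first.
    by apply/funext => w; rewrite hs.
  apply: jm_bm jf _ _; first by rewrite size_rcons size_map sz.
  move=> g; rewrite -cats1 => h; case: (In_cat h) => [|/= [<-|//]].
    by elim: s {sz hs h} => //= y s IH [<-|/IH //]; exact: measurable_cst.
  exact: measurable_snd.
by move=> y; apply: hC; rewrite size_rcons sz.
Qed.

Lemma jm_EI P n k f : jm (n + k) f ->
  jm n (fun s => EI P k (fun t => f (s ++ t))).
Proof.
elim: k n f => [|k IH] n f.
  by rewrite addn0 => jf; apply: jm_ext jf => s _ /=; rewrite cats0.
rewrite -addSnnS => /IH /(jm_Ex P); apply: jm_ext => s _ /=.
by apply: eq_Ex => y; under eq_EI do rewrite cat_rcons.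
Qed.

Lemma bm_EI P n f : jm n.+1 f -> bm (fun y => EI P n (fun s => f (y :: s))).
Proof.
rewrite -add1n => jf; have := jm_EI P jf; move=> jg.
exact: (@jm_head _ _ _ 0 _ [::] jg erefl).
Qed.

Lemma jm_catl n s0 (f : seq Y -> R) : jm (size s0 + n) f -> jm n (fun s => f (s0 ++ s)).
Proof.
move=> jf; have := @jm_cat _ _ _ n _ f s0 [::] jf _.
by rewrite addn0 => /(_ erefl); apply: jm_ext => s _; rewrite cats0.
Qed.

Lemma EI_Ex P Q n f : jm n.+1 f ->
  EI P n (fun s => Ex Q (fun y => f (rcons s y))) =
  Ex Q (fun y => EI P n (fun s => f (rcons s y))).
Proof.
elim: n f => [|n IH] f jf //=.
have -> : (fun y => EI P n (fun s => Ex Q (fun z => f (y :: rcons s z)))) =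
    (fun y => Ex Q (fun z => EI P n (fun s => f (y :: rcons s z)))).
  by apply/funext => y; apply: (IH (fun s => f (y :: s))); exact: jm_cons.
have jf' : jm n.+2 (fun s => if s is y :: z :: t then f (y :: rcons t z) else 0).
  apply: (@jm_ext _ _ _ _ (f \o (fun s => if s is y :: z :: t then y :: rcons t z
     else [::]))); first by case=> [|y [|z t]].
  apply: (jm_comp jf) => d' O [|g [|h a]] //= [sz] ma.
  exists (g :: rcons a h); split => [||w]; first by rewrite /= size_rcons sz.
    move=> k /= [<-|]; first by apply: ma; left.
    rewrite -cats1 => hk; apply: ma; case: (In_cat hk) => [|/= [<-|//]]; tauto.
  by rewrite /= map_rcons.
have := @jm_EI P 2 n _ jf'.
set g := fun s : seq Y => EI P n _ => jg.
have hg : forall y z, EI P n (fun s => f (y :: rcons s z)) = g [:: y; z] by [].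
have bg : bm (fun w : Y * Y => g [:: w.1; w.2]).
  apply: (@jm_bm _ _ _ 2 g _ _ [:: fst; snd]) => //.
  by move=> h /= [<-|[<-|//]]; [exact: measurable_fst|exact: measurable_snd].
exact: (@Ex_swap _ _ _ _ _ P Q _ bg).
Qed.

Lemma EI_le P n f g : jm n f -> jm n g ->
  (forall s, size s = n -> f s <= g s) -> EI P n f <= EI P n g.
Proof.
elim: n f g => [|n IH] f g jf jg fg /=; first exact: fg.
apply: Ex_le; [exact: bm_EI|exact: bm_EI|] => y.
by apply: IH; [exact: jm_cons..|] => s sz; apply: fg; rewrite /= sz.
Qed.

Lemma EI_cst P n c : EI P n (fun=> c) = c.
Proof. by elim: n => //= n ->; rewrite Ex_cst. Qed.

Lemma EID P n f g : jm n f -> jm n g ->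
  EI P n (fun s => f s + g s) = EI P n f + EI P n g.
Proof.
elim: n f g => [|n IH] f g jf jg //=; rewrite -ExD; try exact: bm_EI.
by apply: eq_Ex => y; apply: IH; exact: jm_cons.
Qed.

Lemma EIZ P n c f : jm n f -> EI P n (fun s => c * f s) = c * EI P n f.
Proof.
elim: n f => [|n IH] f jf //=; rewrite -ExZ; try exact: bm_EI.
by apply: eq_Ex => y; apply: IH; exact: jm_cons.
Qed.

Lemma jmZ n c (f : seq Y -> R) : jm n f -> jm n (fun s => c * f s).
Proof. by move=> jf; apply: jmM => //; exact: jm_cst. Qed.

Lemma jmB n (f g : seq Y -> R) : jm n f -> jm n g -> jm n (fun s => f s - g s).
Proof.
move=> jf jg; have := jmD jf (jmZ (-1) jg).
by apply: jm_ext => s _; rewrite mulN1r.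
Qed.

Lemma iid_E_EI P n f : jm n f -> (forall s, 0 <= f s) ->
  iid_E P n (fun s => (f s)%:E) = (EI P n f)%:E.
Proof.
elim: n f => [|n IH] f jf f0 //=.
rewrite -Ex_EFin; last exact: bm_EI.
by apply: eq_integral => y _; apply: IH => //; exact: jm_cons.
Qed.

Fixpoint EC (r : nat) (f : seq bool -> R) : R :=
  if r is m.+1 then (EC m (fun w => f (true :: w)) +
                     EC m (fun w => f (false :: w))) / 2
  else f [::].

Lemma eq_EC r f g : (forall w, size w = r -> f w = g w) -> EC r f = EC r g.
Proof.
elim: r f g => [|r IH] f g fg /=; first exact: fg.
by congr ((_ + _) / _); apply: IH => w sw; apply: fg; rewrite /= sw.
Qed.

Lemma EC_le r f g : (forall w, size w = r -> f w <= g w) -> EC r f <= EC r g.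
Proof.
elim: r f g => [|r IH] f g fg /=; first exact: fg.
rewrite ler_pM2r ?invr_gt0 //; apply: lerD; apply: IH => w sw; apply: fg;
  by rewrite /= sw.
Qed.

Lemma EC_cst r c : EC r (fun=> c) = c.
Proof. by elim: r => //= r ->; lra. Qed.

Lemma EC_ge0 r f : (forall w, 0 <= f w) -> 0 <= EC r f.
Proof. by move=> h; rewrite -(EC_cst r 0); apply: EC_le. Qed.

Lemma ECD r f g : EC r (fun w => f w + g w) = EC r f + EC r g.
Proof. by elim: r f g => [|r IH] f g //=; rewrite !IH; lra. Qed.

Lemma ECZ r c f : EC r (fun w => c * f w) = c * EC r f.
Proof. by elim: r f => [|r IH] f //=; rewrite !IH; lra. Qed.

Lemma jm_EC n r (f : seq Y -> seq bool -> R) :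
  (forall w, size w = r -> jm n (f^~ w)) -> jm n (fun s => EC r (f s)).
Proof.
elim: r f => [|r IH] f jf /=; first exact: jf.
have h b : jm n (fun s => EC r (fun w => f s (b :: w))).
  by apply: (IH (fun s w => f s (b :: w))) => w sw; apply: jf; rewrite /= sw.
apply: (@jm_ext _ _ _ _ (fun s => 2^-1 * (EC r (fun w => f s (true :: w)) +
   EC r (fun w => f s (false :: w))))); first by move=> s _; rewrite mulrC.
by apply: jmZ; exact: jmD.
Qed.

Lemma iid_E_coin r f : (forall w, 0 <= f w) ->
  iid_E (@fair_coin R) r (fun w => (f w)%:E) = (EC r f)%:E.
Proof.
elim: r f => [|r IH] f f0 //=.
have -> : (fun b => iid_E (@fair_coin R) r (fun w => (f (b :: w))%:E)) =
          (fun b => (EC r (fun w => f (b :: w)))%:E).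
  by apply/funext => b; apply: (IH (fun w => f (b :: w))).
rewrite /fair_coin integral_bernoulli_prob; last 2 first.
- by rewrite invr_ge0 ler0n /= invf_le1 ?ler1n.
- by move=> b; rewrite lee_fin; exact: EC_ge0.
by rewrite -!EFinM -EFinD /unstable.onem; congr EFin; lra.
Qed.

End IteratedExpectation.

(** * Random decision trees *)

(* Randomized procedures drawing labeled training points, unlabeled test points
   and fair coins one at a time. *)
Inductive prog (X : Type) (A : Type) : Type :=
| Ret (a : A)
| DrawS (k : X * bool -> prog X A)
| DrawU (k : X -> prog X A)
| Coin (k : bool -> prog X A).

Arguments Ret {X A} a.
Arguments DrawS {X A} k.
Arguments DrawU {X A} k.
Arguments Coin {X A} k.

Fixpoint bind {X A B} (p : prog X A) (f : A -> prog X B) : prog X B :=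
  match p with
  | Ret a => f a
  | DrawS k => DrawS (fun y => bind (k y) f)
  | DrawU k => DrawU (fun x => bind (k x) f)
  | Coin k => Coin (fun b => bind (k b) f)
  end.

Notation "x <-- p ;; q" := (bind p (fun x => q))
  (at level 61, p at next level, right associativity).

Fixpoint reps {X A} (n : nat) (p : prog X A) : prog X (seq A) :=
  if n is m.+1 then a <-- p ;; s <-- reps m p ;; Ret (a :: s) else Ret [::].

Definition stream (X : Type) := (seq (X * bool) * seq X * seq bool)%type.

Fixpoint run {X A} (p : prog X A) (st : stream X) : option (A * stream X) :=
  match p with
  | Ret a => Some (a, st)
  | DrawS k => if st is (y :: s, U, w) then run (k y) (s, U, w) else None
  | DrawU k => if st is (s, x :: U, w) then run (k x) (s, U, w) else None
  | Coin k => if st is (s, U, b :: w) then run (k b) (s, U, w) else None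
  end.

Lemma run_bind {X A B} (p : prog X A) (f : A -> prog X B) st :
  run (bind p f) st = if run p st is Some (a, st') then run (f a) st' else None.
Proof.
elim: p st => [a|k IH|k IH|k IH] [[S U] w] //=.
- by case: S.
- by case: U.
- by case: w.
Qed.

Fixpoint uses {X A} (p : prog X A) (n1 n2 r : nat) : Prop :=
  match p with
  | Ret _ => True
  | DrawS k => (0 < n1)%N /\ forall y, uses (k y) n1.-1 n2 r
  | DrawU k => (0 < n2)%N /\ forall x, uses (k x) n1 n2.-1 r
  | Coin k => (0 < r)%N /\ forall b, uses (k b) n1 n2 r.-1
  end.

Lemma uses_le {X A} (p : prog X A) n1 n2 r m1 m2 s : uses p n1 n2 r ->
  (n1 <= m1)%N -> (n2 <= m2)%N -> (r <= s)%N -> uses p m1 m2 s.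
Proof.
elim: p n1 n2 r m1 m2 s => //= k IH n1 n2 r m1 m2 s [n0 h] h1 h2 h3;
  (split; [lia|move=> y; apply: IH (h y) _ _ _; lia]).
Qed.

Lemma uses_bind {X A B} (p : prog X A) (f : A -> prog X B) n1 n2 r m1 m2 s :
  uses p n1 n2 r -> (forall a, uses (f a) m1 m2 s) ->
  uses (bind p f) (n1 + m1) (n2 + m2) (r + s).
Proof.
elim: p n1 n2 r => [a|k IH|k IH|k IH] n1 n2 r /=.
- by move=> _ h; apply: uses_le (h a) _ _ _; lia.
- move=> [n0 h] hf; split; first by lia.
  by move=> y; apply: uses_le (IH _ _ _ _ (h y) hf) _ _ _; lia.
- move=> [n0 h] hf; split; first by lia.
  by move=> y; apply: uses_le (IH _ _ _ _ (h y) hf) _ _ _; lia.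
- move=> [n0 h] hf; split; first by lia.
  by move=> y; apply: uses_le (IH _ _ _ _ (h y) hf) _ _ _; lia.
Qed.

Lemma uses_reps {X A} (p : prog X A) k n1 n2 r : uses p n1 n2 r ->
  uses (reps k p) (k * n1) (k * n2) (k * r).
Proof.
move=> h; elim: k => //= k IH; rewrite !mulSn; apply: uses_bind => // a.
rewrite -[(k * n1)%N]addn0 -[(k * n2)%N]addn0 -[(k * r)%N]addn0.
exact: uses_bind.
Qed.

Lemma run_uses {X A} (p : prog X A) n1 n2 r (st : stream X) : uses p n1 n2 r ->
  (n1 <= size st.1.1)%N -> (n2 <= size st.1.2)%N -> (r <= size st.2)%N ->
  exists a st', run p st = Some (a, st').
Proof.
elim: p n1 n2 r st => [a|k IH|k IH|k IH] n1 n2 r [[S U] w] /=.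
- by move=> _ _ _ _; exists a, (S, U, w).
- case: S => [|y S] /= [n0 h] h1 h2 h3; first by lia.
  by apply: (IH _ _ _ _ (_, _, _) (h y)) => /=; lia.
- case: U => [|y U] /= [n0 h] h1 h2 h3; first by lia.
  by apply: (IH _ _ _ _ (_, _, _) (h y)) => /=; lia.
- case: w => [|y w] /= [n0 h] h1 h2 h3; first by lia.
  by apply: (IH _ _ _ _ (_, _, _) (h y)) => /=; lia.
Qed.

Fixpoint outcomes {X A} (p : prog X A) (F : A -> Prop) : Prop :=
  match p with
  | Ret a => F a
  | DrawS k => forall y, outcomes (k y) F
  | DrawU k => forall x, outcomes (k x) F
  | Coin k => forall b, outcomes (k b) F
  end.

Lemma outcomes_bind {X A B} (p : prog X A) (k : A -> prog X B) F G :
  outcomes p F -> (forall a, F a -> outcomes (k a) G) -> outcomes (bind p k) G.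
Proof.
by elim: p => [a|k' IH|k' IH|k' IH] /= h hk; [exact: hk|move=> ?; exact: IH..].
Qed.

Lemma outcomesT {X A} (p : prog X A) : outcomes p (fun=> True).
Proof. by elim: p. Qed.

Lemma outcomes_reps {X A} n (p : prog X A) :
  outcomes (reps n p) (fun s => size s = n).
Proof.
elim: n => //= n IH; apply: outcomes_bind (outcomesT p) _ => a _.
by apply: outcomes_bind IH _ => s /= ->.
Qed.

(** * Upper expectations of randomized procedures *)

Section UpperBounds.
Context {R : realType} {d : measure_display} {X : measurableType d}.
Notation Y := (X * bool)%type.
Variables (P Q : probability Y R).

(* [c] bounds the upper expectation of [f] on the outcome of [p], when training
   points come from [P] and test points from the marginal of [Q].  The function
   [f] need not be measurable: it is dominated step by step by measurable
   functions. *)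
Fixpoint UB {A} (p : prog X A) (f : A -> R) (c : R) : Prop :=
  match p with
  | Ret a => f a <= c
  | DrawS k => exists g : Y -> R,
      [/\ bm g, forall y, UB (k y) f (g y) & Ex P g <= c]
  | DrawU k => exists g : X -> R,
      [/\ bm g, forall x, UB (k x) f (g x) & Ex Q (g \o fst) <= c]
  | Coin k => exists c1 c0 : R,
      [/\ UB (k true) f c1, UB (k false) f c0 & (c1 + c0) / 2 <= c]
  end.

Lemma bm_fst (g : X -> R) : bm g -> bm (g \o (fst : Y -> X)).
Proof. by move=> bg; apply: bm_comp => //; exact: measurable_fst. Qed.

Lemma UB_le {A} (p : prog X A) f f' c c' : UB p f c ->
  (forall a, f' a <= f a) -> c <= c' -> UB p f' c'.
Proof.
move=> + ff'; elim: p c c' => [a|k IH|k IH|k IH] c c' /=.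
- by move=> h cc'; apply: le_trans (ff' a) _; exact: le_trans h cc'.
- move=> [g [bg hg gc]] cc'; exists g; split => //; last exact: le_trans gc cc'.
  by move=> y; apply: IH (hg y) _.
- move=> [g [bg hg gc]] cc'; exists g; split => //; last exact: le_trans gc cc'.
  by move=> y; apply: IH (hg y) _.
- move=> [c1 [c0 [h1 h0 h]]] cc'; exists c1, c0; split => //.
  + exact: IH h1 _.
  + exact: IH h0 _.
  + exact: le_trans h cc'.
Qed.

Lemma UB_add {A} (p : prog X A) f f' c c' : UB p f c -> UB p f' c' ->
  UB p (fun a => f a + f' a) (c + c').
Proof.
elim: p c c' => [a|k IH|k IH|k IH] c c' /=.
- exact: lerD.
- move=> [g [bg hg gc]] [g' [bg' hg' gc']].
  exists (fun y => g y + g' y); split; [exact: bmD|by move=> y; exact: IH|].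
  by rewrite ExD //; exact: lerD.
- move=> [g [bg hg gc]] [g' [bg' hg' gc']].
  exists (fun y => g y + g' y); split; [exact: bmD|by move=> y; exact: IH|].
  have -> : Ex Q ((fun y => g y + g' y) \o fst) =
    Ex Q (fun y => (g \o fst) y + (g' \o fst) y) by [].
  by rewrite ExD; [exact: lerD|exact: bm_fst..].
- move=> [c1 [c0 [h1 h0 h]]] [c1' [c0' [h1' h0' h']]].
  exists (c1 + c1'), (c0 + c0'); split; [exact: IH|exact: IH|lra].
Qed.

Lemma UB_scale {A} (p : prog X A) a f c : 0 <= a -> UB p f c ->
  UB p (fun x => a * f x) (a * c).
Proof.
move=> a0; elim: p c => [b|k IH|k IH|k IH] c /=.
- by move=> h; rewrite ler_wpM2l.
- move=> [g [bg hg gc]]; exists (fun y => a * g y).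
  by split; [exact: bmZ|by move=> y; exact: IH|rewrite ExZ // ler_wpM2l].
- move=> [g [bg hg gc]]; exists (fun y => a * g y).
  split; [exact: bmZ|by move=> y; exact: IH|].
  by have := ExZ Q a (bm_fst bg); rewrite /comp => ->; rewrite ler_wpM2l.
- move=> [c1 [c0 [h1 h0 h]]]; exists (a * c1), (a * c0); split; try exact: IH.
  by rewrite -mulrDr -mulrA ler_wpM2l.
Qed.

Lemma UB_cst {A} (p : prog X A) c : UB p (fun=> c) c.
Proof.
elim: p => [a|k IH|k IH|k IH] //=.
- by exists (fun=> c); split; [exact: bm_cst|exact: IH|rewrite Ex_cst].
- exists (fun=> c); split; [exact: bm_cst|exact: IH|].
  by rewrite -[X in _ <= X](Ex_cst Q c).
- by exists c, c; split => //; lra.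
Qed.

Lemma UB_bind_out {A B} (p : prog X A) (k : A -> prog X B) F f f1 c :
  outcomes p F -> UB p f1 c ->
  (forall a, F a -> UB (k a) f (f1 a)) -> UB (bind p k) f c.
Proof.
move=> + + hk; elim: p c => [a|k' IH|k' IH|k' IH] c /=.
- by move=> Fa h; apply: UB_le (hk a Fa) _ _.
- by move=> Fk [g [bg hg gc]]; exists g; split => // y; exact: IH.
- by move=> Fk [g [bg hg gc]]; exists g; split => // y; exact: IH.
- by move=> Fk [c1 [c0 [h1 h0 h]]]; exists c1, c0; split => //; exact: IH.
Qed.

Lemma UB_bind {A B} (p : prog X A) (k : A -> prog X B) f f1 c : UB p f1 c ->
  (forall a, UB (k a) f (f1 a)) -> UB (bind p k) f c.
Proof. by move=> h hk; apply: UB_bind_out (outcomesT p) h _ => a _. Qed.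

(** Bounded measurable functions are closed under negation, so upper bounds for all of them pin down
    the law of [p]. *)
Definition samplesS (p : prog X Y) (mu : probability Y R) :=
  forall g, bm g -> UB p g (Ex mu g).

Definition samplesU (p : prog X X) (mu : probability Y R) :=
  forall g, bm g -> UB p g (Ex mu (g \o fst)).

Lemma UB_reps p mu n f : samplesS p mu -> jm n f -> UB (reps n p) f (EI mu n f).
Proof.
move=> hp; elim: n f => [|n IH] f jf //=.
apply: (@UB_bind _ _ _ _ _ (fun y => EI mu n (fun s => f (y :: s)))).
  by apply: hp; exact: bm_EI.
move=> y; apply: (@UB_bind _ _ _ _ _ (fun s => f (y :: s))).
  by apply: IH; exact: jm_cons.
by move=> s /=; exact: lexx.
Qed.

Lemma jm_fst n (f : seq X -> R) : jm n f ->
  jm n (fun s : seq Y => f (map fst s)).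
Proof.
move=> [mf [C hC]]; split; last by exists C => s sz; rewrite hC // size_map.
move=> d' O a sa ma.
rewrite (_ : (fun w => _) = (fun w => f [seq g w | g <- [seq (fst \o g) | g <- a]])).
  apply: mf; first by rewrite size_map.
  elim: a {sa} ma => //= g a IH ma h [<-|hh].
    by apply: measurableT_comp; [exact: measurable_fst|apply: ma; left].
  by apply: IH hh => k hk; apply: ma; right.
by apply/funext => w; rewrite -!map_comp.
Qed.

Lemma fst_jm n (f : seq X -> R) : jm n (fun s : seq Y => f (map fst s)) -> jm n f.
Proof.
move=> [mf [C hC]]; split; last first.
  exists C => s sz; have := hC [seq (x, true) | x <- s].
  by rewrite -map_comp map_id size_map; apply.
move=> d' O a sa ma.
rewrite (_ : (fun w => _) = (fun w => f (map fst
   [seq g w | g <- [seq (fun w => (g w, true)) | g <- a]]))).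
  apply: mf; first by rewrite size_map.
  elim: a {sa} ma => //= g a IH ma h [<-|hh].
    by apply: measurable_fun_pair => //; apply: ma; left.
  by apply: IH hh => k hk; apply: ma; right.
by apply/funext => w; rewrite -!map_comp.
Qed.

Lemma UB_repsU p mu n f : samplesU p mu -> jm n f ->
  UB (reps n p) f (EI mu n (fun s => f (map fst s))).
Proof.
move=> hp; elim: n f => [|n IH] f jf //=.
apply: (@UB_bind _ _ _ _ _ (fun x => EI mu n (fun s => f (x :: map fst s)))).
  apply: (hp (fun x => EI mu n (fun s => f (x :: map fst s)))).
  have := @bm_EI _ _ _ mu n _ (jm_fst jf) => /=.
  move=> /(@bm_comp _ _ _ _ _ _ (fun x : X => (x, true))); apply.
  exact: measurable_fun_pair.
move=> y; apply: (@UB_bind _ _ _ _ _ (fun s => f (y :: s))).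
  by apply: IH; exact: jm_cons.
by move=> s /=; exact: lexx.
Qed.

Lemma UB_coins n f : UB (reps n (Coin (fun b => Ret b))) f (EC n f).
Proof.
elim: n f => [|n IH] f //=.
exists (EC n (fun w => f (true :: w))), (EC n (fun w => f (false :: w))).
split => //; apply: UB_bind (IH _) _ => s /=; exact: lexx.
Qed.

(* The lists are drawn in full before the procedure starts, training points
   first: Fubini lets us draw each item only when it is consumed. *)
Lemma UB_transfer {A} (p : prog X A) n1 n2 r (F : seq Y -> seq bool -> R) f c :
  uses p n1 n2 r -> (forall w, size w = r -> jm (n1 + n2) (F^~ w)) ->
  UB p f c ->
  (forall S V w a st, size S = n1 -> size V = n2 -> size w = r ->
    run p (S, map fst V, w) = Some (a, st) -> 1 - F (S ++ V) w <= f a) ->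
  1 - c <= EI P n1 (fun S => EI Q n2 (fun V => EC r (fun w => F (S ++ V) w))).
Proof.
have jin n1' n2' r' (G : seq Y -> seq bool -> R) :
  (forall w, size w = r' -> jm (n1' + n2') (G^~ w)) ->
  jm n1' (fun S => EI Q n2' (fun V => EC r' (fun w => G (S ++ V) w))).
  by move=> jG; exact: (jm_EI Q (jm_EC jG)).
elim: p n1 n2 r F c => [a|k IH|k IH|k IH] n1 n2 r F c /=.
- move=> _ jF hc hF; rewrite -[leLHS](EI_cst P n1).
  apply: EI_le => //; [exact: jm_cst|exact: jin|] => S sS.
  rewrite -[leLHS](EI_cst Q n2).
  apply: EI_le; [exact: jm_cst| |] => [|V sV].
    apply: (@jm_catl _ _ _ n2 S (fun s => EC r (fun w => F s w))).
    by rewrite sS; exact: jm_EC.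
  rewrite -[leLHS](EC_cst r); apply: EC_le => w sw.
  by have := hF S V w a _ sS sV sw erefl; move: hc; clear; lra.
- case: n1 => [|n1] [] // _ hk jF [g [bg hg gc]] hF /=.
  apply: le_trans (_ : Ex P (fun y => 1 - g y) <= _).
    by rewrite ExB ?Ex_cst //; [lra|exact: bm_cst].
  apply: Ex_le; [by apply: bmB => //; exact: bm_cst|exact: bm_EI (jin n1.+1 _ _ _ jF)|].
  move=> y; apply: (IH y n1 n2 r (fun s w => F (y :: s) w) (g y) (hk y) _ (hg y)).
    by move=> w sw; exact: (@jm_cons _ _ _ _ (F^~ w) y (jF w sw)).
  by move=> S V w a st sS sV sw hr; apply: (hF (y :: S) V w a st); rewrite /= ?sS.
- case: n2 => [|n2] [] // _ hk jF [g [bg hg gc]] hF /=.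
  have jFV : jm n1.+1 (fun S => EI Q n2 (fun V => EC r (fun w => F (S ++ V) w))).
    by apply: jin => w sw; rewrite addSnnS; exact: jF.
  (* The training points still in the list are integrated outside the test point just drawn. [EI_Ex]
     moves the test point out, and the induction hypothesis is applied to the function that
     reinserts it at position [n1]. *)
  rewrite (_ : EI P n1 _ = Ex Q (fun v => EI P n1 (fun S => EI Q n2
      (fun V => EC r (fun w => F (rcons S v ++ V) w))))); last first.
    rewrite -(@EI_Ex _ _ _ P Q n1 (fun S => EI Q n2 (fun V => EC r (fun w =>
       F (S ++ V) w))) jFV).
    by apply: eq_EI => s _; apply: eq_Ex => y; apply: eq_EI => t _; rewrite cat_rcons.
  have bg' := bm_fst bg.
  apply: le_trans (_ : Ex Q (fun y => 1 - (g \o fst) y) <= _).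
    by rewrite ExB ?Ex_cst //; [lra|exact: bm_cst].
  have bF : bm (fun v => EI P n1 (fun S => EI Q n2
      (fun V => EC r (fun w => F (rcons S v ++ V) w)))).
    have jj : jm n1.+1 (fun l : seq Y => if l is v :: s then EI Q n2
      (fun V => EC r (fun w => F (rcons s v ++ V) w)) else 0).
      apply: (@jm_ext _ _ _ _ ((fun S => EI Q n2 (fun V => EC r (fun w => F (S ++ V) w)))
        \o (fun l => if l is v :: s then rcons s v else [::]))); first by case.
      apply: (jm_comp jFV) => d' O [|h a] //= [sz] ma; exists (rcons a h); split.
      - by rewrite size_rcons sz.
      - move=> q; rewrite -cats1 => hq; apply: ma.
        by case: (In_cat hq) => [|/= [<-|//]]; tauto.
      - by move=> w; rewrite map_rcons.
    exact: (bm_EI P jj).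
  apply: Ex_le => //; first by apply: bmB => //; exact: bm_cst.
  move=> v.
  have := IH v.1 n1 n2 r (fun s w => F (take n1 s ++ v :: drop n1 s) w) (g v.1)
    (hk v.1) _ (hg v.1) _.
  move=> /= h; apply: le_trans (h _ _) _.
  + by move=> w sw; apply: (@jm_insert _ _ _ _ n1 (F^~ w)); [rewrite -addnS; exact: jF|lia].
  + move=> S V w a st sS sV sw hr.
    rewrite take_size_cat // drop_size_cat //.
    by apply: (hF S (v :: V) w a st); rewrite /= ?sV.
  + rewrite le_eqVlt; apply/orP; left; apply/eqP; apply: eq_EI => S sS.
    apply: eq_EI => V sV; apply: eq_EC => w sw.
    by rewrite take_size_cat // drop_size_cat // cat_rcons.
- case: r => [|r] [] // _ hk jF [c1 [c0 [h1 h0 hc]]] hF /=.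
  have jb b : forall w, size w = r -> jm (n1 + n2) (fun s => F s (b :: w)).
    by move=> w sw; apply: jF; rewrite /= sw.
  have hb b cb : UB (k b) f cb -> 1 - cb <= EI P n1 (fun S => EI Q n2 (fun V =>
      EC r (fun w => F (S ++ V) (b :: w)))).
    move=> hu; apply: (IH b n1 n2 r (fun s w => F s (b :: w)) cb (hk b) (jb b) hu).
    by move=> S V w a st sS sV sw hr; apply: (hF S V (b :: w) a st); rewrite /= ?sw.
  apply: (@le_trans _ _ (2^-1 * ((1 - c1) + (1 - c0)))); first by move: hc; clear; lra.
  rewrite (_ : EI P n1 _ = 2^-1 * (EI P n1 (fun S => EI Q n2 (fun V =>
      EC r (fun w => F (S ++ V) (true :: w)))) + EI P n1 (fun S => EI Q n2 (fun V =>
      EC r (fun w => F (S ++ V) (false :: w)))))).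
    by rewrite ler_pM2l ?invr_gt0 //; apply: lerD; exact: hb.
  rewrite -EID; try exact: (jin _ _ _ (fun s w => F s (_ :: w)) (jb _)).
  rewrite -EIZ; last first.
    by apply: jmD; exact: (jin _ _ _ (fun s w => F s (_ :: w)) (jb _)).
  apply: eq_EI => S sS.
  have je b : jm n2 (fun V => EC r (fun w => F (S ++ V) (b :: w))).
    apply: (@jm_catl _ _ _ n2 S (fun s => EC r (fun w => F s (b :: w)))).
    by rewrite sS; exact: jm_EC (jb b).
  rewrite -EID //.
  rewrite -EIZ; last by exact: jmD.
  by apply: eq_EI => V sV /=; rewrite mulrC.
Qed.

End UpperBounds.

(** * Measures with a density, and their mixtures *)

Section Density.
Context {R : realType} {d : measure_display} {Y : measurableType d}.

Definition density (P : probability Y R) (f : Y -> R) (bf : bm f)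
    (f0 : forall y, 0 <= f y) (A : set Y) : \bar R :=
  (\int[P]_(y in A) (f y)%:E)%E.

Section density_measure.
Variables (P : probability Y R) (f : Y -> R) (bf : bm f) (f0 : forall y, 0 <= f y).

Let density0 : density P bf f0 set0 = 0%E.
Proof. exact: integral_set0. Qed.

Let density_ge0 A : (0 <= density P bf f0 A)%E.
Proof. by apply: integral_ge0 => y _; rewrite lee_fin. Qed.

Let density_sigma_additive : semi_sigma_additive (density P bf f0).
Proof.
move=> /= A mA tA mUA; rewrite /density integral_bigcup//=; last first.
  by apply: (integrableS _ _ (subsetT _)) => //; exact: bm_integrable.
apply: is_cvg_ereal_nneg_natsum_cond => n _ _.
by apply: integral_ge0 => /= x ?; rewrite lee_fin.
Qed.

HB.instance Definition _ := isMeasure.Build _ _ _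
  (density P bf f0) density0 density_ge0 density_sigma_additive.

Let density_finite : fin_num_fun (density P bf f0).
Proof.
move=> A mA; apply: integrable_fin_num => //.
by apply: (integrableS _ _ (subsetT _)) => //; exact: bm_integrable.
Qed.

HB.instance Definition _ := Measure_isFinite.Build _ _ _
  (density P bf f0) density_finite.

Let density_dom : density P bf f0 `<< P.
Proof.
apply/null_content_dominatesP => /= A mA PA0.
apply: null_set_integral => //; apply/measurable_EFinP.
by apply: measurable_funTS; case: bf.
Qed.

(** Change of variables goes through the Radon-Nikodym derivative, which equals [f] almost
    everywhere because both have the same integral over every measurable set. *)
Lemma integral_density (h : Y -> R) : bm h -> (forall y, 0 <= h y) ->
  (\int[density P bf f0]_y (h y)%:E = (Ex P (fun y => f y * h y))%:E)%E.
Proof.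
move=> bh h0; have mh : measurable_fun setT (EFin \o h).
  by apply/measurable_EFinP; case: bh.
rewrite -(Radon_Nikodym_SigmaFinite.change_of_variables density_dom) //=.
rewrite -Ex_EFin; last exact: bmM.
apply: ae_eq_integral => //.
- apply: emeasurable_funM => //; apply: (measurable_int P).
  exact: Radon_Nikodym_SigmaFinite.f_integrable.
- by apply/measurable_EFinP; have [] := bmM bf bh.
under [X in ae_eq _ _ _ X]eq_fun do rewrite mulrC EFinM.
apply: ae_eqe_mul2l => /=.
apply: integral_ae_eq => //=.
- exact: Radon_Nikodym_SigmaFinite.f_integrable.
- by apply/measurable_EFinP; case: bf.
- by move=> A AT mA; rewrite -Radon_Nikodym_SigmaFinite.f_integral.
Qed.

End density_measure.

Section mixture.
Variables (P Q : probability Y R) (f g : Y -> R) (bf : bm f) (bg : bm g).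
Hypotheses (f0 : forall y, 0 <= f y) (g0 : forall y, 0 <= g y).
Hypothesis fg1 : Ex P f + Ex Q g = 1.

Definition mixture (fg1 : Ex P f + Ex Q g = 1) : set Y -> \bar R :=
  measure_add (density P bf f0) (density Q bg g0).

HB.instance Definition _ := Measure.on (mixture fg1).

Lemma integral_mixture (h : Y -> R) : bm h -> (forall y, 0 <= h y) ->
  (\int[mixture fg1]_y (h y)%:E =
   (Ex P (fun y => f y * h y) + Ex Q (fun y => g y * h y))%:E)%E.
Proof.
move=> bh h0; rewrite ge0_integral_measure_add //.
- by rewrite EFinD -(integral_density P bf f0 bh h0)
    -(integral_density Q bg g0 bh h0).
- by move=> y _; rewrite lee_fin.
- by apply/measurable_EFinP; case: bh.
Qed.

Let mixtureT : mixture fg1 setT = 1%E.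
Proof.
have := integral_mixture (bm_cst 1) (fun=> ler01).
rewrite integral_cst //= mul1e => ->.
transitivity (Ex P f + Ex Q g)%:E; last by rewrite fg1.
by congr (_ + _)%:E; apply: eq_Ex => y; rewrite mulr1.
Qed.

HB.instance Definition _ := Measure_isProbability.Build _ _ _
  (mixture fg1) mixtureT.

End mixture.

(** A signed [h] is made nonnegative by adding a bound [C]; since the total mass is 1, the shift
    contributes [C] to both sides and cancels. *)
Lemma mixture_exists (P Q : probability Y R) (f g : Y -> R) :
  bm f -> bm g -> (forall y, 0 <= f y) -> (forall y, 0 <= g y) ->
  Ex P f + Ex Q g = 1 ->
  exists mu : probability Y R, forall h, bm h ->
    Ex mu h = Ex P (fun y => f y * h y) + Ex Q (fun y => g y * h y).
Proof.
move=> bf bg f0 g0 fg1.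
exists (mixture bf bg f0 g0 fg1) => h bh; have [mh [C hC]] := bh.
have bhC : bm (fun y => h y + C) by apply: bmD => //; exact: bm_cst.
have h0 y : 0 <= h y + C.
  by have := hC y; rewrite ler_norml => /andP[]; lra.
have e1 : Ex (mixture bf bg f0 g0 fg1) (fun y => h y + C) =
    Ex P (fun y => f y * (h y + C)) + Ex Q (fun y => g y * (h y + C)).
  by apply: EFin_inj; rewrite -(integral_mixture bf bg f0 g0) // -Ex_EFin.
have e2 (S : probability Y R) k : bm k -> Ex S (fun y => k y * (h y + C)) =
    Ex S (fun y => k y * h y) + C * Ex S k.
  move=> bk; rewrite -ExZ // -ExD; [|exact: bmM|exact: bmZ].
  by apply: eq_Ex => y; ring.
move: e1; rewrite !e2 // ExD ?Ex_cst; [|by []|exact: bm_cst].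
have -> : Ex P (fun y => f y * h y) + C * Ex P f +
  (Ex Q (fun y => g y * h y) + C * Ex Q g) = Ex P (fun y => f y * h y) +
  Ex Q (fun y => g y * h y) + C * (Ex P f + Ex Q g) by ring.
by rewrite fg1 mulr1 => /addIr.
Qed.

End Density.

Import HBNNSimple.

(** * Lower integrals of possibly nonmeasurable functions *)

Section LowerIntegral.
Context {R : realType} {d : measure_display} {Y : measurableType d}.

(* The integral of a nonnegative, possibly nonmeasurable function is a supremum
   over simple functions below it. *)
Lemma integral_minorant (mu : {measure set Y -> \bar R}) (f : Y -> R) (e : R) :
  (forall y, 0 <= f y) -> (exists C : R, forall y, f y <= C) -> 0 < e ->
  (mu setT < +oo)%E ->
  exists h : Y -> R, [/\ bm h, forall y, 0 <= h y <= f y &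
    (\int[mu]_y (f y)%:E <= \int[mu]_y (h y)%:E + e%:E)%E].
Proof.
move=> f0 [C hC] e0 muT.
have fE0 y : (0 <= (f y)%:E)%E by rewrite lee_fin.
have ub (g : {nnsfun Y >-> R}) : (forall y, g y <= f y) ->
  (\int[mu]_y (g y)%:E <= (`|C| * fine (mu setT))%:E)%E.
  move=> gf; have fT : mu setT \is a fin_num by rewrite ge0_fin_numE.
  rewrite EFinM fineK // -integral_cst //; apply: ge0_le_integral => //.
  - by move=> y _; rewrite lee_fin fun_ge0.
  - by apply/measurable_EFinP; exact: measurable_funP.
  - by move=> y _; rewrite lee_fin; apply: le_trans (gf y) _;
      apply: le_trans (hC y) _; exact: ler_norm.
rewrite ge0_integralTE //.
set A := [set _ | _ in _].
have Afin : ereal_sup A \is a fin_num.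
  rewrite ge0_fin_numE; last first.
    by apply: ereal_sup_ubound; exists nnsfun0 => //; exact: sintegral0.
  apply: (@le_lt_trans _ _ (`|C| * fine (mu setT))%:E); last exact: ltry.
  apply/ge_ereal_sup => _ [g /= gf <-].
  have := ub g (fun y => gf y); rewrite integral_nnsfun //.
  by rewrite patch_setT; apply.
have [_ [g /= gf <-] hg] := ub_ereal_sup_adherent e0 Afin.
have gfy y : g y <= f y by have := gf y; rewrite lee_fin.
exists g; split.
- split; first exact: measurable_funP.
  exists `|C| => y; rewrite ger0_norm ?fun_ge0 //; apply: le_trans (gfy y) _.
  by apply: le_trans (hC y) _; exact: ler_norm.
- by move=> y; rewrite fun_ge0 /=; exact: gfy.
- rewrite integral_nnsfun // patch_setT.
  by rewrite -leeBlDr // ltW.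
Qed.

End LowerIntegral.

Section Marginal.
Context {R : realType} {d : measure_display} {X : measurableType d}.
Notation Y := (X * bool)%type.

Let fst_mfun : {mfun Y >-> X} :=
  HB.pack (fst : Y -> X) (isMeasurableFun.Build _ _ _ _ fst measurable_fst).

(** The set function [marginal] with its structure of probability. *)
Definition marg (Q : probability Y R) : probability X R := distribution Q fst_mfun.

Lemma Ex_marg Q (g : X -> R) : bm g -> Ex (marg Q) g = Ex Q (g \o fst).
Proof.
move=> bg; have [mg [C hC]] := bg.
have bgC : bm (fun x => g x + C) by apply: bmD => //; exact: bm_cst.
have g0 y : 0 <= g y + C.
  by have := hC y; rewrite ler_norml => /andP[]; lra.
suff h : Ex (marg Q) (fun x => g x + C) = Ex Q (fun y => (g \o fst) y + C).
  by apply: (addIr C); move: h; rewrite !ExD ?Ex_cst //;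
    try exact: bm_cst; exact: bm_fst.
apply: EFin_inj; rewrite -!Ex_EFin //; last first.
  by apply: bmD; [exact: bm_fst|exact: bm_cst].
rewrite ge0_integral_pushforward //.
- by apply/measurable_EFinP; case: bgC.
- by move=> x _; rewrite lee_fin.
Qed.

End Marginal.

Section LowerExpectation.
Context {R : realType} {d d' : measure_display} {X : measurableType d}
  {Z : measurableType d'}.
Notation Y := (X * bool)%type.
Variables (P Q : probability Y R).

Lemma le_integral_ge0 (mu : {measure set Z -> \bar R}) (f g : Z -> \bar R) :
  (forall z, 0 <= f z)%E -> (forall z, f z <= g z)%E ->
  (\int[mu]_z f z <= \int[mu]_z g z)%E.
Proof.
move=> f0 fg; rewrite !ge0_integralTE //; last first.
  by move=> z; exact: le_trans (fg z).
apply: ereal_sup_le => _ [h /= hf <-]; exists h => // z.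
exact: le_trans (hf z) (fg z).
Qed.

Lemma iid_E_ge0 (mu : {measure set Z -> \bar R}) n (F : seq Z -> \bar R) :
  (forall s, 0 <= F s)%E -> (0 <= iid_E mu n F)%E.
Proof.
elim: n F => [|n IH] F F0 //=; apply: integral_ge0 => z _.
by apply: IH => s.
Qed.

Lemma eq_iid_E (mu : set Z -> \bar R) n (F G : seq Z -> \bar R) :
  (forall s, size s = n -> F s = G s) -> iid_E mu n F = iid_E mu n G.
Proof.
elim: n F G => [|n IH] F G FG /=; first exact: FG.
by congr integral; apply/funext => z; apply: IH => s sz; apply: FG; rewrite /= sz.
Qed.

Lemma iid_E_le (mu : {measure set Z -> \bar R}) n (F G : seq Z -> \bar R) :
  (forall s, 0 <= F s)%E -> (forall s, F s <= G s)%E ->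
  (iid_E mu n F <= iid_E mu n G)%E.
Proof.
elim: n F G => [|n IH] F G F0 FG //=; apply: le_integral_ge0 => z.
  exact: iid_E_ge0.
exact: IH.
Qed.

Lemma iid_E_cst (mu : probability Z R) n (c : R) :
  iid_E mu n (fun=> c%:E) = c%:E.
Proof. by elim: n => //= n ->; rewrite Ex_EFin ?Ex_cst //; exact: bm_cst. Qed.

Lemma iid_E_fin (mu : probability Z R) n (F : seq Z -> \bar R) :
  (forall s, 0 <= F s <= 1)%E ->
  iid_E mu n F \is a fin_num /\ (0 <= iid_E mu n F <= 1)%E.
Proof.
move=> h; have h0 : (0 <= iid_E mu n F)%E by apply: iid_E_ge0 => s; case/andP: (h s).
have h1 : (iid_E mu n F <= 1)%E.
  rewrite -(iid_E_cst mu n 1); apply: iid_E_le => s; by case/andP: (h s).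
by rewrite h0 h1; split => //; rewrite ge0_fin_numE // (le_lt_trans h1) ?ltry.
Qed.

(** Since [f] may be nonmeasurable, each integral is replaced by that of a measurable minorant, at
    the price of half of the remaining slack [e]. One minus the minorant is then the dominating
    function that [UB] asks for. *)
Lemma UB_reps_lower (mu : probability Z R) (p : prog X Z) n (f : seq Z -> R)
    (lo e : R) :
  (forall g, bm g -> UB P Q p g (Ex mu g)) ->
  (forall s, 0 <= f s <= 1) ->
  (lo%:E <= iid_E mu n (fun s => (f s)%:E))%E -> 0 < e ->
  UB P Q (reps n p) (fun s => 1 - f s) (1 - lo + e).
Proof.
move=> hp; elim: n f lo e => [|n IH] f lo e hf /=.
  by rewrite lee_fin => h e0; lra.
move=> hlo e0.
have hD z : (forall s, 0 <= (f (z :: s))%:E <= 1)%E by move=> s; rewrite !lee_fin.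
pose D z := fine (iid_E mu n (fun s => (f (z :: s))%:E)).
have DE z : iid_E mu n (fun s => (f (z :: s))%:E) = (D z)%:E.
  by have [h _] := iid_E_fin mu n (hD z); rewrite fineK.
have D01 z : 0 <= D z <= 1.
  by have [_] := iid_E_fin mu n (hD z); rewrite DE !lee_fin.
have e2 : 0 < e / 2 by rewrite divr_gt0.
have muT : (mu setT < +oo)%E.
  by apply: le_lt_trans (ltry 1); exact: (probability_le1 mu measurableT).
have [||h [bh hD' hh]] := @integral_minorant _ _ _ mu D (e / 2) _ _ e2 muT.
- by move=> z; case/andP: (D01 z).
- by exists 1 => z; case/andP: (D01 z).
have hlo' : lo <= Ex mu h + e / 2.
  rewrite -lee_fin; apply: le_trans hlo _; rewrite EFinD -Ex_EFin //.
  by under eq_integral do rewrite DE.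
apply: (@UB_bind _ _ _ _ _ _ _ _ _ _ (fun z => 1 - h z + e / 2)).
  apply: UB_le (hp (fun z => 1 - h z + e / 2) _) _ _ => //.
    by apply: bmD; [apply: bmB => //|]; exact: bm_cst.
  have b1 : bm (fun z => 1 - h z) by apply: bmB => //; exact: bm_cst.
  rewrite ExD //; last exact: bm_cst.
  by rewrite ExB ?Ex_cst //; [lra|exact: bm_cst].
move=> z; apply: UB_bind (_ : UB P Q (reps n p) (fun s => 1 - f (z :: s)) _) _.
  apply: IH => //; rewrite DE lee_fin.
  by case/andP: (hD' z).
by move=> s /=; exact: lexx.
Qed.

End LowerExpectation.

Section Samples.
Context {R : realType} {d : measure_display} {X : measurableType d}.
Notation Y := (X * bool)%type.
Variables (P Q : probability Y R).

Definition sample (n1 n2 r : nat) (pS : prog X Y) (pU : prog X X) :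
    prog X (stream X) :=
  S <-- reps n1 pS ;; U <-- reps n2 pU ;;
  w <-- reps r (Coin (fun b => Ret b)) ;; Ret (S, U, w).

Variables (pS : prog X Y) (pU : prog X X) (P' Q' : probability Y R).
Hypotheses (hS : samplesS P Q pS P') (hU : samplesU P Q pU Q').

Lemma UB_sample_lower n1 n2 r (f : seq Y -> seq X -> seq bool -> R) (lo e : R) :
  (forall S U w, 0 <= f S U w <= 1) ->
  (lo%:E <= iid_E P' n1 (fun S => iid_E (marginal Q') n2 (fun U =>
     iid_E (@fair_coin R) r (fun w => (f S U w)%:E))))%E -> 0 < e ->
  UB P Q (sample n1 n2 r pS pU) (fun a => 1 - f a.1.1 a.1.2 a.2) (1 - lo + e).
Proof.
move=> hf hlo e0.
have e2 : 0 < e / 2 by rewrite divr_gt0.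
have coinE S U : iid_E (@fair_coin R) r (fun w => (f S U w)%:E) =
    (EC r (f S U))%:E.
  by apply: iid_E_coin => w; case/andP: (hf S U w).
have EC01 S U : 0 <= EC r (f S U) <= 1.
  rewrite EC_ge0 /=; last by move=> w; case/andP: (hf S U w).
  by rewrite -(EC_cst r 1); apply: EC_le => w _; case/andP: (hf S U w).
have hD S : (forall U, 0 <= (EC r (f S U))%:E <= 1)%E.
  by move=> U; rewrite !lee_fin.
pose D S := fine (iid_E (marg Q') n2 (fun U => (EC r (f S U))%:E)).
have DE S : iid_E (marg Q') n2 (fun U => (EC r (f S U))%:E) = (D S)%:E.
  by have [h _] := iid_E_fin (marg Q') n2 (hD S); rewrite fineK.
have D01 S : 0 <= D S <= 1.
  by have [_] := iid_E_fin (marg Q') n2 (hD S); rewrite DE !lee_fin.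
have hlo' : (lo%:E <= iid_E P' n1 (fun S => (D S)%:E))%E.
  apply: le_trans hlo _; rewrite (_ : (fun S => (D S)%:E) = (fun S =>
    iid_E (marginal Q') n2 (fun U => iid_E (@fair_coin R) r
      (fun w => (f S U w)%:E)))) //.
  by apply/funext => S; rewrite -DE; apply: eq_iid_E => U _; rewrite coinE.
have h1 := UB_reps_lower hS D01 hlo' e2.
have h2 : UB P Q (reps n1 pS) (fun S => 1 - D S + e / 2) (1 - lo + e).
  by apply: UB_le (UB_add h1 (UB_cst _ _ _ (e / 2))) _ _ => //; lra.
apply: UB_bind h2 _ => S.
have hU' (g : X -> R) : bm g -> UB P Q pU g (Ex (marg Q') g).
  by move=> bg; rewrite Ex_marg //; exact: hU.
have h3 := @UB_reps_lower _ _ _ _ _ P Q (marg Q') pU n2 (fun U => EC r (f S U))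
  (D S) (e / 2) hU' (EC01 S) _ e2.
apply: UB_bind (h3 _) _; first by rewrite DE.
move=> U; apply: (@UB_bind _ _ _ _ _ _ _ _ _ _ (fun w => 1 - f S U w)).
  rewrite (_ : 1 - EC r (f S U) = EC r (fun w => 1 - f S U w)); first exact: UB_coins.
  by rewrite (ECD r (fun=> 1)) EC_cst; congr (_ + _);
    rewrite -mulN1r -ECZ; apply: eq_EC => w _; rewrite mulN1r.
by move=> w /=; exact: lexx.
Qed.

Lemma UB_sample_jm n1 n2 r (f : seq Y -> seq X -> seq bool -> R) :
  (forall w, size w = r ->
     jm (n1 + n2) (fun s => f (take n1 s) (map fst (drop n1 s)) w)) ->
  UB P Q (sample n1 n2 r pS pU) (fun a => f a.1.1 a.1.2 a.2)
    (EI P' n1 (fun S => EI Q' n2 (fun V => EC r (f S (map fst V))))).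
Proof.
move=> jf; rewrite (_ : EI P' n1 _ = EI P' n1 (fun S => EI Q' n2 (fun V =>
    EC r (f (take n1 (S ++ V)) (map fst (drop n1 (S ++ V))))))); last first.
  apply: eq_EI => S sS; apply: eq_EI => V _.
  by rewrite take_size_cat // drop_size_cat.
apply: (UB_bind_out (outcomes_reps n1 pS) (UB_reps hS (jm_EI Q' (jm_EC jf)))).
move=> S sS.
have jS : jm n2 (fun V : seq Y => EC r (f S (map fst V))).
  have jS : jm (size S + n2) (fun s => EC r (f (take n1 s) (map fst (drop n1 s)))).
    by rewrite sS; exact: (jm_EC jf).
  apply: jm_ext (jm_catl jS) => V _ /=.
  by rewrite take_size_cat // drop_size_cat.
rewrite (_ : EI Q' n2 _ = EI Q' n2 (fun V => EC r (f S (map fst V)))); last first.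
  by apply: eq_EI => V _; rewrite take_size_cat // drop_size_cat.
apply: (UB_bind (UB_repsU hU (fst_jm (f := fun U => EC r (f S U)) jS))).
move=> U; apply: UB_bind (UB_coins _ _ _ (f S U)) _ => w /=.
exact: lexx.
Qed.

End Samples.

(** * Measurability of what a fitted learner answers *)

Section FitMeasurability.
Context {R : realType} {d : measure_display} {X : measurableType d}
  (feat : nat -> X -> R).
Notation Y := (X * bool)%type.
Hypothesis mfeat : forall i, measurable_fun setT (feat i).
Variable L : learner.

Fixpoint lift {d'} {O : measurableType d'} (v : value R X) :
    value (O -> R) (O -> X) :=
  match v with
  | VUnit => VUnit
  | VNum r => VNum (fun=> r)
  | VPt x => VPt (fun=> x)
  | VPair u v => VPair (lift u) (lift v)
  | VInl v => VInl (lift v)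
  | VInr v => VInr (lift v)
  | VClo e t => VClo (map lift e) t
  end.

Fixpoint lift_inst {d'} {O : measurableType d'} (w : O) (v : value R X) :
    inst w (lift v) = v.
Proof.
case: v => //= [u v|v|v|e t].
- by rewrite !lift_inst.
- by rewrite lift_inst.
- by rewrite lift_inst.
- congr VClo; move: e; fix IH 1 => -[|v e]; first exact: erefl.
  by rewrite /= lift_inst (IH e).
Qed.

Fixpoint lift_mval {d'} {O : measurableType d'} (v : value R X) :
    mval (lift v : value (O -> R) (O -> X)).
Proof.
case: v => [|r|x|u v|v|v|e t].
- exact: I.
- exact: measurable_cst.
- exact: measurable_cst.
- by split; exact: lift_mval.
- exact: (lift_mval _ _ v).
- exact: (lift_mval _ _ v).
- move: e; fix IH 1 => -[|v e]; first exact: I.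
  split; [exact: lift_mval|exact: (IH e)].
Qed.

(** Truth without a time bound: a union over all step counts, hence measurable jointly in the value
    and the point. *)
Definition answers (u : value R X) (x : X) : Prop :=
  exists k, Defs.eval feat [:: u; VPt x] (TApp (TVar 0) (TVar 1)) (vbool true) k.

Lemma answers_denotes V u h : denotes feat V u h ->
  forall x, answers u x <-> h x.
Proof.
move=> hu x; have [k _ ek] := hu x; split; last first.
  by move=> hx; exists k; rewrite hx in ek.
move=> [k' ek']; have [] := eval_det ek ek'.
by case: (h x).
Qed.

Lemma measurable_answers {d'} {O : measurableType d'}
    (u : value (O -> R) (O -> X)) (x : O -> X) :
  mval u -> measurable_fun setT x -> measurable [set w | answers (inst w u) (x w)].
Proof.
move=> mu mx; apply: measurable_exists => k.
rewrite (_ : [set w | _] = [set w | exists2 v, Defs.eval feat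
   (map (inst w) [:: u; VPt x]) (TApp (TVar 0) (TVar 1)) v k &
   v = vbool true]).
  apply: measurable_eval => //= v _.
  have [->|hv] := pselect (v = vbool true).
    by rewrite (_ : [set w | _] = setT) //; apply/seteqP; split.
  rewrite (_ : [set w | _] = set0) //; apply/seteqP; split => // w /=.
  by case: v hv => // -[] //= hv [].
apply/seteqP; split => w /=; first by exists (vbool true).
by move=> [v h vE]; rewrite vE in h.
Qed.

Lemma denotes_measurable V u h : denotes feat V u h ->
  measurable [set x | h x].
Proof.
move=> hu; rewrite (_ : [set x | h x] = [set x | answers u x]).
  have := @measurable_answers _ X (lift u) id (lift_mval u) (@measurable_id _ _ _).
  by under eq_fun do rewrite lift_inst.
by apply/seteqP; split => x /=; [move/(answers_denotes hu)|move/(answers_denotes hu)].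
Qed.

Lemma measurable_labels {d'} {O : measurableType d'} (a : seq (O -> Y)) l :
  (forall g, List.In g a -> measurable_fun setT g) ->
  measurable [set w | [seq (g w).2 | g <- a] = l].
Proof.
elim: a l => [|g a IH] [|b l] ma /=; try exact: measurable0.
- by rewrite (_ : [set w | _] = setT) //; apply/seteqP; split.
- by rewrite (_ : [set w | _] = set0) //; apply/seteqP; split.
- by rewrite (_ : [set w | _] = set0) //; apply/seteqP; split.
rewrite (_ : [set w | _] = [set w | (g w).2 = b] `&`
   [set w | [seq (g w).2 | g <- a] = l]).
  apply: measurableI; last by apply: IH => h ha; apply: ma; right.
  have mg : measurable_fun setT (fun w => (g w).2).
    by apply: measurableT_comp; [exact: measurable_snd|apply: ma; left].
  by have := mg measurableT [set b] I; rewrite setTI.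
by apply/seteqP; split => w /= [-> ->].
Qed.

(** Labels belong to the shape of the input value, which a parametrized value keeps fixed. The
    parameter space is therefore cut along the countably many lists of labels, enumerated by
    [unpickle]. *)
Lemma measurable_fits {d'} {O : measurableType d'} (a : seq (O -> Y))
    (b : seq (O -> X)) (w : seq bool) (p : value R X)
    (F : O -> value R X -> Prop) :
  (forall g, List.In g a -> measurable_fun setT g) ->
  (forall g, List.In g b -> measurable_fun setT g) ->
  (forall v, mval v -> measurable [set o | F o (inst o v)]) ->
  measurable [set o | exists k v, fits feat L p [seq g o | g <- a]
     [seq g o | g <- b] w v k /\ F o v].
Proof.
move=> ma mb mF; apply: measurable_exists => k.
rewrite (_ : [set o | _] = [set o | exists n : nat,
   [seq (g o).2 | g <- a] = odflt [::] (unpickle n) /\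
   exists2 v, Defs.eval feat (map (inst o)
     [:: lift p;
         vlist [seq VPair (VPt (fst \o z.1)) (vbool z.2)
               | z <- zip a (odflt [::] (unpickle n))];
         vlist [seq VPt g | g <- b];
         vlist [seq vbool c | c <- w]]) (fit L) v k & F o v]).
  apply: measurable_exists => n; move: (odflt _ _) => l.
  apply: (measurable_conj (measurable_labels _ ma)).
  apply: measurable_eval => //=; split; first exact: lift_mval.
  split; last split.
  - elim: a l ma => [|g a IH] [|c l] //= ma.
    split; [split; last by case: c|].
      apply: measurableT_comp; first exact: measurable_fst.
      by apply: ma; left.
    by apply: IH => h hh; apply: ma; right.
  - elim: b mb => //= g b IH mb; split; first by apply: mb; left.
    by apply: IH => h hh; apply: mb; right.
  - split => //; elim: w => //= c w IH; split => //; by case: c.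
have envE o n : [seq (g o).2 | g <- a] = odflt [::] (unpickle n) ->
  map (inst o) [:: lift p;
         vlist [seq VPair (VPt (fst \o z.1)) (vbool z.2)
               | z <- zip a (odflt [::] (unpickle n))];
         vlist [seq VPt g | g <- b]; vlist [seq vbool c | c <- w]] =
  [:: p; vlist [seq VPair (VPt z.1) (vbool z.2) | z <- [seq g o | g <- a]];
        vlist [seq VPt x | x <- [seq g o | g <- b]]; vlist [seq vbool b | b <- w]].
  move=> <- /=; rewrite lift_inst; congr [:: _; _; _; _].
  - by elim: (a) => //= g a' ->; rewrite inst_bool.
  - by elim: (b) => //= g b' ->.
  - by elim: (w) => //= g b' ->; rewrite inst_bool.
apply/seteqP; split => o /=.
  move=> [v [hf Fv]]; exists (pickle [seq (g o).2 | g <- a]).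
  have e : [seq (g o).2 | g <- a] =
    odflt [::] (unpickle (pickle [seq (g o).2 | g <- a])) by rewrite pickleK.
  by split => //; exists v => //; move: (envE o _ e) => /= ->.
move=> [n [e [v ev Fv]]]; exists v; split => //.
by move: (envE o _ e) ev => /= ->.
Qed.

End FitMeasurability.

(** * Reweighted distributions *)

Section Potential.
Context {R : realType}.
Variable h : R.
Hypothesis h0 : 0 < h.
Implicit Types z s : R.

Definition pos z := Num.max z 0.
Definition clamp z : R := (pos (z + h) - pos (z - h)) / (2 * h).
(** An antiderivative of [clamp]. As [clamp] is nondecreasing with slope at most [1 / (2 * h)],
    [phi] is convex and its second-order error is the one in [phi_step]. *)
Definition phi z : R := (pos (z + h) ^+ 2 - pos (z - h) ^+ 2) / (4 * h).

Lemma posE z : (0 <= z /\ pos z = z) \/ (z <= 0 /\ pos z = 0).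
Proof. by rewrite /pos; case: (leP z 0) => ?; [right|left]; split => //; exact: ltW. Qed.

Lemma clamp_ge0 z : 0 <= clamp z.
Proof.
rewrite /clamp divr_ge0 //; last by move: h0; lra.
by move: (posE (z + h)) (posE (z - h)) h0 => [[? ->]|[? ->]] [[? ->]|[? ->]]; lra.
Qed.

Lemma clamp_le1 z : clamp z <= 1.
Proof.
rewrite /clamp ler_pdivrMr ?mul1r; last by move: h0; lra.
by move: (posE (z + h)) (posE (z - h)) h0 => [[? ->]|[? ->]] [[? ->]|[? ->]]; lra.
Qed.

Lemma clamp_half z : 0 <= z -> 1 / 2 <= clamp z.
Proof.
move=> z0; rewrite /clamp ler_pdivlMr; last by move: h0; lra.
by move: (posE (z + h)) (posE (z - h)) h0 => [[? ->]|[? ->]] [[? ->]|[? ->]]; lra.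
Qed.

Lemma clamp_half' z : z <= 0 -> clamp z <= 1 / 2.
Proof.
move=> z0; rewrite /clamp ler_pdivrMr; last by move: h0; lra.
by move: (posE (z + h)) (posE (z - h)) h0 => [[? ->]|[? ->]] [[? ->]|[? ->]]; lra.
Qed.

Lemma phi_step z s : phi (z + s) <= phi z + s * clamp z + s ^+ 2 / (4 * h).
Proof.
have h4 : 0 < 4 * h by move: h0; lra.
rewrite -subr_ge0 /phi /clamp (_ : _ - _ = (pos (z + h) ^+ 2 - pos (z - h) ^+ 2 +
  2 * s * (pos (z + h) - pos (z - h)) + s ^+ 2 -
  (pos (z + s + h) ^+ 2 - pos (z + s - h) ^+ 2)) / (4 * h)); last first.
  by field; rewrite gt_eqF.
apply: divr_ge0; last exact: ltW.
by move: (posE (z + h)) (posE (z - h)) (posE (z + s + h)) (posE (z + s - h)) h0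
  => [[? ->]|[? ->]] [[? ->]|[? ->]] [[? ->]|[? ->]] [[? ->]|[? ->]] ?; nra.
Qed.

Lemma phi_lip z s : 0 <= s -> phi z <= phi (z + s) <= phi z + s.
Proof.
move=> s0; have h4 : 0 < 4 * h by move: h0; lra.
apply/andP; split.
  rewrite ler_pM2r ?invr_gt0 //.
  move: (posE (z + h)) (posE (z - h)) (posE (z + s + h)) (posE (z + s - h)) h0;
  by move=> [[? ->]|[? ->]] [[? ->]|[? ->]] [[? ->]|[? ->]] [[? ->]|[? ->]] ?; nra.
rewrite -subr_ge0.
rewrite (_ : _ - _ = (pos (z + h) ^+ 2 - pos (z - h) ^+ 2 + 4 * h * s -
  (pos (z + s + h) ^+ 2 - pos (z + s - h) ^+ 2)) / (4 * h)); last first.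
  by rewrite /phi; field; rewrite gt_eqF.
apply: divr_ge0 (ltW h4).
move: (posE (z + h)) (posE (z - h)) (posE (z + s + h)) (posE (z + s - h)) h0;
by move=> [[? ->]|[? ->]] [[? ->]|[? ->]] [[? ->]|[? ->]] [[? ->]|[? ->]] ?; nra.
Qed.

Lemma phi_ge0 z : 0 <= phi z /\ z <= phi z.
Proof.
have h4 : 0 < 4 * h by move: h0; lra.
split; [rewrite /phi divr_ge0 //|rewrite /phi ler_pdivlMr //]; last 1 first.
  by move: (posE (z + h)) (posE (z - h)) h0
    => [[? ->]|[? ->]] [[? ->]|[? ->]] ?; nra.
- by move: (posE (z + h)) (posE (z - h)) h0
    => [[? ->]|[? ->]] [[? ->]|[? ->]] ?; nra.
- exact: ltW.
Qed.

Lemma phi0 : phi 0 = h / 4.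
Proof.
rewrite /phi /pos add0r sub0r max_l ?(ltW h0) // max_r ?oppr_le0 ?(ltW h0) //.
by field; rewrite gt_eqF.
Qed.

Lemma measurable_pos {d} {Y : measurableType d} (f : Y -> R) :
  measurable_fun setT f -> measurable_fun setT (fun y => pos (f y)).
Proof. by move=> mf; apply: measurable_maxr => //; exact: measurable_cst. Qed.

Lemma bm_pos {d} {Y : measurableType d} (f : Y -> R) :
  bm f -> bm (fun y => pos (f y)).
Proof.
move=> [mf [C hC]]; split; first exact: measurable_pos.
exists C => y; have := hC y; rewrite !ler_norml => /andP[].
by move: (posE (f y)) => [[? ->]|[? ->]] ? ?; apply/andP; split; lra.
Qed.

Lemma bm_posD {d} {Y : measurableType d} (f : Y -> R) (c : R) :
  bm f -> bm (fun y => pos (f y + c)).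
Proof. by move=> bf; apply: bm_pos; apply: bmD => //; exact: bm_cst. Qed.

Lemma bm_clamp {d} {Y : measurableType d} (f : Y -> R) :
  bm f -> bm (fun y => clamp (f y)).
Proof.
by move=> bf; apply: bmM (bm_cst _); apply: bmB; exact: bm_posD.
Qed.

Lemma bm_phi {d} {Y : measurableType d} (f : Y -> R) :
  bm f -> bm (fun y => phi (f y)).
Proof.
by move=> bf; apply: bmM (bm_cst _); apply: bmB; apply: bmM; exact: bm_posD.
Qed.

End Potential.

(** From [acc = 0], a uniform number below [2 ^ l], most significant bit first. *)
Fixpoint thr {X} (l acc : nat) : prog X nat :=
  if l is m.+1 then Coin (fun b : bool => thr m (2 * acc + b)) else Ret acc.

(** * Sampling according to the weights *)

Section Weights.
Context {R : realType} {d : measure_display} {X : measurableType d}.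
Notation Y := (X * bool)%type.
Variables (P Q : probability Y R).

Lemma sum_double n (F : nat -> R) : \sum_(0 <= j < n + n) F j =
  \sum_(0 <= j < n) F j + \sum_(0 <= j < n) F (n + j)%N.
Proof.
rewrite (@big_cat_nat _ _ _ n) ?leq_addr //=; congr (_ + _).
rewrite -{1}[n]add0n big_addn addnK.
by apply: eq_bigr => j _; rewrite addnC.
Qed.

Lemma UB_thr l acc (f : nat -> R) :
  UB P Q (thr l acc) f ((\sum_(0 <= j < 2 ^ l) f (acc * 2 ^ l + j)%N) / (2 ^ l)%:R).
Proof.
elim: l acc => [|l IH] acc /=.
  by rewrite big_nat1 muln1 addn0 divr1.
exists ((\sum_(0 <= j < 2 ^ l) f ((2 * acc + 1) * 2 ^ l + j)%N) / (2 ^ l)%:R).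
exists ((\sum_(0 <= j < 2 ^ l) f ((2 * acc + 0) * 2 ^ l + j)%N) / (2 ^ l)%:R).
split; [exact: IH|exact: IH|].
rewrite -mulrDl -mulrA -invfM -natrM -expnSr.
rewrite (_ : (2 ^ l.+1 = 2 ^ l + 2 ^ l)%N); last by rewrite expnSr muln2 addnn.
rewrite sum_double addrC le_eqVlt; apply/orP; left; apply/eqP.
by congr (_ / _); congr (_ + _); apply: eq_bigr => j _; congr f; ring.
Qed.

Variables (G : X -> int) (l : nat).
Hypothesis bG : bm (fun x => (G x)%:~R : R).
Let h : R := (2 ^ l)%:R.
Let h0 : 0 < h. Proof. by rewrite ltr0n expn_gt0. Qed.

(* [true] has probability [1 - v], where [v] is the weight of the point as a
   training point and [1 - v] its weight as a test point *)
Definition bit (g : int) : prog X bool :=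
  t <-- thr l.+1 0 ;; Ret ((g + (2 ^ l)%:Z <= t%:Z)).

Definition v (x : X) : R := clamp h (G x)%:~R.

(** The number of [t < n] below the threshold [k] is [k] clipped to the interval from 0 to [n]. *)
Lemma sum_threshold (k : int) n (a b : R) :
  \sum_(0 <= t < n) (if k <= t%:Z then a else b) =
  (n%:R - (Num.min (pos k%:~R) n%:R)) * a + Num.min (pos k%:~R) n%:R * b.
Proof.
elim: n => [|n IH].
  rewrite big_nil sub0r min_r ?oppr0 ?mul0r ?addr0 //.
  by case: (posE (k%:~R : R)) => -[? ->].
rewrite big_nat_recr //= IH; case: ifPn => kn.
  have kn' : pos (k%:~R : R) <= n%:R.
    by case: (posE (k%:~R : R)) => -[? ->] //; rewrite -[n%:R]/((n%:Z)%:~R) ler_int.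
  rewrite !min_l //; first by rewrite -natr1; ring.
  by apply: le_trans kn' _; rewrite ler_nat.
have kn' : n.+1%:R <= pos (k%:~R : R).
  have : (n.+1%:Z%:~R : R) <= k%:~R by rewrite ler_int; lia.
  move=> hk; apply: le_trans hk _.
  by case: (posE (k%:~R : R)) => -[? ->].
rewrite !min_r //; first by rewrite -natr1; ring.
by apply: le_trans kn'; rewrite ler_nat.
Qed.

Lemma UB_bit x (f : bool -> R) :
  UB P Q (bit (G x)) f ((1 - v x) * f true + v x * f false).
Proof.
apply: (@UB_bind _ _ _ P Q _ _ _ _ _ (fun t => f (G x + (2 ^ l)%:Z <= t%:Z)));
  last by move=> t /=; exact: lexx.
apply: (UB_le (UB_thr l.+1 0 (fun t => f (G x + (2 ^ l)%:Z <= t%:Z)))) => //.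
rewrite mul0n; under eq_bigr do rewrite add0n.
rewrite (eq_bigr (fun t : nat => if G x + (2 ^ l)%:Z <= t%:Z then f true else f false));
  last by move=> t _; case: ifP.
rewrite sum_threshold /v /clamp rmorphD /= -/h expnS natrM.
(* Clipping to the interval from 0 to [2 * h] is the difference of positive parts that forms the
   numerator of [clamp], so a uniform integer of [l.+1] bits realizes the weight without
   rounding. *)
have -> : Num.min (pos ((G x)%:~R + h)) (2 * h) =
    pos ((G x)%:~R + h) - pos ((G x)%:~R - h).
  have hh := h0.
  by case: (posE ((G x)%:~R + h)) => -[? ->];
    case: (posE ((G x)%:~R - h)) => -[? ->]; [rewrite min_r|rewrite min_l|
      rewrite min_r|rewrite min_l]; lra.
by rewrite le_eqVlt; apply/orP; left; apply/eqP; field; rewrite gt_eqF.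
Qed.

Opaque bit.

Notation Ev f := (Ex P (fun y => v y.1 * f y)).

Definition pbar : R := Ex P (fun y : Y => v y.1).
Definition qbar : R := Ex Q (fun y : Y => 1 - v y.1).

Lemma v01 x : 0 <= v x <= 1.
Proof. by rewrite /v clamp_ge0 // clamp_le1. Qed.

Lemma bm_v : bm v.
Proof. exact: bm_clamp. Qed.

Lemma bm_v1 : bm (fun y : Y => v y.1).
Proof. exact: (bm_fst bm_v). Qed.

Lemma pbar01 : 0 <= pbar <= 1.
Proof.
rewrite Ex_ge0 => [|y]; last by case/andP: (v01 y.1).
rewrite /= -[leRHS](Ex_cst P 1); apply: Ex_le; [exact: bm_v1|exact: bm_cst|].
by move=> y; case/andP: (v01 y.1).
Qed.

Lemma qbar01 : 0 <= qbar <= 1.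
Proof.
rewrite Ex_ge0 => [|y]; last by move: (v01 y.1); lra.
rewrite /= -[leRHS](Ex_cst Q 1); apply: Ex_le; [|exact: bm_cst|].
  by apply: bmB bm_v1; exact: bm_cst.
by move=> y; move: (v01 y.1); lra.
Qed.

Fixpoint none (k : nat) : prog X bool :=
  if k is k'.+1 then
    DrawS (fun y => c <-- bit (G y.1) ;; if c then none k' else Ret false)
  else Ret true.

Notation q := (1 - pbar).

Lemma UB_none k (f : bool -> R) :
  UB P Q (none k) f (q ^+ k * f true + (1 - q ^+ k) * f false).
Proof.
elim: k => [|k IH] /=; first by rewrite expr0; lra.
set N := q ^+ k * _ + _ in IH.
exists (fun y => (1 - v y.1) * N + v y.1 * f false); split.
- apply: bmD; apply: bmM; try exact: bm_cst; last exact: bm_v1.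
  by apply: bmB bm_v1; exact: bm_cst.
- move=> y; pose f1 (c : bool) := if c then N else f false.
  apply: (@UB_bind _ _ _ P Q _ _ _ _ _ f1); first exact: (UB_bit _ f1).
  by case => /=; [exact: IH|exact: lexx].
- rewrite (eq_Ex P (_ : _ =1 (fun y => N + (f false - N) * v y.1))); last first.
    by move=> y; ring.
  rewrite ExD; [|exact: bm_cst|apply: bmZ; exact: bm_v1].
  rewrite Ex_cst ExZ; last exact: bm_v1.
  by rewrite -/pbar /N exprS le_eqVlt; apply/orP; left; apply/eqP; ring.
Qed.

(* the unique accepted point of a block of [k] training points, or a fresh
   training point when the number of accepted points is not one *)
Fixpoint selP (k : nat) : prog X Y :=
  if k is k'.+1 then
    DrawS (fun y => c <-- bit (G y.1) ;;
      if c then selP k' else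
        (nn <-- none k' ;; if nn then Ret y else DrawS (fun y0 => Ret y0)))
  else DrawS (fun y0 => Ret y0).

Lemma UB_fresh (f : Y -> R) : bm f -> UB P Q (DrawS (fun y0 => Ret y0)) f (Ex P f).
Proof. by move=> bf; exists f; split => // y; exact: lexx. Qed.

(** Each of the [k] positions can hold the only accepted point, the others being refused with
    probability [q ^+ k.-1]. The fallback is drawn afresh, so that failing blocks contribute a
    multiple of [Ex P f] and not a law conditioned on failure. *)
Lemma UB_selP k (f : Y -> R) : bm f ->
  UB P Q (selP k) f (k%:R * q ^+ k.-1 * Ev f +
    (1 - k%:R * pbar * q ^+ k.-1) * Ex P f).
Proof.
move=> bf; have bvf : bm (fun y => v y.1 * f y) by apply: bmM => //; exact: bm_v1.
elim: k => [|k IH] /=.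
  by apply: UB_le (UB_fresh bf) _ _ => //; lra.
set s := (X in UB P Q (selP k) f X) in IH.
pose t y := q ^+ k * f y + (1 - q ^+ k) * Ex P f.
exists (fun y => (1 - v y.1) * s + v y.1 * t y); split.
- apply: bmD; apply: bmM; try exact: bm_cst; try exact: bm_v1.
    by apply: bmB bm_v1; exact: bm_cst.
  by apply: bmD; [apply: bmZ|exact: bm_cst].
- move=> y; pose f1 (c : bool) := if c then s else t y.
  apply: (@UB_bind _ _ _ P Q _ _ _ _ _ f1); first exact: (UB_bit _ f1).
  case => //=; pose f2 (c : bool) := if c then f y else Ex P f.
  apply: (@UB_bind _ _ _ P Q _ _ _ _ _ f2); first exact: (UB_none _ f2).
  by case => /=; [exact: lexx|exact: UB_fresh].
- rewrite (eq_Ex P (_ : _ =1 (fun y => s + (q ^+ k * (v y.1 * f y) +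
    ((1 - q ^+ k) * Ex P f - s) * v y.1)))); last by move=> y; rewrite /t; ring.
  rewrite ExD; [|exact: bm_cst|by apply: bmD; apply: bmZ => //; exact: bm_v1].
  rewrite Ex_cst ExD; [|exact: bmZ|by apply: bmZ; exact: bm_v1].
  rewrite !ExZ //; last exact: bm_v1.
  rewrite -/pbar /s le_eqVlt; apply/orP; left; apply/eqP.
  case: (k) => [|k'] /=; first by rewrite !expr0; ring.
  by rewrite -!(natr1 k'.+1) exprS; ring.
Qed.

(** Exactly one accepted point is a case of at least one. This keeps the weight of the fallback in
    [P'] nonnegative. *)
Lemma one_of_block k : k%:R * pbar * q ^+ k.-1 <= 1 - q ^+ k.
Proof.
have [p0 p1] := andP pbar01; have q01 : 0 <= q <= 1 by apply/andP; split; lra.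
elim: k => [|k IH]; first by rewrite expr0; lra.
have qk : 0 <= q ^+ k <= 1.
  by rewrite exprn_ge0 ?exprn_ile1 //; case/andP: q01.
rewrite /= exprS -natr1.
have : q * (k%:R * pbar * q ^+ k.-1) <= q * (1 - q ^+ k).
  by rewrite ler_wpM2l //; case/andP: q01.
case: k IH qk => [|k] /= IH qk; first by rewrite expr0; nra.
rewrite exprS in qk *; move: (k.+1%:R : R) => K; nra.
Qed.

End Weights.

(** * Exchanging a single draw with samples and coins *)

Section MoreIterated.
Context {R : realType} {d : measure_display} {Y : measurableType d}.
Implicit Types P Q : probability Y R.

Lemma EI_rcons P n (f : seq Y -> R) :
  EI P n.+1 f = EI P n (fun s => Ex P (fun y => f (rcons s y))).
Proof.
elim: n f => [|n IH] f //.
rewrite -[LHS]/(Ex P (fun y => EI P n.+1 (fun s => f (y :: s)))).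
by under eq_fun do rewrite IH.
Qed.

Lemma jm_move n j (f : seq Y -> R) : jm n.+1 f -> (j <= n)%N ->
  jm n.+1 (fun s => if s is y :: t then f (take j t ++ y :: drop j t) else 0).
Proof.
move=> jf jn.
apply: (@jm_ext _ _ _ _ (f \o (fun s => if s is y :: t then
  take j t ++ y :: drop j t else [::]))); first by case.
apply: (jm_comp jf) => d' O [|h a] //= [sz] ma.
exists (take j a ++ h :: drop j a); split.
- by rewrite size_cat /= size_take size_drop sz; case: ltnP => //; lia.
- move=> g hg; apply: ma; case: (In_cat hg) => [k|/= [<-|k]]; try tauto.
    by right; apply: (@In_take_drop _ j); left.
  by right; apply: (@In_take_drop _ j); right.
- by move=> w; rewrite map_cat /= map_take map_drop.
Qed.

Lemma jm_first n (f : seq Y -> R) : jm n.+1 f ->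
  jm n.+1 (fun s => f (last point s :: take n s)).
Proof.
move=> jf; apply: (@jm_comp _ _ _ _ _ f (fun s => last point s :: take n s) jf).
move=> d' O a; case: (lastP a) => [//|a' h] sz ma.
have sz' : size a' = n by move: sz; rewrite size_rcons => -[].
exists (h :: a'); split => [||w]; first by rewrite /= sz'.
  by move=> g hg; apply: ma; rewrite -cats1; elim: (a') hg => //= k l IH; tauto.
rewrite map_rcons last_rcons /= -cats1 take_cat size_map sz' ltnn subnn take0.
by rewrite cats0.
Qed.

Lemma Ex_EI P Q n f : jm n.+1 f ->
  Ex Q (fun y => EI P n (fun s => f (y :: s))) =
  EI P n (fun s => Ex Q (fun y => f (y :: s))).
Proof.
move=> jf; have e s y : size s = n ->
    f (y :: s) = f (last point (rcons s y) :: take n (rcons s y)).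
  move=> sz; rewrite last_rcons -cats1 take_cat sz ltnn subnn take0 cats0 //.
have := EI_Ex P Q (jm_first jf) => h.
transitivity (Ex Q (fun y => EI P n
  (fun s => f (last point (rcons s y) :: take n (rcons s y))))).
  by apply: eq_Ex => y; apply: eq_EI => s sz; exact: e.
by rewrite -h; apply: eq_EI => s sz; apply: eq_Ex => y; rewrite -e.
Qed.

Lemma jm_Ex_insert Q n j (f : seq Y -> R) : jm n.+1 f -> (j <= n)%N ->
  jm n (fun s => Ex Q (fun y => f (take j s ++ y :: drop j s))).
Proof.
move=> jf jn; have jg := jm_first (jm_move jf jn).
apply: jm_ext (jm_Ex Q jg) => s sz; apply: eq_Ex => y.
by rewrite last_rcons -cats1 take_cat sz ltnn subnn take0 cats0.
Qed.

Lemma Ex_EC Q r (f : Y -> seq bool -> R) :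
  (forall w, size w = r -> bm (f^~ w)) ->
  Ex Q (fun y => EC r (f y)) = EC r (fun w => Ex Q (f^~ w)) /\
  bm (fun y => EC r (f y)).
Proof.
elim: r f => [|r IH] f bf /=; first by split => //; exact: bf.
have hb b : forall w, size w = r -> bm ((fun y w => f y (b :: w))^~ w).
  by move=> w sw; apply: bf; rewrite /= sw.
have [e1 b1] := IH _ (hb true); have [e0 b0] := IH _ (hb false).
split; last by apply: bmM; [exact: bmD|exact: bm_cst].
rewrite -e1 -e0 -ExD // mulrC -ExZ; last exact: bmD.
by apply: eq_Ex => y; rewrite mulrC.
Qed.

Lemma jm_prefix n m s0 (f : seq Y -> R) : size s0 = n -> jm (n + m) f ->
  jm m (fun s => f (s0 ++ s)).
Proof. by move=> <-; exact: jm_catl. Qed.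

Lemma EI_affine P n (f g : seq Y -> R) (al be ga : R) : jm n f -> jm n g ->
  EI P n (fun s => al + be * f s + ga * g s) =
  al + be * EI P n f + ga * EI P n g.
Proof.
move=> jf jg; have h1 := jmZ be jf; have h2 := jmZ ga jg.
rewrite EID //; last by apply: jmD => //; exact: jm_cst.
by rewrite EID ?EI_cst ?EIZ //; exact: jm_cst.
Qed.

Lemma EI3_affine P1 P2 P3 n1 n2 n3 (f g : seq Y -> R) (al be ga : R) :
  jm (n1 + (n2 + n3)) f -> jm (n1 + (n2 + n3)) g ->
  EI P1 n1 (fun s1 => EI P2 n2 (fun s2 => EI P3 n3 (fun s3 =>
    al + be * f (s1 ++ s2 ++ s3) + ga * g (s1 ++ s2 ++ s3)))) =
  al + be * EI P1 n1 (fun s1 => EI P2 n2 (fun s2 => EI P3 n3 (fun s3 =>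
    f (s1 ++ s2 ++ s3)))) + ga * EI P1 n1 (fun s1 => EI P2 n2 (fun s2 =>
      EI P3 n3 (fun s3 => g (s1 ++ s2 ++ s3)))).
Proof.
move=> jf jg.
have j1 (f' : seq Y -> R) s1 : jm (n1 + (n2 + n3)) f' -> size s1 = n1 ->
    jm (n2 + n3) (fun s => f' (s1 ++ s)).
  by move=> jf' sz; exact: (jm_prefix (f := f') sz jf').
have j2 (f' : seq Y -> R) s1 s2 : jm (n1 + (n2 + n3)) f' -> size s1 = n1 ->
    size s2 = n2 -> jm n3 (fun s => f' (s1 ++ s2 ++ s)).
  by move=> jf' z1 z2; exact: (jm_prefix (f := fun s => f' (s1 ++ s)) z2 (j1 _ _ jf' z1)).
have j3 (f' : seq Y -> R) s1 : jm (n1 + (n2 + n3)) f' -> size s1 = n1 ->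
    jm n2 (fun s2 => EI P3 n3 (fun s3 => f' (s1 ++ s2 ++ s3))).
  by move=> jf' z1; exact: (jm_EI P3 (j1 _ _ jf' z1)).
have j4 (f' : seq Y -> R) : jm (n1 + (n2 + n3)) f' ->
    jm n1 (fun s1 => EI P2 n2 (fun s2 => EI P3 n3 (fun s3 => f' (s1 ++ s2 ++ s3)))).
  rewrite addnA => jf'; have := jm_EI P2 (jm_EI P3 jf').
  by apply: jm_ext => s _; apply: eq_EI => t _; apply: eq_EI => u _; rewrite catA.
rewrite -EI_affine; [|exact: j4..]; apply: eq_EI => s1 z1.
rewrite -EI_affine; [|exact: j3..]; apply: eq_EI => s2 z2.
by rewrite -EI_affine; [|exact: j2..].
Qed.

End MoreIterated.

Section Concentration.
Context {R : realType} {d : measure_display} {X : measurableType d}.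
Notation Y := (X * bool)%type.
Variables (P Q : probability Y R).

(* Chernoff: Markov's inequality for the [count]-th power of [y]. *)
Lemma UB_count {A} (p : prog X A) (e : A -> bool) (mu y : R) m n :
  UB P Q p (fun a => (e a)%:R) mu -> 0 <= mu -> 1 <= y ->
  (1 + (y - 1) * mu) ^+ 16 <= y ^+ m / 2 ->
  UB P Q (reps (16 * n) p) (fun s => (m * n <= count e s)%:R) (2^-1 ^+ n).
Proof.
move=> hp mu0 y1 hy; have y0 : 0 < y by lra.
set b := 1 + (y - 1) * mu in hy.
have b0 : 0 <= b by rewrite /b; nra.
have h N : UB P Q (reps N p) (fun s => y ^+ count e s) (b ^+ N).
  elim: N => [|N IH] /=; first by rewrite !expr0.
  have hb : UB P Q p (fun a => b ^+ N * (1 + (y - 1) * (e a)%:R)) (b ^+ N * b).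
    apply: UB_scale; first exact: exprn_ge0.
    apply: UB_add (UB_cst _ _ _ 1) _; apply: UB_scale => //; lra.
  rewrite exprSr; apply: UB_bind hb _ => a.
  apply: (@UB_bind _ _ _ P Q _ _ _ _ _ (fun s => y ^+ (e a) * y ^+ count e s)).
    apply: UB_le (UB_scale (_ : 0 <= y ^+ (e a)) IH) _ _ => //.
      by rewrite exprn_ge0 // ltW.
    rewrite le_eqVlt; apply/orP; left; apply/eqP.
    by case: (e a) => /=; rewrite ?expr1 ?expr0; ring.
  by move=> s /=; rewrite exprD.
apply: UB_le (UB_scale (_ : 0 <= (y ^+ (m * n))^-1) (h (16 * n)%N)) _ _.
- by rewrite invr_ge0 exprn_ge0 // ltW.
- move=> s; case: leqP => hc; last by rewrite mulr_ge0 ?invr_ge0 ?exprn_ge0 // ltW.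
  rewrite ler_pdivlMl ?exprn_gt0 // mulr1.
  by apply: ler_weXn2l.
- rewrite !exprM -exprVn -exprMn; apply: lerXn2r; rewrite ?nnegrE //.
    by rewrite mulr_ge0 ?invr_ge0 ?exprn_ge0 // ltW.
  by rewrite ler_pdivrMl ?exprn_gt0.
Qed.

End Concentration.

(** * The two reweighted laws of a round *)

Section Distributions.
Context {R : realType} {d : measure_display} {X : measurableType d}.
Notation Y := (X * bool)%type.
Variables (P Q : probability Y R) (G : X -> int) (l k : nat).
Hypothesis bG : bm (fun x => (G x)%:~R : R).
Notation v := (@v R d X G l).
Notation p := (pbar P G l).
Notation q := (qbar Q G l).

Definition keep : R := (1 - p) ^+ k.
Notation a := keep.
Notation B := (k.+1%:R : R).

Definition drawQ : prog X X :=
  DrawU (fun u => c <-- bit l (G u) ;;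
    if c then
      nn <-- none G l k ;; if nn then Ret u else DrawS (fun y0 => Ret y0.1)
    else DrawS (fun y0 => Ret y0.1)).

Lemma keep01 : 0 <= a <= 1.
Proof.
have /andP[p0 p1] := pbar01 P l bG.
by rewrite exprn_ge0 ?exprn_ile1 //; lra.
Qed.

Lemma UB_drawQ g : bm g -> UB P Q drawQ g
  (Ex Q (fun y => a * (1 - v y.1) * g y.1) + (1 - a * q) * Ex P (g \o fst)).
Proof.
move=> bg; have bv := bm_v l bG; have bgf := bm_fst bg.
set F := Ex P (g \o fst).
have hF : UB P Q (DrawS (fun y0 => Ret y0.1)) g F.
  by exists (g \o fst); split => // y; exact: lexx.
have b1v : bm (fun x => 1 - v x) by apply: bmB => //; exact: bm_cst.
exists (fun u => (1 - v u) * (a * g u + (1 - a) * F) + v u * F); split.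
- apply: bmD; apply: bmM => //; try exact: bm_cst.
  by apply: bmD; [apply: bmZ|exact: bm_cst].
- move=> u; pose f1 (c : bool) := if c then a * g u + (1 - a) * F else F.
  apply: (@UB_bind _ _ _ P Q _ _ _ _ _ f1); first exact: (UB_bit P Q G l u f1).
  case => //=; pose f2 (c : bool) := if c then g u else F.
  apply: (@UB_bind _ _ _ P Q _ _ _ _ _ f2); first exact: (UB_none P Q l bG k f2).
  by case => //=; exact: lexx.
- rewrite (eq_Ex Q (_ : _ =1 (fun y => a * (1 - v y.1) * g y.1 +
     (F + - (a * F) * (1 - v y.1))))); last by move=> y /=; ring.
  have b2 : bm (fun y : Y => 1 - v y.1) by exact: (bm_fst b1v).
  have b3 : bm (fun y : Y => a * (1 - v y.1) * g y.1).
    by apply: bmM => //; exact: bmZ.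
  rewrite ExD //; last by apply: bmD; [exact: bm_cst|exact: bmZ].
  rewrite ExD ?Ex_cst ?ExZ //; try exact: bm_cst; try exact: bmZ.
  by rewrite -/q lerD2l le_eqVlt; apply/orP; left; apply/eqP; ring.
Qed.

(** A block of [k.+1] points accepts exactly one with density [k.+1 * (1 - p) ^+ k * v], that is
    [a * B * v]: the factor [a] is the one of [testE], where the block has only [k] points. *)
Lemma trainE : exists P' : probability Y R,
  samplesS P Q (selP G l k.+1) P' /\ forall f, bm f ->
  Ex P' f = a * B * Ex P (fun y => v y.1 * f y) + (1 - a * B * p) * Ex P f.
Proof.
have bv := bm_v1 l bG; have /andP[a0 a1] := keep01.
have B0 : 0 <= B by exact: ler0n.
have aBp : 0 <= 1 - a * B * p.
  have := one_of_block P l bG k.+1; rewrite /= -/a.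
  have : 0 <= (1 - p) ^+ k.+1.
    by have /andP[? ?] := pbar01 P l bG; apply: exprn_ge0; lra.
  by nra.
have [|||||P' hP'] := @mixture_exists _ _ _ P P (fun y => a * B * v y.1)
  (fun=> 1 - a * B * p).
- exact: bmZ.
- exact: bm_cst.
- move=> y; apply: mulr_ge0; first exact: mulr_ge0.
  by case/andP: (@v01 R d X G l y.1).
- by [].
- by rewrite ExZ // Ex_cst -/p; ring.
have hE f : bm f -> Ex P' f =
    a * B * Ex P (fun y => v y.1 * f y) + (1 - a * B * p) * Ex P f.
  move=> bf; rewrite hP' // ExZ //; congr (_ + _).
  by rewrite -ExZ; [apply: eq_Ex => y; ring|exact: bmM].
exists P'; split => // f bf; rewrite hE //.
apply: UB_le (UB_selP P Q l bG k.+1 bf) _ _ => //=.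
by rewrite le_eqVlt; apply/orP; left; apply/eqP; rewrite /a; ring.
Qed.

Lemma testE : exists Q' : probability Y R,
  samplesU P Q drawQ Q' /\ forall f, bm f ->
  Ex Q' f = a * Ex Q (fun y => (1 - v y.1) * f y) + (1 - a * q) * Ex P f.
Proof.
have bv := bm_v1 l bG; have /andP[a0 a1] := keep01.
have /andP[q0 q1] := qbar01 Q l bG.
have b2 : bm (fun y : Y => 1 - v y.1) by apply: bmB => //; exact: bm_cst.
have [|||||Q' hQ'] := @mixture_exists _ _ _ Q P (fun y => a * (1 - v y.1))
  (fun=> 1 - a * q).
- exact: bmZ.
- exact: bm_cst.
- move=> y; apply: mulr_ge0 => //; rewrite subr_ge0.
  by case/andP: (@v01 R d X G l y.1).
- by move=> _; nra.
- by rewrite ExZ // Ex_cst -/q; ring.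
have hE f : bm f -> Ex Q' f =
    a * Ex Q (fun y => (1 - v y.1) * f y) + (1 - a * q) * Ex P f.
  move=> bf; rewrite hQ' // ExZ //; congr (_ + _).
  by rewrite -ExZ; [apply: eq_Ex => y; ring|exact: bmM].
exists Q'; split => // f bf; rewrite hE; last exact: bm_fst.
apply: UB_le (UB_drawQ bf) _ _ => //=.
rewrite -ExZ; last by apply: bmM => //; exact: bm_fst.
by rewrite lerD2r le_eqVlt; apply/orP; left; apply/eqP; apply: eq_Ex => y /=; ring.
Qed.

End Distributions.

(** * The hybrid argument *)

Section Distinguisher.
Context {R : realType} {d : measure_display} {X : measurableType d}.
Notation Y := (X * bool)%type.
Variables (P Q : probability Y R) (n1 n2 r : nat).
Variable acc : seq Y -> seq X -> seq bool -> bool.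
Hypothesis jacc : forall w, size w = r ->
  jm (n1 + n2) (fun s : seq Y => (acc (take n1 s) (map fst (drop n1 s)) w)%:R : R).
Variables (G : X -> int) (l k : nat).
Hypothesis bG : bm (fun x => (G x)%:~R : R).
Notation v := (@v R d X G l).
Notation p := (pbar P G l).
Notation q := (qbar Q G l).
Notation a := (keep P G l k).
Notation B := (k.+1%:R : R).

Definition coins : prog X (seq bool) := reps r (Coin (fun b => Ret b)).

Definition rejz (S : seq Y) (U : seq X) (w : seq bool) : int := (~~ acc S U w)%:Z.

(* one term of the hybrid argument: the rejection indicator as a function of one
   test point, recentered at a fresh training point *)
Definition psi (b : nat) : prog X (X -> int) :=
  i <-- thr b 0 ;;
  if (i < n2)%N then
    S <-- reps n1 (selP G l k.+1) ;;
    U <-- reps i (drawQ G l k) ;;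
    V <-- reps (n2 - i.+1) (selP G l k.+1) ;;
    w <-- coins ;;
    DrawS (fun y0 => Ret (fun x => rejz S (U ++ x :: map fst V) w -
                                 rejz S (U ++ y0.1 :: map fst V) w))
  else Ret (fun=> 0).

(* To first order, the decrease of the potential when [D] is added to [G]. *)
Definition gain (D : X -> int) : R :=
  Ex Q (fun y => (1 - v y.1) * (D y.1)%:~R) -
  B * Ex P (fun y => v y.1 * (D y.1)%:~R).

(** Training and test samples are put in a single list, the form to which [jm] applies; the test
    points in it carry dummy labels. *)
Definition rejl (w : seq bool) (s : seq Y) : R :=
  (rejz (take n1 s) (map fst (drop n1 s)) w)%:~R.

Lemma rejlE w s : rejl w s = (~~ acc (take n1 s) (map fst (drop n1 s)) w)%:R.
Proof. by []. Qed.

Lemma jm_rejl w : size w = r -> jm (n1 + n2) (rejl w).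
Proof.
move=> sw; apply: jm_ext (jmB (jm_cst (n1 + n2) 1) (jacc sw)) => s _.
by rewrite rejlE; case: acc => /=; rewrite ?subr0 ?subrr.
Qed.

Definition rejection (P' Q' : probability Y R) : R :=
  EI P' n1 (fun S => EI Q' n2 (fun V =>
    EC r (fun w => (~~ acc S (map fst V) w)%:R))).

Lemma rejectionE P' Q' : rejection P' Q' =
  EI P' n1 (fun S => EI Q' n2 (fun V => EC r (fun w => rejl w (S ++ V)))).
Proof.
apply: eq_EI => S sS; apply: eq_EI => V _; apply: eq_EC => w _.
by rewrite rejlE take_size_cat // drop_size_cat.
Qed.

Section Hybrids.
Variables (P' Q' : probability Y R).
Hypothesis hP' : samplesS P Q (selP G l k.+1) P'.
Hypothesis hQ' : samplesU P Q (drawQ G l k) Q'.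
Hypothesis P'E : forall f, bm f ->
  Ex P' f = a * B * Ex P (fun y => v y.1 * f y) + (1 - a * B * p) * Ex P f.
Hypothesis Q'E : forall f, bm f ->
  Ex Q' f = a * Ex Q (fun y => (1 - v y.1) * f y) + (1 - a * q) * Ex P f.

Definition hybrid (i : nat) : R :=
  EI P' n1 (fun S => EI Q' i (fun V1 => EI P' (n2 - i) (fun V2 =>
    EC r (fun w => rejl w (S ++ V1 ++ V2))))).

(** The test sample of index [i] is isolated: it comes from [Q'] in hybrid [i.+1] and from [P'] in
    hybrid [i], all others having the same law in both. *)
Definition hybrid1 (mu : probability Y R) (i : nat) : R :=
  EI P' n1 (fun S => EI Q' i (fun V1 => EI P' (n2 - i.+1) (fun V2 =>
    EC r (fun w => Ex mu (fun y => rejl w (S ++ V1 ++ y :: V2)))))).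

Lemma hybrid_first : hybrid 0 = rejection P' P'.
Proof. by rewrite rejectionE /hybrid subn0. Qed.

Lemma hybrid_last : hybrid n2 = rejection P' Q'.
Proof.
rewrite rejectionE /hybrid subnn; apply: eq_EI => S sS; apply: eq_EI => V _ /=.
by rewrite cats0.
Qed.

Lemma jm_tail w T m : size w = r -> (size T + m = n1 + n2)%N ->
  jm m (fun V => rejl w (T ++ V)).
Proof. by move=> sw sz; apply: jm_catl; rewrite sz; exact: jm_rejl. Qed.

Lemma swap_in (mu : probability Y R) T m : (size T + m.+1 = n1 + n2)%N ->
  Ex mu (fun y => EI P' m (fun V => EC r (fun w => rejl w (T ++ y :: V)))) =
  EI P' m (fun V => EC r (fun w => Ex mu (fun y => rejl w (T ++ y :: V)))).
Proof.
move=> sz; have jT : jm m.+1 (fun V => EC r (fun w => rejl w (T ++ V))).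
  by apply: (jm_EC (f := fun V w => rejl w (T ++ V))) => w sw; exact: jm_tail.
rewrite (Ex_EI P' mu jT); apply: eq_EI => V sV.
have bw w : size w = r -> bm (fun y => rejl w (T ++ y :: V)).
  by move=> sw; exact: (jm_head (jm_tail sw sz) sV).
by case: (Ex_EC mu (f := fun y w => rejl w (T ++ y :: V)) bw).
Qed.

Lemma hybrid_succ i : (i < n2)%N -> hybrid i.+1 = hybrid1 Q' i.
Proof.
move=> hi; apply: eq_EI => S sS; rewrite EI_rcons; apply: eq_EI => V1 sV1.
rewrite (_ : Ex Q' _ = Ex Q' (fun y => EI P' (n2 - i.+1) (fun V2 =>
    EC r (fun w => rejl w ((S ++ V1) ++ y :: V2))))); last first.
  by apply: eq_Ex => y; apply: eq_EI => V2 _; apply: eq_EC => w _;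
    rewrite cat_rcons catA.
rewrite swap_in; last by rewrite size_cat sS sV1; lia.
by apply: eq_EI => V2 _; apply: eq_EC => w _; apply: eq_Ex => y; rewrite catA.
Qed.

Lemma hybrid_pred i : (i < n2)%N -> hybrid i = hybrid1 P' i.
Proof.
move=> hi; apply: eq_EI => S sS; apply: eq_EI => V1 sV1.
rewrite (_ : (n2 - i = (n2 - i.+1).+1)%N); last by lia.
rewrite (_ : EI P' _.+1 _ = Ex P' (fun y => EI P' (n2 - i.+1) (fun V2 =>
    EC r (fun w => rejl w ((S ++ V1) ++ y :: V2))))); last first.
  by apply: eq_Ex => y; apply: eq_EI => V2 _; apply: eq_EC => w _; rewrite catA.
rewrite swap_in; last by rewrite size_cat sS sV1; lia.
by apply: eq_EI => V2 _; apply: eq_EC => w _; apply: eq_Ex => y; rewrite catA.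
Qed.

Definition adv (w : seq bool) (S V1 V2 : seq Y) : R :=
  Ex Q' (fun y => rejl w (S ++ V1 ++ y :: V2)) -
  Ex P' (fun y => rejl w (S ++ V1 ++ y :: V2)).

Hypothesis a0 : 0 < a.

(** By the formulas for the two laws, [Ex Q' f - Ex P' f] is [a] times the gain of [f] plus
    [a * (B * p - q) * Ex P f]. Subtracting [f y0], with [y0] drawn from [P], raises the mean gain
    by [(B * p - q) * Ex P f]; the mean gain of the recentered function is thus exactly the
    advantage divided by [a]. *)
Lemma UB_psi_last S U (V : seq Y) w (c0 : R) :
  size w = r -> (size S = n1)%N -> (size U + (size V).+1 = n2)%N ->
  UB P Q (DrawS (fun y0 => Ret (fun x => rejz S (U ++ x :: map fst V) w -
                                 rejz S (U ++ y0.1 :: map fst V) w)))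
    (fun D => c0 - gain D)
    (c0 - adv w S [seq (u, true) | u <- U] V / a).
Proof.
move=> sw sS sUV.
pose f (y : Y) : R := rejl w (S ++ [seq (u, true) | u <- U] ++ y :: V).
have fE x : f x = (rejz S (U ++ x.1 :: map fst V) w)%:~R.
  rewrite /f /rejl take_size_cat // drop_size_cat // map_cat /= -map_comp.
  by rewrite (@eq_map _ _ _ id) ?map_id.
have bf : bm f.
  have jw : jm (size V).+1 (fun t : seq Y =>
      rejl w ((S ++ [seq (u, true) | u <- U]) ++ t)).
    by apply: jm_tail => //; rewrite size_cat size_map sS; lia.
  have := jm_head jw erefl.
  rewrite (_ : (fun y => _) = f) //.
  by apply/funext => y; rewrite /f catA.
have b1v : bm (fun y : Y => 1 - v y.1).
  by apply: bmB => //; [exact: bm_cst|exact: bm_v1].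
set g0 := Ex Q (fun y => (1 - v y.1) * f y) - B * Ex P (fun y => v y.1 * f y).
exists (fun y0 => c0 - g0 + (q - B * p) * f y0); split.
- by apply: bmD; [exact: bm_cst|exact: bmZ].
- move=> y0 /=; rewrite /gain (eq_Ex Q (_ : _ =1 (fun y : Y =>
    (1 - v y.1) * f y - f y0 * (1 - v y.1)))); last first.
    by move=> y; rewrite rmorphB /= -!fE; ring.
  rewrite (eq_Ex P (_ : _ =1 (fun y : Y => v y.1 * f y - f y0 * v y.1)));
    last by move=> y; rewrite rmorphB /= -!fE; ring.
  have bv := bm_v1 l bG.
  rewrite !ExB ?ExZ //; try by [exact: bmM|exact: bmZ].
  by rewrite -/p -/q /g0 le_eqVlt; apply/orP; left; apply/eqP; ring.
- rewrite ExD ?Ex_cst ?ExZ //; try by [exact: bm_cst|exact: bmZ].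
  rewrite /adv -/f P'E // Q'E // /g0 le_eqVlt; apply/orP; left; apply/eqP.
  by field; rewrite gt_eqF.
Qed.

Definition hyb (mu : probability Y R) (S V1 V2 : seq Y) : R :=
  EC r (fun w => Ex mu (fun y => rejl w (S ++ V1 ++ y :: V2))).

Lemma jm_hyb mu i : (i < n2)%N -> jm (n1 + (i + (n2 - i.+1)))
  (fun s => hyb mu (take n1 s) (take i (drop n1 s)) (drop i (drop n1 s))).
Proof.
move=> hi; have sz : (n1 + n2 = (n1 + (i + (n2 - i.+1))).+1)%N by lia.
apply: (jm_EC (f := fun s w => Ex mu (fun y => rejl w (take n1 s ++
  take i (drop n1 s) ++ y :: drop i (drop n1 s))))) => w sw.
have jw := jm_rejl sw; rewrite sz in jw.
have hj : (n1 + i <= n1 + (i + (n2 - i.+1)))%N by lia.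
apply: jm_ext (jm_Ex_insert mu jw hj) => s ss.
by apply: eq_Ex => y; rewrite takeD drop_drop addnC catA.
Qed.

Lemma hyb_cat mu i S V1 V2 : size S = n1 -> size V1 = i ->
  hyb mu (take n1 (S ++ V1 ++ V2)) (take i (drop n1 (S ++ V1 ++ V2)))
    (drop i (drop n1 (S ++ V1 ++ V2))) = hyb mu S V1 V2.
Proof. by move=> sS s1; rewrite !(take_size_cat, drop_size_cat). Qed.

(** The learner sees test points without labels, so the points drawn by [drawQ] may be given the
    label [true] to fit in a list of labeled points. *)
Lemma hyb_label mu S V1 V2 : size S = n1 ->
  hyb mu S [seq (u, true) | u <- map fst V1] V2 = hyb mu S V1 V2.
Proof.
move=> sS; apply: eq_EC => w _; apply: eq_Ex => y; rewrite !rejlE.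
by rewrite !(take_size_cat, drop_size_cat) // !map_cat -!map_comp.
Qed.

Lemma UB_psi_at i (c0 : R) : (i < n2)%N ->
  UB P Q (S <-- reps n1 (selP G l k.+1) ;;
    U <-- reps i (drawQ G l k) ;;
    V <-- reps (n2 - i.+1) (selP G l k.+1) ;;
    w <-- coins ;;
    DrawS (fun y0 => Ret (fun x => rejz S (U ++ x :: map fst V) w -
                                 rejz S (U ++ y0.1 :: map fst V) w)))
  (fun D => c0 - gain D) (c0 - (hybrid i.+1 - hybrid i) / a).
Proof.
move=> hi; rewrite hybrid_succ // hybrid_pred //.
pose F S V1 V2 := c0 + (- a^-1) * hyb Q' S V1 V2 + a^-1 * hyb P' S V1 V2.
set m := (n2 - i.+1)%N.
pose Fl s := F (take n1 s) (take i (drop n1 s)) (drop i (drop n1 s)).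
have FlE S V1 V2 : size S = n1 -> size V1 = i -> Fl (S ++ V1 ++ V2) = F S V1 V2.
  by move=> sS sV; rewrite /Fl /F !hyb_cat.
have jF : jm (n1 + (i + m)) Fl.
  apply: jmD; [apply: jmD; first exact: jm_cst|]; apply: jmZ; exact: jm_hyb.
have -> : c0 - (hybrid1 Q' i - hybrid1 P' i) / a =
    EI P' n1 (fun S => EI Q' i (fun V1 => EI P' m (fun V2 => Fl (S ++ V1 ++ V2)))).
  rewrite /Fl /F (EI3_affine P' Q' P' c0 (- a^-1) a^-1 (jm_hyb Q' hi) (jm_hyb P' hi)).
  rewrite [X in - a^-1 * X](_ : _ = hybrid1 Q' i); last first.
    by apply: eq_EI => S sS; apply: eq_EI => V1 s1; apply: eq_EI => V2 _;
      rewrite hyb_cat.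
  rewrite [X in a^-1 * X](_ : _ = hybrid1 P' i); last first.
    by apply: eq_EI => S sS; apply: eq_EI => V1 s1; apply: eq_EI => V2 _;
      rewrite hyb_cat.
  by ring.
have jF1 : jm n1 (fun S => EI Q' i (fun V1 => EI P' m (fun V2 => Fl (S ++ V1 ++ V2)))).
  have := jF; rewrite addnA => jF'; have := jm_EI Q' (jm_EI P' jF').
  by apply: jm_ext => s _; apply: eq_EI => t _; apply: eq_EI => u _; rewrite catA.
apply: (UB_bind_out (outcomes_reps _ _) (UB_reps hP' jF1)) => S sS.
have jF2 : jm i (fun V1 => EI P' m (fun V2 => Fl (S ++ V1 ++ V2))).
  exact: (jm_EI P' (jm_prefix sS jF)).
pose f U := EI P' m (fun V2 => Fl (S ++ [seq (u, true) | u <- U] ++ V2)).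
have fE V1 : size V1 = i -> f (map fst V1) = EI P' m (fun V2 => Fl (S ++ V1 ++ V2)).
  move=> sV; apply: eq_EI => V2 _.
  by rewrite !FlE ?size_map // /F !hyb_label.
rewrite -(eq_EI Q' (f := fun V1 => f (map fst V1)) fE).
have jf : jm i f by apply: fst_jm; apply: jm_ext jF2 => s ss; rewrite fE.
apply: (UB_bind_out (outcomes_reps _ _) (UB_repsU hQ' jf)) => U sU.
have sU' : size [seq (u, true) | u <- U] = i by rewrite size_map.
have jF3 : jm m (fun V2 => Fl (S ++ [seq (u, true) | u <- U] ++ V2)).
  exact: (jm_prefix sU' (jm_prefix sS jF)).
apply: (UB_bind_out (outcomes_reps _ _) (UB_reps hP' jF3)) => V sV.
rewrite FlE //.
pose g w := c0 - adv w S [seq (u, true) | u <- U] V / a.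
have -> : F S [seq (u, true) | u <- U] V = EC r g.
  rewrite /g (ECD r (fun=> c0)) EC_cst /F -addrA; congr (_ + _).
  rewrite /hyb -!ECZ -ECD; apply: eq_EC => w _; rewrite /adv; ring.
apply: (UB_bind_out (outcomes_reps _ _) (UB_coins _ _ _ g)) => w sw.
by apply: UB_psi_last => //; rewrite sU sV /m; lia.
Qed.

(** The differences of consecutive hybrids telescope. The index is uniform below [2 ^ b], which
    coins can produce, and an index from [n2] on yields the zero function, whose gain is 0; hence
    the divisor [2 ^ b]. *)
Lemma UB_psi b (c0 : R) : (n2 <= 2 ^ b)%N ->
  UB P Q (psi b) (fun D => c0 - gain D)
    (c0 - (rejection P' Q' - rejection P' P') / (a * (2 ^ b)%:R)).
Proof.
move=> hb; pose g i := if (i < n2)%N then c0 - (hybrid i.+1 - hybrid i) / a else c0.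
apply: (@UB_bind _ _ _ P Q _ _ _ _ _ g).
  apply: (UB_le (UB_thr P Q b 0 g)) => //.
  have M0 : (0 : R) < (2 ^ b)%:R by rewrite ltr0n expn_gt0.
  rewrite ler_pdivrMr // mul0n; under eq_bigr do rewrite add0n.
  rewrite (@big_cat_nat _ _ _ n2) //=.
  rewrite (eq_big_nat _ _ (F2 := fun i => c0 - (hybrid i.+1 - hybrid i) / a)); last first.
    by move=> i /andP[_ hi]; rewrite /g hi.
  rewrite [X in _ + X <= _](eq_big_nat _ _ (F2 := fun=> c0)); last first.
    by move=> i /andP[hi _]; rewrite /g ltnNge hi.
  rewrite sumrB -mulr_suml telescope_sumr // !sumr_const_nat subn0.
  rewrite hybrid_first hybrid_last -[c0 *+ n2]mulr_natr -[c0 *+ _]mulr_natr natrB //.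
  by rewrite le_eqVlt; apply/orP; left; apply/eqP; field; rewrite !gt_eqF.
move=> i; rewrite /g; case: ifP => hi; first exact: UB_psi_at.
rewrite /= /gain (eq_Ex Q (_ : _ =1 (fun=> 0))) => [|y]; last by rewrite mulr0.
rewrite (eq_Ex P (_ : _ =1 (fun=> 0))) => [|y]; last by rewrite mulr0.
by rewrite !Ex_cst; lra.
Qed.

End Hybrids.
End Distinguisher.

(** Squaring [1 - x / 2 <= expR (- (x / 2))] gives [expR x * (1 - x / 2) ^+ 2 <= 1], while
    [(1 + x + x ^+ 2) * (1 - x / 2) ^+ 2] exceeds 1 by a quarter of [x ^+ 2 * (1 - 3 * x + x ^+ 2)],
    which is nonnegative in this range. *)
Lemma expR_le_quad {R : realType} (x : R) : `|x| <= 1 / 4 ->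
  expR x <= 1 + x + x ^+ 2.
Proof.
rewrite ler_norml => /andP[x1 x2].
have h : expR x * (1 - x / 2) ^+ 2 <= 1.
  have -> : expR x = expR (x / 2) ^+ 2.
    by rewrite expr2 -expRD; congr expR; lra.
  rewrite -exprMn; apply: exprn_ile1.
    by apply: mulr_ge0; [exact: expR_ge0|lra].
  have := expR_ge1Dx (- (x / 2)); rewrite expRN.
  have e0 := expR_gt0 (x / 2).
  by move=> hh; rewrite mulrC -ler_pdivlMr // mul1r.
have e0 := expR_ge0 x.
have d0 : 0 < (1 - x / 2) ^+ 2 by apply: exprn_gt0; lra.
rewrite -(ler_pM2r d0); apply: le_trans h _.
have : 0 <= x ^+ 2 * (1 - 3 * x + x ^+ 2) by apply: mulr_ge0; nra.
rewrite (_ : _ * _ ^+ 2 = 1 + 4^-1 * (x ^+ 2 * (1 - 3 * x + x ^+ 2))); last by field.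
lra.
Qed.

Lemma bernoulli_ge {R : realType} (p : R) k : 0 <= p <= 1 ->
  1 - k%:R * p <= (1 - p) ^+ k.
Proof.
move=> /andP[p0 p1]; elim: k => [|k IH]; first by rewrite expr0; lra.
rewrite exprS -natr1.
have : (1 - p) * (1 - k%:R * p) <= (1 - p) * (1 - p) ^+ k.
  by rewrite ler_wpM2l // subr_ge0.
have : 0 <= k%:R * (p * p) by rewrite !mulr_ge0.
by move: (k%:R : R) => K; lra.
Qed.

Lemma bernoulli_le {R : realType} (p : R) k : 0 <= p <= 1 ->
  (1 + k%:R * p) * (1 - p) ^+ k <= 1.
Proof.
move=> /andP[p0 p1]; elim: k => [|k IH]; first by rewrite expr0; lra.
have h0 : 0 <= (1 - p) ^+ k by apply: exprn_ge0; lra.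
have : 0 <= k.+1%:R * (p * p) * (1 - p) ^+ k by rewrite !mulr_ge0.
rewrite exprS -natr1; move: IH.
by move: (k%:R : R) ((1 - p) ^+ k) => K z; lra.
Qed.

Lemma count_split {T} (o e : pred T) s :
  (count e s <= count (fun x => ~~ o x) s + count (fun x => o x && e x) s)%N.
Proof. by elim: s => //= x s; case: (o x); case: (e x) => /=; lia. Qed.

(** * The potential argument *)

Section Loop.
Context {R : realType} {d : measure_display} {X : measurableType d}.
Notation Y := (X * bool)%type.
Variables (n1 n2 r : nat).
Variable acc : seq Y -> seq X -> seq bool -> bool.
Variable hyp : seq Y -> seq X -> seq bool -> X -> bool.
(* [kt] is the length of a test block and [k.+1] that of a sampling block *)
Variables (b kt k l R0 : nat).

(** The first component tells whether a block of [kt] training points contains an accepted one,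
    which measures [p] on the scale [1 / kt]; the second is the answer of the TDS learner on a
    reweighted sample. *)
Definition trial (G : X -> int) : prog X (bool * option (X -> bool)) :=
  nn <-- none G l kt ;;
  s <-- sample n1 n2 r (selP G l k.+1) (drawQ G l k) ;;
  Ret (~~ nn, if acc s.1.1 s.1.2 s.2 then Some (hyp s.1.1 s.1.2 s.2) else None).

Definition vote (hs : seq (X -> bool)) (x : X) : int :=
  foldr (fun h s => (if h x then 1 else -1) + s) 0 hs.

Definition majority hs x := 0 <= vote hs x.

Definition is_hit (o : bool * option (X -> bool)) := o.1.
Definition is_rej (o : bool * option (X -> bool)) := ~~ isSome o.2.

Fixpoint learn (t : nat) (G : X -> int) : prog X ((X -> bool) * (X -> bool)) :=
  if t is t'.+1 then
    os <-- reps (16 * R0) (trial G) ;;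
    if (12 * R0 <= count is_hit os)%N then learn t' (fun x => G x - 1)
    else if (4 * R0 <= count is_rej os)%N then
      D <-- psi n1 n2 r acc G l k b ;; learn t' (fun x => G x + D x)
    else Ret (majority (pmap snd os), fun x => G x <= 0)
  else Ret (majority [::], fun x => G x <= 0).

Variables (P Q : probability Y R).
Hypothesis jacc : forall w, size w = r ->
  jm (n1 + n2) (fun s : seq Y => (acc (take n1 s) (map fst (drop n1 s)) w)%:R : R).
Hypothesis n2b : (n2 <= 2 ^ b)%N.
Hypothesis R0_gt0 : (0 < R0)%N.
Hypothesis kt_gt0 : (0 < kt)%N.
Hypothesis kE : k.+1 = (4 * kt)%N.
Hypothesis lE : (2 ^ l = 32 * 2 ^ b * kt)%N.

Notation h := ((2 ^ l)%:R : R).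
Notation B := (k.+1%:R : R).
Notation M := ((2 ^ b)%:R : R).
Notation p G := (pbar P G l).
Notation vv G := (@v R d X G l).
Notation bmz G := (bm (fun x => (G x)%:~R : R)).

(** As [phi] has derivative [clamp], the derivative of [Phi] in direction [D] is [- gain D]: the
    term [- G] under [Q] turns [v] into [v - 1]. From [phi z >= z] and [phi z >= 0], [Phi] is
    nonnegative. *)
Definition Phi (G : X -> int) : R :=
  Ex Q (fun y => phi h (G y.1)%:~R - (G y.1)%:~R) +
  B * Ex P (fun y => phi h (G y.1)%:~R).

(** Half of the mean gain that a rejecting round secures; the width [h] is chosen for the
    second-order error not to exceed it either. *)
Definition drift : R := (20 * M)^-1.
Definition cB : R := 1 + B.

Let h0 : 0 < h. Proof. by rewrite ltr0n expn_gt0. Qed.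
Let M1 : 1 <= M. Proof. by rewrite ler1n expn_gt0. Qed.
Let kt1 : 1 <= kt%:R :> R. Proof. by rewrite ler1n. Qed.
Let BE : B = 4 * kt%:R :> R. Proof. by rewrite kE natrM. Qed.
Let hE : h = 32 * M * kt%:R. Proof. by rewrite lE !natrM. Qed.

Let second_order : cB / (4 * h) <= drift.
Proof.
rewrite /cB /drift hE BE; have M1' := M1; have kt1' := kt1.
rewrite ler_pdivrMr; last by apply: mulr_gt0 => //; nra.
rewrite (_ : _^-1 * _ = 32 / 5 * kt%:R); first by lra.
by field; rewrite gt_eqF //; lra.
Qed.

Lemma bmzf G : bmz G -> bm (fun y : Y => (G y.1)%:~R : R).
Proof. exact: bm_fst. Qed.

Lemma Phi_step G D : bmz G -> bmz D -> (forall x, `|D x| <= 1) ->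
  Phi (fun x => G x + D x) <= Phi G - gain P Q G l k D + drift.
Proof.
move=> bG bD D1; have bGf := bmzf bG; have bDf := bmzf bD.
have bGDf : bm (fun y : Y => (G y.1 + D y.1)%:~R : R).
  by under eq_fun do rewrite rmorphD /=; exact: bmD.
have bv := bm_v1 l bG.
have b1v : bm (fun y : Y => 1 - vv G y.1) by apply: bmB => //; exact: bm_cst.
have D2 x : ((D x)%:~R : R) ^+ 2 <= 1.
  have := D1 x; rewrite -(ler_int R) intr_norm ler_norml => /andP[].
  by rewrite expr2; nra.
have h4 : 0 < 4 * h by move: h0; lra.
have step (y : Y) : phi h (G y.1 + D y.1)%:~R <= phi h (G y.1)%:~R +
    (D y.1)%:~R * vv G y.1 + (4 * h)^-1.
  rewrite rmorphD /=; apply: le_trans (phi_step h0 _ _) _.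
  rewrite lerD2l -[leRHS]mul1r ler_pM2r ?invr_gt0 //; exact: D2.
have e1 : Ex Q (fun y => phi h (G y.1 + D y.1)%:~R - (G y.1 + D y.1)%:~R) <=
    Ex Q (fun y => phi h (G y.1)%:~R - (G y.1)%:~R) -
    Ex Q (fun y => (1 - vv G y.1) * (D y.1)%:~R) + (4 * h)^-1.
  rewrite -ExB; [|by apply: bmB => //; exact: bm_phi|exact: bmM].
  rewrite -[X in _ + X](Ex_cst Q) -ExD; last 2 first.
  - by apply: bmB; [apply: bmB => //; exact: bm_phi|exact: bmM].
  - exact: bm_cst.
  apply: Ex_le.
  - by apply: bmB => //; exact: bm_phi.
  - by apply: bmD; [apply: bmB; [apply: bmB => //; exact: bm_phi|exact: bmM]|exact: bm_cst].
  - by move=> y; have := step y; rewrite rmorphD /=; lra.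
have e2 : Ex P (fun y => phi h (G y.1 + D y.1)%:~R) <=
    Ex P (fun y => phi h (G y.1)%:~R) +
    Ex P (fun y => vv G y.1 * (D y.1)%:~R) + (4 * h)^-1.
  rewrite -ExD; [|exact: bm_phi|exact: bmM].
  rewrite -[X in _ + X](Ex_cst P) -ExD; last 2 first.
  - by apply: bmD; [exact: bm_phi|exact: bmM].
  - exact: bm_cst.
  apply: Ex_le.
  - exact: bm_phi.
  - by apply: bmD; [apply: bmD; [exact: bm_phi|exact: bmM]|exact: bm_cst].
  - by move=> y; have := step y; lra.
have := second_order; rewrite /Phi /gain /cB.
have B0 : 0 <= B by exact: ler0n.
move: e1 (ler_wpM2l B0 e2).
by move: (Ex _ _) (Ex _ _) (Ex _ _) (Ex _ _) (Ex _ _) (Ex _ _) => *; lra.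
Qed.

Lemma Phi_lip G D : bmz G -> bmz D -> (forall x, `|D x| <= 1) ->
  `|Phi (fun x => G x + D x) - Phi G| <= cB.
Proof.
move=> bG bD D1; have bGf := bmzf bG; have bDf := bmzf bD.
have bGDf : bm (fun y : Y => (G y.1 + D y.1)%:~R : R).
  by under eq_fun do rewrite rmorphD /=; exact: bmD.
have lip z s : `|s| <= 1 -> `|phi h (z + s) - phi h z| <= 1 /\
    `|(phi h (z + s) - (z + s)) - (phi h z - z)| <= 1.
  move=> s1; case: (leP 0 s) => s0.
    have /andP[? ?] := phi_lip h0 z s0; rewrite ger0_norm // in s1.
    by split; rewrite ler_norml; apply/andP; split; lra.
  have s0' : 0 <= - s by lra.
  have := phi_lip h0 (z + s) s0'; rewrite addrK => /andP[? ?].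
  rewrite ltr0_norm // in s1.
  by split; rewrite ler_norml; apply/andP; split; lra.
have D1' x : `|(D x)%:~R : R| <= 1.
  by have := D1 x; rewrite -(ler_int R) intr_norm.
rewrite /Phi /cB.
rewrite (_ : _ - _ = Ex Q (fun y => (phi h (G y.1 + D y.1)%:~R - (G y.1 + D y.1)%:~R)
   - (phi h (G y.1)%:~R - (G y.1)%:~R)) + B * Ex P (fun y =>
   phi h (G y.1 + D y.1)%:~R - phi h (G y.1)%:~R)); last first.
  rewrite ExB; [|by apply: bmB => //; exact: bm_phi|by apply: bmB => //; exact: bm_phi].
  by rewrite ExB; [ring|exact: bm_phi|exact: bm_phi].
apply: le_trans (ler_normD _ _) _; apply: lerD.
  apply: Ex_bounded.
    by apply: bmB; apply: bmB => //; exact: bm_phi.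
  by move=> y; rewrite rmorphD /=; case: (lip (G y.1)%:~R _ (D1' y.1)).
rewrite normrM (ger0_norm (ler0n _ _)) -[leRHS]mulr1.
apply: ler_wpM2l; first exact: ler0n.
apply: Ex_bounded; first by apply: bmB; exact: bm_phi.
by move=> y; rewrite rmorphD /=; case: (lip (G y.1)%:~R _ (D1' y.1)).
Qed.

(** The minimizer over [s] of [- s * drift + (s * cB) ^+ 2], where [cB] bounds the change of [Phi]
    in one move; the minimum is [- kappa]. *)
Definition sc : R := drift / (2 * cB ^+ 2).
Definition kappa : R := drift ^+ 2 / (4 * cB ^+ 2).

Let drift01 : 0 < drift <= 1 / 20.
Proof.
have M1' := M1; rewrite /drift invr_gt0; apply/andP; split; first by lra.
by rewrite div1r lef_pV2 ?posrE; lra.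
Qed.

Let cB1 : 1 <= cB.
Proof. by rewrite /cB lerDl. Qed.

Let sc_bound : 0 < sc /\ sc * cB <= 1 / 40.
Proof.
have /andP[d0 d1] := drift01; have c1 := cB1.
have c20 : 0 < 2 * cB ^+ 2 by rewrite mulr_gt0 // exprn_gt0 //; lra.
split; first by rewrite /sc divr_gt0.
rewrite (_ : sc * cB = drift / (2 * cB)); last first.
  by rewrite /sc; field; rewrite gt_eqF //; lra.
by rewrite ler_pdivrMr; nra.
Qed.

Let kappaE : 1 - sc * drift + (sc * cB) ^+ 2 = 1 - kappa.
Proof.
have c1 := cB1; rewrite /kappa /sc; field.
by rewrite gt_eqF //; lra.
Qed.

Definition energy (G : X -> int) : R := expR (sc * Phi G).

Lemma energy_step G D : bmz G -> bmz D -> (forall x, `|D x| <= 1) ->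
  energy (fun x => G x + D x) <=
  energy G * (1 + sc * (drift - gain P Q G l k D) + (sc * cB) ^+ 2).
Proof.
move=> bG bD D1; have [s0 s1] := sc_bound.
set Dl := Phi (fun x => G x + D x) - Phi G.
have -> : energy (fun x => G x + D x) = energy G * expR (sc * Dl).
  by rewrite /energy -expRD; congr expR; rewrite /Dl; ring.
rewrite ler_pM2l ?expR_gt0 //.
have lip := Phi_lip bG bD D1; rewrite -/Dl in lip.
have lip' : `|sc * Dl| <= sc * cB.
  by rewrite normrM (ger0_norm (ltW s0)) ler_pM2l.
apply: le_trans (expR_le_quad _) _; first by apply: le_trans lip' _; lra.
apply: lerD.
  rewrite lerD2l ler_pM2l //; have := Phi_step bG bD D1; rewrite /Dl; lra.
by rewrite -real_normK ?num_real // lerXn2r ?nnegrE //; apply: le_trans lip'.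
Qed.

(** This forces [kt * p <= 7] by [bernoulli_le], and keeps the acceptance factor [keep] away from 0
    because [k < 4 * kt]. *)
Definition pgood (G : X -> int) := ((1 - p G) ^+ kt >= 1 / 8 :> R).

Lemma keep_pgood G : bmz G -> pgood G -> (1 / 8) ^+ 4 <= keep P G l k.
Proof.
move=> bG pg; have /andP[p0 p1] := pbar01 P l bG.
apply: (@le_trans _ _ (((1 - p G) ^+ kt) ^+ 4)).
  by apply: lerXn2r; rewrite ?nnegrE //; apply: le_trans pg.
rewrite -exprM mulnC -kE /keep exprS.
have : 0 <= (1 - p G) ^+ k by apply: exprn_ge0; lra.
by move: (_ ^+ _) => z; nra.
Qed.

Lemma outcomes_psi G : bmz G -> outcomes (psi n1 n2 r acc G l k b)
  (fun D => bmz D /\ forall x, `|D x| <= 1).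
Proof.
move=> bG; apply: outcomes_bind (outcomesT _) _ => i _; case: ifP => hi; last first.
  by split => //; exact: bm_cst.
apply: outcomes_bind (outcomes_reps _ _) _ => S sS.
apply: outcomes_bind (outcomes_reps _ _) _ => U sU.
apply: outcomes_bind (outcomes_reps _ _) _ => V sV.
apply: outcomes_bind (outcomes_reps _ _) _ => w sw y0 /=; split; last first.
  by move=> x; rewrite /rejz; case: acc; case: acc.
have bf : bm (fun x => (rejz acc S (U ++ x :: map fst V) w)%:~R : R).
  have jw : jm (size V).+1 (fun t : seq Y =>
      rejl n1 acc w ((S ++ [seq (u, true) | u <- U]) ++ t) : R).
    apply: (jm_prefix (n := n1 + i)); first by rewrite size_cat size_map sS sU.
    rewrite (_ : (n1 + i + _ = n1 + n2)%N); last by rewrite sV; move: hi; clear; lia.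
    exact: (jm_rejl jacc sw).
  have := jm_head jw erefl.
  move=> /(@bm_comp _ _ _ _ _ _ (fun x : X => (x, true))) bc.
  have -> : (fun x => (rejz acc S (U ++ x :: map fst V) w)%:~R : R) =
    (fun y => rejl n1 acc w ((S ++ [seq (u, true) | u <- U]) ++ y :: V)) \o
    (fun x : X => (x, true)).
    apply/funext => x /=; rewrite /rejl -catA take_size_cat // drop_size_cat //.
    by rewrite map_cat /= -map_comp (@eq_map _ _ _ id) ?map_id.
  by apply: bc; exact: measurable_fun_pair.
by under eq_fun do rewrite rmorphB /=; apply: bmB => //; exact: bm_cst.
Qed.

Lemma vote_count hs x : vote hs x + (size hs)%:Z = 2 * (count (fun h => h x) hs)%:Z.
Proof.
elim: hs => [//|g hs IH] /=; move: IH; rewrite -/(vote hs x).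
by case: (g x) => /=; clear; lia.
Qed.

Lemma majority_wrong hs (y : Y) : y.2 != majority hs y.1 ->
  (size hs <= 2 * count (fun h => h y.1 != y.2) hs)%N.
Proof.
have hv := vote_count hs y.1.
have hc := count_predC (fun g : X -> bool => g y.1) hs.
have he : count (fun g : X -> bool => g y.1 != y.2) hs =
    if y.2 then count (predC (fun g : X -> bool => g y.1)) hs
    else count (fun g : X -> bool => g y.1) hs.
  by case: y {hv hc} => x [] /=; apply: eq_count => g /=; case: (g x).
rewrite he; case: (y.2) => /=; rewrite /majority; case: leP => //; move: hv hc; clear; lia.
Qed.

Variables (E1 : R).
Hypothesis E1_ge0 : 0 <= E1.

(** [keep] times the weighted error is the part of the risk under [Q'] that comes from [Q], which is
    what soundness on the reweighted laws controls. *)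
Definition okh (G : X -> int) (g : X -> bool) : bool :=
  keep P G l k * Ex Q (fun y => (1 - vv G y.1) * (g y.1 != y.2)%:R) <= E1.

Definition fail (hg : (X -> bool) * (X -> bool)) : R :=
  (~~ `[< Ex Q (fun y => ((y.2 != hg.1 y.1) && hg.2 y.1)%:R) <=
            16 * 8 ^+ 4 * E1 /\
          Ex P (fun y => (~~ hg.2 y.1)%:R) <= 14 / kt%:R >])%:R.

Lemma fail01 hg : 0 <= fail hg <= 1.
Proof. by rewrite /fail; case: asbool; rewrite /= ler01 lexx. Qed.

Lemma bm_err (g : X -> bool) : measurable [set x | g x] ->
  bm (fun y : Y => (g y.1 != y.2)%:R : R).
Proof.
move=> mg; have m1 : measurable [set y : Y | g y.1].
  rewrite (_ : [set y | _] = fst @^-1` [set x | g x]) // -[X in measurable X]setTI.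
  exact: measurable_fst.
have m2 : measurable [set y : Y | y.2].
  rewrite (_ : [set y | _] = snd @^-1` [set true]).
    by rewrite -[X in measurable X]setTI; exact: measurable_snd.
  by apply/seteqP; split => y /=; case: y.2.
apply: bm_indic; rewrite (_ : [set y | _] =
   ([set y : Y | g y.1] `\` [set y : Y | y.2]) `|`
   ([set y : Y | y.2] `\` [set y : Y | g y.1])).
  by apply: measurableU; exact: measurableD.
by apply/seteqP; split => y /=; case: (g y.1); case: (y.2) => //=;
  by [left|right|move=> _; left|move=> _; right|case=> -[]].
Qed.

Lemma measurable_sign G : bmz G -> measurable [set y : Y | G y.1 <= 0].
Proof.
move=> bG; have [mG _] := bmzf bG.
rewrite (_ : [set y : Y | _] = [set y | ((G y.1)%:~R <= (0 : R)) = true]).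
  apply: measurable_le_fun => //; exact: measurable_cst.
by apply/seteqP; split => y /=; rewrite lerz0.
Qed.

Lemma measurable_majority (hs : seq (X -> bool)) :
  (forall g, List.In g hs -> measurable [set x | g x]) ->
  measurable [set x | majority hs x].
Proof.
move=> mhs; have mv : measurable_fun setT (fun x => (vote hs x)%:~R : R).
  elim: hs mhs => [|g hs IH] mhs /=; first exact: measurable_cst.
  have mg : bm (fun x => (g x)%:R : R) by apply: bm_indic; apply: mhs; left.
  have -> : (fun x => ((if g x then 1 else -1) + vote hs x)%:~R : R) =
     (fun x => (2 * (g x)%:R - 1) + (vote hs x)%:~R).
    by apply/funext => x; rewrite rmorphD /=; case: (g x) => /=; congr (_ + _);
      rewrite ?rmorphN /=; lra.
  apply: measurable_funD; last by apply: IH => f hf; apply: mhs; right.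
  by have [] := bmB (bmZ 2 mg) (bm_cst 1).
rewrite (_ : [set x | _] = [set x | ((0 : R) <= (vote hs x)%:~R) = true]).
  by apply: measurable_le_fun => //; exact: measurable_cst.
by apply/seteqP; split => x /=; rewrite /majority ler0z.
Qed.

(** Where the vote is wrong, at least half of the more than [12 * R0] hypotheses are wrong, and
    fewer than [4 * R0] of them fail [okh]; so at least [2 * R0] good ones err, each with weight at
    least 1/2 if [G <= 0]. Their total weighted error has mean at most [16 * R0 * E1 / keep], and
    Markov's inequality with [keep >= 8 ^- 4] gives the first bound. *)
Lemma stop_good G (hs : seq (X -> bool)) : bmz G ->
  (forall g, List.In g hs -> measurable [set x | g x]) -> pgood G ->
  (12 * R0 < size hs)%N ->
  (size hs <= 16 * R0)%N -> (count (fun g => ~~ okh G g) hs < 4 * R0)%N ->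
  fail (majority hs, fun x => G x <= 0) = 0.
Proof.
move=> bG mhs pg h12 h16 hbad; have a4 := keep_pgood bG pg.
have bv := bm_v1 l bG; have v01 x := @v01 R d X G l x.
have b1v : bm (fun y : Y => 1 - vv G y.1) by apply: bmB => //; exact: bm_cst.
have msgn := measurable_sign bG.
have a0 : 0 < keep P G l k by apply: lt_le_trans a4; rewrite exprn_gt0 //; lra.
set a := keep P G l k in a0 a4.
suff [e1 e2] : Ex Q (fun y => ((y.2 != majority hs y.1) && (G y.1 <= 0))%:R) <=
    16 * 8 ^+ 4 * E1 /\ Ex P (fun y => (~~ (G y.1 <= 0))%:R) <= 14 / kt%:R.
  by rewrite /fail /=; case: asboolP => // -[].
split; last first.
  have /andP[p0 p1] := pbar01 P l bG.
  (* From [(1 + kt * p) * (1 - p) ^+ kt <= 1] and [pgood]. A rejected point has weight at least 1/2,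
     so the rejection rate is at most [2 * p], hence the constant 14. *)
  have hp : kt%:R * p G <= 7.
    have := bernoulli_le kt (pbar01 P l bG); move: pg; rewrite /pgood.
    have : 0 <= kt%:R * p G by rewrite mulr_ge0.
    by move: (kt%:R * p G) ((1 - p G) ^+ kt) => z w; nra.
  apply: (@le_trans _ _ (2 * p G)); last first.
    by rewrite ler_pdivlMr; [move: hp; lra|move: kt1; lra].
  rewrite -ExZ //; apply: Ex_le.
  - by apply: bm_indic; rewrite (_ : [set y | _] = ~` [set y : Y | G y.1 <= 0]);
      [exact: measurableC|apply/seteqP; split => y /= /negP].
  - exact: bmZ.
  - move=> y; case: (leP (G y.1) 0) => hG /=.
      by rewrite mulr_ge0 //; case/andP: (v01 y.1).
    have : (0 : R) <= (G y.1)%:~R by rewrite ler0z ltW.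
    by move=> /(clamp_half h0); rewrite /v; lra.
pose W (y : Y) : R :=
  \sum_(g <- hs | okh G g) ((1 - vv G y.1) * (g y.1 != y.2)%:R).
have [bW hW] : bm W /\ Ex Q W <= (size hs)%:R * (E1 / a).
  rewrite /W; elim: (hs) mhs => [|g gs IHg] /= mhs.
    under eq_fun do rewrite big_nil; rewrite Ex_cst mul0r.
    by split => //; exact: bm_cst.
  have [bgs IH] : _ /\ _ := IHg (fun f hf => mhs f (or_intror hf)).
  under eq_fun do rewrite big_cons.
  case hg : (okh G g); last first.
    split => //; apply: le_trans IH _; apply: ler_wpM2r.
      by rewrite divr_ge0 // ltW.
    by rewrite ler_nat.
  have be := bm_err (mhs g (or_introl erefl)).
  split; first by apply: bmD => //; exact: bmM.
  rewrite ExD //; last exact: bmM.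
  rewrite -natr1 mulrDl mul1r addrC; apply: lerD => //.
  by rewrite ler_pdivlMr // mulrC.
have Rpos : (0 : R) < R0%:R by rewrite ltr0n.
apply: (@le_trans _ _ (R0%:R^-1 * Ex Q W)); last first.
  rewrite ler_pdivrMl //; apply: le_trans hW _.
  apply: (@le_trans _ _ ((16 * R0)%:R * (E1 / a))).
    by apply: ler_wpM2r; [rewrite divr_ge0 // ltW|rewrite ler_nat].
  rewrite natrM [leRHS](_ : _ = 16 * R0%:R * (8 ^+ 4 * E1)); last by ring.
  apply: ler_wpM2l; first by rewrite mulr_ge0.
  rewrite ler_pdivrMr // -[leLHS]mulr1 -mulrA.
  rewrite [leRHS](_ : _ = E1 * (8 ^+ 4 * a)); last by ring.
  apply: ler_wpM2l => //; move: a4; rewrite !expr_div_n expr1n.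
  by rewrite ler_pdivrMr ?exprn_gt0 // mulrC.
have mono (y : Y) : ((y.2 != majority hs y.1) && (G y.1 <= 0))%:R <= R0%:R^-1 * W y.
  have W0 : 0 <= W y.
    by apply: sumr_ge0 => g _; rewrite mulr_ge0 // subr_ge0; case/andP: (v01 y.1).
  case: (boolP (y.2 != majority hs y.1)) => hw /=; last first.
    by rewrite mulr_ge0 // invr_ge0.
  case: (leP (G y.1) 0) => hG /=; last by rewrite mulr_ge0 // invr_ge0.
  have := majority_wrong hw; set wr := count _ hs => hwr.
  have hgw : (wr <= count (fun g => ~~ okh G g) hs +
      count (fun g => okh G g && (g y.1 != y.2)) hs)%N.
    exact: count_split.
  have WE : W y = (1 - vv G y.1) * (count (fun g => okh G g && (g y.1 != y.2)) hs)%:R.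
    rewrite /W; elim: (hs) => [|g gs IH]; first by rewrite big_nil mulr0.
    rewrite big_cons IH /=; case: (okh G g) => //=.
    by case: (g y.1 != y.2) => /=; rewrite natrD; ring.
  rewrite ler_pdivlMl // mulr1 WE.
  have hc : (2 * R0)%:R <= (count (fun g => okh G g && (g y.1 != y.2)) hs)%:R :> R.
    by rewrite ler_nat; move: hwr hgw h12 hbad; clear; lia.
  have : (G y.1)%:~R <= (0 : R) by rewrite lerz0.
  move=> /(clamp_half' h0) hv; rewrite natrM in hc.
  have hv' : 1 / 2 <= 1 - vv G y.1 by rewrite /v; lra.
  apply: (@le_trans _ _ (1 / 2 * (2 * R0%:R))); first by move: Rpos; lra.
  by apply: ler_pM => //; rewrite mulr_ge0.
rewrite -ExZ //; apply: Ex_le => //; last exact: bmZ.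
have -> : (fun y : Y => ((y.2 != majority hs y.1) && (G y.1 <= 0))%:R : R) =
  (fun y : Y => ((majority hs y.1 != y.2)%:R : R) * ((G y.1 <= 0)%R : bool)%:R).
  by apply/funext => y; rewrite -natrM mulnb eq_sym.
by apply: bmM; [exact: bm_err (measurable_majority mhs)|exact: bm_indic].
Qed.

Hypothesis hyp_measurable : forall S U w,
  size S = n1 -> size U = n2 -> size w = r -> acc S U w ->
  measurable [set x | hyp S U w x].
Hypothesis complete : forall P' : probability Y R,
  rejection n1 n2 r acc P' P' <= 1 / 100.
Hypothesis sound : forall G, bmz G ->
  UB P Q (sample n1 n2 r (selP G l k.+1) (drawQ G l k))
    (fun s => (acc s.1.1 s.1.2 s.2 && ~~ okh G (hyp s.1.1 s.1.2 s.2))%:R) (1 / 8).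

Let del : R := 2^-1 ^+ R0.

Definition bad_hyp (G : X -> int) (o : option (X -> bool)) : bool :=
  if o is Some g then ~~ okh G g else false.

Definition is_bad G (o : bool * option (X -> bool)) : bool := bad_hyp G o.2.

Lemma outcomes_sample (G : X -> int) : outcomes (sample n1 n2 r (selP G l k.+1) (drawQ G l k))
  (fun s => [/\ size s.1.1 = n1, size s.1.2 = n2 & size s.2 = r]).
Proof.
apply: outcomes_bind (outcomes_reps _ _) _ => S sS.
apply: outcomes_bind (outcomes_reps _ _) _ => U sU.
by apply: outcomes_bind (outcomes_reps _ _) _ => w sw.
Qed.

Lemma outcomes_trial (G : X -> int) : outcomes (trial G)
  (fun o => forall g, o.2 = Some g -> measurable [set x | g x]).
Proof.
apply: outcomes_bind (outcomesT _) _ => nn _.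
apply: outcomes_bind (outcomes_sample G) _ => s [s1 s2 s3] /=.
by case: ifP => // ha g [<-]; exact: hyp_measurable.
Qed.

Lemma outcomes_repsF {A} (pr : prog X A) (F : A -> Prop) n : outcomes pr F ->
  outcomes (reps n pr) (fun s => size s = n /\ forall a, List.In a s -> F a).
Proof.
move=> hp; elim: n => [|n IH] //=; apply: outcomes_bind hp _ => a Fa.
apply: outcomes_bind IH _ => s [<- hs] /=; split => // a' [<- //|]; exact: hs.
Qed.

Lemma UB_hit G (f : bool -> R) : bmz G ->
  UB P Q (trial G) (fun o => f o.1)
    ((1 - p G) ^+ kt * f false + (1 - (1 - p G) ^+ kt) * f true).
Proof.
move=> bG; apply: UB_bind (UB_none P Q l bG kt (fun c => f (~~ c))) _ => c.
by apply: UB_bind (UB_cst _ _ _ (f (~~ c))) _ => s /=; exact: lexx.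
Qed.

Lemma UB_trial_sample G (f : option (X -> bool) -> R) c :
  UB P Q (sample n1 n2 r (selP G l k.+1) (drawQ G l k))
    (fun s => f (if acc s.1.1 s.1.2 s.2 then Some (hyp s.1.1 s.1.2 s.2) else None)) c ->
  UB P Q (trial G) (fun o => f o.2) c.
Proof.
move=> hc; apply: UB_bind (UB_cst _ _ _ c) _ => nn.
by apply: UB_bind hc _ => s /=; exact: lexx.
Qed.

(** The flag [c] is a fact about the current score and not about the draws. When it is false the
    event is empty, so the bad events of a round can be bounded without first comparing the true
    frequencies with their thresholds. *)
Lemma UB_event {A} (pr : prog X A) (c : bool) (e : A -> bool) (mu y : R) m :
  UB P Q pr (fun o => (e o)%:R) mu -> 0 <= mu ->
  (c -> exists2 mu', mu <= mu' & (1 + (y - 1) * mu') ^+ 16 <= y ^+ m / 2) -> 1 <= y ->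
  UB P Q (reps (16 * R0) pr) (fun os => (c && (m * R0 <= count e os)%N)%:R) del.
Proof.
move=> he mu0 hc y1; case: c hc => [/(_ isT) [mu' hmu hm]|_]; last first.
  apply: UB_le (UB_cst _ _ _ 0) _ _ => //.
  by rewrite /del exprn_ge0 // invr_ge0.
apply: (@UB_count _ _ _ _ _ _ _ _ _ y _ _ (UB_le he (fun=> lexx _) hmu)) => //.
exact: (le_trans mu0 hmu).
Qed.

Lemma kappa01 : 0 <= 1 - kappa.
Proof.
have /andP[d0 d1] := drift01; have c1 := cB1; rewrite subr_ge0 /kappa.
rewrite ler_pdivrMr; last by rewrite mulr_gt0 // exprn_gt0 //; lra.
by rewrite !expr2; nra.
Qed.

(** Bernoulli's inequality gives [kt * p > 1/2], hence [B * p > 2] as [B = 4 * kt]. Lowering the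
    score by 1 has gain [B * p - q >= 1], far above the required [2 * drift]. *)
Lemma hit_step G : bmz G -> (1 - p G) ^+ kt < 1 / 2 ->
  bmz (fun x => G x - 1) /\
  energy (fun x => G x - 1) <= energy G * (1 - kappa).
Proof.
move=> bG hp; have bD : bm (fun _ : X => (-1)%:~R : R) by exact: bm_cst.
split; first by under eq_fun do rewrite rmorphB /=; apply: bmB => //; exact: bm_cst.
have hD : forall x : X, `|(-1 : int)| <= 1 by [].
have := energy_step bG bD hD => /le_trans; apply.
rewrite ler_pM2l ?expR_gt0 // -kappaE lerD2r lerD2l.
have [s0 _] := sc_bound; have /andP[d0 d1] := drift01.
rewrite -mulrN ler_pM2l //.
clear hD; suff : 1 <= gain P Q G l k (fun=> -1) by lra.
have bv := bm_v1 l bG.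
have b1v : bm (fun y : Y => 1 - vv G y.1) by apply: bmB => //; exact: bm_cst.
rewrite /gain (eq_Ex Q (_ : _ =1 (fun y : Y => -1 * (1 - vv G y.1)))); last first.
  by move=> y; rewrite rmorphN /=; ring.
rewrite (eq_Ex P (_ : _ =1 (fun y : Y => -1 * vv G y.1))); last first.
  by move=> y; rewrite rmorphN /=; ring.
rewrite !ExZ // -/(p G) -/(qbar Q G l).
have /andP[q0 q1] := qbar01 Q l bG.
have := bernoulli_ge kt (pbar01 P l bG); rewrite BE.
by move: hp; move: (_ ^+ _) => z; lra.
Qed.

Lemma psi_step G t c : bmz G -> pgood G ->
  (forall D, bmz D -> (forall x, `|D x| <= 1) -> UB P Q (learn t (fun x => G x + D x)) fail
     ((1 - kappa) ^+ t * energy (fun x => G x + D x) + c)) ->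
  (exists P' Q', [/\ samplesS P Q (selP G l k.+1) P', samplesU P Q (drawQ G l k) Q',
    (forall f, bm f -> Ex P' f = keep P G l k * B * Ex P (fun y => vv G y.1 * f y) +
       (1 - keep P G l k * B * p G) * Ex P f),
    (forall f, bm f -> Ex Q' f = keep P G l k * Ex Q (fun y => (1 - vv G y.1) * f y) +
       (1 - keep P G l k * qbar Q G l) * Ex P f) &
    1 / 8 <= rejection n1 n2 r acc P' Q']) ->
  UB P Q (D <-- psi n1 n2 r acc G l k b ;; learn t (fun x => G x + D x)) fail
    ((1 - kappa) ^+ t.+1 * energy G + c).
Proof.
move=> bG pg IH [P' [Q' [hP' hQ' P'E Q'E hrej]]].
have [s0 s1] := sc_bound; have M1' := M1.
have a4 := keep_pgood bG pg.
have a0 : 0 < keep P G l k by apply: lt_le_trans a4; rewrite exprn_gt0 //; lra.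
have /andP[_ a1] := keep01 P l k bG.
have hpsi := UB_psi jacc bG hP' hQ' P'E Q'E a0 drift n2b.
pose E := (1 - kappa) ^+ t * energy G.
have E0 : 0 <= E.
  by rewrite mulr_ge0 ?exprn_ge0 ?kappa01 // expR_ge0.
have := UB_scale E0 (UB_add (UB_cst _ _ _ (1 + (sc * cB) ^+ 2))
   (UB_scale (ltW s0) hpsi)).
move=> /(fun hh => UB_add hh (UB_cst _ _ _ c)) hu.
apply: (UB_bind_out (outcomes_psi bG) (UB_le hu (fun=> lexx _) _)); last first.
  move=> D [bD D1]; apply: UB_le (IH D bD D1) (fun=> lexx _) _.
  rewrite lerD2r /E -mulrA; apply: ler_wpM2l; first by rewrite exprn_ge0 ?kappa01.
  by apply: le_trans (energy_step bG bD D1) _; rewrite ler_pM2l ?expR_gt0 //; lra.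
rewrite lerD2r [_ ^+ t.+1]exprSr /E.
rewrite [leRHS](_ : _ = (1 - kappa) ^+ t * energy G * (1 - kappa)); last by ring.
rewrite [leLHS](_ : _ = (1 - kappa) ^+ t * energy G * (1 + (sc * cB) ^+ 2 +
  sc * (drift - (rejection n1 n2 r acc P' Q' - rejection n1 n2 r acc P' P') /
   (keep P G l k * M)))); last by ring.
apply: ler_wpM2l => //; rewrite -kappaE.
(* The pair [(P', Q')] is rejected with probability at least 1/8 and [(P', P')] at most 1/100. The
   difference exceeds 1/10, and [keep <= 1]. *)
suff : 2 * drift <= (rejection n1 n2 r acc P' Q' - rejection n1 n2 r acc P' P') /
   (keep P G l k * M).
  move: (_ / (keep P G l k * M)) => z hz.
  have : sc * (drift - z) <= sc * (- drift) by rewrite ler_pM2l //; lra.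
  by lra.
rewrite ler_pdivlMr; last by rewrite mulr_gt0 //; lra.
have -> : 2 * drift * (keep P G l k * M) = keep P G l k / 10.
  by rewrite /drift; field; rewrite gt_eqF //; lra.
by have := complete P'; move: hrej a1; lra.
Qed.

Lemma count_pmap (os : seq (bool * option (X -> bool))) :
  (size (pmap snd os) + count is_rej os = size os)%N.
Proof. by elim: os => //= -[a [g|]] os <- /=; rewrite /is_rej /=; clear; lia. Qed.

Lemma count_is_bad G (os : seq (bool * option (X -> bool))) :
  count (fun g => ~~ okh G g) (pmap snd os) = count (is_bad G) os.
Proof. by elim: os => //= -[a [g|]] os /= ->. Qed.

Lemma energy_ge1 G : bmz G -> 1 <= energy G.
Proof.
move=> bG; rewrite /energy; apply: le_trans (expR_ge1Dx _); rewrite lerDl.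
have [s0 _] := sc_bound; apply: mulr_ge0 (ltW s0) _.
apply: addr_ge0; first by apply: Ex_ge0 => y; rewrite subr_ge0; case: (phi_ge0 h0 (G y.1)%:~R).
by apply: mulr_ge0 => //; apply: Ex_ge0 => y; case: (phi_ge0 h0 (G y.1)%:~R).
Qed.

Lemma rejection_ge0 (P' Q' : probability Y R) : 0 <= rejection n1 n2 r acc P' Q' :> R.
Proof.
have EI0 (mu : probability Y R) n f : (forall s, 0 <= f s) -> 0 <= EI mu n f.
  elim: n f => [|n IHn] f f0 //=; apply: Ex_ge0 => y; exact: IHn.
by apply: (EI0) => S; apply: (EI0) => V; apply: EC_ge0.
Qed.

(** A round has four bad events, each of probability at most [del]: many hits although [p] is small,
    many misses although [p] is large, many rejections although they are unlikely, and many accepted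
    hypotheses that fail [okh]. Outside them the branch taken is the right one: two branches shrink
    the mean energy and the third stops without failure. When the rounds run out, failure is at most
    1, hence at most the energy, because [Phi] is nonnegative. *)
Theorem UB_learn t G : bmz G -> UB P Q (learn t G) fail
  ((1 - kappa) ^+ t * energy G + (4 * t)%:R * del).
Proof.
have del0 : 0 <= del by rewrite /del exprn_ge0 // invr_ge0.
elim: t G => [|t IH] G bG.
  rewrite muln0 mul0r addr0 expr0 mul1r /=.
  by apply: le_trans (energy_ge1 bG); case/andP: (fail01 (majority [::], fun x => G x <= 0)).
have [P' [hP' P'E]] := trainE P Q l k bG.
have [Q' [hQ' Q'E]] := testE P Q l k bG.
have hrej := UB_sample_jm hP' hQ' (f := fun S U w => (~~ acc S U w)%:R)
  (fun w sw => jm_rejl jacc sw).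
set z := (1 - p G) ^+ kt; set rho := rejection n1 n2 r acc P' Q'.
have z01 : 0 <= z <= 1.
  have /andP[p0 p1] := pbar01 P l bG; rewrite /z.
  by rewrite exprn_ge0 ?exprn_ile1 //; lra.
pose e1 (os : seq (bool * option (X -> bool))) :=
  (1 / 2 <= z) && (12 * R0 <= count is_hit os)%N.
pose e2 (os : seq (bool * option (X -> bool))) :=
  (~~ pgood G) && (4 * R0 <= count (fun o => ~~ is_hit o) os)%N.
pose e3 (os : seq (bool * option (X -> bool))) :=
  (rho < 1 / 8) && (4 * R0 <= count is_rej os)%N.
pose e4 (os : seq (bool * option (X -> bool))) :=
  true && (4 * R0 <= count (is_bad G) os)%N.
(* Bases for the Chernoff bound: 2 separates a mean of 1/8 from the frequency 4/16, and 3 separates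
   a mean of 1/2 from the frequency 12/16. *)
have num2 : (1 + (2 - 1) * (1 / 8)) ^+ 16 <= 2 ^+ 4 / 2 :> R.
  by rewrite !exprS !expr0; lra.
have num3 : (1 + (3 - 1) * (1 / 2)) ^+ 16 <= 3 ^+ 12 / 2 :> R.
  by rewrite !exprS !expr0; lra.
have u1 : UB P Q (reps (16 * R0) (trial G)) (fun os => (e1 os)%:R) del.
  apply: (@UB_event _ _ _ is_hit (1 - z) 3); last by lra.
  - apply: UB_le (UB_hit (fun c : bool => c%:R) bG) (fun=> lexx _) _.
    by rewrite -/z mulr0 mulr1 add0r.
  - by lra.
  - by move=> hz; exists (1 / 2) => //; lra.
have u2 : UB P Q (reps (16 * R0) (trial G)) (fun os => (e2 os)%:R) del.
  apply: (@UB_event _ _ _ (fun o => ~~ is_hit o) z 2); last by lra.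
  - apply: UB_le (UB_hit (fun c : bool => (~~ c)%:R) bG) (fun=> lexx _) _.
    by rewrite -/z /= mulr0 mulr1 addr0.
  - by lra.
  - by rewrite /pgood -ltNge -/z => hz; exists (1 / 8) => //; exact: ltW.
have u3 : UB P Q (reps (16 * R0) (trial G)) (fun os => (e3 os)%:R) del.
  apply: (@UB_event _ _ _ is_rej rho 2); last by lra.
  - apply: (@UB_trial_sample _ (fun o => (~~ isSome o)%:R)).
    by apply: UB_le hrej _ (lexx _) => s; case: (acc _ _ _).
  - exact: rejection_ge0.
  - by move=> hz; exists (1 / 8) => //; exact: ltW.
have u4 : UB P Q (reps (16 * R0) (trial G)) (fun os => (e4 os)%:R) del.
  apply: (@UB_event _ _ _ (is_bad G) (1 / 8) 2); last by lra.
  - apply: (@UB_trial_sample G (fun o => (bad_hyp G o)%:R)).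
    by apply: UB_le (sound bG) _ (lexx _) => s; case: (acc _ _ _).
  - by lra.
  - by move=> _; exists (1 / 8).
pose E0 := (1 - kappa) ^+ t.+1 * energy G + (4 * t)%:R * del.
have E00 : 0 <= E0.
  rewrite /E0; apply: addr_ge0; apply: mulr_ge0 => //.
    by rewrite exprn_ge0 ?kappa01.
  exact: expR_ge0.
have hu := UB_add (UB_cst P Q _ E0) (UB_add (UB_add u1 u2) (UB_add u3 u4)).
rewrite -[learn t.+1 G]/(bind _ _).
apply: (UB_bind_out (outcomes_repsF _ (outcomes_trial G)) (UB_le hu (fun=> lexx _) _)).
  by rewrite /E0 -addrA lerD2l mulnS natrD; lra.
move=> os [sos mos].
case he : [|| e1 os, e2 os, e3 os | e4 os].
  apply: (UB_le (UB_cst P Q _ 1)) => [hg|]; first by case/andP: (fail01 hg).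
  have : 1 <= (e1 os)%:R + (e2 os)%:R + ((e3 os)%:R + (e4 os)%:R) :> R.
    by rewrite -!natrD ler1n; move: he; case: (e1 os); case: (e2 os); case: (e3 os);
      case: (e4 os).
  by lra.
suff hE0 : UB P Q (if (12 * R0 <= count is_hit os)%N then learn t (fun x => G x - 1)
    else if (4 * R0 <= count is_rej os)%N then
      D <-- psi n1 n2 r acc G l k b ;; learn t (fun x => G x + D x)
    else Ret (majority (pmap snd os), fun x => G x <= 0)) fail E0.
  apply: UB_le hE0 (fun=> lexx _) _; rewrite lerDl.
  by rewrite !addr_ge0 // ler0n.
move/negbT: he; rewrite !negb_or => /and4P[n1e n2e n3e n4e].
case: ifP => h12.
  move: n1e; rewrite /e1 h12 andbT -ltNge => hz.
  have [bG' hE'] := hit_step bG hz.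
  apply: UB_le (IH _ bG') (fun=> lexx _) _; rewrite lerD2r exprSr -mulrA.
  by apply: ler_wpM2l; [rewrite exprn_ge0 ?kappa01|rewrite mulrC].
have hnh : (4 * R0 <= count (fun o => ~~ is_hit o) os)%N.
  have := count_predC is_hit os; rewrite sos.
  rewrite (eq_count (a1 := predC is_hit) (a2 := fun o => ~~ is_hit o)) //.
  by move/negbT: h12; rewrite -ltnNge; clear; lia.
have pg : pgood G by move: n2e; rewrite /e2 hnh andbT negbK.
case: ifP => h4.
  apply: psi_step => //; last first.
    exists P', Q'; split => //.
    by move: n3e; rewrite /e3 h4 andbT -leNgt.
  move=> D bD D1; apply: IH.
  by under eq_fun do rewrite rmorphD /=; exact: bmD.
have hs := count_pmap os; rewrite sos in hs.
rewrite /= stop_good //.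
- move=> g hg; have [oc ho hgo] : exists2 o, List.In o os & o.2 = Some g.
    elim: (os) hg => //= -[a [g'|]] os' IHo /=; last first.
      by move=> /IHo[oc ho ?]; exists oc => //; right.
    move=> [<-|/IHo[oc ho ?]]; last by exists oc => //; right.
    by exists (a, Some g') => //; left.
  exact: (mos _ ho).
- by move/negbT: h4; rewrite -ltnNge; move: hs; clear; lia.
- by move: hs; clear; lia.
- by rewrite count_is_bad; move: n4e; rewrite /e4 /= -ltnNge.
Qed.

End Loop.

Lemma EI_marg {R : realType} {d} {X : measurableType d}
    (Q : probability (X * bool)%type R) n (h : seq X -> R) : jm n h ->
  EI (marg Q) n h = EI Q n (fun V => h (map fst V)).
Proof.
elim: n h => [|n IH] h jh //=; rewrite Ex_marg; last exact: bm_EI.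
by apply: eq_Ex => y /=; apply: (IH (fun U => h (y.1 :: U))); exact: jm_cons.
Qed.

Lemma iid_E_samples {R : realType} {d} {X : measurableType d}
    (P Q : probability (X * bool)%type R) n1 n2 r
    (f : seq (X * bool) -> seq X -> seq bool -> R) :
  (forall w, size w = r ->
     jm (n1 + n2) (fun s => f (take n1 s) (map fst (drop n1 s)) w)) ->
  (forall S U w, 0 <= f S U w) ->
  iid_E P n1 (fun S => iid_E (marginal Q) n2 (fun U =>
    iid_E (@fair_coin R) r (fun w => (f S U w)%:E))) =
  (EI P n1 (fun S => EI Q n2 (fun V => EC r (f S (map fst V)))))%:E.
Proof.
move=> jf f0.
pose g S := EI (marg Q) n2 (fun U => EC r (f S U)).
have jS S : size S = n1 -> jm n2 (fun U => EC r (f S U)).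
  move=> sS; apply: fst_jm.
  apply: jm_ext (jm_prefix sS (jm_EC jf)) => V _ /=.
  by rewrite take_size_cat // drop_size_cat.
have gE S : size S = n1 -> g S = EI Q n2 (fun V => EC r (f S (map fst V))).
  by move=> sS; rewrite /g EI_marg //; exact: jS.
have EC0 S U : 0 <= EC r (f S U) by apply: EC_ge0 => w; exact: f0.
have EI0 d' (Z : measurableType d') (mu : probability Z R) n h :
    (forall s, 0 <= h s) -> 0 <= EI mu n h.
  by elim: n h => [|n IHn] h h0 //=; apply: Ex_ge0 => y; exact: IHn.
transitivity (iid_E P n1 (fun S => (g S)%:E)).
  apply: eq_iid_E => S sS.
  rewrite -[RHS](iid_E_EI (marg Q) (jS S sS) (EC0 S)).
  by apply: eq_iid_E => U _; apply: iid_E_coin => w; exact: f0.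
rewrite iid_E_EI.
- by congr EFin; exact: eq_EI.
- have := jm_EI Q (jm_EC jf); apply: jm_ext => S sS; rewrite gE //.
  apply: eq_EI => V _; by rewrite take_size_cat // drop_size_cat.
- by move=> S; exact: EI0.
Qed.

(** * Consequences of the TDS guarantee on reweighted samples *)

Section Tds.
Context {R : realType} {d : measure_display} {X : measurableType d}
  (feat : nat -> X -> R).
Notation Y := (X * bool)%type.
Hypothesis mfeat : forall i, measurable_fun setT (feat i).
Variables (C : set (X -> bool)) (L : learner) (A eps V : R) (n1 n2 r : nat).
Hypothesis A1 : 1 <= A.
Hypothesis eps0 : 0 < eps.
Hypothesis mC : forall f, C f -> measurable_fun setT f.

(** Acceptance and hypothesis are extracted as total functions of the lists; determinism makes the
    existential refer to the only possible result. *)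
Definition acc (S : seq Y) (U : seq X) (w : seq bool) : bool :=
  `[< exists k u, fits feat L (VNum eps) S U w (VInr u) k >].

Definition hyp (S : seq Y) (U : seq X) (w : seq bool) (x : X) : bool :=
  `[< exists k u, fits feat L (VNum eps) S U w (VInr u) k /\ answers feat u x >].

Hypothesis runs : forall S U w, size S = n1 -> size U = n2 -> size w = r ->
  exists v k o, fits feat L (VNum eps) S U w v k /\ tds_output feat V v o.

Lemma jm_bool n (F : seq Y -> bool) :
  (forall d' (O : measurableType d') (a : seq (O -> Y)), size a = n ->
    (forall g, List.In g a -> measurable_fun setT g) ->
    measurable [set w | F [seq g w | g <- a]]) ->
  jm n (fun s => (F s)%:R : R).
Proof.
move=> hF; split; last by exists 1 => s _; case: (F s); rewrite ?normr1 ?normr0.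
by move=> d' O a sa ma; have [] := @bm_indic R _ O _ (hF _ O a sa ma).
Qed.

Lemma map_params d' (O : measurableType d') (a : seq (O -> Y)) :
  (forall g, List.In g a -> measurable_fun setT g) ->
  [/\ forall g, List.In g (take n1 a) -> measurable_fun setT g,
      forall g, List.In g [seq fst \o g | g <- drop n1 a] -> measurable_fun setT g &
      forall w, take n1 [seq g w | g <- a] = [seq g w | g <- take n1 a] /\
      map fst (drop n1 [seq g w | g <- a]) =
      [seq g w | g <- [seq fst \o g | g <- drop n1 a]]].
Proof.
move=> ma; split.
- by move=> g hg; apply: ma; apply: (@In_take_drop _ n1); left.
- have : forall g, List.In g (drop n1 a) -> measurable_fun setT g.
    by move=> g hg; apply: ma; apply: (@In_take_drop _ n1); right.
  elim: (drop n1 a) => //= g s IH h f [<-|]; last first.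
    by apply: IH => k hk; apply: h; right.
  by apply: measurableT_comp; [exact: measurable_fst|apply: h; left].
- by move=> w; rewrite map_take -map_drop -!map_comp.
Qed.

Lemma jm_acc w : jm (n1 + n2)
  (fun s : seq Y => (acc (take n1 s) (map fst (drop n1 s)) w)%:R : R).
Proof.
apply: (jm_bool (F := fun s => acc (take n1 s) (map fst (drop n1 s)) w)).
move=> d' O a sa ma; have [m1 m2 e] := map_params ma.
have := @measurable_fits _ _ _ feat mfeat L _ O _ _ w (VNum eps)
  (fun _ v => exists u, v = VInr u) m1 m2 _.
rewrite (_ : [set o | _] = [set o | acc (take n1 [seq g o | g <- a])
    (map fst (drop n1 [seq g o | g <- a])) w]).
  apply => v _; have [[u ->]|hv] := pselect (exists u, v = VInr u).
    rewrite (_ : [set o | _] = setT) //; apply/seteqP; split => // o _ /=.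
    by exists (inst o u).
  rewrite (_ : [set o | _] = set0) //; apply/seteqP; split => // o /= [u].
  by case: v hv => //= v hv _; apply: hv; exists v.
apply/seteqP; split => o /=; have [-> ->] := e o.
  by move=> [k [v [hf [u vE]]]]; apply/asboolP; exists k, u; rewrite -vE.
by move=> /asboolP[k [u hf]]; exists k, (VInr u); split => //; exists u.
Qed.

Lemma acc_spec S U w : size S = n1 -> size U = n2 -> size w = r ->
  (acc S U w = false /\ exists k, fits feat L (VNum eps) S U w (VInl VUnit) k) \/
  (acc S U w /\ exists u k, fits feat L (VNum eps) S U w (VInr u) k /\
     denotes feat V u (hyp S U w)).
Proof.
move=> sS sU sw; have [v [k [ [h|] [hf]]]] := runs sS sU sw; last first.
  move=> /= vE; subst v; left; split; last by exists k.
  by apply/negbTE/asboolP => -[k' [u hf']]; have [] := eval_det hf hf'.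
move=> [u vE hu]; subst v; right; split; first by apply/asboolP; exists k, u.
exists u, k; split => // x.
have -> : hyp S U w x = h x; last exact: hu.
apply/asboolP/idP => [[k' [u' [hf' ha]]]|hx].
  have [[uE] _] := eval_det hf hf'; subst u'.
  exact/(answers_denotes hu).
by exists k, u; split => //; exact/(answers_denotes hu).
Qed.

Lemma hyp_measurable S U w : size S = n1 -> size U = n2 -> size w = r ->
  acc S U w -> measurable [set x | hyp S U w x].
Proof.
move=> sS sU sw ha; have [[]|[_ [u [k [_ hu]]]]] := acc_spec sS sU sw.
  by rewrite ha.
exact (denotes_measurable mfeat hu).
Qed.

Hypothesis guarantee : forall Pt Qt : probability Y R,
  ((1 - 100^-1)%:E <= iid_E Pt n1 (fun S => iid_E (marginal Qt) n2 (fun U =>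
     iid_E (@fair_coin R) r (fun w => (`[< exists v k o,
       [/\ fits feat L (VNum eps) S U w v k, tds_output feat V v o &
        (forall h, o = Some h ->
           (risk Qt h <= A%:E * lambda C Pt Qt + eps%:E)%E) /\
        ((forall B, measurable B -> marginal Pt B = marginal Qt B) -> o <> None)] >]
         : nat)%:R%:E))))%E.

(** With equal marginals completeness applies, so the success event is contained in acceptance.
    Acceptance is measurable, which allows the passage from its lower integral to the complement. *)
Lemma rejection_same (P' : probability Y R) :
  rejection n1 n2 r acc P' P' <= 1 / 100.
Proof.
have := guarantee P' P' => hg.
have hacc : ((1 - 100^-1)%:E <= iid_E P' n1 (fun S => iid_E (marginal P') n2
    (fun U => iid_E (@fair_coin R) r (fun w => ((acc S U w)%:R : R)%:E))))%E.
  apply: le_trans hg _.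
  apply: iid_E_le => S; first apply: (@iid_E_ge0 _ _ _ (marg P')) => U.
    rewrite iid_E_coin => [|w]; last exact: ler0n.
    by rewrite lee_fin EC_ge0.
  apply: (@iid_E_le _ _ _ (marg P')) => U.
    rewrite iid_E_coin => [|w]; last exact: ler0n.
    by rewrite lee_fin EC_ge0.
  rewrite !iid_E_coin; [|by move=> w; exact: ler0n..].
  rewrite lee_fin; apply: EC_le => w _; rewrite ler_nat.
  case: asboolP => // -[v [k [[h|] [hf ho [_ hN]]]]]; last by case: hN.
  case: ho => u vE _; subst v.
  by rewrite (_ : acc S U w) //; apply/asboolP; exists k, u.
move: hacc; rewrite (iid_E_samples _ _ (f := fun S U w => (acc S U w)%:R)) //;
  last by move=> w _; exact: jm_acc.
rewrite lee_fin => hh.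
have -> : rejection n1 n2 r acc P' P' =
  EI P' n1 (fun S => EI P' n2 (fun W =>
    EC r (fun w => 1 + (-1) * (acc S (map fst W) w)%:R))).
  by apply: eq_EI => S _; apply: eq_EI => W _; apply: eq_EC => w _;
    case: acc => /=; lra.
have jl : jm (n1 + n2) (fun s => EC r (fun w => (acc (take n1 s) (map fst (drop n1 s)) w)%:R) : R).
  by apply: (jm_EC (f := fun s w => (acc (take n1 s) (map fst (drop n1 s)) w)%:R)) => w _;
    exact: jm_acc.
rewrite (_ : EI P' n1 _ = 1 + (-1) * EI P' n1 (fun S => EI P' n2 (fun W =>
    EC r (fun w => (acc S (map fst W) w)%:R))) + 0 * 0); first by lra.
have j1 : jm n1 (fun S => EI P' n2 (fun W => EC r (fun w => (acc S (map fst W) w)%:R)) : R).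
  have := jm_EI P' jl; apply: jm_ext => S sS; apply: eq_EI => W _.
  by rewrite take_size_cat // drop_size_cat.
rewrite -[0 in X in _ + _ * X](EI_cst P' n1 0) -EI_affine //; last exact: jm_cst.
apply: eq_EI => S sS.
have j2 : jm n2 (fun W : seq Y => EC r (fun w => (acc S (map fst W) w)%:R) : R).
  apply: jm_ext (jm_prefix sS jl) => W _ /=.
  by rewrite take_size_cat // drop_size_cat.
rewrite -[0 in X in _ + _ * X](EI_cst P' n2 0) -EI_affine //; last exact: jm_cst.
by apply: eq_EI => W _; rewrite (ECD r (fun=> 1)) EC_cst ECZ mul0r addr0.
Qed.

Section Sound.
Variables (P Q : probability Y R) (G : X -> int) (l k : nat).
Hypothesis bG : bm (fun x => (G x)%:~R : R).
Notation B := (k.+1%:R : R).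
Notation vv := (@v R d X G l).

(** When [lambda] is not finite, which for measurable concepts means that [C] is empty, the final
    error bound is infinite, and 1 bounds every error. *)
Definition target : R :=
  if lambda C P Q \is a fin_num then A * (B + 2) * fine (lambda C P Q) + eps else 1.

Lemma lambda_ge0 (P1 Q1 : probability Y R) : (0 <= lambda C P1 Q1)%E.
Proof.
by apply: le_ereal_inf_tmp => _ [f _ <-]; apply: adde_ge0; exact: measure_ge0.
Qed.

Lemma target_ge0 : 0 <= target.
Proof.
rewrite /target; case: ifP => // _; apply: addr_ge0; last exact: ltW.
apply: mulr_ge0; last exact: fine_ge0 (lambda_ge0 P Q).
by apply: mulr_ge0; [move: A1; lra|exact: addr_ge0].
Qed.

Lemma riskE (mu : probability Y R) (f : X -> bool) : measurable [set x | f x] ->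
  risk mu f = (Ex mu (fun y => (f y.1 != y.2)%:R))%:E.
Proof.
move=> mf; apply: Ex_indic.
have [m1 _] := @bm_err R d X f mf.
rewrite (_ : [set y | _] = [set y : Y | ((1 : R) <= (f y.1 != y.2)%:R) = true]).
  by apply: measurable_le_fun => //; exact: measurable_cst.
by apply/seteqP; split => y /=; case: (_ != _) => //=; rewrite ?lexx // ler10.
Qed.

(** The errors of one concept under the new laws add up to at most [B + 2] times its error under [P]
    plus its error under [Q]. The infimum is then taken over all concepts. *)
Lemma lambda_mixed (P' Q' : probability Y R) : lambda C P Q \is a fin_num ->
  (forall e, bm e -> (forall y, 0 <= e y) -> Ex P' e <= (B + 1) * Ex P e) ->
  (forall e, bm e -> (forall y, 0 <= e y) -> Ex Q' e <= Ex Q e + Ex P e) ->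
  lambda C P' Q' \is a fin_num /\
  fine (lambda C P' Q') <= (B + 2) * fine (lambda C P Q).
Proof.
move=> hfin hP' hQ'.
have B0 : 0 <= B by [].
have mf f : C f -> measurable [set x | f x].
  by move=> /mC /(_ measurableT [set true] I); rewrite setTI.
have key f : C f -> (lambda C P' Q' <=
    ((B + 2) * (Ex P (fun y => (f y.1 != y.2)%:R) + Ex Q (fun y => (f y.1 != y.2)%:R)))%:E)%E.
  move=> Cf; apply: (@le_trans _ _ (risk P' f + risk Q' f)%E).
    by apply: ereal_inf_lbound; exists f.
  rewrite (riskE P' (mf f Cf)) (riskE Q' (mf f Cf)) -EFinD lee_fin.
  have be := @bm_err R d X f (mf f Cf).
  have e0 : forall y : Y, 0 <= (f y.1 != y.2)%:R :> R by [].
  have := hP' _ be e0; have := hQ' _ be e0.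
  have := Ex_ge0 P e0; have := Ex_ge0 Q e0.
  by move: (Ex P _) (Ex Q _) => z w; nra.
have [f Cf] : exists f, C f.
  apply/not_existsP => hN; move: hfin; rewrite /lambda (_ : [set _ | f in C] = set0).
    by rewrite ereal_inf0.
  by apply/seteqP; split => // y [f /hN].
have fin' : lambda C P' Q' \is a fin_num.
  rewrite ge0_fin_numE ?lambda_ge0 //.
  by apply: le_lt_trans (key f Cf) _; exact: ltry.
split => //.
have B2 : 0 < B + 2 by move: B0; lra.
rewrite mulrC -ler_pdivrMr // -lee_fin fineK //.
apply: le_ereal_inf_tmp => _ [g Cg <-].
rewrite (riskE P (mf g Cg)) (riskE Q (mf g Cg)) -EFinD lee_fin ler_pdivrMr //.
rewrite mulrC -lee_fin fineK //.
exact: key.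
Qed.

(** [Q'] dominates [keep * (1 - v) * Q], so a low risk under [Q'] implies [okh]. The failure
    probability 1/100 and the slack 1/10, paid because the success event may be nonmeasurable, stay
    below 1/8 together. *)
Lemma sound_sample : UB P Q (sample n1 n2 r (selP G l k.+1) (drawQ G l k))
  (fun s => (acc s.1.1 s.1.2 s.2 &&
     ~~ okh k l P Q target G (hyp s.1.1 s.1.2 s.2))%:R) (1 / 8).
Proof.
have [P' [hP' P'E]] := trainE P Q l k bG.
have [Q' [hQ' Q'E]] := testE P Q l k bG.
have /andP[a0 a1] := keep01 P l k bG; set a := keep P G l k in a0 a1 P'E Q'E.
have /andP[p0 p1] := pbar01 P l bG; have /andP[q0 q1] := qbar01 Q l bG.
have v01 y := @v01 R d X G l y.
have bv : bm (fun y : Y => vv y.1) := bm_v1 l bG.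
have b1v : bm (fun y : Y => 1 - vv y.1) by apply: bmB => //; exact: bm_cst.
have B0 : 0 <= B by [].
have leP e : bm e -> (forall y, 0 <= e y) -> Ex P' e <= (B + 1) * Ex P e.
  move=> be e0; rewrite P'E //; have eP := Ex_ge0 P e0.
  have : Ex P (fun y => vv y.1 * e y) <= Ex P e.
    apply: Ex_le => //; first exact: bmM.
    by move=> y; rewrite ler_piMl //; case/andP: (v01 y.1).
  have : 0 <= Ex P (fun y => vv y.1 * e y).
    by apply: Ex_ge0 => y; rewrite mulr_ge0 //; case/andP: (v01 y.1).
  have aB : 0 <= a * B <= B by rewrite mulr_ge0 //= ler_piMl.
  have : 0 <= a * B * pbar P G l by rewrite !mulr_ge0.
  move: eP aB; move: (a * B) (Ex P e) (Ex P _) => aB z w z0 /andP[aB0 aB1] h1 h2 h3.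
  have := ler_pM aB0 h2 aB1 h3.
  by have := mulr_ge0 h1 z0; lra.
have geQ e : bm e -> (forall y, 0 <= e y) ->
    a * Ex Q (fun y => (1 - vv y.1) * e y) <= Ex Q' e.
  move=> be e0; rewrite Q'E // lerDl mulr_ge0 ?Ex_ge0 // subr_ge0.
  by rewrite mulr_ile1.
have leQ e : bm e -> (forall y, 0 <= e y) -> Ex Q' e <= Ex Q e + Ex P e.
  move=> be e0; rewrite Q'E //; have eP := Ex_ge0 P e0; apply: lerD.
    apply: (@le_trans _ _ (1 * Ex Q (fun y => (1 - vv y.1) * e y))).
      apply: ler_wpM2r => //; apply: Ex_ge0 => y.
      by rewrite mulr_ge0 // subr_ge0; case/andP: (v01 y.1).
    rewrite mul1r; apply: Ex_le => //; first exact: bmM.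
    by move=> y; rewrite ler_piMl // lerBlDr lerDl; case/andP: (v01 y.1).
  by rewrite ler_piMl // lerBlDr lerDl mulr_ge0.
have hu := UB_sample_lower hP' hQ' (f := fun S U w => (`[< exists v k o,
       [/\ fits feat L (VNum eps) S U w v k, tds_output feat V v o &
        (forall h, o = Some h ->
           (risk Q' h <= A%:E * lambda C P' Q' + eps%:E)%E) /\
        ((forall B, measurable B -> marginal P' B = marginal Q' B) -> o <> None)] >]
         : nat)%:R) _ (guarantee P' Q') (e := 1 / 10).
apply: UB_le (hu _ _) _ _; [by move=> S U w; case: asbool; rewrite /= ?ler01 lexx|by lra| |by lra].
move=> [[S U] w] /=; case: asboolP => [hex|_]; last first.
  by rewrite subr0 lern1; case: (_ && _).
rewrite subrr; case: (boolP (acc S U w)) => //= /asboolP[k1 [u hf]].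
case: (boolP (okh _ _ _ _ _ _ _)) => //= /negP; case.
have [v [k2 [h [hf2 ho [hrisk _]]]]] := hex.
have [vE _] := eval_det hf hf2; subst v.
case: h ho hrisk => [h [u' [uE] hd] /(_ _ erefl) hrisk|//]; subst u'.
have mh : measurable [set x | h x] by exact: denotes_measurable hd.
have -> : hyp S U w = h.
  apply/funext => x; apply/asboolP/idP => [[k' [u' [hf' ha]]]|hx].
    have [[uE] _] := eval_det hf hf'; subst u'.
    exact/(answers_denotes hd).
  by exists k1, u; split => //; exact/(answers_denotes hd).
have be := @bm_err R d X h mh; have e0 (y : Y) : 0 <= (h y.1 != y.2)%:R :> R by [].
rewrite /okh -/a /target; case: ifP => hfin; last first.
  rewrite -[leRHS]mulr1; apply: ler_pM => //.
    by apply: Ex_ge0 => y; rewrite mulr_ge0 // subr_ge0; case/andP: (v01 y.1).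
  rewrite -[leRHS](Ex_cst Q 1); apply: Ex_le => //; [exact: bmM|exact: bm_cst|].
  move=> y; rewrite mulr_ile1 ?subr_ge0 ?lern1 ?leq_b1 //; try by case/andP: (v01 y.1).
  by rewrite lerBlDr lerDl; case/andP: (v01 y.1).
have [hfin' hle] := lambda_mixed hfin leP leQ.
apply: (le_trans (geQ _ be e0)).
move: hrisk; rewrite riskE // -(fineK hfin') -EFinM -EFinD lee_fin => /le_trans; apply.
by rewrite lerD2r -mulrA ler_wpM2l //; move: A1; lra.
Qed.
End Sound.
End Tds.

(** * Numbers of draws *)

Section Uses.
Context {R : realType} {d : measure_display} {X : measurableType d}.
Notation Y := (X * bool)%type.
Variables (n1 n2 r : nat).
Variable acc : seq Y -> seq X -> seq bool -> bool.
Variable hyp : seq Y -> seq X -> seq bool -> X -> bool.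
Variables (b kt k l R0 : nat).
Implicit Type G : X -> int.

Lemma uses_thr s j : uses (thr s j : prog X nat) 0 0 s.
Proof. by elim: s j => //= s IH j; split => // c; exact: IH. Qed.

Lemma uses_bit (g : int) : uses (bit l g : prog X bool) 0 0 l.+1.
Proof.
rewrite -[l.+1]addn0; apply: (@uses_bind _ _ _ _ _ 0 0 _ 0 0 0) => //.
exact: uses_thr.
Qed.

Lemma uses_none G s : uses (none G l s) s 0 (s * l.+1).
Proof.
elim: s => //= s IH; split=> // y; rewrite mulSn.
apply: (@uses_bind _ _ _ _ _ 0 0 _ s 0) (uses_bit _) _ => -[] //.
Qed.

Lemma uses_selP G s : uses (selP G l s) s.+1 0 (s * l.+1).
Proof.
elim: s => [|s IH]; first by split.
rewrite /= -/(selP G l s); split => // y; rewrite mulSn.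
apply: (@uses_bind _ _ _ _ _ 0 0 _ s.+1 0) (uses_bit _) _ => -[] //.
rewrite -addn1 -[(s * _)%N]addn0.
by apply: (@uses_bind _ _ _ _ _ s 0 _ 1 0 0) (uses_none _ _) _ => -[] /=.
Qed.

Lemma uses_drawQ G : uses (drawQ G l k) k.+1 1 (k.+1 * l.+1).
Proof.
split => // u; rewrite mulSn.
apply: (@uses_bind _ _ _ _ _ 0 0 _ k.+1 0) (uses_bit _) _ => -[]; last by split.
rewrite -addn1 -[(k * _)%N]addn0.
by apply: (@uses_bind _ _ _ _ _ k 0 _ 1 0 0) (uses_none _ _) _ => -[] /=.
Qed.

Lemma uses_coins n : uses (reps n (Coin (fun c => Ret c)) : prog X (seq bool)) 0 0 n.
Proof.
have h : uses (Coin (fun c => Ret c) : prog X bool) 0 0 1 by [].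
by have := uses_reps n h; rewrite muln0 muln1.
Qed.

(** Enough training points and enough test points for one trial, and also for one call of [psi]. *)
Definition block := (kt + (n1 + n2) * k.+2)%N.

Lemma uses_sample G : uses (sample n1 n2 r (selP G l k.+1) (drawQ G l k))
  ((n1 + n2) * k.+2) n2 ((n1 + n2) * k.+2 * l.+1 + r).
Proof.
apply: (@uses_le _ _ _ (n1 * k.+2 + (n2 * k.+1 + (0 + 0)))
  (n1 * 0 + (n2 * 1 + (0 + 0))) (n1 * (k.+1 * l.+1) + (n2 * (k.+1 * l.+1) + (r + 0)))).
- apply: uses_bind (uses_reps _ (uses_selP _ _)) _ => S.
  apply: uses_bind (uses_reps _ (uses_drawQ _)) _ => U.
  by apply: uses_bind (uses_coins _) _ => w.
- by nia.
- by lia.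
- by nia.
Qed.

Hypothesis kt_gt0 : (0 < kt)%N.
Hypothesis b_le : (b <= l)%N.

Lemma uses_trial G : uses (trial n1 n2 r acc hyp kt k l G)
  block block (block * l.+1 + r).
Proof.
apply: (@uses_le _ _ _ (kt + ((n1 + n2) * k.+2 + 0)) (0 + (n2 + 0))
  (kt * l.+1 + ((n1 + n2) * k.+2 * l.+1 + r + 0))).
- apply: uses_bind (uses_none _ _) _ => nn.
  by apply: uses_bind (uses_sample _) _ => s.
- by rewrite /block; lia.
- by rewrite /block; nia.
- by rewrite /block; nia.
Qed.

Lemma uses_psi G : uses (psi n1 n2 r acc G l k b) block block (block * l.+1 + r).
Proof.
apply: (@uses_le _ _ _ (0 + ((n1 + n2) * k.+2 + 1)) (0 + n2)
  (b + ((n1 + n2) * k.+2 * l.+1 + r))).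
- apply: uses_bind (uses_thr _ _) _ => i; case: ifP => // hi.
  apply: (@uses_le _ _ _ (n1 * k.+2 + (i * k.+1 + ((n2 - i.+1) * k.+2 + (0 + 1))))
   (n1 * 0 + (i * 1 + ((n2 - i.+1) * 0 + (0 + 0))))
   (n1 * (k.+1 * l.+1) + (i * (k.+1 * l.+1) + ((n2 - i.+1) * (k.+1 * l.+1) + (r + 0))))).
  + apply: uses_bind (uses_reps _ (uses_selP _ _)) _ => S.
    apply: uses_bind (uses_reps _ (uses_drawQ _)) _ => U.
    apply: uses_bind (uses_reps _ (uses_selP _ _)) _ => V.
    by apply: uses_bind (uses_coins _) _ => w.
  + by nia.
  + by lia.
  + by nia.
- by rewrite /block; lia.
- by rewrite /block; nia.
- by rewrite /block; nia.
Qed.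

Lemma uses_learn t G : uses (learn n1 n2 r acc hyp b kt k l R0 t G)
  (t * (16 * R0).+1 * block) (t * (16 * R0).+1 * block)
  (t * (16 * R0).+1 * (block * l.+1 + r)).
Proof.
elim: t G => [|t IH] G //.
have sz x : (t.+1 * (16 * R0).+1 * x =
    16 * R0 * x + (x + t * (16 * R0).+1 * x))%N by ring.
rewrite !sz; apply: uses_bind (uses_reps _ (uses_trial G)) _ => os.
case: ifP => _; first by apply: uses_le (IH _) _ _ _; lia.
case: ifP => _ //; apply: uses_bind (uses_psi G) _ => D; exact: IH.
Qed.

End Uses.

Lemma run_reps_size {X A} n (p : prog X A) st s st' :
  run (reps n p) st = Some (s, st') -> size s = n.
Proof.
elim: n st s st' => [|n IH] st s st' /=; first by case=> <-.
rewrite run_bind; case: (run p st) => [[a st1]|//].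
rewrite run_bind; case hr : (run (reps n p) st1) => [[s1 st2]|//] /= [<- _] /=.
by rewrite (IH _ _ _ hr).
Qed.

(** * Writing programs *)

(* A [tm] is a term with named variables: variables are de Bruijn levels and the
   argument is the number of variables in scope. *)
Definition tm := nat -> term.

Definition lv i : tm := fun d => TVar (d - i.+1).
Definition rec_ (F : tm -> tm -> tm) : tm := fun d => TFun (F (lv d) (lv d.+1) d.+2).
Definition lam (F : tm -> tm) : tm := rec_ (fun _ x => F x).
Definition app_ (t u : tm) : tm := fun d => TApp (t d) (u d).
Definition unit_ : tm := fun=> TUnit.
Definition pair_ (t u : tm) : tm := fun d => TPair (t d) (u d).
Definition fst_ (t : tm) : tm := fun d => TFst (t d).
Definition snd_ (t : tm) : tm := fun d => TSnd (t d).
Definition inl_ (t : tm) : tm := fun d => TInl (t d).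
Definition inr_ (t : tm) : tm := fun d => TInr (t d).
Definition case_ (t : tm) (F G : tm -> tm) : tm :=
  fun d => TCase (t d) (F (lv d) d.+1) (G (lv d) d.+1).
Definition num_ (n : nat) : tm := fun=> TNat n.
Definition add_ (t u : tm) : tm := fun d => TAdd (t d) (u d).
Definition sub_ (t u : tm) : tm := fun d => TSub (t d) (u d).
Definition mul_ (t u : tm) : tm := fun d => TMul (t d) (u d).
Definition div_ (t u : tm) : tm := fun d => TDiv (t d) (u d).
Definition le_ (t u : tm) : tm := fun d => TLe (t d) (u d).
Definition let_ (t : tm) (F : tm -> tm) : tm := case_ (inl_ t) F (fun=> unit_).
Definition if_ (t a b : tm) : tm := case_ t (fun=> b) (fun=> a).
Definition nil_ : tm := inl_ unit_.
Definition cons_ (t u : tm) : tm := inr_ (pair_ t u).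

(* A [cm] is a program in state-passing style: it maps the remaining inputs to
   its result together with the inputs that it leaves. *)
Definition cm := tm -> tm.

Definition cret (t : tm) : cm := fun s => pair_ t s.
Definition cbind (m : cm) (f : tm -> cm) : cm := fun s =>
  let_ (m s) (fun r => let_ (fst_ r) (fun x => let_ (snd_ r) (fun s' => f x s'))).
Definition cif (t : tm) (a b : cm) : cm := fun s => if_ t (a s) (b s).
Definition cdrawS : cm := fun s => case_ (fst_ s) (fun=> unit_)
  (fun z => pair_ (fst_ z) (pair_ (snd_ z) (snd_ s))).
Definition cdrawU : cm := fun s => case_ (fst_ (snd_ s)) (fun=> unit_)
  (fun z => pair_ (fst_ z) (pair_ (fst_ s) (pair_ (snd_ z) (snd_ (snd_ s))))).
Definition ccoin : cm := fun s => case_ (snd_ (snd_ s)) (fun=> unit_)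
  (fun z => pair_ (fst_ z) (pair_ (fst_ s) (pair_ (fst_ (snd_ s)) (snd_ z)))).
Definition cfix (F : (tm -> cm) -> tm -> cm) (t : tm) : cm := fun s =>
  app_ (rec_ (fun self a => let_ (fst_ a) (fun x => let_ (snd_ a) (fun s0 =>
    F (fun u s' => app_ self (pair_ u s')) x s0)))) (pair_ t s).
Definition creps (m : cm) (t : tm) : cm := cfix (fun self n =>
  cif (le_ n (num_ 0)) (cret nil_)
    (cbind m (fun a => cbind (self (sub_ n (num_ 1))) (fun s => cret (cons_ a s))))) t.

(** * Rules for the values and costs of terms *)

Section Rules.
Context {R : realType} {d : measure_display} {X : measurableType d}
  (feat : nat -> X -> R).
Notation Y := (X * bool)%type.
Notation value := (value R X).
Notation ev := (ev feat).
Notation vapp := (vapp feat).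

Definition look (e : seq value) i := if (i < size e)%N then onth e (size e - i.+1) else None.

Definition below (e e1 : seq value) := exists e', e1 = e' ++ e.

Lemma below_refl e : below e e. Proof. by exists [::]. Qed.
Lemma below_cons e e1 v : below e e1 -> below e (v :: e1).
Proof. by move=> [e' ->]; exists (v :: e'). Qed.
Lemma below_trans e1 e e2 : below e e1 -> below e1 e2 -> below e e2.
Proof. by move=> [a ->] [b ->]; exists (b ++ a); rewrite catA. Qed.

Lemma look_mono e e1 i v : below e e1 -> look e i = Some v -> look e1 i = Some v.
Proof.
move=> [e' ->]; rewrite /look; case: ltnP => // hi; rewrite size_cat.
rewrite (leq_trans hi) ?leq_addl //.
elim: e' => // x e' IH h.
have hs : (i < size e' + size e)%N by apply: (leq_trans hi); rewrite leq_addl.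
by rewrite /= addSn subSn //= (IH h).
Qed.

Lemma look_here v e : look (v :: e) (size e) = Some v.
Proof. by rewrite /look /= ltnSn subSS subnn. Qed.

(* [t] evaluates to a value satisfying [Q] wherever [e] is in scope *)
Definition E e (t : tm) (Q : value -> Prop) K :=
  forall e1, below e e1 -> exists2 v, Q v & ev e1 (t (size e1)) v K.

Lemma E_mono e e1 t Q K : below e e1 -> E e t Q K -> E e1 t Q K.
Proof. by move=> h hE e2 h2; apply: hE; exact: below_trans h2. Qed.

Lemma E_weak e t Q Q' k K : E e t Q k -> (forall v, Q v -> Q' v) -> (k <= K)%N ->
  E e t Q' K.
Proof.
move=> h hQ hK e1 he; have [v qv hv] := h e1 he; exists v; first exact: hQ.
exact: ev_le hv hK.
Qed.

Lemma E_lv e i v : look e i = Some v -> E e (lv i) (eq v) 1.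
Proof.
move=> h e1 he; exists v => //; apply: ev_var.
by have := look_mono he h; rewrite /look; case: ltnP.
Qed.

Lemma E_unit e : E e unit_ (eq VUnit) 1.
Proof. by move=> e1 _; exists VUnit => //; exact: ev_unit. Qed.

Lemma E_num e n : E e (num_ n) (eq (VNum n%:R)) 1.
Proof. by move=> e1 _; exists (VNum n%:R) => //; exact: ev_nat. Qed.

Arguments E_unit {e}.
Arguments E_num {e} n.

Lemma E_pair e t u Q Q' k1 k2 : E e t Q k1 -> E e u Q' k2 ->
  E e (pair_ t u) (fun z => exists v w, [/\ z = VPair v w, Q v & Q' w]) (k1 + k2).+1.
Proof.
move=> h1 h2 e1 he; have [v q1 ev1] := h1 _ he; have [w q2 ev2] := h2 _ he.
by exists (VPair v w); [exists v, w|exact: ev_pair].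
Qed.

Lemma E_fst e t Q k : E e t (fun z => exists v w, z = VPair v w /\ Q v) k ->
  E e (fst_ t) Q k.+1.
Proof.
by move=> h e1 he; have [z [v [w [-> qv]]] hz] := h _ he; exists v => //; exact: ev_fst hz.
Qed.

Lemma E_snd e t Q k : E e t (fun z => exists v w, z = VPair v w /\ Q w) k ->
  E e (snd_ t) Q k.+1.
Proof.
by move=> h e1 he; have [z [v [w [-> qv]]] hz] := h _ he; exists w => //; exact: ev_snd hz.
Qed.

Lemma E_inl e t Q k : E e t Q k ->
  E e (inl_ t) (fun z => exists2 v, z = VInl v & Q v) k.+1.
Proof.
by move=> h e1 he; have [v q hv] := h _ he; exists (VInl v); [exists v|exact: ev_inl].
Qed.

Lemma E_inr e t Q k : E e t Q k ->
  E e (inr_ t) (fun z => exists2 v, z = VInr v & Q v) k.+1.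
Proof.
by move=> h e1 he; have [v q hv] := h _ he; exists (VInr v); [exists v|exact: ev_inr].
Qed.

Lemma E_case e t F G Q1 Q2 Q k1 k2 :
  E e t (fun z => (exists2 v, z = VInl v & Q1 v) \/ (exists2 v, z = VInr v & Q2 v)) k1 ->
  (forall e1 i v, below e e1 -> Q1 v -> look e1 i = Some v -> E e1 (F (lv i)) Q k2) ->
  (forall e1 i v, below e e1 -> Q2 v -> look e1 i = Some v -> E e1 (G (lv i)) Q k2) ->
  E e (case_ t F G) Q (k1 + k2).+1.
Proof.
move=> h hF hG e1 he; have [z qz hz] := h _ he.
case: qz => -[v zE qv]; rewrite zE in hz.
  have [w qw hw] := hF _ (size e1) _ (below_cons v he) qv (look_here _ _) _ (below_refl _).
  by exists w => //; exact: ev_caseL hz hw.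
have [w qw hw] := hG _ (size e1) _ (below_cons v he) qv (look_here _ _) _ (below_refl _).
by exists w => //; exact: ev_caseR hz hw.
Qed.

Lemma E_let e t F Q Q' k1 k2 : E e t Q k1 ->
  (forall e1 i v, below e e1 -> Q v -> look e1 i = Some v -> E e1 (F (lv i)) Q' k2) ->
  E e (let_ t F) Q' (k1 + k2).+2.
Proof.
move=> h hF; rewrite -addSn.
apply: (@E_case _ _ _ _ Q (fun=> False)) => //.
by apply: E_weak (E_inl h) _ (leqnn _) => v [z -> qz]; left; exists z.
Qed.

Lemma E_if e t a b (c : bool) Q k1 k2 : E e t (eq (vbool c)) k1 ->
  E e (if c then a else b) Q k2 -> E e (if_ t a b) Q (k1 + k2).+1.
Proof.
move=> h hab e1 he; have [z <- hz] := h _ he.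
have [w qw hw] := hab _ (below_cons VUnit he).
by exists w => //; apply: ev_case_bool hz _; case: (c) hw.
Qed.

Lemma E_add e t u r s k1 k2 : E e t (eq (VNum r)) k1 -> E e u (eq (VNum s)) k2 ->
  E e (add_ t u) (eq (VNum (r + s))) (k1 + k2).+1.
Proof.
move=> h1 h2 e1 he; have [z <- hz] := h1 _ he; have [w <- hw] := h2 _ he.
by exists (VNum (r + s)) => //; exact: ev_add.
Qed.

Lemma E_sub e t u r s k1 k2 : E e t (eq (VNum r)) k1 -> E e u (eq (VNum s)) k2 ->
  E e (sub_ t u) (eq (VNum (r - s))) (k1 + k2).+1.
Proof.
move=> h1 h2 e1 he; have [z <- hz] := h1 _ he; have [w <- hw] := h2 _ he.
by exists (VNum (r - s)) => //; exact: ev_sub.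
Qed.

Lemma E_mul e t u r s k1 k2 : E e t (eq (VNum r)) k1 -> E e u (eq (VNum s)) k2 ->
  E e (mul_ t u) (eq (VNum (r * s))) (k1 + k2).+1.
Proof.
move=> h1 h2 e1 he; have [z <- hz] := h1 _ he; have [w <- hw] := h2 _ he.
by exists (VNum (r * s)) => //; exact: ev_mul.
Qed.

Lemma E_div e t u r s k1 k2 : E e t (eq (VNum r)) k1 -> E e u (eq (VNum s)) k2 ->
  E e (div_ t u) (eq (VNum (r / s))) (k1 + k2).+1.
Proof.
move=> h1 h2 e1 he; have [z <- hz] := h1 _ he; have [w <- hw] := h2 _ he.
by exists (VNum (r / s)) => //; exact: ev_div.
Qed.

Lemma E_le e t u r s k1 k2 : E e t (eq (VNum r)) k1 -> E e u (eq (VNum s)) k2 ->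
  E e (le_ t u) (eq (vbool (r <= s))) (k1 + k2).+1.
Proof.
move=> h1 h2 e1 he; have [z <- hz] := h1 _ he; have [w <- hw] := h2 _ he.
by exists (vbool (r <= s)) => //; exact: ev_tle.
Qed.

Definition maps (f a : value) (Q : value -> Prop) K := exists2 w, Q w & vapp f a w K.

Lemma E_app e t u P P' Q k1 k2 k3 : E e t P k1 -> E e u P' k2 ->
  (forall f a, P f -> P' a -> maps f a Q k3) -> E e (app_ t u) Q (k1 + k2 + k3).+1.
Proof.
move=> h1 h2 h3 e1 he; have [f pf hf] := h1 _ he; have [a pa ha] := h2 _ he.
have [w qw hw] := h3 _ _ pf pa; exists w => //; exact: ev_app hf ha hw.
Qed.

Lemma E_lam e F (P : value -> Prop) (Q : value -> value -> Prop) K :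
  (forall e1 i a, below e e1 -> P a -> look e1 i = Some a -> E e1 (F (lv i)) (Q a) K) ->
  E e (lam F) (fun f => forall a, P a -> maps f a (Q a) K) 1.
Proof.
move=> h e1 he; exists (VClo e1 (F (lv (size e1).+1) (size e1).+2)).
  move=> a pa; set c := VClo _ _.
  have he2 : below e [:: a, c & e1] by do 2 apply: below_cons.
  have [w qw hw] := h _ (size e1).+1 a he2 pa (look_here _ (c :: e1)) _ (below_refl _).
  by exists w => //; apply: vapp_clo; exact: hw.
exact: ev_fun.
Qed.

(** Well-founded induction on [mu]. The type [I] indexes calls by their mathematical argument, and
    the body may rely on calls of smaller measure from any larger scope; [K n] pays for the
    recursive calls too. *)
Lemma E_fix e F (I : Type) (mu : I -> nat) (P Q : I -> value -> Prop) (K : I -> nat) :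
  (forall n e1 f i a, below e e1 -> P n a -> look e1 i = Some a ->
    (forall m e2 u k, (mu m < mu n)%N -> below e1 e2 -> E e2 u (P m) k ->
       E e2 (app_ f u) (Q m) (k + K m + 2)) ->
    E e1 (F f (lv i)) (Q n) (K n)) ->
  forall n t k, E e t (P n) k -> E e (app_ (rec_ F) t) (Q n) (k + K n + 2).
Proof.
move=> h n t k ht e1 he; have [a pa ha] := ht _ he.
pose c := VClo e1 (F (lv (size e1)) (lv (size e1).+1) (size e1).+2).
have key m : forall a, P m a -> maps c a (Q m) (K m).
  have [N] := ubnP (mu m); elim: N m => // N IH m hm a' pa'.
  have hc : look [:: a', c & e1] (size e1) = Some c.
    by apply: look_mono (look_here c e1); apply: below_cons; exact: below_refl.
  have he2 : below e [:: a', c & e1] by do 2 apply: below_cons.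
  have [|w qw hw] := h m [:: a', c & e1] (lv (size e1)) (size e1).+1 a' he2 pa'
    (look_here _ (c :: e1)) _ _ (below_refl _).
    move=> m' e2 u k' hm' he3 hu.
    apply: E_weak (E_app (E_lv (look_mono he3 hc)) hu (k3 := K m') _) (fun _ h => h) _; last by lia.
    by move=> _ a'' <- pa''; apply: IH => //; lia.
  by exists w => //; apply: vapp_clo; exact: hw.
have [w qw hw] := key n a pa; exists w => //.
by apply: ev_le (ev_app (ev_fun _ _ _) ha hw) _; lia.
Qed.

Definition vpoint (y : Y) : value := VPair (VPt y.1) (vbool y.2).
Definition vstream (st : stream X) : value :=
  VPair (vlist (map vpoint st.1.1))
    (VPair (vlist (map VPt st.1.2)) (vlist (map vbool st.2))).

Definition out {A} (enc : A -> value -> Prop) a (st : stream X) z :=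
  exists2 v, z = VPair v (vstream st) & enc a v.

(* [m] implements the randomized procedure [p] in the scope of [e] *)
Definition I_ {A} e (m : cm) (p : prog X A) (enc : A -> value -> Prop) K :=
  forall e1 i st a st', below e e1 -> look e1 i = Some (vstream st) ->
    run p st = Some (a, st') -> E e1 (m (lv i)) (out enc a st') K.

Lemma I_mono {A} e e1 m (p : prog X A) enc K : below e e1 -> I_ e m p enc K -> I_ e1 m p enc K.
Proof. by move=> h hI e2 i st a st' h2; apply: hI; exact: below_trans h2. Qed.

Lemma I_weak {A} e m (p : prog X A) (enc enc' : A -> value -> Prop) k K : I_ e m p enc k ->
  (forall st a st', run p st = Some (a, st') -> forall v, enc a v -> enc' a v) ->
  (k <= K)%N -> I_ e m p enc' K.
Proof.
move=> h hc hk e1 i st a st' he hl hr; apply: E_weak (h _ _ _ _ _ he hl hr) _ hk.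
by move=> v [w -> hw]; exists w => //; exact: hc hr _ hw.
Qed.

Lemma I_ret {A} e t (a : A) (enc : A -> value -> Prop) k :
  E e t (enc a) k -> I_ e (cret t) (Ret a) enc k.+2.
Proof.
move=> h e1 i st _ _ he hl [<- <-].
apply: E_weak (E_pair (E_mono he h) (E_lv hl)) _ _; last by lia.
by move=> z [v [w [-> hv <-]]]; exists v.
Qed.

Lemma I_bind {A B} e m f (p : prog X A) (q : A -> prog X B) (enc : A -> value -> Prop)
    (enc' : B -> value -> Prop) k1 k2 : I_ e m p enc k1 ->
  (forall e1 i a v, below e e1 -> enc a v -> look e1 i = Some v ->
     I_ e1 (f (lv i)) (q a) enc' k2) ->
  I_ e (cbind m f) (bind p q) enc' (k1 + k2 + 10).
Proof.
move=> hm hf e1 i st b st2 he hl; rewrite run_bind.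
case hr : (run p st) => [[a st1]|//] hq.
apply: (E_weak _ (fun _ h => h)).
  apply: E_let (hm _ _ _ _ _ he hl hr) _ => e2 j z h2 [v zE hv] hj.
  apply: (@E_let _ _ _ (eq v)); first apply: E_fst.
    by apply: E_weak (E_lv hj) _ (leqnn _) => _ <-; exists v, (vstream st1).
  move=> e3 x _ h3 <- hx.
  apply: (@E_let _ _ _ (eq (vstream st1))).
    apply: E_snd; apply: E_weak (E_lv (look_mono h3 hj)) _ (leqnn _) => _ <-.
    by exists v, (vstream st1).
  move=> e4 s _ h4 <- hs.
  apply: (hf e4 x a v _ hv (look_mono h4 hx) _ _ _ _ _ (below_refl _) hs hq).
  by do 3 (apply: below_trans; last eassumption).
by lia.
Qed.

Lemma I_if {A} e t m1 m2 (c : bool) (p : prog X A) enc k1 k2 : E e t (eq (vbool c)) k1 ->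
  I_ e (if c then m1 else m2) p enc k2 -> I_ e (cif t m1 m2) p enc (k1 + k2).+1.
Proof.
move=> h hm e1 i st a st' he hl hr; apply: E_if; first exact: E_mono he h.
by have := hm _ _ _ _ _ he hl hr; case: (c).
Qed.

Lemma I_let {A} e t (F : tm -> cm) (p : prog X A) Q enc k1 k2 : E e t Q k1 ->
  (forall e1 i v, below e e1 -> Q v -> look e1 i = Some v -> I_ e1 (F (lv i)) p enc k2) ->
  I_ e (fun s => let_ t (fun x => F x s)) p enc (k1 + k2).+2.
Proof.
move=> h hF e1 i st a st' he hl hr.
apply: E_let (E_mono he h) _ => e2 j v h2 qv hj.
exact: (hF e2 j v (below_trans he h2) qv hj _ _ _ _ _ (below_refl _) (look_mono h2 hl) hr).
Qed.

Lemma E_lfst e i v w : look e i = Some (VPair v w) -> E e (fst_ (lv i)) (eq v) 2.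
Proof.
by move=> h; apply: E_fst; apply: E_weak (E_lv h) _ (leqnn _) => _ <-; exists v, w.
Qed.

Lemma E_lsnd e i v w : look e i = Some (VPair v w) -> E e (snd_ (lv i)) (eq w) 2.
Proof.
by move=> h; apply: E_snd; apply: E_weak (E_lv h) _ (leqnn _) => _ <-; exists v, w.
Qed.

Lemma E_fst_eq e t v w k : E e t (eq (VPair v w)) k -> E e (fst_ t) (eq v) k.+1.
Proof.
by move=> h; apply: E_fst; apply: E_weak h _ (leqnn _) => _ <-; exists v, w.
Qed.

Lemma E_snd_eq e t v w k : E e t (eq (VPair v w)) k -> E e (snd_ t) (eq w) k.+1.
Proof.
by move=> h; apply: E_snd; apply: E_weak h _ (leqnn _) => _ <-; exists v, w.
Qed.

Lemma E_pair_eq e t u v w k1 k2 : E e t (eq v) k1 -> E e u (eq w) k2 ->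
  E e (pair_ t u) (eq (VPair v w)) (k1 + k2).+1.
Proof.
by move=> h1 h2; apply: E_weak (E_pair h1 h2) _ (leqnn _) => z [v' [w' [-> <- <-]]].
Qed.

Lemma I_drawS {A} e f (k : Y -> prog X A) enc K :
  (forall e1 i y, below e e1 -> look e1 i = Some (vpoint y) -> I_ e1 (f (lv i)) (k y) enc K) ->
  I_ e (cbind cdrawS f) (DrawS k) enc (K + 30).
Proof.
move=> hf; apply: (@I_weak _ _ _ _ enc _ (20 + K + 10)) => //; last by lia.
apply: (@I_bind _ _ e cdrawS f (DrawS (fun y => Ret y)) k (fun y => eq (vpoint y))).
  move=> e1 i [[S U] w] a st' he hl; case: S hl => //= y S hl [<- <-].
  apply: (E_weak _ (fun _ h => h)); first apply: (@E_case _ _ _ _ (fun=> False)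
     (eq (VPair (vpoint y) (vlist (map vpoint S))))) => //.
  - by apply: E_weak (E_lfst hl) _ (leqnn _) => _ <-; right; eexists.
  - move=> e2 j _ h2 <- hj.
    apply: E_weak (E_pair_eq (E_lfst hj) (E_pair_eq (E_lsnd hj)
      (E_lsnd (look_mono h2 hl)))) _ (leqnn _).
    by move=> _ <-; exists (vpoint y).
  - by [].
by move=> e1 i y _ he <- hl; exact: hf.
Qed.

Lemma I_drawU {A} e f (k : X -> prog X A) enc K :
  (forall e1 i x, below e e1 -> look e1 i = Some (VPt x) -> I_ e1 (f (lv i)) (k x) enc K) ->
  I_ e (cbind cdrawU f) (DrawU k) enc (K + 30).
Proof.
move=> hf; apply: (@I_weak _ _ _ _ enc _ (20 + K + 10)) => //; last by lia.
apply: (@I_bind _ _ e cdrawU f (DrawU (fun y => Ret y)) k (fun y => eq (VPt y))).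
  move=> e1 i [[S U] w] a st' he hl; case: U hl => //= y U hl [<- <-].
  apply: (E_weak _ (fun _ h => h)); first apply: (@E_case _ _ _ _ (fun=> False)
     (eq (VPair (VPt y) (vlist (map VPt U))))) => //.
  - by apply: E_weak (E_fst_eq (E_lsnd hl)) _ (leqnn _) => _ <-; right; eexists.
  - move=> e2 j _ h2 <- hj; have hl2 := look_mono h2 hl.
    apply: E_weak (E_pair_eq (E_lfst hj) (E_pair_eq (E_lfst hl2)
      (E_pair_eq (E_lsnd hj) (E_snd_eq (E_lsnd hl2))))) _ (leqnn _).
    by move=> _ <-; exists (VPt y).
  - by [].
by move=> e1 i y _ he <- hl; exact: hf.
Qed.

Lemma I_ccoin e : I_ e ccoin (Coin (fun c => Ret c)) (fun c => eq (vbool c)) 20.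
Proof.
move=> e1 i [[S U] w] a st' he hl; case: w hl => //= c w hl [<- <-].
apply: (E_weak _ (fun _ h => h)); first apply: (@E_case _ _ _ _ (fun=> False)
   (eq (VPair (vbool c) (vlist (map vbool w))))) => //.
- by apply: E_weak (E_snd_eq (E_lsnd hl)) _ (leqnn _) => _ <-; right; eexists.
- move=> e2 j _ h2 <- hj; have hl2 := look_mono h2 hl.
  apply: E_weak (E_pair_eq (E_lfst hj) (E_pair_eq (E_lfst hl2)
    (E_pair_eq (E_fst_eq (E_lsnd hl2)) (E_lsnd hj)))) _ (leqnn _).
  by move=> _ <-; exists (vbool c).
- by [].
Qed.

Lemma I_coin {A} e f (k : bool -> prog X A) enc K :
  (forall e1 i c, below e e1 -> look e1 i = Some (vbool c) -> I_ e1 (f (lv i)) (k c) enc K) ->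
  I_ e (cbind ccoin f) (Coin k) enc (K + 30).
Proof.
move=> hf; apply: (@I_weak _ _ _ _ enc _ (20 + K + 10)) => //; last by lia.
apply: (@I_bind _ _ e ccoin f (Coin (fun c => Ret c)) k (fun c => eq (vbool c))).
  exact: I_ccoin.
by move=> e1 i y _ he <- hl; exact: hf.
Qed.

(** [E_fix] with a call indexed by its argument, the stream it receives and the outcome of the run:
    a recursive call happens on whatever stream is left. *)
Lemma I_fix {J A} e F (mu : J -> nat) (P : J -> value -> Prop) (p : J -> prog X A)
    (enc : A -> value -> Prop) (K : J -> nat) :
  (forall n e1 self i a, below e e1 -> P n a -> look e1 i = Some a ->
    (forall m e2 u k, (mu m < mu n)%N -> below e1 e2 -> E e2 u (P m) k ->
       I_ e2 (self u) (p m) enc (k + K m + 12)) ->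
    I_ e1 (F self (lv i)) (p n) enc (K n)) ->
  forall n t k, E e t (P n) k -> I_ e (cfix F t) (p n) enc (k + K n + 12).
Proof.
move=> h n t k ht e1 i st a st' he hl hr.
pose arg (z : J * stream X * (A * stream X)) := fun v : value =>
  run (p z.1.1) z.1.2 = Some z.2 /\ exists2 w, v = VPair w (vstream z.1.2) & P z.1.1 w.
apply: (E_weak (@E_fix e1 _ _ (fun z => mu z.1.1) arg (fun z => out enc z.2.1 z.2.2)
  (fun z => K z.1.1 + 8)%N _ (n, st, (a, st')) (pair_ t (lv i)) (k + 2) _) (fun _ h => h)).
- move=> [[m s] [b s']] e2 f j z h2 [/= hrm [w -> pw]] hj hrec.
  apply: (E_weak _ (fun _ h => h)).
    apply: E_let (E_lfst hj) _ => e3 x _ h3 <- hx.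
    apply: E_let (E_lsnd (look_mono h3 hj)) _ => e4 y _ h4 <- hy.
    have he4 : below e2 e4 := below_trans h3 h4.
    apply: (h m e4 _ x w (below_trans he (below_trans h2 he4)) pw (look_mono h4 hx) _
      e4 y s b s' (below_refl _) hy hrm).
    move=> m' e5 u k' hm' h5 hu e6 y' s1 b1 s1' h6 hy' hr1.
    apply: (E_weak (hrec (m', s1, (b1, s1')) e6 _ (k' + 1).+1 hm' _ _) (fun _ h => h)).
    + exact: below_trans (below_trans he4 h5) h6.
    + apply: E_weak (E_pair (E_mono h6 hu) (E_lv hy')) _ (leqnn _).
      by move=> _ [v [w' [-> pv <-]]]; split => //; exists v.
    + by move=> /=; lia.
  by lia.
- apply: (E_weak (E_pair (E_mono he ht) (E_lv hl))); last by lia.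
  by move=> _ [v [w [-> pv <-]]]; split => //; exists v.
- by move=> /=; lia.
Qed.

Fixpoint lenc {A} (enc : A -> value -> Prop) (s : seq A) (v : value) : Prop :=
  if s is a :: s' then exists x y, [/\ v = VInr (VPair x y), enc a x & lenc enc s' y]
  else v = VInl VUnit.

Lemma I_reps {A} e m t (p : prog X A) n enc k kt : I_ e m p enc k ->
  E e t (eq (VNum n%:R)) kt ->
  I_ e (creps m t) (reps n p) (fun s v => size s = n /\ lenc enc s v)
    (n * (k + 60) + 40 + kt).
Proof.
move=> hm ht.
have h := @I_fix nat _ e (fun self n =>
  cif (le_ n (num_ 0)) (cret nil_)
    (cbind m (fun a => cbind (self (sub_ n (num_ 1))) (fun s => cret (cons_ a s)))))
  id (fun n => eq (VNum n%:R)) (fun n => reps n p) (lenc enc) (fun n => n * (k + 60) + 20)%N.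
apply: (I_weak (h _ n t kt ht)); last by lia.
  move=> n0 e1 self i a he <- hl hrec; refine (I_weak (I_if (k2 := (n0 * (k + 60) + 10)%N)
    (E_le (E_lv hl) (E_num 0)) _) (fun _ _ _ _ _ h => h) _); last by lia.
  rewrite ler_nat leqn0; case: n0 hl hrec => [|n'] hl hrec /=.
    apply: (I_weak (I_ret (E_weak (E_inl E_unit) _ (leqnn _))) (fun _ _ _ _ _ h => h)) => //.
    by move=> _ [_ -> <-].
  apply: (I_weak _ (fun _ _ _ _ _ h => h)).
    apply: I_bind (I_mono he hm) _ => e2 j b v h2 hv hj.
    apply: I_bind.
      apply: (hrec n' e2 _ _ (ltnSn _) h2 (E_weak (E_sub
        (E_lv (look_mono h2 hl)) (E_num 1)) _ (leqnn _))).
      by move=> _ <-; rewrite -natr1 addrK.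
    move=> e3 x s w h3 hw hx; apply: I_ret.
    apply: (E_weak (E_inr (E_pair (E_lv (look_mono h3 hj)) (E_lv hx))) _ (leqnn _)).
    by move=> _ [_ -> [_ [_ [-> <- <-]]]]; exists v, w.
  by rewrite mulSn; lia.
move=> st s st' hr v hv; split => //.
exact: run_reps_size hr.
Qed.

End Rules.

Arguments E_unit {R d X feat e}.
Arguments E_num {R d X feat e} n.
Arguments E_lv {R d X feat e i v} _.
Arguments E_lfst {R d X feat e i v w} _.
Arguments E_lsnd {R d X feat e i v w} _.

(** [bl], [lk] and [go] settle scopes, lookups and straight-line code, the costs being found by
    unification; [cost] and [ecost] postpone the comparison with the announced cost. *)
Ltac bl := solve [eassumption | apply: below_refl |
  eapply below_trans; [|eassumption]; bl].
Ltac lk := first [eassumption | eapply look_mono; [eassumption|]; lk].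
Ltac go := lazymatch goal with
  | |- @E _ _ _ _ _ (lv _) _ _ => eapply E_lv; lk
  | |- @E _ _ _ _ _ (num_ _) _ _ => apply: E_num
  | |- @E _ _ _ _ _ unit_ _ _ => apply: E_unit
  | |- @E _ _ _ _ _ (pair_ _ _) _ _ => eapply E_pair_eq; [go|go]
  | |- @E _ _ _ _ _ (fst_ _) _ _ => eapply E_fst_eq; go
  | |- @E _ _ _ _ _ (snd_ _) _ _ => eapply E_snd_eq; go
  | |- @E _ _ _ _ _ (add_ _ _) _ _ => eapply E_add; [go|go]
  | |- @E _ _ _ _ _ (sub_ _ _) _ _ => eapply E_sub; [go|go]
  | |- @E _ _ _ _ _ (mul_ _ _) _ _ => eapply E_mul; [go|go]
  | |- @E _ _ _ _ _ (div_ _ _) _ _ => eapply E_div; [go|go]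
  | |- @E _ _ _ _ _ (le_ _ _) _ _ => eapply E_le; [go|go]
  | |- _ => eapply E_mono; [|eassumption]; bl
  end.
Ltac gow := eapply E_weak; [go| |exact (leqnn _)].
Ltac cost := refine (I_weak _ (fun _ _ _ _ _ h => h) _).
Ltac ecost := refine (E_weak _ (fun _ h => h) _).

Definition true_ : tm := inr_ unit_.
Definition false_ : tm := inl_ unit_.
Definition not_ (t : tm) : tm := if_ t false_ true_.
Definition fresh : cm := cbind cdrawS cret.
Definition fresh_point : cm := cbind cdrawS (fun y => cret (fst_ y)).

Definition csum (w : tm -> tm) (s : tm) : tm := app_ (rec_ (fun f a =>
  case_ a (fun=> num_ 0) (fun z => let_ (fst_ z) (fun x => add_ (w x) (app_ f (snd_ z)))))) s.

Definition ccat (s t : tm) : tm := app_ (rec_ (fun f a =>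
  case_ a (fun=> t) (fun z => cons_ (fst_ z) (app_ f (snd_ z))))) s.

Definition cthr (t : tm) : cm := cfix (fun self a =>
  cif (le_ (fst_ a) (num_ 0)) (cret (snd_ a)) (cbind ccoin (fun c =>
    self (pair_ (sub_ (fst_ a) (num_ 1))
                (add_ (mul_ (num_ 2) (snd_ a)) (if_ c (num_ 1) (num_ 0))))))) t.

(** * Sums, concatenation and uniform integers *)

Section Library.
Context {R : realType} {d : measure_display} {X : measurableType d}
  (feat : nat -> X -> R).
Notation E := (E feat).
Notation I_ := (I_ feat).
Notation value := (value R X).

Lemma E_true e : E e true_ (eq (vbool true)) 2.
Proof. by apply: E_weak (E_inr E_unit) _ (leqnn _) => _ [_ -> <-]. Qed.

Lemma E_false e : E e false_ (eq (vbool false)) 2.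
Proof. by apply: E_weak (E_inl E_unit) _ (leqnn _) => _ [_ -> <-]. Qed.

Lemma E_not e t c k : E e t (eq (vbool c)) k -> E e (not_ t) (eq (vbool (~~ c))) k.+3.
Proof.
move=> h; apply: E_weak (E_if (k2 := 2) h (_ : E e _ (eq (vbool (~~ c))) 2)) _ _; last by lia.
  by case: c {h}; [exact: E_false|exact: E_true].
by [].
Qed.

Lemma E_sum {A} e w t (enc : A -> value -> Prop) (f : A -> R) k kt s :
  (forall e1 i a v, below e e1 -> enc a v -> look e1 i = Some v ->
     E e1 (w (lv i)) (eq (VNum (f a))) k) ->
  E e t (lenc enc s) kt ->
  E e (csum w t) (eq (VNum (foldr (fun a x => f a + x) 0 s))) (kt + size s * (k + 20) + 20).
Proof.
move=> hw ht.
refine (E_weak (@E_fix _ _ _ feat e _ (seq A) size (lenc enc)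
  (fun s => eq (VNum (foldr (fun a x => f a + x) 0 s))) (fun s => size s * (k + 20) + 10)%N
  _ s t kt ht) (fun _ h => h) _); last by lia.
move=> s0 e1 g i v he hv hi hrec.
refine (E_weak (E_case (k2 := (size s0 * (k + 20) + 5)%N) (Q1 := fun=> s0 = [::])
  (Q2 := fun z => exists a s' x y, [/\ s0 = a :: s', z = VPair x y, enc a x & lenc enc s' y])
  (E_weak (E_lv hi) _ (leqnn _)) _ _) (fun _ h => h) _); last by lia.
- move=> _ <-; case: s0 hv {hrec} => [|a s'] /=; first by move=> ->; left; exists VUnit.
  by move=> [x [y [-> hx hy]]]; right; exists (VPair x y) => //; exists a, s', x, y.
- move=> e2 j _ h2 -> _; apply: E_weak (E_num 0) _ _ => //= _ <-; by [].
- move=> e2 j _ h2 [a [s' [x [y [sE -> hx hy]]]]] hj.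
  ecost.
    apply: (E_let (Q := eq x)); first by go.
    move=> e3 p _ h3 <- hp; eapply E_weak; [apply: E_add| |exact (leqnn _)].
    + by refine (hw _ _ _ _ _ hx hp); bl.
    + apply: (hrec s' e3 _ 2); [by rewrite sE|bl|].
      by gow => _ <-.
    + by move=> _ <-; rewrite sE.
  by rewrite sE /= mulSn; lia.
Qed.

Lemma E_cat e t u (xs ys : seq value) k1 k2 : E e t (eq (vlist xs)) k1 ->
  E e u (eq (vlist ys)) k2 -> E e (ccat t u) (eq (vlist (xs ++ ys))) (k1 + size xs * 20 + k2 + 20).
Proof.
move=> ht hu.
refine (E_weak (@E_fix _ _ _ feat e _ (seq value) size (fun s => eq (vlist s))
  (fun s => eq (vlist (s ++ ys))) (fun s => size s * 20 + k2 + 10)%N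
  _ xs t k1 ht) (fun _ h => h) _); last by lia.
move=> s e1 g i _ he <- hi hrec.
refine (E_weak (E_case (k2 := (size s * 20 + k2 + 5)%N) (Q1 := fun=> s = [::])
  (Q2 := fun z => exists x s', s = x :: s' /\ z = VPair x (vlist s'))
  (E_weak (E_lv hi) _ (leqnn _)) _ _) (fun _ h => h) _); last by lia.
- move=> _ <-; case: s {hi hrec} => [|x s] /=; first by left; exists VUnit.
  by right; exists (VPair x (vlist s)) => //; exists x, s.
- move=> e2 j _ h2 -> _; apply: E_weak (E_mono _ hu) _ _ => //; first bl.
  by rewrite /=; lia.
- move=> e2 j _ h2 [x [s' [sE ->]]] hj; ecost.
    eapply E_weak; [apply: E_inr; apply: (E_pair (Q := eq x))| |exact (leqnn _)].
    + by go.
    + apply: (hrec s' e2 _ 2); [by rewrite sE|bl|].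
      by gow => _ <-.
    + by move=> _ [_ -> [_ [_ [-> <- <-]]]]; rewrite sE.
  by rewrite sE /=; lia.
Qed.

Lemma I_thr e t l j k : E e t (eq (VPair (VNum l%:R) (VNum j%:R))) k ->
  I_ e (cthr t) (thr l j) (fun t => eq (VNum t%:R)) (k + l * 80 + 40).
Proof.
move=> ht.
refine (I_weak (@I_fix _ _ _ feat (nat * nat) nat e _ fst
  (fun z => eq (VPair (VNum z.1%:R) (VNum z.2%:R))) (fun z => thr z.1 z.2)
  (fun t => eq (VNum t%:R)) (fun z => z.1 * 80 + 20)%N _ (l, j) t k ht)
  (fun _ _ _ _ _ h => h) _); last by rewrite /=; lia.
move=> [n i] e1 self a _ he <- hl hrec /=.
refine (I_weak (I_if (k2 := (n * 80 + 10)%N) (c := n%:R <= 0%:R :> R) _ _)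
  (fun _ _ _ _ _ h => h) _); first by go.
  rewrite ler_nat leqn0; case: n hl hrec => [|n] hl hrec /=.
    by cost; [apply: I_ret; go|].
  cost.
    apply: I_coin => e2 p c h2 hp; move: (hrec (n, (2 * i + c)%N)) => /= hr.
    apply: (hr e2) => //.
    eapply E_weak.
    - apply: E_pair_eq; first by go.
      apply: E_add; first by go.
      apply: (E_if (c := c) (Q := eq (VNum c%:R)) (k2 := 1)); first by go.
      by case: (c); exact: E_num.
    - by move=> _ <- /=; rewrite -natr1 addrK natrD natrM.
    - exact (leqnn _).
  by lia.
by lia.
Qed.

Lemma I_fresh e : I_ e fresh (DrawS (fun y0 => Ret y0)) (fun y => eq (vpoint y)) 40.
Proof.
by cost; first (apply: I_drawS => e1 i y he hi; apply: I_ret; go).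
Qed.

Lemma I_fresh_point e :
  I_ e fresh_point (DrawS (fun y0 => Ret y0.1)) (fun x => eq (VPt x)) 40.
Proof.
by cost; first (apply: I_drawS => e1 i y he hi; apply: I_ret; go).
Qed.

End Library.

(** * The procedure as a term *)

Section Code.
Variables (L : learner) (ceps cn1 cn2 cr cb ckt ck cl ch cR0 : tm).

Definition cbit (g : tm) : cm :=
  cbind (cthr (pair_ (add_ cl (num_ 1)) (num_ 0))) (fun t => cret (le_ (add_ g ch) t)).

Definition cnone (g t : tm) : cm := cfix (fun self n =>
  cif (le_ n (num_ 0)) (cret true_) (cbind cdrawS (fun y =>
    cbind (cbit (app_ g (fst_ y))) (fun c =>
      cif c (self (sub_ n (num_ 1))) (cret false_))))) t.

Definition cselP (g t : tm) : cm := cfix (fun self n =>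
  cif (le_ n (num_ 0)) fresh (cbind cdrawS (fun y =>
    cbind (cbit (app_ g (fst_ y))) (fun c =>
      cif c (self (sub_ n (num_ 1)))
        (cbind (cnone g (sub_ n (num_ 1))) (fun nn => cif nn (cret y) fresh)))))) t.

Definition cdrawQ (g : tm) : cm := cbind cdrawU (fun u =>
  cbind (cbit (app_ g u)) (fun c =>
    cif c (cbind (cnone g ck) (fun nn => cif nn (cret u) fresh_point)) fresh_point)).

Definition csample (g : tm) : cm :=
  cbind (creps (cselP g (add_ ck (num_ 1))) cn1) (fun S =>
  cbind (creps (cdrawQ g) cn2) (fun U =>
  cbind (creps ccoin cr) (fun w => cret (pair_ S (pair_ U w))))).

(** [fit L] is foreign de Bruijn code that reads its inputs from the first four places of the
    environment. They are bound in reverse order, so that the parameter comes first, followed by the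
    training list, the test list and the coins. *)
Definition cfit (s : tm) : tm :=
  let_ (snd_ (snd_ s)) (fun=> let_ (fst_ (snd_ s)) (fun=>
  let_ (fst_ s) (fun=> let_ ceps (fun=> fun=> fit L)))).

Definition ctrial (g : tm) : cm :=
  cbind (cnone g ckt) (fun nn => cbind (csample g) (fun s =>
    cret (pair_ (not_ nn) (cfit s)))).

Definition crej (S U V w x : tm) : tm :=
  let_ (pair_ S (pair_ (ccat U (cons_ x V)) w)) (fun s =>
    case_ (cfit s) (fun=> num_ 1) (fun=> num_ 0)).

Definition cpsi (g : tm) : cm :=
  cbind (cthr (pair_ cb (num_ 0))) (fun i =>
  cif (le_ (add_ i (num_ 1)) cn2)
    (cbind (creps (cselP g (add_ ck (num_ 1))) cn1) (fun S =>
     cbind (creps (cdrawQ g) i) (fun U =>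
     cbind (creps (cbind (cselP g (add_ ck (num_ 1))) (fun y => cret (fst_ y)))
                  (sub_ cn2 (add_ i (num_ 1)))) (fun V =>
     cbind (creps ccoin cr) (fun w =>
     cbind cdrawS (fun y => cret (lam (fun x =>
       sub_ (crej S U V w x) (crej S U V w (fst_ y))))))))))
    (cret (lam (fun=> num_ 0)))).

Definition chits : tm -> tm := csum (fun z => if_ (fst_ z) (num_ 1) (num_ 0)).
Definition crejs : tm -> tm :=
  csum (fun z => case_ (snd_ z) (fun=> num_ 1) (fun=> num_ 0)).

Definition cout (os g : tm) : tm := pair_
  (lam (fun x => le_ (num_ 0) (csum (fun z => case_ (snd_ z) (fun=> num_ 0)
    (fun u => if_ (app_ u x) (num_ 1) (sub_ (num_ 0) (num_ 1)))) os)))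
  (lam (fun x => le_ (app_ g x) (num_ 0))).

Definition clearn (t : tm) : cm := cfix (fun self a s0 => let_ (snd_ a) (fun g =>
  cif (le_ (fst_ a) (num_ 0)) (cret (cout nil_ g))
    (cbind (creps (ctrial g) (mul_ (num_ 16) cR0)) (fun os =>
      cif (le_ (mul_ (num_ 12) cR0) (chits os))
        (self (pair_ (sub_ (fst_ a) (num_ 1)) (lam (fun x => sub_ (app_ g x) (num_ 1)))))
        (cif (le_ (mul_ (num_ 4) cR0) (crejs os))
          (cbind (cpsi g) (fun D => self (pair_ (sub_ (fst_ a) (num_ 1))
             (lam (fun x => add_ (app_ g x) (app_ D x))))))
          (cret (cout os g))))) s0)) t.

End Code.

(** * Correctness and cost of the term *)

Section Specs.
Context {R : realType} {d : measure_display} {X : measurableType d}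
  (feat : nat -> X -> R).
Notation Y := (X * bool)%type.
Notation value := (value R X).
Notation E := (E feat).
Notation I_ := (I_ feat).
Notation maps := (maps feat).
Variables (L : learner) (eps : R) (V T n1 n2 r b kt k l R0 N : nat).
Variables (acc : seq Y -> seq X -> seq bool -> bool)
  (hyp : seq Y -> seq X -> seq bool -> X -> bool).
Variables (ceps cn1 cn2 cr cb ckt ck cl ch cR0 : tm) (e0 : seq value).
Hypotheses (heps : E e0 ceps (eq (VNum eps)) 1)
  (hn1 : E e0 cn1 (eq (VNum n1%:R)) 1) (hn2 : E e0 cn2 (eq (VNum n2%:R)) 1)
  (hr : E e0 cr (eq (VNum r%:R)) 1) (hb : E e0 cb (eq (VNum b%:R)) 1)
  (hkt : E e0 ckt (eq (VNum kt%:R)) 1) (hk : E e0 ck (eq (VNum k%:R)) 1)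
  (hl : E e0 cl (eq (VNum l%:R)) 1) (hh : E e0 ch (eq (VNum (2 ^ l)%N%:R)) 1)
  (hR0 : E e0 cR0 (eq (VNum R0%:R)) 1).

Definition genc (G : X -> int) K (f : value) : Prop :=
  forall x, maps f (VPt x) (eq (VNum (G x)%:~R)) K.

Lemma genc_le G K K' f : genc G K f -> (K <= K')%N -> genc G K' f.
Proof. by move=> h hK x; have [v qv hv] := h x; exists v => //; exact: vapp_le hv hK. Qed.

Lemma E_g e g G Kg u x j : E e g (genc G Kg) 1 -> E e u (eq (VPt x)) j ->
  E e (app_ g u) (eq (VNum (G x)%:~R)) (j + Kg + 2).
Proof.
move=> hg hu; refine (E_weak (E_app hg hu (k3 := Kg) _) (fun _ h => h) _); last by lia.
by move=> f a hf <-; exact: hf.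
Qed.

Lemma I_bit e t (z : int) j : below e0 e -> E e t (eq (VNum z%:~R)) j ->
  I_ e (cbit cl ch t) (bit l z) (fun c => eq (vbool c)) (j + l * 80 + 200).
Proof.
move=> he ht; cost.
  apply: I_bind.
    apply: I_thr; eapply E_weak.
    - apply: E_pair_eq; go.
    - by move=> _ <-; rewrite natr1.
    - exact (leqnn _).
  move=> e1 i a _ h1 <- hi; apply: I_ret; eapply E_weak.
  - apply: E_le; [apply: E_add; [apply: E_mono _ ht; bl|go]|go].
  - by move=> _ <-; rewrite -(ler_int R) rmorphD.
  - exact (leqnn _).
by lia.
Qed.

Hypothesis hfit : forall S U w, size S = n1 -> size U = n2 -> size w = r ->
  exists v j, [/\ fits feat L (VNum eps) S U w v j, (j <= T)%N &
    tds_output feat V%:R v (if acc S U w then Some (hyp S U w) else None)].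

Lemma E_ev e t v K : E e t (eq v) K -> ev feat e (t (size e)) v K.
Proof. by move=> h; have [_ <- hv] := h e (below_refl e). Qed.

Lemma ev_let e t F v w k1 k2 : ev feat e (t (size e)) v k1 ->
  ev feat (v :: e) (F (lv (size e)) (size e).+1) w k2 ->
  ev feat e (let_ t F (size e)) w (k1.+1 + k2).+1.
Proof. by move=> h1 h2; apply: ev_caseL (ev_inl h1) h2. Qed.

(** By [eval_ext] the foreign code returns its usual result with longer environments in the
    closures, and this preserves what [tds_output] says of it. *)
Lemma E_fit e i S U w : below e0 e -> look e i = Some (vstream (S, U, w)) ->
  size S = n1 -> size U = n2 -> size w = r ->
  E e (cfit L ceps (lv i)) (fun v => tds_output feat V%:R v
     (if acc S U w then Some (hyp S U w) else None)) (T + 30).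
Proof.
move=> he hi sS sU sw e1 he1.
have [v [j [hf jT ho]]] := hfit sS sU sw.
have hi1 := look_mono he1 hi; have he01 := below_trans he he1.
pose vw : value := vlist (map vbool w); pose vU : value := vlist (map VPt U).
pose vS : value := vlist (map vpoint S).
have mono (z : value) e' : below e1 e' -> below e1 (z :: e') by exact: below_cons.
have b2 := mono vw _ (below_refl e1); have b3 := mono vU _ b2; have b4 := mono vS _ b3.
have [v' vv' hv'] := eval_ext hf (XCons (vext_refl (VNum eps)) (XCons (vext_refl vS)
  (XCons (vext_refl vU) (XCons (vext_refl vw) (XNil e1))))).
exists v'.
  case: (acc S U w) ho => [[u vE hd]|/= vE]; rewrite vE in vv'; inversion vv'; subst.
    by exists v'0 => //; exact: denotes_ext hd _.
  by match goal with H : vext VUnit _ |- _ => inversion H end.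
apply: (@ev_le _ _ _ _ _ _ (3.+1 + (3.+1 + (2.+1 + (1.+1 + T).+1).+1).+1).+1); last by lia.
apply: ev_let; first exact: (E_ev (E_snd_eq (E_lsnd hi1))).
apply: (@ev_let (vw :: e1)); first exact: (E_ev (E_fst_eq (E_lsnd (look_mono b2 hi1)))).
apply: (@ev_let [:: vU, vw & e1]); first exact: (E_ev (E_lfst (look_mono b3 hi1))).
apply: (@ev_let [:: vS, vU, vw & e1]).
  exact: (E_ev (E_mono (below_trans he01 b4) heps)).
by exists j.
Qed.

Lemma E_rej e iS iU iV iw x p kx S U V' w : below e0 e ->
  look e iS = Some (vlist (map vpoint S)) -> look e iU = Some (vlist (map VPt U)) ->
  look e iV = Some (vlist (map VPt V')) -> look e iw = Some (vlist (map vbool w)) ->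
  E e x (eq (VPt p)) kx ->
  size S = n1 -> (size U + (size V').+1 = n2)%N -> size w = r ->
  E e (crej L ceps (lv iS) (lv iU) (lv iV) (lv iw) x)
    (eq (VNum (rejz acc S (U ++ p :: V') w)%:~R)) (T + n2 * 20 + kx + 150).
Proof.
move=> he hS hU hV hw hx sS sU sw; ecost.
  apply: (E_let (Q := eq (vstream (S, U ++ p :: V', w)))).
    eapply E_weak; [apply: E_pair_eq; [go|apply: E_pair_eq; [|go]]| |exact (leqnn _)].
    - apply: (E_cat (xs := map VPt U) (ys := VPt p :: map VPt V')); first go.
      eapply E_weak; [apply: E_inr; apply: E_pair_eq; [exact: hx|go]| |exact (leqnn _)].
      by move=> _ [_ -> <-].
    - by move=> _ <-; rewrite /vstream /= map_cat.
  move=> e1 i _ h1 <- hi.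
  apply: (E_case (Q1 := fun=> acc S (U ++ p :: V') w = false)
    (Q2 := fun=> acc S (U ++ p :: V') w = true)).
  - eapply E_weak; [apply: E_fit; [bl|exact: hi|exact: sS|by rewrite size_cat|exact: sw]
      | |exact (leqnn _)].
    by move=> v; case: (acc _ _ _) => [[u -> _]|->]; [right|left]; eexists.
  - by move=> e2 j v h2 ha _; rewrite /rejz ha; exact: E_num.
  - by move=> e2 j v h2 ha _; rewrite /rejz ha; exact: E_num.
by rewrite size_map; lia.
Qed.

Lemma E_lam_score e F (D : X -> int) K :
  (forall e1 i x, below e e1 -> look e1 i = Some (VPt x) ->
     E e1 (F (lv i)) (eq (VNum (D x)%:~R)) K) ->
  E e (lam F) (genc D K) 1.
Proof.
move=> h; apply: (E_weak (E_lam (P := fun a => exists x, a = VPt x)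
  (Q := fun a w => forall x, a = VPt x -> VNum (D x)%:~R = w) (K := K) _)) => //.
  move=> e1 i a he [x ->] hi; apply: (E_weak (h _ _ _ he hi)) => // w <- y.
  by case=> ->.
move=> f hf x; have [w hw hv] := hf _ (ex_intro _ x erefl).
by exists w => //; exact: hw.
Qed.

Lemma E_lam_bool e F (g : X -> bool) K :
  (forall e1 i x, below e e1 -> look e1 i = Some (VPt x) ->
     E e1 (F (lv i)) (eq (vbool (g x))) K) ->
  E e (lam F) (fun u => forall x, vapp feat u (VPt x) (vbool (g x)) K) 1.
Proof.
move=> h; apply: (E_weak (E_lam (P := fun a => exists x, a = VPt x)
  (Q := fun a w => forall x, a = VPt x -> vbool (g x) = w) (K := K) _)) => //.
  move=> e1 i a he [x ->] hi; apply: (E_weak (h _ _ _ he hi)) => // w <- y.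
  by case=> ->.
move=> f hf x; have [w hw hv] := hf _ (ex_intro _ x erefl).
by rewrite (hw x erefl).
Qed.

Lemma I_bind_ret {A} e m (p : prog X A) enc K :
  I_ e m (bind p (fun a => Ret a)) enc K -> I_ e m p enc K.
Proof.
move=> h e1 i st a st' he hi hr0; apply: (h _ _ _ _ _ he hi).
by rewrite run_bind hr0.
Qed.

Definition tenc (o : bool * option (X -> bool)) (v : value) : Prop :=
  exists2 u, v = VPair (vbool o.1) u & tds_output feat V%:R u o.2.

Definition outenc K (hg : (X -> bool) * (X -> bool)) (v : value) : Prop :=
  exists u1 u2, [/\ v = VPair u1 u2, forall x, vapp feat u1 (VPt x) (vbool (hg.1 x)) K &
    forall x, vapp feat u2 (VPt x) (vbool (hg.2 x)) K].

Lemma foldr_count {A} (q : A -> bool) (s : seq A) :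
  foldr (fun a x => (q a)%:R + x) 0 s = (count q s)%:R :> R.
Proof. by elim: s => //= a s ->; rewrite -natrD. Qed.

Lemma E_hits e t s j : E e t (lenc tenc s) j ->
  E e (chits t) (eq (VNum (count is_hit s)%:R)) (j + size s * 30 + 20).
Proof.
move=> h; apply: (E_weak (E_sum (k := 10) (f := fun o => (is_hit o)%:R) _ h)) => //.
  move=> e1 i o v he [u -> _] hi; ecost.
    apply: (E_if (c := is_hit o)); first go.
    by instantiate (1 := 1%N); case: (is_hit o); exact: E_num.
  by [].
by move=> _ <-; rewrite foldr_count.
Qed.

Lemma E_rejs e t s j : E e t (lenc tenc s) j ->
  E e (crejs t) (eq (VNum (count is_rej s)%:R)) (j + size s * 30 + 20).
Proof.
move=> h; apply: (E_weak (E_sum (k := 10) (f := fun o => (is_rej o)%:R) _ h)) => //.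
  move=> e1 i o v he [u -> ho] hi; ecost.
    apply: (E_case (Q1 := fun=> is_rej o = true) (Q2 := fun=> is_rej o = false)).
    - gow => _ <-; rewrite /is_rej; case: (o.2) ho => [g [u' -> _]|->];
        [right|left]; by eexists.
    - by move=> e2 p v' h2 -> _; exact: E_num.
    - by move=> e2 p v' h2 -> _; exact: E_num.
  by [].
by move=> _ <-; rewrite foldr_count.
Qed.

Lemma E_out e t g s G Kg : E e t (lenc tenc s) 2 -> E e g (genc G Kg) 1 ->
  E e (cout t g) (outenc (size s * (V + 40) + Kg + 50)
    (majority (pmap snd s), fun x => G x <= 0)) 3.
Proof.
move=> ht hg.
refine (E_weak (E_pair (E_lam_bool (K := (size s * (V + 40) + Kg + 50)%N)
  (g := majority (pmap snd s)) _)
  (E_lam_bool (K := (size s * (V + 40) + Kg + 50)%N) (g := fun x => G x <= 0) _)) _ _) => //.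
- move=> e1 i x he hi; refine (E_weak (E_le (E_num 0) (E_sum (k := (V + 20)%N) (enc := tenc)
    (f := fun o => if o.2 is Some h then (if h x then 1 else 0 - 1) else 0)
    _ (E_mono he ht))) _ _); last by lia.
  + move=> e2 j o v h2 [u -> ho] hj; ecost.
      apply: (E_case (Q1 := fun=> o.2 = None)
        (Q2 := fun u' => exists2 h, o.2 = Some h & denotes feat V%:R u' h)).
      * gow => _ <-; case: (o.2) ho => [h [u' -> hd]|->]; [right|left]; last by eexists.
        by exists u' => //; exists h.
      * move=> e3 p v' h3 -> _; instantiate (1 := (V + 10)%N).
          by refine (E_weak (E_num 0) _ _) => [_ <-|] //; lia.
      * move=> e3 p v' h3 [h -> hd] hp; ecost.
          apply: (E_if (c := h x)).
            apply: (@E_app _ _ _ _ _ _ _ (eq v') (eq (VPt x)) _ _ _ V); [go|go|].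
            by move=> _ _ <- <-; exists (vbool (h x)) => //; exact: denotes_vapp.
          by instantiate (1 := 3%N); case: (h x); [
            refine (E_weak (E_num 1) _ _) => [_ <-|] //|
            refine (E_weak (E_sub (E_num 0) (E_num 1)) _ _) => [_ <-|] //].
        by lia.
    by lia.
  + move=> _ <-; rewrite /majority -(ler0z R); congr (vbool (_ <= _)).
    by elim: (s) => //= -[c [h|]] s' /= <-; rewrite ?add0r // rmorphD /=; case: (h x);
      rewrite ?rmorphN /= ?sub0r.
- move=> e1 i x he hi.
  refine (E_weak (E_le (E_g (E_mono he hg) (E_lv hi)) (E_num 0)) _ _); last by lia.
  by move=> _ <-; rewrite lerz0.
Qed.

#[local] Opaque bit.

Section Score.
Variables (G : X -> int) (Kg : nat).
Definition bitcost := (Kg + l * 80 + 400)%N.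
Notation KB := bitcost.

Lemma I_none e g t n j : below e0 e -> E e g (genc G Kg) 1 ->
  E e t (eq (VNum n%:R)) j ->
  I_ e (cnone cl ch g t) (none G l n) (fun c => eq (vbool c)) (j + n * KB + 50).
Proof.
move=> he hg ht.
refine (I_weak (@I_fix _ _ _ feat nat bool e _ id
  (fun n => eq (VNum n%:R)) (fun n => none G l n)
  (fun c => eq (vbool c)) (fun n => n * KB + 30)%N _ n t j ht)
  (fun _ _ _ _ _ h => h) _); last by lia.
move=> m e1 self a _ h1 <- ha hrec.
refine (I_weak (I_if (k2 := (m * KB + 20)%N) (c := m%:R <= 0%:R :> R) _ _)
  (fun _ _ _ _ _ h => h) _); first by go.
  rewrite ler_nat leqn0; case: m ha hrec => [|m] ha hrec /=.
    by cost; [apply: I_ret; exact: E_true|].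
  cost.
    apply: I_drawS => e2 p y h2 hp; apply: I_bind.
      apply: I_bit; first bl.
      by apply: E_g; [apply: E_mono _ hg; bl|go].
    move=> e3 q c _ h3 <- hq; apply: I_if; first by go.
    instantiate (1 := (m * KB + 60)%N); case: c hq => hq.
      cost; first (apply: (hrec m); [by []|bl|gow]).
        by move=> _ <-; rewrite -natr1 addrK.
      by lia.
    by cost; [apply: I_ret; exact: E_false|lia].
  by rewrite mulSn /bitcost; lia.
by lia.
Qed.

Lemma I_selP e g t n j : below e0 e -> E e g (genc G Kg) 1 ->
  E e t (eq (VNum n%:R)) j ->
  I_ e (cselP cl ch g t) (selP G l n) (fun y => eq (vpoint y)) (j + n * KB + 150).
Proof.
move=> he hg ht.
refine (I_weak (@I_fix _ _ _ feat nat Y e _ id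
  (fun n => eq (VNum n%:R)) (fun n => selP G l n)
  (fun y => eq (vpoint y)) (fun n => n * KB + 130)%N _ n t j ht)
  (fun _ _ _ _ _ h => h) _); last by lia.
move=> m e1 self a _ h1 <- ha hrec.
refine (I_weak (I_if (k2 := (m * KB + 110)%N) (c := m%:R <= 0%:R :> R) _ _)
  (fun _ _ _ _ _ h => h) _); first by go.
  rewrite ler_nat leqn0; case: m ha hrec => [|m] ha hrec /=.
    by cost; [exact: I_fresh|].
  cost.
    apply: I_drawS => e2 p y h2 hp; apply: I_bind.
      apply: I_bit; first bl.
      by apply: E_g; [apply: E_mono _ hg; bl|go].
    move=> e3 q c _ h3 <- hq; apply: I_if; first by go.
    instantiate (1 := (m * KB + 150)%N); case: c hq => hq.
      cost; first (apply: (hrec m); [by []|bl|gow]).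
        by move=> _ <-; rewrite -natr1 addrK.
      by lia.
    cost.
      apply: I_bind.
        apply: I_none; [bl|apply: E_mono _ hg; bl|gow].
        by move=> _ <-; rewrite -natr1 addrK.
      move=> e4 s c _ h4 <- hs; apply: I_if; first by go.
      instantiate (1 := 40%N); case: c hs => hs; last exact: I_fresh.
      by cost; [apply: I_ret; go|].
    by lia.
  by rewrite mulSn /bitcost; lia.
by lia.
Qed.

Lemma I_drawQ e g : below e0 e -> E e g (genc G Kg) 1 ->
  I_ e (cdrawQ ck cl ch g) (drawQ G l k) (fun x => eq (VPt x)) (k.+1 * KB + 100).
Proof.
move=> he hg; cost.
  apply: I_drawU => e2 p y h2 hp; apply: I_bind.
    apply: I_bit; first bl.
    by apply: E_g; [apply: E_mono _ hg; bl|go].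
  move=> e3 q c _ h3 <- hq; apply: I_if; first by go.
  instantiate (1 := (k * KB + 120)%N); case: c hq => hq; last first.
    by cost; [exact: I_fresh_point|lia].
  cost.
    apply: I_bind.
      by apply: I_none; [bl|apply: E_mono _ hg; bl|go].
    move=> e4 s c _ h4 <- hs; apply: I_if; first by go.
    instantiate (1 := 40%N); case: c hs => hs; last exact: I_fresh_point.
    by cost; [apply: I_ret; go|].
  by lia.
by rewrite mulSn /bitcost; lia.
Qed.

Lemma lenc_map {A} (f : A -> value) s v :
  lenc (fun a => eq (f a)) s v -> v = vlist (map f s).
Proof. by elim: s v => //= a s IH v [_ [y [-> <- /IH ->]]]. Qed.

Definition samcost := ((n1 + n2) * (k.+1 * KB + 250) + r * 80 + 200)%N.

Lemma I_sample e g : below e0 e -> E e g (genc G Kg) 1 ->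
  I_ e (csample cn1 cn2 cr ck cl ch g) (sample n1 n2 r (selP G l k.+1) (drawQ G l k))
    (fun s v => v = vstream s /\
       [/\ size s.1.1 = n1, size s.1.2 = n2 & size s.2 = r]) samcost.
Proof.
move=> he hg; cost.
  apply: I_bind.
    apply: I_reps; last by go.
    apply: I_selP; [bl|exact: hg|gow].
    by move=> _ <-; rewrite natr1.
  move=> e1 i S vS h1 [sS /lenc_map ->] hi; apply: I_bind.
    by apply: I_reps; [apply: I_drawQ; [bl|apply: E_mono _ hg; bl]|go].
  move=> e2 j U vU h2 [sU /lenc_map ->] hj; apply: I_bind.
    by apply: I_reps; [exact: I_ccoin|go].
  move=> e3 p w vw h3 [sw /lenc_map ->] hp; apply: I_ret; gow.
  by move=> _ <-.
rewrite /samcost !mulnDr !mulnDl; lia.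
Qed.

Definition trialcost := (kt * KB + samcost + T + 300)%N.

Lemma I_trial e g : below e0 e -> E e g (genc G Kg) 1 ->
  I_ e (ctrial L ceps cn1 cn2 cr ckt ck cl ch g)
    (trial n1 n2 r acc hyp kt k l G) tenc trialcost.
Proof.
move=> he hg; cost.
  apply: I_bind; first by apply: I_none; [bl|exact: hg|go].
  move=> e1 i nn _ h1 <- hi; apply: I_bind.
    by apply: I_sample; [bl|apply: E_mono _ hg; bl].
  move=> e2 j [[S U] w] _ h2 [-> [sS sU sw]] hj; apply: I_ret; eapply E_weak.
  - apply: E_pair; [apply: E_not; go|apply: E_fit; [bl|exact: hj|done..]].
  - by move=> _ [_ [u [-> <- hu]]]; exists u.
  - exact (leqnn _).
by rewrite /trialcost; lia.
Qed.

Definition psicost := (b * 80 + (n1 + n2) * (k.+1 * KB + 300) + r * 80 + 800)%N.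
(** An increment of the score runs the given learner twice, on test lists that differ in one
    point. *)
Definition stepcost := (2 * T + n2 * 40 + 400)%N.

Lemma I_psi e g : below e0 e -> E e g (genc G Kg) 1 ->
  I_ e (cpsi L ceps cn1 cn2 cr cb ck cl ch g) (psi n1 n2 r acc G l k b)
    (fun D => genc D stepcost) psicost.
Proof.
move=> he hg; cost.
  apply: I_bind; first by apply: I_thr; go.
  move=> e1 i m _ h1 <- hi.
  apply: (I_if (c := m%:R + 1%:R <= n2%:R :> R)); first go.
  rewrite natr1 ler_nat.
  instantiate (1 := ((n1 + n2) * (k.+1 * KB + 300) + r * 80 + 600)%N).
  case: ifP => hm; last first.
    cost; first (apply: I_ret; apply: E_lam_score => e2 j x h2 hj;
      refine (E_weak (E_num 0) _ _) => [_ <-|] //; rewrite /stepcost; lia).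
    by lia.
  cost.
    apply: I_bind.
      apply: I_reps; [apply: I_selP; [bl|apply: E_mono _ hg; bl|gow]|go].
      by move=> _ <-; rewrite natr1.
    move=> e2 iS S _ h2 [sS /lenc_map ->] hS; apply: I_bind.
      by apply: I_reps; [apply: I_drawQ; [bl|apply: E_mono _ hg; bl]|go].
    move=> e3 iU U _ h3 [sU /lenc_map ->] hU; apply: I_bind.
      apply: (@I_reps _ _ _ _ _ _ _ _ _ _ (fun y => eq (VPt y.1))).
        apply: I_bind_ret; apply: I_bind.
          apply: I_selP; [bl|apply: E_mono _ hg; bl|gow].
          by move=> _ <-; rewrite natr1.
        by move=> e4 j y _ h4 <- hj; apply: I_ret; go.
      by gow => _ <-; rewrite natr1 natrB.
    move=> e4 iV W _ h4 [sV /lenc_map ->] hV; rewrite map_comp in hV; apply: I_bind.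
      by apply: I_reps; [exact: I_ccoin|go].
    move=> e5 iw w _ h5 [sw /lenc_map ->] hw; apply: I_drawS => e6 p y h6 hp.
    apply: I_ret; apply: E_lam_score => e7 q x h7 hq; refine (E_weak (E_sub _ _) _ _).
    + apply: (@E_rej _ _ _ _ _ _ x _ S U (map fst W) w); try (by lk); first bl.
      * by go.
      * by rewrite size_map sU sV; lia.
    + apply: (@E_rej _ _ _ _ _ _ y.1 _ S U (map fst W) w); try (by lk); first bl.
      * by go.
      * by rewrite size_map sU sV; lia.
    + by move=> _ <-; rewrite rmorphB.
    + by rewrite /stepcost; lia.
  have : (m * (k.+1 * KB + 100 + 60) + (n2 - m.+1) * (k.+1 * KB + 230) <=
     n2 * (k.+1 * KB + 230))%N.
    by rewrite -[in leqRHS](subnK hm); nia.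
  by rewrite !mulnDr !mulnDl; lia.
by rewrite /psicost; lia.
Qed.

End Score.

(** A score is a chain of closures, one for each past round, and every evaluation goes through the
    whole chain. *)
Definition scorecost := (N * (stepcost + 10) + 10)%N.
Definition roundcost :=
  (16 * R0 * (trialcost scorecost + 200) + psicost scorecost + 1000)%N.
Definition outcost := (16 * R0 * (V + 40) + scorecost + 50)%N.

Lemma outenc_le K K' hg v : outenc K hg v -> (K <= K')%N -> outenc K' hg v.
Proof.
move=> [u1 [u2 [-> h1 h2]]] hK; exists u1, u2.
by split => // x; [exact: vapp_le (h1 x) hK|exact: vapp_le (h2 x) hK].
Qed.

Lemma I_learn e t G j : below e0 e ->
  E e t (fun v => exists2 f, v = VPair (VNum N%:R) f & genc G 10 f) j ->
  I_ e (clearn L ceps cn1 cn2 cr cb ckt ck cl ch cR0 t)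
    (learn n1 n2 r acc hyp b kt k l R0 N G) (outenc outcost) (j + N * roundcost + 300).
Proof.
move=> he ht.
(* With [z.1] rounds left, the chain has [N - z.1] links; the cost of the score is part of the
   invariant. *)
pose P (z : nat * (X -> int)) v := exists f, [/\ v = VPair (VNum z.1%:R) f, (z.1 <= N)%N
  & genc z.2 (10 + (N - z.1) * (stepcost + 10)) f].
refine (I_weak (@I_fix _ _ _ feat (nat * (X -> int)) _ e _ fst P
  (fun z => learn n1 n2 r acc hyp b kt k l R0 z.1 z.2) (outenc outcost)
  (fun z => z.1 * roundcost + 200)%N _ (N, G) t j _)
  (fun _ _ _ _ _ h => h) _); last by rewrite /=; lia.
  2: by apply: (E_weak ht) => // v [f -> hf]; exists f; split => //=; rewrite subnn.
move=> [m G'] e1 self a _ h1 [f [-> /= mN hf]] ha hrec; cost.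
  apply: (I_let (Q := eq f)); first by go.
  move=> e2 ig _ h2 <- hg.
  have gK : E e2 (lv ig) (genc G' (10 + (N - m) * (stepcost + 10))) 1.
    by apply: (E_weak (E_lv hg)) => // _ <-.
  have gE : E e2 (lv ig) (genc G' scorecost) 1.
    apply: (E_weak gK) => // v hv; apply: genc_le hv _.
    by rewrite /scorecost addnC leq_add2r leq_mul2r leq_subr orbT.
  apply: (I_if (c := m%:R <= 0%:R :> R)); first by go.
  rewrite ler_nat leqn0; instantiate (1 := (m * roundcost + 100)%N).
  case: m mN hf ha hrec gK => [|m] mN hf ha hrec gK /=.
    cost; first (apply: I_ret; apply: (E_weak (E_out (s := [::]) _ gE)) => //).
    + by apply: (E_weak (E_inl E_unit)) => // _ [_ -> <-].
    + by move=> v hv; apply: outenc_le hv _; rewrite /outcost /= mul0n -!addnA leq_addl.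
    + by lia.
  have Nm : (N - m = (N - m.+1).+1)%N by lia.
  cost.
    apply: I_bind.
      apply: I_reps; first by apply: (I_trial (Kg := scorecost) _ gE); bl.
      by gow => _ <-; rewrite natrM.
    move=> e3 io os v h3 [sos hos] ho.
    have hos' : E e3 (lv io) (lenc tenc os) 1 by apply: (E_weak (E_lv ho)) => // _ <-.
    have := E_hits hos'; rewrite sos => hhits.
    apply: (I_if (c := 12%:R * R0%:R <= (count is_hit os)%:R :> R)).
      by apply: E_le; [go|exact: hhits].
    rewrite -natrM ler_nat.
    instantiate (1 := (m * roundcost + psicost scorecost + 16 * R0 * 30 + 700)%N).
    case: ifP => h12.
      cost; first (apply: (hrec (m, fun x => G' x - 1)) => //; first bl).
        apply: E_weak (E_pair (E_sub (E_lfst (look_mono (below_trans h2 h3) ha)) (E_num 1))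
          (E_lam_score (D := fun x => G' x - 1)
            (K := (10 + (N - m) * (stepcost + 10))%N) _)) _ (leqnn _).
          move=> e4 ix x h4 hx.
          refine (E_weak (E_sub (E_g (E_mono _ gK) (E_lv hx)) (E_num 1)) _ _); first bl.
            by move=> _ <-; rewrite rmorphB.
          by rewrite Nm mulSn; lia.
        by move=> _ [_ [f' [-> <- hf']]]; exists f'; split => //=;
          [rewrite -natr1 addrK|lia].
      by rewrite /=; lia.
    cost.
      apply: (I_if (c := 4%:R * R0%:R <= (count is_rej os)%:R :> R)).
        by apply: E_le; [go|exact: (E_rejs hos')].
      rewrite -natrM ler_nat.
      instantiate (1 := (m * roundcost + psicost scorecost + 500)%N).
      case: ifP => h4; last first.
        cost; first (apply: I_ret; apply: (E_weak (E_out (s := os) _ (E_mono h3 gE))) => //).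
        + by apply: (E_weak hos').
        + by move=> w hw; apply: outenc_le hw _; rewrite /outcost sos.
        + by lia.
      cost.
        apply: I_bind; first by apply: (I_psi (Kg := scorecost) _ (E_mono h3 gE)); bl.
        move=> e4 iD D fD h5 hD hi; move: (hrec (m, fun x => G' x + D x)) => /= hr'.
        apply: (hr' e4) => //; first bl.
        have hDE : E e4 (lv iD) (genc D stepcost) 1 by apply: (E_weak (E_lv hi)) => // _ <-.
        apply: E_weak (E_pair
          (E_sub (E_lfst (look_mono (below_trans h2 (below_trans h3 h5)) ha)) (E_num 1))
          (E_lam_score (D := fun x => G' x + D x)
            (K := (10 + (N - m) * (stepcost + 10))%N) _)) _ (leqnn _).
          move=> e6 ix x h6 hx.
          refine (E_weak (E_add (E_g (E_mono _ gK) (E_lv hx)) (E_g (E_mono _ hDE) (E_lv hx))) _ _);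
            [bl|bl| |].
            by move=> _ <-; rewrite rmorphD.
          by rewrite Nm mulSn; lia.
        by move=> _ [_ [f' [-> <- hf']]]; exists f'; split => //=;
          [rewrite -natr1 addrK|lia].
      by rewrite /=; lia.
    by rewrite sos; lia.
  by rewrite -[m.+1]addn1 mulnDl mul1n {3}/roundcost; lia.
by rewrite /=; lia.
Qed.

End Specs.

(** * Rounding up to powers of two *)

Lemma ex_pow2 {R : realType} (y : R) : exists j, y <= 2 ^+ j.
Proof. by exists (Num.bound y); apply/ltW/upper_nthrootP. Qed.

Definition lg {R : realType} (y : R) : nat := ex_minn (ex_pow2 y).

Lemma lg_ge {R : realType} (y : R) : y <= 2 ^+ lg y.
Proof. by rewrite /lg; case: ex_minnP. Qed.

Lemma lg_min {R : realType} (y : R) j : y <= 2 ^+ j -> (lg y <= j)%N.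
Proof. by rewrite /lg; case: ex_minnP => m _; exact. Qed.

Lemma lg_le1 {R : realType} (y : R) : y <= 1 -> lg y = 0%N.
Proof. by move=> y1; apply/eqP; rewrite -leqn0 lg_min // expr0. Qed.

Lemma lgS {R : realType} (y : R) : 1 < y -> lg y = (lg (y / 2)).+1.
Proof.
move=> y1; apply/eqP; rewrite eqn_leq; apply/andP; split.
  by apply: lg_min; rewrite exprS -ler_pdivrMl // mulrC lg_ge.
have := lg_ge y; case: (lg y) => [|j]; first by rewrite expr0 leNgt y1.
by move=> hj; rewrite ltnS; apply: lg_min; rewrite ler_pdivrMr // mulrC -exprS.
Qed.

Lemma lg_lt {R : realType} (y : R) : 1 <= y -> 2 ^+ lg y <= 2 * y.
Proof.
rewrite le_eqVlt => /orP[/eqP <-|y1]; first by rewrite lg_le1 // expr0; lra.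
rewrite leNgt; apply/negP => h.
have : (lg y <= lg (y / 2))%N.
  apply: lg_min; move: h; rewrite lgS // exprS ltr_pM2l // => /ltW; exact.
by rewrite lgS // ltnn.
Qed.

Definition clg (t : tm) : tm := app_ (rec_ (fun f a =>
  if_ (le_ a (num_ 1)) (num_ 0) (add_ (num_ 1) (app_ f (div_ a (num_ 2)))))) t.

Definition cpow2 (t : tm) : tm := app_ (rec_ (fun f a =>
  if_ (le_ a (num_ 0)) (num_ 1) (mul_ (num_ 2) (app_ f (sub_ a (num_ 1)))))) t.

Section Arithmetic.
Context {R : realType} {d : measure_display} {X : measurableType d}
  (feat : nat -> X -> R).
Notation E := (E feat).

Lemma E_clg e t (y : R) j : E e t (eq (VNum y)) j ->
  E e (clg t) (eq (VNum (lg y)%:R)) (j + lg y * 20 + 20).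
Proof.
move=> ht.
refine (E_weak (@E_fix _ _ _ feat e _ R lg (fun y => eq (VNum y))
  (fun y => eq (VNum (lg y)%:R)) (fun y => lg y * 20 + 10)%N _ y t j ht)
  (fun _ h => h) _); last by lia.
move=> z e1 f i _ he <- hi hrec.
refine (E_weak (E_if (c := z <= 1%:R) (k2 := (lg z * 20 + 5)%N) _ _) (fun _ h => h) _).
- by go.
- case: (leP z 1%:R) => z1.
    by rewrite lg_le1 //; apply: (E_weak (E_num 0)) => // _ <-.
  refine (E_weak (E_add (E_num 1) (hrec (z / 2%:R) e1 _ 3 _ (below_refl _) _)) _ _).
  + by rewrite (lgS z1).
  + by gow => _ <-.
  + by move=> _ <-; rewrite (lgS z1) -natr1 addrC.
  + by rewrite (lgS z1) mulSn; lia.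
- by lia.
Qed.

Lemma E_pow2 e t n j : E e t (eq (VNum n%:R)) j ->
  E e (cpow2 t) (eq (VNum (2 ^ n)%N%:R)) (j + n * 20 + 20).
Proof.
move=> ht.
refine (E_weak (@E_fix _ _ _ feat e _ nat id (fun n => eq (VNum n%:R))
  (fun n => eq (VNum (2 ^ n)%N%:R)) (fun n => n * 20 + 10)%N _ n t j ht)
  (fun _ h => h) _); last by lia.
move=> m e1 f i _ he <- hi hrec.
refine (E_weak (E_if (c := m%:R <= 0%:R :> R) (k2 := (m * 20 + 5)%N) _ _) (fun _ h => h) _).
- by go.
- rewrite ler_nat leqn0; case: m hi hrec => [|m] hi hrec /=.
    by apply: (E_weak (E_num 1)) => // _ <-.
  refine (E_weak (E_mul (E_num 2) (hrec m e1 _ 3 _ (below_refl _) _)) _ _).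
  + by [].
  + by gow => _ <-; rewrite -natr1 addrK.
  + by move=> _ <-; rewrite expnS natrM.
  + by lia.
- by lia.
Qed.

End Arithmetic.

(** * The PQ learner and its parameters *)

Section Learner.
Variable L : learner.

Definition with_params (p : tm)
    (F : tm -> tm -> tm -> tm -> tm -> tm -> tm -> tm -> tm -> tm -> tm -> tm) : tm :=
  let_ (fst_ p) (fun eps => let_ (fst_ (snd_ p)) (fun eta =>
  let_ (if_ (le_ eta eps) eps eta) (fun eta1 =>
  let_ (let_ eps (fun=> fun=> plan L)) (fun pl =>
  let_ (fst_ pl) (fun n1 => let_ (fst_ (snd_ pl)) (fun n2 =>
  let_ (snd_ (snd_ pl)) (fun r =>
  let_ (clg n2) (fun b => let_ (clg (div_ (num_ 1) eta1)) (fun b' =>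
  let_ (cpow2 b') (fun kt => let_ (sub_ (mul_ (num_ 4) kt) (num_ 1)) (fun k =>
  let_ (add_ (num_ 5) (add_ b b')) (fun l => let_ (cpow2 l) (fun h =>
  let_ (clg (div_ (num_ 1) (snd_ (snd_ p)))) (fun D =>
  let_ (add_ (num_ 21) (mul_ (num_ 2) (add_ b (add_ b' D)))) (fun R0 =>
  let_ (cpow2 b) (fun M =>
  let_ (mul_ (mul_ (num_ 200) (num_ 200))
          (mul_ (mul_ (mul_ M M) (mul_ kt kt)) (add_ D (num_ 2)))) (fun N =>
  F eps n1 n2 r b kt k l h R0 N))))))))))))))))).

Definition pq_plan : tm := with_params (lv 0)
  (fun eps n1 n2 r b kt k l h R0 N =>
    let rounds := mul_ N (add_ (mul_ (num_ 16) R0) (num_ 1)) in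
    let draws := add_ kt (mul_ (add_ n1 n2) (add_ k (num_ 2))) in
    pair_ (mul_ rounds draws) (pair_ (mul_ rounds draws)
      (mul_ rounds (add_ (mul_ draws (add_ l (num_ 1))) r)))).

Definition pq_fit : tm := with_params (lv 3)
  (fun eps n1 n2 r b kt k l h R0 N =>
    let_ (pair_ (lv 2) (pair_ (lv 1) (lv 0))) (fun s =>
      fst_ (clearn L eps n1 n2 r b kt k l h R0
        (pair_ N (lam (fun=> num_ 0))) s))).

(** The scopes have the sizes 1 and 4 fixed by [plans] and [fits]. Levels count from the far end of
    the environment, so in [pq_fit] the parameter has level 3 and the coins have level 0. *)
Definition pq_learner : learner := Learner (pq_plan 1) (pq_fit 4).

Context {R : realType} {d : measure_display} {X : measurableType d}
  (feat : nat -> X -> R).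
Notation Y := (X * bool)%type.
Notation value := (value R X).
Notation E := (E feat).
Variables (eps eta delta : R) (V T n1 n2 r : nat).

(** The rejection rate [eta + eps] permits the larger of the two, which keeps [kt] below [2 / eps];
    this is why the factor in front of the running time depends on [eps] and [delta] only. *)
Definition eta1 : R := if eta <= eps then eps else eta.
Definition pb : nat := lg (n2%:R : R).
Definition pe : nat := lg (1 / eta1).
Definition pkt : nat := (2 ^ pe)%N.
Definition pk : nat := (4 * pkt - 1)%N.
Definition pl : nat := (5 + (pb + pe))%N.
Definition pD : nat := lg (1 / delta).
(** [2 ^ pR] has to exceed a multiple of [pN / delta]. The squares of [2 ^ pb] and [pkt] match those
    in [pN]; [pD] occurs twice, once for [delta] and once for the factor [pD + 2]. *)
Definition pR : nat := (21 + 2 * (pb + (pe + pD)))%N.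
(** At least [(pD + 2) / kappa]: the inverse of [kappa] is [1600 * M ^ 2 * (1 + 4 * kt) ^ 2], and
    [1 + 4 * kt <= 5 * kt], whence [1600 * 25 = 200 * 200]. *)
Definition pN : nat := (200 * 200 * (2 ^ pb * 2 ^ pb * (pkt * pkt) * (pD + 2)))%N.
Definition param : value := VPair (VNum eps) (VPair (VNum eta) (VNum delta)).

Hypothesis hplan : exists2 j, plans feat L (VNum eps) n1 n2 r j & (j <= T)%N.

Definition paramcost := (T + 100 * (pb + pe + pD) + 1000)%N.

Lemma E_params e p F Q K : E e p (eq param) 1 ->
  (forall e1 i1 i2 i3 i4 i5 i6 i7 i8 i9 i10 i11, below e e1 ->
    look e1 i1 = Some (VNum eps) -> look e1 i2 = Some (VNum n1%:R) ->
    look e1 i3 = Some (VNum n2%:R) -> look e1 i4 = Some (VNum r%:R) ->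
    look e1 i5 = Some (VNum pb%:R) -> look e1 i6 = Some (VNum pkt%:R) ->
    look e1 i7 = Some (VNum pk%:R) -> look e1 i8 = Some (VNum pl%:R) ->
    look e1 i9 = Some (VNum (2 ^ pl)%N%:R) -> look e1 i10 = Some (VNum pR%:R) ->
    look e1 i11 = Some (VNum pN%:R) ->
    E e1 (F (lv i1) (lv i2) (lv i3) (lv i4) (lv i5) (lv i6) (lv i7) (lv i8) (lv i9)
       (lv i10) (lv i11)) Q K) ->
  E e (with_params p F) Q (paramcost + K).
Proof.
move=> hp hF; rewrite /param in hp.
have hp1 := E_fst_eq hp; have hp2 := E_fst_eq (E_snd_eq hp).
have hp3 := E_snd_eq (E_snd_eq hp).
ecost.
  apply: (E_let (Q := eq (VNum eps))); first exact: hp1.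
  move=> e1 i1 _ b1 <- g1.
  apply: (E_let (Q := eq (VNum eta))); first by apply: E_mono _ hp2; bl.
  move=> e2 i2 _ b2 <- g2.
  apply: (E_let (Q := eq (VNum eta1))).
    apply: (E_if (c := eta <= eps)); first go.
    by instantiate (1 := 1%N); rewrite /eta1; case: ifP => _; go.
  move=> e3 i3 _ b3 <- g3.
  apply: (E_let (Q := eq (VPair (VNum n1%:R) (VPair (VNum n2%:R) (VNum r%:R))))).
    instantiate (1 := (T + 3)%N) => e' he'.
    have [j hj jT] := hplan.
    have [v' vv' hv'] := eval_ext hj (XCons (vext_refl (VNum eps)) (XNil e')).
    exists v'.
      inversion vv' as [| | |a a' b b' ha hb| | |]; subst.
      inversion hb as [| | |a2 a2' b2' b3' ha2 hb2| | |]; subst.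
      by inversion ha; inversion ha2; inversion hb2.
    apply: (@ev_le _ _ _ _ _ _ (1.+1 + T).+1); last by lia.
    apply: (ev_let (E_ev (E_mono he' (E_lv (look_mono (below_trans b2 b3) g1))))).
    by exists j.
  move=> e4 i4 _ b4 <- g4.
  apply: (E_let (Q := eq (VNum n1%:R))); first go.
  move=> e5 i5 _ b5 <- g5.
  apply: (E_let (Q := eq (VNum n2%:R))); first go.
  move=> e6 i6 _ b6 <- g6.
  apply: (E_let (Q := eq (VNum r%:R))); first go.
  move=> e7 i7 _ b7 <- g7.
  apply: (E_let (Q := eq (VNum pb%:R))); first by apply: (E_clg (y := n2%:R)); go.
  move=> e8 i8 _ b8 <- g8.
  apply: (E_let (Q := eq (VNum pe%:R))).
    by apply: (E_clg (y := 1 / eta1)); go.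
  move=> e9 i9 _ b9 <- g9.
  apply: (E_let (Q := eq (VNum pkt%:R))); first by apply: E_pow2; go.
  move=> e10 i10 _ b10 <- g10.
  apply: (E_let (Q := eq (VNum pk%:R))).
    gow => _ <-; rewrite -natrM -natrB // muln_gt0 expn_gt0 //.
  move=> e11 i11 _ b11 <- g11.
  apply: (E_let (Q := eq (VNum pl%:R))).
    by gow => _ <-; rewrite !natrD.
  move=> e12 i12 _ b12 <- g12.
  apply: (E_let (Q := eq (VNum (2 ^ pl)%N%:R))); first by apply: E_pow2; go.
  move=> e13 i13 _ b13 <- g13.
  apply: (E_let (Q := eq (VNum pD%:R))).
    apply: (E_clg (y := 1 / delta)); apply: E_div; [exact: E_num|apply: E_mono _ hp3; bl].
  move=> e14 i14 _ b14 <- g14.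
  apply: (E_let (Q := eq (VNum pR%:R))).
    by gow => _ <-; rewrite !(natrD, natrM).
  move=> e15 i15 _ b15 <- g15.
  apply: (E_let (Q := eq (VNum (2 ^ pb)%N%:R))); first by apply: E_pow2; go.
  move=> e16 i16 _ b16 <- g16.
  apply: (E_let (Q := eq (VNum pN%:R))).
    by gow => _ <-; rewrite -!(natrD, natrM).
  move=> e17 i17 _ b17 <- g17.
  by apply: hF; try (by lk); bl.
by rewrite -/pb -/pe -/pD /paramcost /pl; lia.
Qed.

Notation blk := (block n1 n2 pkt pk).
Definition pm : nat := (pN * (16 * pR).+1 * blk)%N.
Definition pr : nat := (pN * (16 * pR).+1 * (blk * pl.+1 + r))%N.

Lemma pq_plans : exists2 j, plans feat pq_learner param pm pm pr j & (j <= paramcost + 100)%N.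
Proof.
have hp : E [:: param] (lv 0) (eq param) 1 by apply: E_lv.
have h : E [:: param] pq_plan
    (eq (VPair (VNum pm%:R) (VPair (VNum pm%:R) (VNum pr%:R)))) (paramcost + 100).
  apply: (E_params hp) => e1 i1 i2 i3 i4 i5 i6 i7 i8 i9 i10 i11
    b1 g1 g2 g3 g4 g5 g6 g7 g8 g9 g10 g11.
  lazy beta zeta; eapply E_weak; [by go| |by []].
  move=> _ <-; rewrite -!(natrD, natrM) /pm /pr /block !addn1 !addn2.
  by [].
by have [_ <- [j hj jK]] := h _ (below_refl _); exists j.
Qed.

Variables (acc : seq Y -> seq X -> seq bool -> bool)
  (hyp : seq Y -> seq X -> seq bool -> X -> bool).
Hypothesis hfit : forall S U w, size S = n1 -> size U = n2 -> size w = r ->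
  exists v j, [/\ fits feat L (VNum eps) S U w v j, (j <= T)%N &
    tds_output feat V%:R v (if acc S U w then Some (hyp S U w) else None)].

Definition fitcost :=
  (paramcost + pN * roundcost T n1 n2 r pb pkt pk pl pR pN + 500)%N.
Definition evalcost := outcost V T n2 pR pN.

Lemma pq_fits S U w hg st :
  run (learn n1 n2 r acc hyp pb pkt pk pl pR pN (fun=> 0)) (S, U, w) = Some (hg, st) ->
  exists2 v, outenc feat evalcost hg v &
    exists2 j, fits feat pq_learner param S U w v j & (j <= fitcost)%N.
Proof.
move=> hrun; pose e : seq value := [:: param; vlist (map vpoint S); vlist (map VPt U);
  vlist (map vbool w)].
have hp : E e (lv 3) (eq param) 1 by apply: E_lv.
have h : E e pq_fit (outenc feat evalcost hg) fitcost.
  rewrite /fitcost -addnA.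
  apply: (E_params hp) => e1 i1 i2 i3 i4 i5 i6 i7 i8 i9 i10 i11
    b1 g1 g2 g3 g4 g5 g6 g7 g8 g9 g10 g11.
  ecost.
    apply: (E_let (Q := eq (vstream (S, U, w)))).
      by apply: E_pair_eq; [apply: E_lv; apply: (look_mono b1)|
        apply: E_pair_eq; apply: E_lv; apply: (look_mono b1)].
    move=> e2 i _ b2 <- hi; apply: E_fst.
    have hl := @I_learn R d X feat L eps V T n1 n2 r pb pkt pk pl pR pN acc hyp
      (lv i1) (lv i2) (lv i3) (lv i4) (lv i5) (lv i6) (lv i7) (lv i8) (lv i9) (lv i10) e1
      (E_lv g1) (E_lv g2) (E_lv g3) (E_lv g4) (E_lv g5) (E_lv g6) (E_lv g7) (E_lv g8)
      (E_lv g9) (E_lv g10) hfit e2 (pair_ (lv i11) (lam (fun=> num_ 0))) (fun=> 0) 3 b2.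
    apply: E_weak (hl _ _ _ _ _ _ (below_refl _) hi hrun) _ (leqnn _).
      eapply E_weak; [apply: E_pair; [go|]| |exact (leqnn _)].
        refine (E_lam_score (D := fun _ : X => 0) (K := 10) _) => e3 i' x b3 hx.
        by apply: (E_weak (E_num 0)).
      by move=> _ [_ [f [-> <- hf]]]; exists f.
    by move=> z [v -> hv]; exists v, (vstream st).
  by lia.
by have [v hv [j hj jK]] := h _ (below_refl _); exists v => //; exists j.
Qed.

End Learner.

(** * Reparametrization of values *)

Section Pull.
Context {R : realType} {d d1 d2 : measure_display} {X : measurableType d}
  {O : measurableType d1} {Z : measurableType d2} (f : Z -> O).
Notation pvalue O := (value (O -> R) (O -> X)).

Fixpoint pull (v : pvalue O) : pvalue Z :=
  match v with
  | VUnit => VUnit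
  | VNum r => VNum (r \o f)
  | VPt x => VPt (x \o f)
  | VPair u v => VPair (pull u) (pull v)
  | VInl v => VInl (pull v)
  | VInr v => VInr (pull v)
  | VClo e t => VClo (map pull e) t
  end.

Fixpoint pull_inst z (v : pvalue O) : inst z (pull v) = inst (f z) v.
Proof.
case: v => [|r|x|u v|v|v|e t] //=; try by rewrite !pull_inst.
congr VClo; move: e; fix IH 1 => -[|v e] //=.
by rewrite (pull_inst z v) (IH e).
Qed.

Hypothesis mf : measurable_fun setT f.

Fixpoint pull_mval (v : pvalue O) : mval v -> mval (pull v).
Proof.
case: v => [|r|x|u v|v|v|e t] //=.
- by move=> mr; exact: measurableT_comp.
- by move=> mx; exact: measurableT_comp.
- by move=> [mu mv]; split; exact: pull_mval.
- exact: (pull_mval v).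
- exact: (pull_mval v).
- move: e; fix IH 1 => -[|v e]; first by [].
  by move=> [mv me]; split; [exact: pull_mval mv|exact: (IH e me)].
Qed.

End Pull.

(** * Success probability of the learner *)

Section Success.
Context {R : realType} {d : measure_display} {X : measurableType d}
  (feat : nat -> X -> R).
Notation Y := (X * bool)%type.
Hypothesis mfeat : forall i, measurable_fun setT (feat i).

Definition says (u : value R X) (x : X) : bool := `[< answers feat u x >].

Lemma says_denotes V u h : denotes feat V u h -> says u = h.
Proof.
by move=> hd; apply/funext => x; apply/asboolP/idP => /(answers_denotes hd).
Qed.

Definition risk_bounds (P Q : probability Y R) (c1 c2 : R) (h g : X -> bool) : Prop :=
  Ex Q (fun y => ((y.2 != h y.1) && g y.1)%:R) <= c1 /\
  Ex P (fun y => (~~ g y.1)%:R) <= c2.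

Lemma measurable_says {d'} {O : measurableType d'} (v : value (O -> R) (O -> X)) :
  mval v -> measurable [set z : O * Y | says (inst z.1 v) z.2.1].
Proof.
move=> mv; have := @measurable_answers _ _ _ feat mfeat _ (O * Y)%type (pull fst v)
  (fun z => z.2.1) (pull_mval measurable_fst mv)
  (measurableT_comp measurable_fst measurable_snd).
rewrite (_ : [set w | _] = [set z : O * Y | says (inst z.1 v) z.2.1]) //.
by apply/seteqP; split => z /=; rewrite pull_inst => /asboolP.
Qed.

(** Both quantities are integrals over [Y] of functions jointly measurable in the parameter and the
    point, since evaluating an output at a point is measurable once [pull] has moved the output to
    [O * Y]. *)
Lemma measurable_risk_bounds {d'} {O : measurableType d'} (P Q : probability Y R) c1 c2
    (v : value (O -> R) (O -> X)) : mval v ->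
  measurable [set o | exists u1 u2, inst o v = VPair u1 u2 /\
    risk_bounds P Q c1 c2 (says u1) (says u2)].
Proof.
case: v => [|r|x|u v|u|u|e t] /= mv;
  try by rewrite (_ : [set o | _] = set0) //; apply/seteqP; split => // o [? [? []]].
have [mu mw] := mv.
have m1 := measurable_says mu; have m2 := measurable_says mw.
have b1 : bm (fun z : O * Y => (says (inst z.1 u) z.2.1)%:R : R) by exact: bm_indic.
have b2 : bm (fun z : O * Y => (says (inst z.1 v) z.2.1)%:R : R) by exact: bm_indic.
have b3 : bm (fun z : O * Y => (z.2.2)%:R : R).
  apply: bm_indic; rewrite (_ : [set z | _] = (snd \o snd) @^-1` [set true]).
    rewrite -[X in measurable X]setTI.
    by apply: (measurableT_comp measurable_snd measurable_snd).
  by apply/seteqP; split => z /=; case: (z.2.2).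
have be : bm (fun z : O * Y => ((z.2.2 != says (inst z.1 u) z.2.1) &&
    says (inst z.1 v) z.2.1)%:R : R).
  rewrite (_ : (fun z => _) = (fun z : O * Y =>
    ((z.2.2)%:R + (says (inst z.1 u) z.2.1)%:R -
     2 * ((z.2.2)%:R * (says (inst z.1 u) z.2.1)%:R)) * (says (inst z.1 v) z.2.1)%:R : R)).
    by apply: bmM => //; apply: bmB; [exact: bmD|apply: bmZ; exact: bmM].
  apply/funext => z; case: (z.2.2); case: (says _ _); case: (says _ _) => /=; lra.
have bg : bm (fun z : O * Y => (~~ says (inst z.1 v) z.2.1)%:R : R).
  rewrite (_ : (fun z => _) = (fun z : O * Y => 1 - (says (inst z.1 v) z.2.1)%:R : R)).
    by apply: bmB => //; exact: bm_cst.
  by apply/funext => z; case: (says _ _) => /=; lra.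
have [me _] := bm_Ex Q be; have [mg _] := bm_Ex P bg.
rewrite (_ : [set o | _] = [set o |
    (Ex Q (fun y => ((y.2 != says (inst o u) y.1) && says (inst o v) y.1)%:R) <= c1) = true /\
    (Ex P (fun y => (~~ says (inst o v) y.1)%:R) <= c2) = true]).
  by apply: measurable_conj; apply: measurable_le_fun => //; exact: measurable_cst.
apply/seteqP; split => o /=; first by move=> [u1 [u2 [[<- <-] [-> ->]]]].
by move=> [h1 h2]; exists (inst o u), (inst o v).
Qed.

Lemma jm_fits L p n1 n2 w (F : value R X -> Prop) :
  (forall d' (O : measurableType d') (v : value (O -> R) (O -> X)),
     mval v -> measurable [set o | F (inst o v)]) ->
  jm (n1 + n2) (fun s : seq Y => (`[< exists k v,
    fits feat L p (take n1 s) (map fst (drop n1 s)) w v k /\ F v >])%:R : R).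
Proof.
move=> mF; apply: (jm_bool (F := fun s => `[< exists k v,
    fits feat L p (take n1 s) (map fst (drop n1 s)) w v k /\ F v >])).
move=> d' O a sa ma; have [m1 m2 e] := map_params n1 ma.
have := @measurable_fits _ _ _ feat mfeat L _ O _ _ w p (fun _ => F) m1 m2 (mF _ O).
rewrite (_ : [set o | exists k v, _] = [set w0 | `[< exists k v,
   fits feat L p (take n1 [seq g w0 | g <- a])
    [seq i.1 | i <- drop n1 [seq g w0 | g <- a]] w v k /\ F v >]]) //.
by apply/seteqP; split => o /=; have [-> ->] := e o => /asboolP.
Qed.

Variables (C : set (X -> bool)) (L : learner) (A eps eta delta : R) (V T n1 n2 r : nat).
Hypothesis A1 : 1 <= A.
Hypothesis eps0 : 0 < eps.
Hypothesis mC : forall f, C f -> measurable_fun setT f.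
Hypothesis hplan : exists2 j, plans feat L (VNum eps) n1 n2 r j & (j <= T)%N.
Hypothesis runs : forall S U w, size S = n1 -> size U = n2 -> size w = r ->
  exists v k o, [/\ fits feat L (VNum eps) S U w v k, tds_output feat V%:R v o & (k <= T)%N].
Hypothesis guarantee : forall Pt Qt : probability Y R,
  ((1 - 100^-1)%:E <= iid_E Pt n1 (fun S => iid_E (marginal Qt) n2 (fun U =>
     iid_E (@fair_coin R) r (fun w => (`[< exists v k o,
       [/\ fits feat L (VNum eps) S U w v k, tds_output feat V%:R v o &
        (forall h, o = Some h ->
           (risk Qt h <= A%:E * lambda C Pt Qt + eps%:E)%E) /\
        ((forall B, measurable B -> marginal Pt B = marginal Qt B) -> o <> None)] >]
         : nat)%:R%:E))))%E.
Variables (P Q : probability Y R).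

Notation Acc := (acc feat L eps).
Notation Hyp := (hyp feat L eps).
Notation b := (@pb R n2).
Notation kt := (pkt eps eta).
Notation k := (pk eps eta).
Notation l := (pl eps eta n2).
Notation R0 := (pR eps eta delta n2).
Notation N := (pN eps eta delta n2).
Notation m := (pm eps eta delta n1 n2).
Notation rr := (pr eps eta delta n1 n2 r).
Notation par := (param eps eta delta).
Notation E1 := (target C A eps P Q k).
Notation code := (learn n1 n2 r Acc Hyp b kt k l R0 N (fun=> 0)).

Lemma kt_gt0 : (0 < kt)%N. Proof. by rewrite expn_gt0. Qed.

Lemma kE : k.+1 = (4 * kt)%N.
Proof. by rewrite /pk subn1 prednK // muln_gt0 kt_gt0. Qed.

Lemma lE : (2 ^ l = 32 * 2 ^ b * kt)%N.
Proof. by rewrite /pl expnD expnD mulnA. Qed.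

Lemma n2_le : (n2 <= 2 ^ b)%N.
Proof. by have := lg_ge (n2%:R : R); rewrite -natrX ler_nat. Qed.

Lemma runs' S U w : size S = n1 -> size U = n2 -> size w = r ->
  exists v k o, fits feat L (VNum eps) S U w v k /\ tds_output feat V%:R v o.
Proof. by move=> sS sU sw; have [v [j [h [? ? _]]]] := runs sS sU sw; exists v, j, h. Qed.

Lemma fit_spec S U w : size S = n1 -> size U = n2 -> size w = r ->
  exists v j, [/\ fits feat L (VNum eps) S U w v j, (j <= T)%N &
    tds_output feat V%:R v (if Acc S U w then Some (Hyp S U w) else None)].
Proof.
move=> sS sU sw; have [v [j [h [hf _ hj]]]] := runs sS sU sw.
exists v, j; split => //.
have [[-> [j' hf']]|[-> [u [j' [hf' hd]]]]] := acc_spec runs' sS sU sw.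
  by have [-> _] := eval_det hf hf'.
by have [-> _] := eval_det hf hf'; exists u.
Qed.

Lemma code_uses : uses code m m rr.
Proof.
apply: uses_learn; first exact: kt_gt0.
by rewrite /pl addnCA leq_addr.
Qed.

Definition failure : R :=
  (1 - kappa b k) ^+ N * energy b k l P Q (fun=> 0) + (4 * N)%:R * 2^-1 ^+ R0.

Lemma code_fail : UB P Q code (fail kt P Q E1) failure.
Proof.
apply: UB_learn.
- by move=> w _; exact: jm_acc.
- exact: n2_le.
- by rewrite /pR.
- exact: kt_gt0.
- exact: kE.
- exact: lE.
- exact: target_ge0.
- by move=> S U w; exact: (hyp_measurable mfeat runs').
- exact: (rejection_same mfeat guarantee).
- by move=> G bG; exact: (sound_sample mfeat A1 mC guarantee).
- exact: bm_cst.
Qed.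

Variables (good : (X -> bool) * (X -> bool) -> Prop) (Vq : R).
Hypothesis hgood : forall hg : (X -> bool) * (X -> bool),
  measurable [set x | hg.1 x] -> measurable [set x | hg.2 x] ->
  risk_bounds P Q (16 * 8 ^+ 4 * E1) (14 / kt%:R) hg.1 hg.2 -> good hg.
Hypothesis hVq : (evalcost eps eta delta V T n2).+3%:R <= Vq.

Lemma output_pq hg v : outenc feat (evalcost eps eta delta V T n2) hg v ->
  pq_output feat Vq v hg.
Proof.
move=> [u1 [u2 [-> h1 h2]]]; exists u1, u2; split => //; exact: vapp_denotes hVq _.
Qed.

Lemma pq_runs S U w : size S = m -> size U = m -> size w = rr ->
  exists hg st v j, [/\ run code (S, U, w) = Some (hg, st),
    fits feat (pq_learner L) par S U w v j, (j <= fitcost eps eta delta T n1 n2 r)%N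
    & pq_output feat Vq v hg].
Proof.
move=> sS sU sw.
have [|||hg [st hr]] := run_uses (st := (S, U, w)) code_uses; rewrite /= ?sS ?sU ?sw //.
have [v hv [j hf hj]] := pq_fits hplan fit_spec hr.
by exists hg, st, v, j; split => //; exact: output_pq.
Qed.

(** A measurable event inside the success event: it bounds integrals of what the output says and
    quantifies over no classifier. The sizes belong to it because [iid_E_le] compares integrands on
    all lists. *)
Definition ok S U w : bool := [&& size S == m, size U == m, size w == rr &
  `[< exists k v, fits feat (pq_learner L) par S U w v k /\ exists u1 u2, v = VPair u1 u2 /\
      risk_bounds P Q (16 * 8 ^+ 4 * E1) (14 / kt%:R) (says u1) (says u2) >]].

Lemma ok_good S U w : ok S U w -> exists v j hg,
  [/\ fits feat (pq_learner L) par S U w v j, pq_output feat Vq v hg & good hg].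
Proof.
move=> /and4P[/eqP sS /eqP sU /eqP sw /asboolP[j [v [hf [u1 [u2 [vE hb]]]]]]].
have [hg [st [v' [j' [_ hf' _ ho]]]]] := pq_runs sS sU sw.
have [vv _] := eval_det hf' hf; subst v'.
exists v, j', hg; split => //; have [w1 [w2 [vE' d1 d2]]] := ho.
rewrite vE in vE'; case: vE' => ? ?; subst w1 w2.
apply: hgood; [exact: denotes_measurable d1|exact: denotes_measurable d2|].
by rewrite -(says_denotes d1) -(says_denotes d2).
Qed.

Theorem pq_succeeds : succeeds feat (pq_output feat Vq) (pq_learner L) par P Q (1 - failure) good.
Proof.
have [j hj _] := @pq_plans L R d X feat eps eta delta T n1 n2 r hplan.
exists m, m, rr, j; split => //.
have jok w : size w = rr -> jm (m + m)
    (fun s : seq Y => (ok (take m s) (map fst (drop m s)) w)%:R : R).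
  move=> sw; apply: jm_ext (jm_fits (pq_learner L) par m m w
    (fun d' O v => measurable_risk_bounds P Q (16 * 8 ^+ 4 * E1) (14 / kt%:R) (v := v))).
  move=> s ss; rewrite /ok size_takel ?ss ?leq_addr // size_map size_drop ss addnK sw.
  by rewrite !eqxx.
apply: (@le_trans _ _ (iid_E P m (fun S => iid_E (marginal Q) m (fun U =>
    iid_E (@fair_coin R) rr (fun w => ((ok S U w)%:R : R)%:E))))); last first.
  apply: iid_E_le => S; first apply: (@iid_E_ge0 _ _ _ (marg Q)) => U.
    rewrite iid_E_coin => [|w]; last exact: ler0n.
    by rewrite lee_fin EC_ge0.
  apply: (@iid_E_le _ _ _ (marg Q)) => U.
    rewrite iid_E_coin => [|w]; last exact: ler0n.
    by rewrite lee_fin EC_ge0.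
  rewrite !iid_E_coin; [|by move=> w; exact: ler0n..].
  rewrite lee_fin; apply: EC_le => w _; rewrite ler_nat.
  case hok : (ok S U w) => //.
  have [v [j' [hg h]]] := ok_good hok; rewrite (_ : asbool _) //.
  by apply/asboolP; exists v, j', hg.
rewrite (iid_E_samples _ _ (f := fun S U w => (ok S U w)%:R)) // lee_fin.
have := UB_transfer (F := fun s w => (ok (take m s) (map fst (drop m s)) w)%:R)
  code_uses jok code_fail.
move=> hT; apply: le_trans (hT _) _.
  move=> S W w a st sS sW sw hr.
  rewrite take_size_cat // drop_size_cat //.
  have sW' : size (map fst W) = m by rewrite size_map.
  have [v hv [i hf _]] := pq_fits hplan fit_spec hr.
  have [w1 [w2 [vE d1 d2]]] := output_pq hv.
  rewrite /fail; case: asboolP => [hb|_]; last by rewrite /= lerBlDr lerDl.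
  rewrite /= (_ : ok _ _ _) ?subrr //; rewrite /ok sS sW' sw !eqxx /=.
  apply/asboolP; exists i, v; split => //; exists w1, w2; split => //.
  by rewrite (says_denotes d1) (says_denotes d2).
rewrite le_eqVlt; apply/orP; left; apply/eqP; apply: eq_EI => S sS.
apply: eq_EI => W sW; apply: eq_EC => w _.
by rewrite take_size_cat // drop_size_cat.
Qed.

End Success.

(** Sixteen of the twenty-one powers of two absorb [200 * 200]; the other five absorb the factor 4,
    the 2 in [z <= 2 * g] and the final half. *)
Lemma tail_bound {R : realType} (M K z g : R) : 0 < M -> 1 <= K -> 0 < g -> z <= 2 * g ->
  4 * (200 * 200 * (M * M * (K * K) * z)) * (2 ^+ 21 * M ^+ 2 * K ^+ 2 * g ^+ 2)^-1 <=
  g^-1 / 2.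
Proof.
have c8 : 200 <= 2 ^+ 8 :> R by rewrite !exprS expr0; lra.
have c0 : 0 <= 200 :> R by [].
move: (200 : R) c8 c0 => c c8 c0 M0 K1 g0 hz.
have c5 : 2 ^+ 5 = 32 :> R by rewrite !exprS expr0; lra.
have q0 : 0 < 2 ^+ 21 :> R by rewrite exprn_gt0.
have hc : 4 * c * c / 2 ^+ 21 <= 1 / 4 :> R.
  rewrite ler_pdivrMr // (_ : 21 = 8 + 8 + 5)%N // !exprD c5.
  have : 0 <= c * c by rewrite mulr_ge0.
  by have := ler_pM c0 c0 c8 c8; move: (2 ^+ 8 * 2 ^+ 8 : R) => e; lra.
move: (2 ^+ 21 : R) q0 hc => q q0 hc.
rewrite [leLHS](_ : _ = z * (4 * c * c / q) / g ^+ 2); last first.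
  by field; rewrite !gt_eqF //; lra.
rewrite ler_pdivrMr ?exprn_gt0 // (_ : _ * g ^+ 2 = g / 2); last first.
  by field; rewrite gt_eqF.
have : 0 <= 4 * c * c / q by rewrite divr_ge0 ?mulr_ge0 // ltW.
by move: hc; move: (_ / q) => r hr r0; nra.
Qed.

Lemma pb_le (R : realType) (n2 m : nat) : (0 < m)%N -> (n2 <= m)%N ->
  ((2 ^ @pb R n2)%N%:R : R) <= 2 * m%:R.
Proof.
move=> m0 nm; rewrite natrX; case: (ltnP 0 n2) => n0.
  apply: le_trans (lg_lt _) _; first by rewrite ler1n.
  by rewrite ler_pM2l // ler_nat.
have -> : n2 = 0%N by lia.
rewrite /pb lg_le1 // expr0; have : (1 : R) <= m%:R by rewrite ler1n.
by lra.
Qed.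

(** * Numerical bounds on the parameters and on the failure probability *)

Section Constants.
Context {R : realType} {d : measure_display} {X : measurableType d}.
Variables (eps eta delta : R) (n2 : nat).
Hypotheses (e01 : 0 < eps < 1) (h01 : 0 < eta < 1) (d01 : 0 < delta < 1).
Notation b := (@pb R n2).
Notation kt := (pkt eps eta).
Notation k := (pk eps eta).
Notation l := (pl eps eta n2).
Notation D := (pD delta).
Notation R0 := (pR eps eta delta n2).
Notation N := (pN eps eta delta n2).
Notation e1 := (eta1 eps eta).

Lemma eta1_bounds : [/\ 0 < e1, e1 < 1, eps <= e1, eta <= e1 & e1 <= eta + eps].
Proof.
move: e01 h01 => /andP[? ?] /andP[? ?]; rewrite /eta1.
by case: (leP eta eps) => ?; split; lra.
Qed.

Lemma pkt_ge : e1^-1 <= kt%:R.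
Proof. by rewrite /pkt natrX -[leLHS]div1r; exact: lg_ge. Qed.

Lemma pkt_le : kt%:R <= 2 / e1.
Proof.
have [p0 p1 _ _ _] := eta1_bounds.
rewrite /pkt natrX -[e1^-1]div1r; apply: lg_lt.
by rewrite ler_pdivlMr // mul1r ltW.
Qed.

Lemma pkt_le_eps : kt%:R <= 2 / eps.
Proof.
have [p0 p1 p2 _ _] := eta1_bounds; apply: le_trans pkt_le _.
by rewrite ler_pM2l // lef_pV2 ?posrE //; case/andP: e01.
Qed.

Lemma pkt_le_eta : kt%:R <= 2 / eta.
Proof.
have [p0 p1 _ p2 _] := eta1_bounds; apply: le_trans pkt_le _.
by rewrite ler_pM2l // lef_pV2 ?posrE //; case/andP: h01.
Qed.

Lemma pD_ge : delta^-1 <= 2 ^+ D.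
Proof. by rewrite -div1r; exact: lg_ge. Qed.

Lemma expR1_le4 : expR 1 <= 4 :> R.
Proof.
have := @expR_ge1Dx R (- (1 / 2)); rewrite expRN => h.
have e0 := expR_gt0 (1 / 2 : R).
have h2 : expR (1 / 2) <= 2 :> R.
  have : 1 / 2 * expR (1 / 2) <= (expR (1 / 2))^-1 * expR (1 / 2) :> R.
    by rewrite ler_pM2r //; move: h; lra.
  by rewrite mulVf ?gt_eqF //; lra.
rewrite (_ : 1 = 1 / 2 + 1 / 2 :> R); last by lra.
by rewrite expRD; nra.
Qed.

Lemma pD_le : D%:R <= 2 * ln delta^-1 + 2.
Proof.
have /andP[d0 d1] := d01; set t := ln _.
have t0 : 0 <= t by rewrite ln_ge0 // invf_ge1 // ltW.
have [j /andP[j1 j2]] : exists j : nat, j%:R <= t < j.+1%:R.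
  by exists (Num.truncn t); rewrite truncn_itv.
apply: (@le_trans _ _ (2 * j.+1)%:R); last first.
  by rewrite natrM -natr1; lra.
(* With [j] the integer part of [ln delta^-1], the inequality [expR 1 <= 4] bounds [delta^-1] by
   [2 ^+ (2 * j.+1)]. *)
rewrite ler_nat; apply: lg_min; rewrite div1r.
have -> : delta^-1 = expR t by rewrite lnK // posrE invr_gt0.
apply: (@le_trans _ _ (expR j.+1%:R)); first by rewrite ler_expR ltW.
rewrite -[j.+1%:R]mul1r expRM_natr exprM; apply: lerXn2r.
- by rewrite nnegrE expR_ge0.
- by rewrite nnegrE.
- by apply: le_trans expR1_le4 _; lra.
Qed.

Variables (P Q : probability (X * bool)%type R).

Let M0 : 0 < ((2 ^ b)%N%:R : R). Proof. by rewrite ltr0n expn_gt0. Qed.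
Let kt1 : 1 <= kt%:R :> R. Proof. by rewrite ler1n kt_gt0. Qed.

Let cE : @cB R k = 1 + 4 * kt%:R.
Proof. by rewrite /cB kE natrM. Qed.

(** The zero score has potential [cB * h / 4]. With [h = 32 * M * kt], multiplying by [sc] leaves
    [kt / (5 * (1 + 4 * kt))], which is bounded independently of all parameters. *)
Lemma energy_init : energy b k l P Q (fun=> 0) <= expR 1.
Proof.
rewrite /energy ler_expR /Phi /sc /drift.
have M0' := M0; have kt1' := kt1.
have h0 : 0 < (2 ^ l)%:R :> R by rewrite ltr0n expn_gt0.
rewrite (eq_Ex Q (_ : _ =1 (fun y => (2 ^ l)%:R / 4))); last first.
  by move=> y /=; rewrite phi0 // subr0.
rewrite (eq_Ex P (_ : _ =1 (fun y => (2 ^ l)%:R / 4))); last first.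
  by move=> y /=; rewrite phi0.
rewrite !Ex_cst cE lE kE !natrM.
move: M0' kt1'; move: ((2 ^ b)%:R : R) (kt%:R : R) => M K M0' K1.
rewrite (_ : _ * _ = K / (5 * (1 + 4 * K))); last first.
  by field; rewrite !gt_eqF //; lra.
by rewrite ler_pdivrMr; lra.
Qed.

Lemma kappa_rounds : (D + 2)%:R <= @kappa R b k * N%:R.
Proof.
rewrite /kappa /drift cE /pN !natrM.
have M0' := M0; have kt1' := kt1.
move: M0' kt1'; move: ((2 ^ b)%:R : R) (kt%:R : R) => M K M0' K1.
set z := (D + 2)%:R; have z0 : 0 <= z by [].
rewrite (_ : _ * _ = z * (25 * K ^+ 2 / (1 + 4 * K) ^+ 2)); last first.
  by field; rewrite !gt_eqF //; lra.
rewrite -[leLHS]mulr1; apply: ler_wpM2l => //.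
rewrite ler_pdivlMr ?mul1r; last by rewrite exprn_gt0; lra.
by rewrite !expr2; nra.
Qed.

Lemma pow_linear j : ((j + 2)%:R : R) <= 2 * 2 ^+ j.
Proof.
elim: j => [|j IH]; first by rewrite expr0 mulr1.
have : 1 <= 2 ^+ j :> R by rewrite exprn_ege1 // ler1n.
by rewrite exprS addSn -natr1; move: IH; move: (_ ^+ _) => z; lra.
Qed.

(** Each of the two terms is at most half of [2 ^- D]. For the first, [1 - kappa <= expR (- kappa)]
    and [kappa * N >= D + 2] leave [expR (- (D + 1))] after the initial energy is paid, and
    [expR 1 >= 2]. *)
Lemma failure_le : failure eps eta delta n2 P Q <= delta.
Proof.
have /andP[d0 d1] := d01.
have dD : (2 ^+ D)^-1 <= delta.
  by rewrite -[leRHS]invrK lef_pV2 ?posrE ?exprn_gt0 ?invr_gt0 //; exact: pD_ge.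
have e2 : 2 <= expR 1 :> R by have := @expR_ge1Dx R 1; lra.
have first : (1 - kappa b k) ^+ N * energy b k l P Q (fun=> 0) <= (2 ^+ D)^-1 / 2.
  apply: (@le_trans _ _ (expR (- (D + 2)%:R) * expR 1)).
    apply: ler_pM; [by rewrite exprn_ge0 ?kappa01|exact: expR_ge0| |exact: energy_init].
    apply: (@le_trans _ _ (expR (- kappa b k) ^+ N)).
      apply: lerXn2r; rewrite ?nnegrE ?kappa01 ?expR_ge0 //.
      exact: expR_ge1Dx.
    by rewrite -expRM_natr ler_expR mulNr lerN2 kappa_rounds.
  rewrite -expRD (_ : _ + 1 = - D.+1%:R); last by rewrite natrD -natr1; lra.
  rewrite expRN -[D.+1%:R]mul1r expRM_natr -invfM lef_pV2 ?posrE.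
  - rewrite mulrC -exprS; apply: lerXn2r; rewrite ?nnegrE //.
  - by rewrite exprn_gt0 ?expR_gt0.
  - by rewrite mulr_gt0 // exprn_gt0.
have pE : 2^-1 ^+ R0 = (2 ^+ 21 * (2 ^ b)%:R ^+ 2 * kt%:R ^+ 2 * (2 ^+ D) ^+ 2)^-1 :> R.
  rewrite exprVn; congr (_^-1); rewrite /pR /pkt !natrX -!exprM -!exprD.
  by congr (_ ^+ _); rewrite !mulnDr; lia.
have second : (4 * N)%:R * 2^-1 ^+ R0 <= (2 ^+ D)^-1 / 2 :> R.
  have hp := pow_linear D; have g0 : 0 < 2 ^+ D :> R by rewrite exprn_gt0.
  have NE : (4 * N)%:R = 4 * (200 * 200 * ((2 ^ b)%:R * (2 ^ b)%:R * (kt%:R * kt%:R) *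
      (D + 2)%:R)) :> R by rewrite /pN !natrM.
  by rewrite pE NE; exact: tail_bound.
by rewrite /failure; apply: le_trans (lerD first second) _; rewrite -splitr.
Qed.

End Constants.

(** * A calculus of cost bounds *)

Section Growth.
Context {R : realType}.
Variables (W mu : R).
Hypotheses (W3 : 3 <= W) (mu1 : 1 <= mu).

(** For time bounds [mu] is the sample size of the given learner, whose exponent has to come out
    right; [W] collects the dependence on [eps] and [delta] with generous exponents, and [tau] is
    the time of the given learner, which may occur only linearly. The sample bound takes [mu = 1]
    and puts everything in [W]. *)
Definition bnd (tau : R) i j (n : nat) : Prop :=
  n%:R <= tau * (W ^+ i * mu ^+ j).

Let W0 : 0 <= W. Proof. by move: W3; lra. Qed.
Let mu0 : 0 <= mu. Proof. by move: mu1; lra. Qed.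

Lemma grow_ge1 i j : 1 <= W ^+ i * mu ^+ j.
Proof. by rewrite mulr_ege1 ?exprn_ege1 //; move: W3; lra. Qed.

Lemma grow_le i j i' j' : (i <= i')%N -> (j <= j')%N ->
  W ^+ i * mu ^+ j <= W ^+ i' * mu ^+ j'.
Proof.
move=> hi hj; apply: ler_pM; rewrite ?exprn_ge0 //; apply: ler_weXn2l => //.
by move: W3; lra.
Qed.

Lemma bnd_le tau i j i' j' n : bnd tau i j n -> (i <= i')%N -> (j <= j')%N ->
  bnd tau i' j' n.
Proof.
move=> h hi hj; have [t0|t0] := leP 0 tau.
  by apply: le_trans h _; apply: ler_wpM2l => //; exact: grow_le.
have : n%:R < (0 : R).
  apply: le_lt_trans h _; rewrite nmulr_rlt0 //.
  by apply: lt_le_trans (grow_ge1 i j); lra.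
by rewrite ltrn0.
Qed.

Lemma bnd_weak tau i j n : 1 <= tau -> bnd 1 i j n -> bnd tau i j n.
Proof.
move=> t1 h; apply: le_trans h _; apply: ler_wpM2r => //.
by apply: le_trans (grow_ge1 i j); lra.
Qed.

(** The factor 2 of a sum of two bounded terms is paid with one power of [W]. *)
Lemma bndD tau i j i' j' n n' : bnd tau i j n -> bnd tau i' j' n' ->
  bnd tau (maxn i i').+1 (maxn j j') (n + n').
Proof.
move=> h h'; have := bnd_le h (leq_maxl i i') (leq_maxl j j').
have := bnd_le h' (leq_maxr i i') (leq_maxr j j').
rewrite /bnd => hy hx; rewrite natrD exprS -mulrA mulrCA; set z := tau * _ in hy hx *.
have z0 : 0 <= z := le_trans (ler0n _ _) hx.
apply: (@le_trans _ _ (2 * z)); first by move: hx hy; lra.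
by apply: ler_wpM2r => //; move: W3; lra.
Qed.

Lemma bndM tau i j i' j' n n' : bnd 1 i j n -> bnd tau i' j' n' ->
  bnd tau (i + i') (j + j') (n * n').
Proof.
rewrite /bnd mul1r natrM !exprD => h h'.
rewrite (_ : tau * _ = (W ^+ i * mu ^+ j) * (tau * (W ^+ i' * mu ^+ j'))); last by ring.
exact: ler_pM.
Qed.

(** [2187 = 3 ^ 7] and [W >= 3]. *)
Lemma bnd_cst n : (n <= 2187)%N -> bnd 1 7 0 n.
Proof.
move=> hn; rewrite /bnd mul1r expr0 mulr1; apply: (@le_trans _ _ (3 ^+ 7)).
  by rewrite -natrX ler_nat.
by apply: lerXn2r; rewrite ?nnegrE //.
Qed.

End Growth.

(** Follows the syntax of the expression. In a product only the right factor may carry [tau], which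
    is why some products are commuted before the call. *)
Ltac bb := match goal with
  | H : bnd _ _ _ _ _ ?n |- bnd _ _ _ _ _ ?n => first [exact H |
      eapply bnd_weak; [assumption|assumption|assumption|exact H]]
  | |- _ => lazymatch goal with
    | |- bnd _ _ _ _ _ (_ + _) => eapply bndD; [assumption|assumption|bb|bb]
    | |- bnd _ _ _ _ _ (_ * _) => eapply bndM; [bb|bb]
    | |- _ => first [eapply bnd_cst; [assumption|exact isT] |
       eapply bnd_weak; [assumption|assumption|assumption|
         eapply bnd_cst; [assumption|exact isT]]]
    end
  end.
Ltac bnd := eapply bnd_le; [assumption|assumption|bb|exact isT|exact isT].

Section Costs.
Context {R : realType}.
Variables (W mu tau : R) (V T n1 n2 r b e kt k l D R0 N : nat).
Hypotheses (W3 : 3 <= W) (mu1 : 1 <= mu) (tau1 : 1 <= tau).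
Notation bn := (bnd W mu).
Hypotheses (hM : bn 1 2 1 (2 ^ b)) (hb : bn 1 2 1 b) (he : bn 1 2 0 e) (hkt : bn 1 2 0 kt)
  (hk : bn 1 9 0 k.+1) (hD : bn 1 2 0 D) (hn : bn 1 1 1 (n1 + n2)).
Hypotheses (hT : bn tau 0 0 T) (hV : bn tau 0 0 V) (hn2 : bn tau 0 0 n2) (hr : bn tau 0 0 r).

Lemma rounds_bnd : bn 1 40 2 (200 * 200 * (2 ^ b * 2 ^ b * (kt * kt) * (D + 2))).
Proof. by bnd. Qed.

Lemma level_bnd : bn 1 10 1 (5 + (b + e)).
Proof. by bnd. Qed.

Lemma trials_bnd : bn 1 15 1 (21 + 2 * (b + (e + D))).
Proof. by bnd. Qed.

Hypotheses (hl : bn 1 10 1 l) (hR0 : bn 1 15 1 R0) (hN : bn 1 40 2 N).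

Lemma block_bnd : bn 1 15 1 (block n1 n2 kt k).
Proof. by rewrite /block -[k.+2]addn1; bnd. Qed.

Lemma rounds_trials_bnd : bn 1 70 3 (N * (16 * R0).+1).
Proof. by rewrite -[(16 * R0).+1]addn1; bnd. Qed.

Lemma samples_bnd : bn 1 100 4 (N * (16 * R0).+1 * block n1 n2 kt k).
Proof. by move: block_bnd rounds_trials_bnd => h1 h2; bnd. Qed.

Lemma coins_bnd : bn tau 120 5 (N * (16 * R0).+1 * (block n1 n2 kt k * l.+1 + r)).
Proof.
by rewrite -[l.+1]addn1; move: block_bnd rounds_trials_bnd => h1 h2; bnd.
Qed.

Lemma stepcost_bnd : bn tau 12 0 (stepcost T n2).
Proof. by rewrite /stepcost (mulnC n2); bnd. Qed.

Lemma scorecost_bnd : bn tau 60 2 (scorecost T n2 N).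
Proof. by rewrite /scorecost; move: stepcost_bnd => h; bnd. Qed.

Lemma bitcost_bnd : bn tau 70 2 (bitcost l (scorecost T n2 N)).
Proof. by rewrite /bitcost; move: scorecost_bnd => h; bnd. Qed.

Lemma samcost_bnd : bn tau 90 3 (samcost n1 n2 r k l (scorecost T n2 N)).
Proof. by rewrite /samcost (mulnC r); move: bitcost_bnd => h; bnd. Qed.

Lemma trialcost_bnd : bn tau 100 3 (trialcost T n1 n2 r kt k l (scorecost T n2 N)).
Proof.
by rewrite /trialcost; move: bitcost_bnd samcost_bnd => h h'; bnd.
Qed.

Lemma psicost_bnd : bn tau 100 3 (psicost n1 n2 r b k l (scorecost T n2 N)).
Proof. by rewrite /psicost (mulnC r); move: bitcost_bnd => h; bnd. Qed.

(** Four powers of [mu]: one for the number of trials, a logarithm bounded crudely, one for the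
    sample size and two for the length of the score chain. *)
Lemma roundcost_bnd : bn tau 140 4 (roundcost T n1 n2 r b kt k l R0 N).
Proof.
by rewrite /roundcost; move: trialcost_bnd psicost_bnd => h h'; bnd.
Qed.

Lemma outcost_bnd : bn tau 100 2 (outcost V T n2 R0 N).
Proof. by rewrite /outcost; move: scorecost_bnd => h; bnd. Qed.

Lemma paramcost_bnd : bn tau 20 1 (T + 100 * (b + e + D) + 1000).
Proof. by bnd. Qed.

Lemma totalcost_bnd : bn tau 200 6
  ((T + 100 * (b + e + D) + 1000 + 100) +
   (N * (16 * R0).+1 * block n1 n2 kt k + N * (16 * R0).+1 * block n1 n2 kt k +
    N * (16 * R0).+1 * (block n1 n2 kt k * l.+1 + r)) +
   (T + 100 * (b + e + D) + 1000 + N * roundcost T n1 n2 r b kt k l R0 N + 500)).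
Proof.
move: paramcost_bnd samples_bnd coins_bnd roundcost_bnd.
move: (T + _)%N (N * _ * block _ _ _ _)%N (N * (16 * R0).+1 * (_ + _))%N
  (roundcost _ _ _ _ _ _ _ _ _ _).
by move=> x1 x2 x3 x4 h1 h2 h3 h4; bnd.
Qed.

End Costs.

Section ParamCosts.
Context {R : realType}.
Variables (W mu tau eps eta delta : R) (V T n1 n2 r : nat).
Hypotheses (W3 : 3 <= W) (mu1 : 1 <= mu) (tau1 : 1 <= tau).
Notation bn := (bnd W mu).
Notation b := (@pb R n2).
Notation kt := (pkt eps eta).
Hypotheses (hM : ((2 ^ b)%N%:R : R) <= 2 * W * mu) (hkt : kt%:R <= 2 * W)
  (hD : (pD delta)%:R <= 2 * W) (hn : ((n1 + n2)%:R : R) <= W * mu).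

Let W2 : 2 * W <= W ^+ 2.
Proof. by move: W3; rewrite expr2; nra. Qed.

Let b2 : bn 1 2 1 (2 ^ b).
Proof.
apply: le_trans hM _; rewrite mul1r expr1; apply: ler_wpM2r => //.
by move: mu1; lra.
Qed.

Let b1 : bn 1 2 1 b.
Proof. by apply: le_trans b2; rewrite ler_nat ltnW // ltn_expl. Qed.

Let bkt : bn 1 2 0 kt.
Proof. by rewrite /bnd mul1r expr0 mulr1; exact: le_trans W2. Qed.

Let be : bn 1 2 0 (pe eps eta).
Proof. by apply: le_trans bkt; rewrite ler_nat ltnW // ltn_expl. Qed.

Let bD : bn 1 2 0 (pD delta).
Proof. by rewrite /bnd mul1r expr0 mulr1; exact: le_trans W2. Qed.

Let bk : bn 1 9 0 (pk eps eta).+1.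
Proof.
rewrite kE; apply: (bnd_le W3 mu1 (i := 7 + 2) (j := 0 + 0)) => //.
by apply: bndM bkt; exact: bnd_cst.
Qed.

Let bnn : bn 1 1 1 (n1 + n2).
Proof. by rewrite /bnd mul1r !expr1. Qed.

Let bl : bn 1 10 1 (pl eps eta n2) := level_bnd W3 mu1 b1 be.
Let bR : bn 1 15 1 (pR eps eta delta n2) := trials_bnd W3 mu1 b1 be bD.
Let bN : bn 1 40 2 (pN eps eta delta n2) := rounds_bnd W3 mu1 b2 bkt bD.

Lemma pm_bnd : bn 1 100 4 (pm eps eta delta n1 n2).
Proof. exact: samples_bnd. Qed.

Hypotheses (hT : bn tau 0 0 T) (hV : bn tau 0 0 V) (hn2 : bn tau 0 0 n2) (hr : bn tau 0 0 r).

Lemma time_bnd : bn tau 200 6 (paramcost eps eta delta T n2 + 100 +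
  (pm eps eta delta n1 n2 + pm eps eta delta n1 n2 + pr eps eta delta n1 n2 r) +
  fitcost eps eta delta T n1 n2 r).
Proof. exact: totalcost_bnd. Qed.

Lemma evalcost_bnd : bn tau 200 6 (evalcost eps eta delta V T n2).+3.
Proof.
have h : bn tau 100 2 (evalcost eps eta delta V T n2) by exact: outcost_bnd.
rewrite -[(evalcost _ _ _ _ _ _).+3]addn3.
refine (@bnd_le _ W mu W3 mu1 tau 101 2 200 6 _ _ isT isT).
exact: (bndD W3 mu1 h (bnd_weak W3 mu1 tau1 (bnd_cst mu W3 (n := 3) isT))).
Qed.

End ParamCosts.

Lemma eval_gt0 {R : realType} {X} (feat : nat -> X -> R) e t v k :
  Defs.eval feat e t v k -> (0 < k)%N.
Proof. by case. Qed.

(** * From weighted bounds to the required error and rejection rates *)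

Section Goodness.
Context {R : realType} {d : measure_display} {X : measurableType d}.
Notation Y := (X * bool)%type.
Variables (C : set (X -> bool)) (A eps eta : R) (P Q : probability Y R).
Hypotheses (A1 : 1 <= A) (e01 : 0 < eps < 1) (h01 : 0 < eta < 1).

Lemma measurable_of_bm (b : Y -> bool) : bm (fun y => (b y)%:R : R) ->
  measurable [set y | b y].
Proof.
move=> [mb _]; rewrite (_ : [set y | _] = [set y | ((1 : R) <= (b y)%:R) = true]).
  by apply: measurable_le_fun => //; exact: measurable_cst.
by apply/seteqP; split => y /=; case: (b y) => //=; rewrite ?lexx // ler10.
Qed.

(** [B + 2 = 4 * kt + 2] is at most [10 / eta], and [16 * 8 ^ 4 * 10] is below [10 ^ 6]. *)
Lemma target_le : lambda C P Q \is a fin_num ->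
  16 * 8 ^+ 4 * target C A eps P Q (pk eps eta) <=
  A * 10 ^+ 6 * (fine (lambda C P Q) * eta^-1 + eps).
Proof.
move=> hfin; rewrite /target hfin kE natrM; set lam := fine _.
have lam0 : 0 <= lam by exact: fine_ge0 (lambda_ge0 C P Q).
have /andP[h0 h1] := h01; have /andP[e0 _] := e01.
have i1 : 1 <= eta^-1 by rewrite invf_ge1 // ltW.
have hk : 4 * (pkt eps eta)%:R + 2 <= 10 * eta^-1.
  by have := pkt_le_eta e01 h01; lra.
have A0 : 0 <= A by move: A1; lra.
have h : A * (4 * (pkt eps eta)%:R + 2) * lam <= 10 * (A * (lam * eta^-1)).
  rewrite (_ : 10 * _ = A * (10 * eta^-1) * lam); last by ring.
  by apply: ler_wpM2r => //; apply: ler_wpM2l.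
have q0 : 0 <= A * (lam * eta^-1) by rewrite !mulr_ge0 // ltW // invr_gt0.
have eA : eps <= A * eps by rewrite ler_peMl // ltW.
have e8 : 8 ^+ 4 = 4096 :> R by rewrite !exprS expr0; lra.
have e10 : 10 ^+ 6 = 1000 * 1000 :> R by rewrite !exprS expr0; lra.
rewrite e8 e10.
rewrite [leRHS](_ : _ = 1000 * 1000 * (A * (lam * eta^-1)) + 1000 * 1000 * (A * eps));
  last by ring.
move: h q0 eA; move: (_ * lam) (A * (lam * _)) (A * eps) => x q y.
by move: e0; lra.
Qed.

Lemma rejection_le : 14 / (pkt eps eta)%:R <= A * 10 ^+ 6 * (eta + eps).
Proof.
have [p0 p1 p2 p3 p4] := eta1_bounds e01 h01.
have hk := pkt_ge eps eta.
have : (pkt eps eta)%:R^-1 <= eta1 eps eta.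
  rewrite -[leRHS]invrK lef_pV2 ?posrE ?invr_gt0 //.
  by apply: lt_le_trans hk; rewrite invr_gt0.
have e10 : 14 <= A * 10 ^+ 6 :> R.
  have : 14 <= 10 ^+ 6 :> R by rewrite !exprS expr0; lra.
  by move: A1; move: (10 ^+ 6 : R) => z; nra.
have s0 : 0 <= eta + eps by lra.
move=> h; apply: (@le_trans _ _ (14 * (eta + eps))); first by lra.
exact: ler_wpM2r.
Qed.

Lemma good_output (hg : (X -> bool) * (X -> bool)) :
  measurable [set x | hg.1 x] -> measurable [set x | hg.2 x] ->
  risk_bounds P Q (16 * 8 ^+ 4 * target C A eps P Q (pk eps eta))
    (14 / (pkt eps eta)%:R) hg.1 hg.2 ->
  (Q [set z | (z.2 != hg.1 z.1) && hg.2 z.1] <=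
     (A * 10 ^+ 6)%:E * (lambda C P Q * (eta^-1)%:E + eps%:E))%E /\
  (marginal P [set x | hg.2 x = false] <= (A * 10 ^+ 6 * (eta + eps))%:E)%E.
Proof.
move=> m1 m2 [h1 h2].
have b2 : bm (fun y : Y => (hg.2 y.1)%:R : R) := bm_fst (bm_indic m2).
have be : bm (fun y : Y => ((y.2 != hg.1 y.1) && hg.2 y.1)%:R : R).
  rewrite (_ : (fun y => _) = (fun y : Y => ((hg.1 y.1 != y.2)%:R : R) * (hg.2 y.1)%:R)).
    by apply: bmM => //; exact: bm_err.
  by apply/funext => y; rewrite -natrM mulnb eq_sym.
have bn : bm (fun y : Y => (~~ hg.2 y.1)%:R : R).
  rewrite (_ : (fun y => _) = (fun y : Y => 1 - (hg.2 y.1)%:R : R)).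
    by apply: bmB => //; exact: bm_cst.
  by apply/funext => y; case: (hg.2 y.1) => /=; lra.
split.
  rewrite Ex_indic; last exact: measurable_of_bm.
  have K0 : 0 < A * 10 ^+ 6 by rewrite mulr_gt0 ?exprn_gt0 //; move: A1; lra.
  have i0 : 0 < eta^-1 by rewrite invr_gt0; case/andP: h01.
  have [hfin|] := boolP (lambda C P Q \is a fin_num).
    apply: (@le_trans _ _ (A * 10 ^+ 6 * (fine (lambda C P Q) * eta^-1 + eps))%:E).
      by rewrite lee_fin; exact: le_trans h1 (target_le hfin).
    have -> : lambda C P Q = (fine (lambda C P Q))%:E by rewrite fineK.
    exact: lexx.
  rewrite ge0_fin_numE ?lambda_ge0 // ltey negbK => /eqP ->.
  by rewrite mulyr gtr0_sg // mul1e addye // mulry gtr0_sg // mul1e leey.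
rewrite (_ : marginal P _ = P [set y | ~~ hg.2 y.1]); last first.
  by congr (P _); apply/seteqP; split => y /=; case: (hg.2 y.1).
rewrite Ex_indic; last exact: measurable_of_bm.
by rewrite lee_fin; exact: le_trans h2 rejection_le.
Qed.

End Goodness.

Theorem theoremC4 (R : realType) (A : R) (hA : 1 <= A) :
  exists (K : R) (k : nat) (c : R -> R -> R),
  forall (d : measure_display) (X : measurableType d) (feat : nat -> X -> R)
    (C : set (X -> bool)) (L : learner) (T V m : R -> nat),
    (forall i, measurable_fun setT (feat i)) ->
    (forall f, C f -> measurable_fun setT f) ->
    agnostic_tds_learner feat C A L T V m ->
    (forall eps, 0 < eps < 1 -> (0 < m eps)%N) ->
  exists P : learner,
  forall eps eta delta : R, 0 < eps < 1 -> 0 < eta < 1 -> 0 < delta < 1 ->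
    let softO := c eps delta * (m eps)%:R ^+ 6 * (1 + ln (m eps)%:R) ^+ k in
    let poly :=
      K * (1 + (m eps)%:R + eps^-1 + eta^-1 + ln (delta^-1)) ^+ k in
    agnostic_pq_learner feat C P eps eta delta
      (fun lam => (K%:E * (lam * (eta^-1)%:E + eps%:E))%E)
      (K * (eta + eps))
      ((T eps)%:R * softO + poly)
      ((T eps + V eps)%:R * softO + poly)
      poly.
Proof.
(* The third witness is [W ^+ 200] for the base [W] of the time bounds. The exponents 200 and 400
   exceed those produced by the growth calculus. *)
exists (A * 10 ^+ 6), 400%N, (fun eps delta => (3 + 2 / eps + (pD delta)%:R) ^+ 200).
move=> d X feat C L T V m mfeat mC hL hm; exists (pq_learner L).
move=> eps eta delta e01 h01 d01 softO poly.
have /andP[e0 e1] := e01; have /andP[h0 h1] := h01; have /andP[d0 d1] := d01.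
have [[n1 [n2 [r [k1 [hpl hnm hrun]]]]] hsuc] := hL eps e01.
rewrite ler_nat in hnm.
(* One run on dummy lists shows that planning and drawing fit in [T eps], so [T eps] also bounds the
   numbers of samples and of coins. *)
have [v0 [j0 [x0 [hf0 _]]]] := hrun (nseq n1 (point, true)) (nseq n2 point) (nseq r true)
  (size_nseq _ _) (size_nseq _ _) (size_nseq _ _).
rewrite ler_nat => hT0.
have k10 : (0 < k1)%N := eval_gt0 hpl.
have hplan : exists2 j, plans feat L (VNum eps) n1 n2 r j & (j <= T eps)%N.
  by exists k1 => //; apply: leq_trans hT0; rewrite -addnA leq_addr.
have runs S U w : size S = n1 -> size U = n2 -> size w = r ->
    exists v k o, [/\ fits feat L (VNum eps) S U w v k, tds_output feat (V eps)%:R v o &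
      (k <= T eps)%N].
  move=> sS sU sw; have [v [j [h [hf hh]]]] := hrun S U w sS sU sw.
  by rewrite ler_nat => hj; exists v, j, h; split => //; apply: leq_trans hj; exact: leq_addl.
have guarantee (Pt Qt : probability (X * bool)%type R) := hsuc Pt Qt.
(* The guarantee quantifies its own sample sizes; determinism of [plan] identifies them with those
   of the resource bound. *)
have {}guarantee (Pt Qt : probability (X * bool)%type R) :
  ((1 - 100^-1)%:E <= iid_E Pt n1 (fun S => iid_E (marginal Qt) n2 (fun U =>
     iid_E (@fair_coin R) r (fun w => (`[< exists v k o,
       [/\ fits feat L (VNum eps) S U w v k, tds_output feat (V eps)%:R v o &
        (forall h, o = Some h ->
           (risk Qt h <= A%:E * lambda C Pt Qt + eps%:E)%E) /\
        ((forall B, measurable B -> marginal Pt B = marginal Qt B) -> o <> None)] >]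
         : nat)%:R%:E))))%E.
  have [m1 [m2 [m3 [k2 [hpl2 hg]]]]] := guarantee Pt Qt.
  have [[/eqP c1 /eqP c2 /eqP c3] _] := eval_det hpl hpl2.
  by rewrite !eqr_nat in c1 c2 c3; rewrite (eqP c1) (eqP c2) (eqP c3).
have m0 : 1 <= (m eps)%:R :> R by rewrite ler1n hm.
have ln0 : 0 <= ln (delta^-1) by rewrite ln_ge0 // invf_ge1 // ltW.
have ie : 1 <= eps^-1 by rewrite invf_ge1 // ltW.
have ih : 1 <= eta^-1 by rewrite invf_ge1 // ltW.
have n2m : (n2 <= m eps)%N by apply: leq_trans hnm; exact: leq_addl.
have hM := pb_le R (hm eps e01) n2m.
have hn : (n1 + n2)%:R <= (m eps)%:R :> R by rewrite ler_nat.
pose Z : R := 1 + (m eps)%:R + eps^-1 + eta^-1 + ln (delta^-1).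
have K1 : 1 <= A * 10 ^+ 6.
  have : 1 <= 10 ^+ 6 :> R by rewrite exprn_ege1 // ler1n.
  by move: hA; move: (10 ^+ 6 : R) => z; nra.
have poly0 : 0 <= poly by rewrite /poly mulr_ge0 ?exprn_ge0 //; lra.
have samples : (pm eps eta delta n1 n2 + pm eps eta delta n1 n2)%:R <= poly.
  (* Polynomial growth suffices for the number of samples, so [Z] plays the role of [W] and absorbs
     [m eps] as well. *)
  have Z3 : 3 <= Z by rewrite /Z; lra.
  have h : bnd Z 1 1 100 4 (pm eps eta delta n1 n2).
    apply: pm_bnd => //.
    - by rewrite mulr1; apply: le_trans hM _; rewrite /Z; lra.
    - by apply: le_trans (pkt_le_eta e01 h01) _; rewrite /Z; lra.
    - by apply: le_trans (pD_le d01) _; rewrite /Z; lra.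
    - by rewrite mulr1; apply: le_trans hn _; rewrite /Z; lra.
  have Z1 : 1 <= Z by lra.
  apply: le_trans (bndD Z3 (lexx 1) h h) _.
  rewrite mul1r expr1n mulr1 /poly -/Z.
  apply: (@le_trans _ _ (Z ^+ 400)); first exact: ler_weXn2l.
  by rewrite ler_peMl // exprn_ge0 // ltW // (lt_le_trans _ Z1).
pose W : R := 3 + 2 / eps + (pD delta)%:R.
have D0 : 0 <= (pD delta)%:R :> R by [].
have W3 : 3 <= W by rewrite /W; lra.
have s1 : W ^+ 200 * (m eps)%:R ^+ 6 <= softO.
  rewrite /softO -/W ler_peMr ?exprn_ege1 //.
    by rewrite mulr_ge0 ?exprn_ge0 //; lra.
  by rewrite lerDl ln_ge0.
have hM' : ((2 ^ pb (R := R) n2)%N%:R : R) <= 2 * W * (m eps)%:R.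
  by apply: le_trans hM _; apply: ler_wpM2r => //; lra.
have hkt : (pkt eps eta)%:R <= 2 * W.
  by apply: le_trans (pkt_le_eps e01 h01) _; rewrite /W; lra.
have hD : (pD delta)%:R <= 2 * W by rewrite /W; lra.
have hn' : (n1 + n2)%:R <= W * (m eps)%:R.
  by apply: le_trans hn _; rewrite ler_peMl //; lra.
have b00 (t x : nat) : (x <= t)%N -> bnd W (m eps)%:R t%:R 0 0 x.
  by move=> xt; rewrite /bnd !expr0 !mulr1 ler_nat.
have nn2 : (n1 + n2 <= T eps)%N.
  by apply: leq_trans hT0; rewrite -[X in (_ <= X)%N]addnA addnCA -[X in (_ <= X)%N]addnA leq_addr.
have Tn2 : (n2 <= T eps)%N by apply: leq_trans nn2; exact: leq_addl.
have Tr : (r <= T eps)%N.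
  apply: leq_trans hT0; apply: leq_trans (leq_addr _ _); apply: leq_trans (leq_addl _ _).
  exact: leq_addl.
have T1 : 1 <= (T eps)%:R :> R.
  by rewrite ler1n; apply: leq_trans hT0; rewrite !addn_gt0 k10.
have TV1 : 1 <= (T eps + V eps)%:R :> R by rewrite natrD; apply: le_trans T1 _; rewrite lerDl.
have hVq : (evalcost eps eta delta (V eps) (T eps) n2).+3%:R <=
    (T eps + V eps)%:R * softO + poly.
  have h : bnd W (m eps)%:R (T eps + V eps)%:R 200 6
      (evalcost eps eta delta (V eps) (T eps) n2).+3.
    apply: evalcost_bnd => //; apply: b00; first [
      exact: leq_addl | exact: leq_addr | exact: leq_trans Tn2 (leq_addr _ _)].
  apply: le_trans h _; apply: (@le_trans _ _ ((T eps + V eps)%:R * softO)).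
    exact: ler_wpM2l.
  by rewrite lerDl.
split.
  have [j hj jK] := @pq_plans L R d X feat eps eta delta (T eps) n1 n2 r hplan.
  exists (pm eps eta delta n1 n2), (pm eps eta delta n1 n2), (pr eps eta delta n1 n2 r), j.
  split => // S U w sS sU sw.
  have [hg [st [v [i [_ hf hi ho]]]]] := pq_runs hplan runs hVq sS sU sw.
  exists v, i, hg; split => //.
  have h : bnd W (m eps)%:R (T eps)%:R 200 6 (paramcost eps eta delta (T eps) n2 + 100 +
    (pm eps eta delta n1 n2 + pm eps eta delta n1 n2 + pr eps eta delta n1 n2 r) +
    fitcost eps eta delta (T eps) n1 n2 r).
    by apply: time_bnd => //; exact: b00.
  apply: (@le_trans _ _ ((T eps)%:R * softO)); last by rewrite lerDl.
  apply: (@le_trans _ _ ((T eps)%:R * (W ^+ 200 * (m eps)%:R ^+ 6))); last exact: ler_wpM2l.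
  by apply: le_trans h; rewrite ler_nat; apply: leq_add => //; apply: leq_add.
move=> Pt Qt.
have [m1 [m2 [m3 [k2 [hp hs]]]]] := pq_succeeds mfeat hA e0 mC hplan runs guarantee
  (P := Pt) (Q := Qt) (good_output (C := C) hA e01 h01) hVq.
exists m1, m2, m3, k2; split => //; apply: le_trans hs.
by rewrite lee_fin lerD2l lerN2; exact: failure_le.
Qed.
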